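(* For $0\le\alpha<1$ and $\theta>0$, let $Z=\exp(-W)$, where $W$ is the stationary version of the regenerative set associated with the $(\alpha,\theta)$ regenerative composition structure. Then $Z$ is a self-similar Markov random set associated with an $(\alpha,\theta-\alpha)$ partition structure, i.e. the composition structure $(\mathcal C_n)$ derived by uniform sampling from $Z$ is self-similar Markov and $(\mathcal C_n^\downarrow)$ is the $(\alpha,\theta-\alpha)$ partition structure. The structural distribution of $Z$ is beta$(1-\alpha,\theta)$, and $Z$ has the strong sampling property $$\mathbb P(A_1=V_k\mid V_1,V_2,\dots)=V_k,\qquad k=1,2,\dots,$$ where $(V_j)$ is the decreasing sequence of lengths of the interval components of $[0,1]\setminus Z$ and $A_1=1-\sup(Z\cap[0,1])$ is the length of the rightmost one (the meander).
   Context: Stationary version $W$: let $(Y_t)$, $Y_0=0$, be the subordinator with zero drift whose Lévy measure $\nu$ on $]0,\infty[$ has image $\widetilde\nu$ under $y\mapsto1-e^{-y}$, where $\widetilde\nu$ is the measure on $]0,1]$ given by $\widetilde\nu[x,1]=x^{-\alpha}(1-x)^\theta$, $0<x\le1$. The closed range of $(Y_t)$ is the regenerative set associated with the $(\alpha,\theta)$ regenerative composition structure (that structure is derived by uniform sampling from the image of this range under $y\mapsto e^{-y}$). Its stationary version $W$ is the closed range of $(X+Y_t,t\ge0)$, where $X$ is independent of $(Y_t)$ with density $\nu[y,\infty]/\mathtt m$, $y>0$, and $\mathtt m=\int_0^\infty y\,\nu(dy)<\infty$. The set $\exp(-W)$ is understood to include $0=e^{-\infty}$. Compositions: a composition of $n$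 is a sequence $\lambda=(\lambda_1,\dots,\lambda_\ell)$ of positive integers with sum $n$, and $\lambda^\downarrow$ is its decreasing rearrangement (a partition of $n$). It is represented by a row of $n$ balls in $\ell$ consecutive boxes, the $i$th from the left containing $\lambda_i$ balls, and in binary form by the string of $n$ digits whose $j$th digit is $1$ iff the $j$th ball is leftmost in its box. A composition structure is a sequence $(\mathcal C_n)_{n\ge1}$ of random compositions, $\mathcal C_n$ of $n$, such that for all $n\ge2$ deleting a uniformly random ball from $\mathcal C_n$ (chosen independently of $\mathcal C_n$; an emptied box disappears) gives a composition distributed as $\mathcal C_{n-1}$. Uniform sampling from a random closed $Z\subset[0,1]$: with $U_1,U_2,\dots$ independent uniform $[0,1]$ independent of $Z$, and $U_i\sim U_j$ for $i\neq j$ iff $U_i,U_j$ fall in the same interval component of $[0,1]\setminus Z$, $\mathcal C_n$ is the sequence of sizes of the classes among $U_1,\dots,U_n$ listed left to right. Self-similar Markov: $(\mathcal C_n)$ is self-similar Markov if there is a time-homogeneous (strictly) increasing Markov chain $(Q^\uparrow_t,t=0,1,\dots)$ on $\{1,2,\dots\}$ with $Q^\uparrow_0=1$ such that, with $\xi_j=1$ if the chain visits $j$ and $\xi_j=0$ otherwise, $\mathcal C_n$ has for each $n$ the distribution of the composition with binary form $\xi_1\cdots\xi_n$. In this case $Z$ is the restriction to $[0,1]$ of a random closed set $S\subset[0,\infty[$ with $cS$ distributed as $S$ for all $c>0$. Structural distribution of $Z$: the law of the length of the component of $[0,1]\setminus Z$ containing an independent uniform $[0,1]$ point (length $0$ if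 the point is in $Z$). Two-parameter partition structures: for $0\le\alpha<1$, $\vartheta>-\alpha$, let $W_1,W_2,\dots$ be independent, $W_i$ having beta$(1-\alpha,\vartheta+i\alpha)$ distribution, and $\widetilde V_i=(1-W_1)\cdots(1-W_{i-1})W_i$. The $(\alpha,\vartheta)$ partition structure is the sequence of random partitions $\pi_n$ of $n$, where $\pi_n$ is the decreasing rearrangement of the block sizes obtained when $n$ labels are sampled that are, given $(\widetilde V_i)$, independent with $\mathbb P(\text{label}=i)=\widetilde V_i$, and equal labels are put in the same block. (The decreasing rearrangement of $(\widetilde V_i)$ has the two-parameter Poisson-Dirichlet distribution with parameters $(\alpha,\vartheta)$.) *)

(* Defs.v *)
From HB Require Import structures.
From mathcomp Require Export all_boot all_order all_algebra.
From mathcomp Require Export all_classical all_reals all_analysis.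
Export Order.TTheory GRing.Theory Num.Theory.
Export numFieldNormedType.Exports.

Set Implicit Arguments.
Unset Strict Implicit.
Unset Printing Implicit Defensive.

Local Open Scope classical_set_scope.
Local Open Scope ring_scope.

Definition sigma_rv (d : measure_display) (T : measurableType d) (R : realType)
    (I : Type) (D : set I) (f : I -> T -> R) : set (set T) :=
  <<s \bigcup_(i in D) preimage_set_system setT (f i) measurable >>.

Definition indep_systems (d : measure_display) (T : measurableType d)
    (R : realType) (P : probability T R) (F G : set (set T)) : Prop :=
  forall A B, F A -> G B -> P (A `&` B) = (P A * P B)%E.

Definition mutually_independent (d : measure_display) (T : measurableType d)
    (R : realType) (P : probability T R) (f : nat -> T -> R) : Prop :=
  forall (J : seq nat) (B : nat -> set R), uniq J ->
    (forall i, measurable (B i)) ->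
    P [set w | forall i, i \in J -> B i (f i w)] =
    (\prod_(i <- J) fine (P (f i @^-1` B i)))%:E.

(* g is a version of P(E | G), G being a sub-sigma-algebra. *)
Definition is_cond_prob (d : measure_display) (T : measurableType d)
    (R : realType) (P : probability T R) (G : set (set T)) (E : set T)
    (g : T -> R) : Prop :=
  [/\ G `<=` measurable /\ measurable E,
      forall B : set R, measurable B -> G (g @^-1` B),
      P.-integrable setT (EFin \o g) &
      forall B, G B -> P (E `&` B) = (\int[P]_(w in B) (g w)%:E)%E].

(* The library's beta_prob only covers natural parameters. *)
Definition beta_weight (R : realType) (a b x : R) : R :=
  x `^ (a - 1) * (1 - x) `^ (b - 1).

Definition has_beta_law (d : measure_display) (T : measurableType d)
    (R : realType) (P : probability T R) (f : T -> R) (a b : R) : Prop :=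
  measurable_fun setT f /\
  forall A : set R, measurable A ->
    P (f @^-1` A) =
    (\int[lebesgue_measure]_(x in A `&` `]0%R, 1%R[%classic)
       (beta_weight a b x /
        \int[lebesgue_measure]_(y in `]0%R, 1%R[%classic) beta_weight a b y)%R%:E)%E.

(* The image of nu under y |-> 1 - e^-y is the measure on ]0,1] giving mass
   x^-alpha (1-x)^theta to [x,1]; this determines nu. *)
Definition is_levy_measure (R : realType) (alpha theta : R)
    (nu : {measure set R -> \bar R}) : Prop :=
  nu `]-oo, 0%R]%classic = 0%E /\
  forall x : R, 0 < x <= 1 ->
    pushforward nu (fun y : R => 1 - expR (- y)) `[x, 1%R]%classic =
    (x `^ (- alpha) * (1 - x) `^ theta)%:E.

(* Zero drift and Levy measure nu are expressed by the Levy-Khintchine formula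
   E exp(-l Y_t) = exp(-t int (1 - e^(-l y)) nu(dy)).
   Only the times t >= 0 are meaningful. *)
Definition is_subordinator (d : measure_display) (T : measurableType d)
    (R : realType) (P : probability T R) (nu : {measure set R -> \bar R})
    (Y : R -> {RV P >-> R}) : Prop :=
  [/\ (forall w, Y 0 w = 0) /\
      (forall w s t, 0 <= s -> s <= t -> Y s w <= Y t w),
      forall w t, 0 <= t -> (fun s => Y s w) @ t^'+ --> Y t w,
      forall t : nat -> R, 0 <= t 0%N -> (forall k, t k <= t k.+1) ->
        mutually_independent P (fun k w => Y (t k.+1) w - Y (t k) w),
      forall s t, 0 <= s -> 0 <= t -> forall A : set R, measurable A ->
        P [set w | A (Y (s + t) w - Y s w)] = P [set w | A (Y t w)] &
      forall t l : R, 0 <= t -> 0 <= l ->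
        (\int[P]_w (expR (- l * Y t w))%:E =
         expeR (- (t%:E *
           \int[nu]_(y in `]0%R, +oo[%classic) (1 - expR (- l * y))%:E)))%E].

Definition has_stationary_delay_law (d : measure_display)
    (T : measurableType d) (R : realType) (P : probability T R)
    (nu : {measure set R -> \bar R}) (X : T -> R) : Prop :=
  let m := (\int[nu]_(y in `]0%R, +oo[%classic) y%:E)%E in
  forall A : set R, measurable A ->
    P (X @^-1` A) =
    (\int[lebesgue_measure]_(y in A `&` `]0%R, +oo[%classic)
       (nu `[y, +oo[%classic * ((fine m)^-1)%:E))%E.

Definition stationary_range (R : realType) (x : R) (y : R -> R) : set R :=
  closure [set x + y t | t in [set t | 0 <= t]].

(* exp(-W) together with 0 = e^-oo *)
Definition exp_neg_set (R : realType) (W : set R) : set R :=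
  [set 0] `|` [set expR (- w) | w in W].

(* The sigma-algebra of a random closed set, generated by the hitting events of
   open sets. *)
Definition sigma_random_set (d : measure_display) (T : measurableType d)
    (R : realType) (Z : T -> set R) : set (set T) :=
  <<s [set [set w | Z w `&` G !=set0] | G in [set G : set R | open G]] >>.

(* empty when u is not in [0,1] \ Z *)
Definition gap_at (R : realType) (Z : set R) (u : R) : set R :=
  connected_component (`[0, 1]%classic `\` Z) u.

Definition is_gap (R : realType) (Z : set R) (C : set R) : Prop :=
  exists2 u, (`[0, 1]%classic `\` Z) u & C = gap_at Z u.

Definition gap_length (R : realType) (C : set R) : R :=
  fine (lebesgue_measure C).

(* The (k+1)-st largest gap length, with multiplicity (0 if there are at most
   k gaps): the largest x such that k+1 distinct gaps have length >= x. *)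
Definition ranked_gap (R : realType) (Z : set R) (k : nat) : R :=
  sup [set x : R | exists C : 'I_k.+1 -> set R,
    [/\ injective C, forall i, is_gap Z (C i) &
        forall i, x <= gap_length (C i)]].

Definition meander_length (R : realType) (Z : set R) : R :=
  1 - sup (Z `&` `[0, 1]%classic).

Definition is_composition (n : nat) (lam : seq nat) : bool :=
  all (fun k => 0 < k)%N lam && (sumn lam == n).

(* j is counted from 0, from the left *)
Fixpoint delete_ball (lam : seq nat) (j : nat) : seq nat :=
  if lam is a :: l then
    if (j < a)%N then (if (a == 1)%N then l else a.-1 :: l)
    else a :: delete_ball l (j - a)
  else [::].

Definition binary_form (lam : seq nat) : seq bool :=
  flatten [seq true :: nseq a.-1 false | a <- lam].

Definition ranked (lam : seq nat) : seq nat := sort geq lam.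

(* A sample point lying in Z forms a class by itself. *)
Definition same_class (R : realType) (Z : set R) (n : nat) (u : nat -> R)
    (i j : 'I_n) : bool :=
  (i == j) || `[< gap_at Z (u i) (u j) >].

(* Reading the sample points from left to right meets the classes from left to
   right; undup keeps one copy of each. *)
Definition sample_composition (R : realType) (Z : set R) (n : nat)
    (u : nat -> R) : seq nat :=
  let left_to_right := sort (fun i j : 'I_n => u i <= u j) (enum 'I_n) in
  let classes :=
    [seq [set j | same_class Z u i j]%SET | i <- left_to_right] in
  [seq #|pred_of_set B| | B <- undup classes].

Definition is_composition_structure (d : measure_display)
    (T : measurableType d) (R : realType) (P : probability T R)
    (C : nat -> T -> seq nat) : Prop :=
  [/\ forall n w, (0 < n)%N -> is_composition n (C n w),
      forall n lam, (0 < n)%N -> measurable (C n @^-1` [set lam]) &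
      forall n mu, (2 <= n)%N ->
        P (C n.-1 @^-1` [set mu]) =
        ((n%:R^-1)%:E *
         \sum_(j < n) P [set w | delete_ball (C n w) j = mu])%E].

Definition is_markov_chain (d : measure_display) (T : measurableType d)
    (R : realType) (P : probability T R) (Q : nat -> {RV P >-> nat})
    (p : nat -> nat -> R) : Prop :=
  [/\ forall i j, 0 <= p i j,
      forall i, (\sum_(0 <= j <oo) (p i j)%:E = 1)%E &
      forall t (x : nat -> nat),
        P [set w | forall s, (s <= t.+1)%N -> Q s w = x s] =
        (P [set w | forall s, (s <= t)%N -> Q s w = x s] *
         (p (x t) (x t.+1))%:E)%E].

Definition is_self_similar_markov (d : measure_display)
    (T : measurableType d) (R : realType) (P : probability T R)
    (C : nat -> T -> seq nat) : Prop :=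
  exists (d' : measure_display) (T' : measurableType d')
    (P' : probability T' R) (Q : nat -> {RV P' >-> nat})
    (p : nat -> nat -> R),
    [/\ is_markov_chain Q p,
        forall w, Q 0%N w = 1%N,
        forall t w, (Q t w < Q t.+1 w)%N &
        forall n lam, (0 < n)%N -> is_composition n lam ->
          P (C n @^-1` [set lam]) =
          P' [set w | [seq `[< exists t, Q t w = j >] | j <- iota 1 n] =
                      binary_form lam]].

Definition stick (R : realType) (W : nat -> R) (i : nat) : R :=
  (\prod_(j < i) (1 - W j)) * W i.

Definition label_partition (n : nat) (l : nat -> nat) : seq nat :=
  ranked [seq count_mem a (mkseq l n) | a <- undup (mkseq l n)].

(* W i is the (i+1)-st stick-breaking variable and labels are counted from 0. *)
Definition is_two_parameter_partition_structure (d : measure_display)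
    (T : measurableType d) (R : realType) (P : probability T R)
    (alpha vartheta : R) (ptn : nat -> T -> seq nat) : Prop :=
  exists (d' : measure_display) (T' : measurableType d')
    (P' : probability T' R) (W : nat -> {RV P' >-> R})
    (L : nat -> {RV P' >-> nat}),
    let V i w := stick (fun j => W j w) i in
    [/\ mutually_independent P' (fun i => W i : T' -> R),
        forall i, has_beta_law P' (W i) (1 - alpha)
                    (vartheta + i.+1%:R * alpha),
        forall n (l : nat -> nat),
          is_cond_prob P' (sigma_rv setT V)
            [set w | forall k, (k < n)%N -> L k w = l k]
            (fun w => \prod_(k < n) V (l k) w) &
        forall n lam, (0 < n)%N ->
          P (ptn n @^-1` [set lam]) =
          P' [set w | label_partition n (fun k => L k w) = lam]].

(* Main.v *)
(* The points e^-X, e^-(X + Y_h), e^-(X + Y_2h), ... are products of independent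
   ratios. As h tends to 0 the cells they cut out of [0,1] tend to the gaps of Z,
   which gives the law of C_n and the joint moments of A = 1 - e^-X and of the power
   sums p_b(Z) of the gap lengths. The first ratio 1 - A is beta(theta, 1-alpha)
   distributed, like 1 - W_1 for the (alpha, theta - alpha) stick breaking, and what
   remains, in both cases, is a structure with parameters (alpha, theta): a
   regenerative set on one side, a stick breaking on the other, with the same moments
   because both satisfy the same recursion (one obtained from the Lévy measure).
   The law of C_n factors over its parts, and so is that of a Markov chain visiting
   the left ends of the boxes.

   For strong sampling, comparison of the moments gives
   E [A^m p_(b_1) ... p_(b_k)] = E [p_(m+1) p_(b_1) ... p_(b_k)], and p_(m+1) is the
   conditional m-th moment given Z of the gap length L at a uniform point. Moments
   can be replaced by bounded functions, hence p_b by the number of gaps longer than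
   x; so (A, V_1, V_2, ...) and (L, V_1, V_2, ...) have the same law, and given Z,
   P(L = V_k) = V_k as soon as the V_j are distinct. They are: otherwise, with
   positive probability A would be e^-X times a gap length of exp(-range of Y), which
   is independent of the diffuse variable X. *)

From HB Require Import structures.
Require Import Defs.
From mathcomp Require Import ring lra zify measurable_realfun.

Set Implicit Arguments.
Unset Strict Implicit.
Unset Printing Implicit Defensive.

Import HBNNSimple.

Local Open Scope classical_set_scope.
Local Open Scope ring_scope.

(** * Bounded functions and functionals determined by moments *)

(** Conditioning on [Z] is done on the product [T * T]: a uniform variable read in the second
    coordinate is an independent sample point, and averaging over that coordinate is averaging given
    [Z]. The obstacle is to identify the limits of the discretized moments without any density for
    the gap lengths. Only recursions over subsets of exponents are compared. [Mh] is defined by a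
    size-biased recursion, which is shown not to depend on the chosen index ([Mh_any]) and to be
    equivalent to the plain stick-breaking recursion ([Mh_stick]); a linear combination of the two
    at parameter theta - alpha is the regenerative recursion at theta ([Mh_regen]). One algebraic
    object thus carries both sides, and exchanging the meander with a size-biased gap is an equality
    between two of its recursions. Two limits occur, in the number of cells and then in the mesh; a
    diagonal choice joins them, so that a single sequence also converges pathwise. Since theta -
    alpha may be zero or negative, convergence is proved at theta, after peeling off the first
    stick. *)

Section bounded_expectation.
Context (d : measure_display) (T : measurableType d) (R : realType).

(* [bm]: bounded and measurable; [Ex]: expectation as a real number. *)
Definition bm (f : T -> R) : Prop :=
  measurable_fun setT f /\ exists M : R, forall x, `|f x| <= M.

Definition Ex (P : probability T R) (f : T -> R) : R := \int[P]_w f w.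

Lemma bm_cst c : bm (fun _ => c).
Proof. by split=> //; exists `|c|. Qed.

Lemma bmD f g : bm f -> bm g -> bm (fun x => f x + g x).
Proof.
move=> [mf [M hM]] [mg [N hN]]; split; first exact: measurable_funD.
by exists (M + N) => x; rewrite (le_trans (ler_normD _ _))// lerD.
Qed.

Lemma bmM f g : bm f -> bm g -> bm (fun x => f x * g x).
Proof.
move=> [mf [M hM]] [mg [N hN]]; split; first exact: measurable_funM.
by exists (M * N) => x; rewrite normrM ler_pM.
Qed.

Lemma bmZ c f : bm f -> bm (fun x => c * f x).
Proof. by apply: bmM; exact: bm_cst. Qed.

Lemma bmN f : bm f -> bm (fun x => - f x).
Proof.
move=> bf; rewrite (_ : (fun x => - f x) = (fun x => (-1) * f x)); first exact: bmZ.
by apply/funext => x; rewrite mulN1r.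
Qed.

Lemma bmB f g : bm f -> bm g -> bm (fun x => f x - g x).
Proof. by move=> bf bg; apply: bmD => //; exact: bmN. Qed.

Lemma bm_sum (I : Type) (s : seq I) (p : pred I) (F : I -> T -> R) :
  (forall i, p i -> bm (F i)) -> bm (fun x => \sum_(i <- s | p i) F i x).
Proof.
move=> bF; elim: s => [|i s IH].
  by under eq_fun do rewrite big_nil; exact: bm_cst.
under eq_fun do rewrite big_cons.
by case: (boolP (p i)) => // pi; apply: bmD => //; exact: bF.
Qed.

Lemma bm_prod (I : Type) (s : seq I) (p : pred I) (F : I -> T -> R) :
  (forall i, p i -> bm (F i)) -> bm (fun x => \prod_(i <- s | p i) F i x).
Proof.
move=> bF; elim: s => [|i s IH].
  by under eq_fun do rewrite big_nil; exact: bm_cst.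
under eq_fun do rewrite big_cons.
by case: (boolP (p i)) => // pi; apply: bmM => //; exact: bF.
Qed.

Lemma bmX f n : bm f -> bm (fun x => f x ^+ n).
Proof.
move=> bf; elim: n => [|n IH]; first exact: bm_cst.
by under eq_fun do rewrite exprS; exact: bmM.
Qed.

Lemma bm_indic (A : set T) : measurable A -> bm (\1_A : T -> R).
Proof.
move=> mA; split; first exact: measurable_indic.
by exists 1 => x; rewrite indicE; case: (_ \in _); rewrite ?normr1 ?normr0.
Qed.

Lemma bm01 (f : T -> R) : measurable_fun setT f -> (forall x, 0 <= f x <= 1) -> bm f.
Proof.
move=> mf f01; split=> //; exists 1 => x.
by have /andP[f0 f1] := f01 x; rewrite ger0_norm.
Qed.

Variable P : probability T R.
Implicit Types f g : T -> R.

Lemma bm_integrable f : bm f -> P.-integrable setT (EFin \o f).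
Proof.
move=> [mf [M hM]]; apply/integrableP; split; first exact/measurable_EFinP.
apply: (@le_lt_trans _ _ (\int[P]_x M%:E)%E).
  apply: ge0_le_integral => //=.
    by apply/measurable_EFinP; apply: measurableT_comp.
  by move=> x _; rewrite lee_fin.
by rewrite integral_cst//= probability_setT mule1 ltry.
Qed.

Lemma ExE f : bm f -> (\int[P]_x (f x)%:E)%E = (Ex P f)%:E.
Proof. by move=> bf; rewrite /Ex /Rintegral fineK// integrable_fin_num// bm_integrable. Qed.

Lemma Ex_cst c : Ex P (fun _ => c) = c.
Proof.
rewrite /Ex Rintegral_cst// -[RHS]mulr1; congr (_ * _).
exact: (congr1 fine (probability_setT P)).
Qed.

Lemma ExD f g : bm f -> bm g -> Ex P (fun x => f x + g x) = Ex P f + Ex P g.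
Proof. by move=> bf bg; rewrite /Ex RintegralD//; exact: bm_integrable. Qed.

Lemma ExZ c f : bm f -> Ex P (fun x => c * f x) = c * Ex P f.
Proof. by move=> bf; rewrite /Ex RintegralZl//; exact: bm_integrable. Qed.

Lemma ExZr c f : bm f -> Ex P (fun x => f x * c) = Ex P f * c.
Proof. by move=> bf; rewrite /Ex RintegralZr//; exact: bm_integrable. Qed.

Lemma ExB f g : bm f -> bm g -> Ex P (fun x => f x - g x) = Ex P f - Ex P g.
Proof. by move=> bf bg; rewrite /Ex RintegralB//; exact: bm_integrable. Qed.

Lemma Ex_sum (I : Type) (s : seq I) (p : pred I) (F : I -> T -> R) :
  (forall i, p i -> bm (F i)) ->
  Ex P (fun x => \sum_(i <- s | p i) F i x) = \sum_(i <- s | p i) Ex P (F i).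
Proof.
move=> bF; elim: s => [|i s IH].
  by under eq_fun do rewrite big_nil; rewrite big_nil Ex_cst.
under eq_fun do rewrite big_cons; rewrite big_cons.
case: (boolP (p i)) => // pi; rewrite ExD ?IH//; first exact: bF.
exact: bm_sum.
Qed.

Lemma Ex_le f g : bm f -> bm g -> (forall x, f x <= g x) -> Ex P f <= Ex P g.
Proof.
by move=> bf bg fg; apply: le_Rintegral => //; exact: bm_integrable.
Qed.

Lemma Ex_ge0 f : (forall x, 0 <= f x) -> 0 <= Ex P f.
Proof. by move=> f0; apply: Rintegral_ge0. Qed.

Lemma Ex_norm f M : bm f -> (forall x, `|f x| <= M) -> `|Ex P f| <= M.
Proof.
move=> bf fM; rewrite ler_norml; apply/andP; split.
  rewrite -(Ex_cst (- M)); apply: Ex_le => //; first exact: bm_cst.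
  by move=> x; have := fM x; rewrite ler_norml => /andP[].
rewrite -(Ex_cst M); apply: Ex_le => //; first exact: bm_cst.
by move=> x; have := fM x; rewrite ler_norml => /andP[].
Qed.

Lemma Ex_indic (A : set T) : measurable A -> Ex P \1_A = fine (P A).
Proof. by move=> mA; rewrite /Ex /Rintegral integral_indic// setIT. Qed.

Lemma fineP (A : set T) : measurable A -> (fine (P A))%:E = P A.
Proof. by move=> mA; rewrite fineK// fin_num_measure. Qed.

Lemma Ex_ae f g : bm f -> bm g -> {ae P, forall x, f x = g x} -> Ex P f = Ex P g.
Proof.
move=> [mf _] [mg _] fg; rewrite /Ex /Rintegral; congr fine.
apply: ae_eq_integral => //; [exact/measurable_EFinP|exact/measurable_EFinP|].
by apply: filterS fg => x -> _.
Qed.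

Lemma Ex_lim (f_ : nat -> T -> R) f (M : R) : (forall n, bm (f_ n)) -> bm f ->
  (forall n x, `|f_ n x| <= M) ->
  {ae P, forall x, f_ n x @[n --> \oo] --> f x} ->
  Ex P (f_ n) @[n --> \oo] --> Ex P f.
Proof.
move=> bf_ bf hM hl.
have := @dominated_convergence _ _ _ P setT measurableT
  (fun n => EFin \o f_ n) (EFin \o f) (cst M%:E).
case=> //.
- by move=> n; apply/measurable_EFinP; case: (bf_ n).
- by apply/measurable_EFinP; case: bf.
- by apply: filterS hl => x hx _; apply: cvg_EFin => //; exact: nearW.
- by apply: (bm_integrable (bm_cst M)).
- by apply: aeW => x n _ /=; rewrite lee_fin.
move=> _ _; rewrite (_ : (\int[P]_x _)%E = (Ex P f)%:E); last exact: ExE.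
by under eq_fun do rewrite ExE//; move/fine_cvg.
Qed.

Lemma Ex_ge0_eq0 f : bm f -> (forall x, 0 <= f x) -> Ex P f = 0 ->
  {ae P, forall x, f x = 0}.
Proof.
move=> bf f0 Ef0; have [mf _] := bf.
have := @ae_eq_integral_abs _ _ _ P setT measurableT (EFin \o f).
case; first exact/measurable_EFinP.
move=> + _.
have -> : (\int[P]_x `|(EFin \o f) x| = 0)%E.
  rewrite -[RHS]/(0%:E) -Ef0 -ExE//; apply: eq_integral => x _ /=.
  by rewrite ger0_norm.
move=> /(_ erefl) h; apply: filterS h => x /(_ I) /=; exact: EFin_inj.
Qed.

End bounded_expectation.
Arguments bm {d T R} f.
Arguments bm_cst {d T R} c.
Arguments Ex {d T R} P f.

Section comparison.
Context (d d' : measure_display) (T : measurableType d) (T' : measurableType d').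
Context (R : realType).

Lemma bm_comp (f : T' -> R) (h : T -> T') : measurable_fun setT h -> bm f ->
  bm (fun x => f (h x)).
Proof.
move=> mh [mf [M hM]]; split; last by exists M => x.
exact: measurableT_comp.
Qed.

Lemma Ex_pushforward (P : probability T R) (P' : probability T' R) (h : T -> T') f :
  measurable_fun setT h -> (forall A, measurable A -> P' A = P (h @^-1` A)) ->
  bm f -> Ex P' f = Ex P (fun x => f (h x)).
Proof.
move=> mh PP' bf; rewrite /Ex /Rintegral; congr fine.
have := @integral_pushforward _ _ _ _ _ h mh P setT (EFin \o f).
rewrite /= => <-//.
- by apply: eq_measure_integral => A mA _; exact: PP'.
- by apply/measurable_EFinP; case: bf.
- by rewrite preimage_setT; exact: (bm_integrable P (bm_comp mh bf)).
Qed.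

End comparison.

Section bounded_fubini.
Context (d d' : measure_display) (T : measurableType d) (T' : measurableType d').
Context (R : realType).

Lemma bm_section1 (f : T * T' -> R) x : bm f -> bm (fun y => f (x, y)).
Proof.
by move=> bf; apply: bm_comp bf; exact: measurable_pair1.
Qed.

Variables (P : probability T R) (P' : probability T' R).

Lemma bm_fubini (f : T * T' -> R) : bm f -> bm (fun x => Ex P' (fun y => f (x, y))).
Proof.
move=> bf; have [mf [M hM]] := bf; split; last first.
  by exists M => x; apply: Ex_norm => //; exact: bm_section1.
have := @measurable_fubini_F _ _ _ _ _ P P' (EFin \o f) (bm_integrable (P \x P')%E bf).
rewrite (_ : fubini_F _ _ = EFin \o (fun x => Ex P' (fun y => f (x, y)))); last first.
  by apply/funext => x; rewrite /fubini_F /= ExE//; exact: bm_section1.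
by move/measurable_EFinP.
Qed.

Lemma Ex_fubini (f : T * T' -> R) : bm f ->
  Ex (P \x P')%E f = Ex P (fun x => Ex P' (fun y => f (x, y))).
Proof.
move=> bf; rewrite {1 2}/Ex /Rintegral; congr fine.
have := @integral12_prod_meas1 _ _ _ _ _ P P' (EFin \o f) (bm_integrable (P \x P')%E bf).
move=> <-; apply: eq_integral => x _.
by rewrite /fubini_F /= ExE//; exact: bm_section1.
Qed.

End bounded_fubini.

Lemma cvg_eqlim (R : realType) (u v : nat -> R) (a b : R) :
  (forall n, u n = v n) -> u n @[n --> \oo] --> a -> v n @[n --> \oo] --> b -> a = b.
Proof. by move=> /funext -> ua vb; exact: cvg_unique ua vb. Qed.

Section functionals.
Context (R : realType).
Implicit Types (f g : R -> R) (I J : (R -> R) -> R).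

(** These are integrals against finite measures on the line, in Daniell's form: expressions such as
    E [G f(L)], even with an inner conditional mean, satisfy the clauses directly and need not first
    be turned into measures. *)
Definition bfunctional I : Prop :=
  [/\ forall f g, bm f -> bm g -> I (fun x => f x + g x) = I f + I g,
      forall c f, bm f -> I (fun x => c * f x) = c * I f,
      forall f, bm f -> (forall x, 0 <= f x) -> 0 <= I f &
      forall (f_ : nat -> R -> R) f (M : R), (forall n, bm (f_ n)) -> bm f ->
        (forall n x, `|f_ n x| <= M) ->
        (forall x, f_ n x @[n --> \oo] --> f x) ->
        I (f_ n) @[n --> \oo] --> I f].

Lemma bfunctional_Ex (d : measure_display) (T : measurableType d)
    (P : probability T R) (G L : T -> R) :
  bm G -> (forall x, 0 <= G x) -> measurable_fun setT L ->
  bfunctional (fun f => Ex P (fun x => G x * f (L x))).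
Proof.
move=> bG G0 mL; have bL f : bm f -> bm (fun x => G x * f (L x)).
  by move=> bf; apply: bmM => //; exact: bm_comp bf.
split.
- move=> f g bf bg; rewrite -ExD; [|exact: bL|exact: bL].
  by congr Ex; apply/funext => x; rewrite mulrDr.
- move=> c f bf; rewrite -ExZ; last exact: bL.
  by congr Ex; apply/funext => x; rewrite mulrCA.
- by move=> f bf f0; apply: Ex_ge0 => x; rewrite mulr_ge0.
- move=> f_ f M bf_ bf fM fl; have [_ [N GN]] := bG.
  apply: (@Ex_lim _ _ _ _ _ _ (N * M)); [by move=> n; apply: bL|exact: bL| |].
    by move=> n x; rewrite normrM ler_pM.
  by apply: aeW => x; apply: cvgM; [exact: cvg_cst|exact: fl].
Qed.

Lemma bfunctional_sum I (J : Type) (s : seq J) (F : J -> R -> R) :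
  bfunctional I -> (forall j, bm (F j)) ->
  I (fun x => \sum_(j <- s) F j x) = \sum_(j <- s) I (F j).
Proof.
move=> [ID IZ _ _] bF; elim: s => [|j s IH].
  under eq_fun do rewrite big_nil; rewrite big_nil.
  transitivity (I (fun x => 0 * cst 0 x)).
    by congr I; apply/funext => x; rewrite mul0r.
  by rewrite IZ ?mul0r//; exact: bm_cst.
under eq_fun do rewrite big_cons; rewrite big_cons ID ?IH//.
exact: bm_sum.
Qed.

Section agreement.
Variables I J : (R -> R) -> R.
Hypotheses (fI : bfunctional I) (fJ : bfunctional J).

(** Rays form a pi-system generating the Borel sets. The sets of agreement are a Dynkin class:
    agreement on 1 gives complements, bounded convergence gives disjoint unions. *)
Lemma bfunctional_eq_indic : I (fun _ => 1) = J (fun _ => 1) ->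
  (forall t, I \1_(`]t, +oo[%classic) = J \1_(`]t, +oo[%classic)) ->
  forall A : set R, measurable A -> I \1_A = J \1_A.
Proof.
move=> e1 et A mA.
have [ID IZ _ Il] := fI; have [JD JZ _ Jl] := fJ.
have c1 : bm (fun _ : R => 1 : R) by exact: bm_cst.
have h := @dynkin_induction _ (measurableTypeR R) (@RGenOInfty.G R) (fun A => I \1_A = J \1_A).
have mA' : <<s @RGenOInfty.G R >> A by have := mA; have := @RGenOInfty.measurableE R; rewrite /= => e; rewrite -[<<s _ >>]e.
apply: h mA'; first exact: RGenOInfty.measurableE.
- move=> _ _ [x ->] [y ->]; exists (Num.max x y).
  by apply/seteqP; split=> z /=; rewrite !in_itv/= !andbT gt_max => /andP.
- by rewrite indicT.
- by move=> _ [x ->].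
- move=> S mS IS.
  have -> : \1_(~` S) = (fun x => 1 + (-1) * \1_S x) :> (R -> R).
    apply/funext => x; rewrite !indicE in_setC.
    by case: (x \in S); rewrite /= ?mulr1 ?mulr0 ?subrr ?addr0.
  have bS : bm (\1_S : R -> R) by exact: bm_indic.
  have c2 := bmZ (-1) bS.
  by rewrite ID ?JD ?IZ ?JZ ?IS ?e1//.
- move=> F mF tF IF.
  have bF n : bm (\1_(F n) : R -> R) by apply: bm_indic; exact: mF.
  pose s n := fun x : R => \sum_(k < n) (\1_(F k) x : R).
  have bs n : bm (s n) by exact: bm_sum.
  have sE n : s n = \1_(\big[setU/set0]_(k < n) F k) :> (R -> R).
    apply/funext => x; rewrite /s.
    elim: n => [|n IH]; first by rewrite !big_ord0 indic0.
    rewrite !big_ord_recr /= IH !indicE in_setU.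
    have [xn|xn] := boolP (x \in F n); rewrite ?orbT ?orbF ?addr0//.
    rewrite (_ : x \in _ = false) ?add0r//; apply/negbTE/negP.
    rewrite inE -bigcup_mkord => -[k /= kn xk].
    have kE := tF k n Logic.I Logic.I (ex_intro _ x (conj xk (set_mem xn))).
    by move: kn; rewrite kE ltnn.
  have bU : bm (\1_(\bigcup_k F k) : R -> R).
    by apply: bm_indic; apply: bigcup_measurable => k _; exact: mF.
  have ls x : s n x @[n --> \oo] --> (\1_(\bigcup_k F k) x : R).
    rewrite indicE; have [|xF] := boolP (x \in \bigcup_k F k).
      rewrite inE => -[k _ Fk]; apply: cvg_near_cst; exists k.+1 => // n /= kn.
      rewrite sE indicE (_ : x \in _) //.
      by rewrite inE -bigcup_mkord; exists k.
    apply: cvg_near_cst; apply: nearW => n; rewrite sE indicE.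
    rewrite (_ : x \in _ = false)//; apply/negbTE; apply: contra xF.
    by rewrite !inE -bigcup_mkord => -[k _ ?]; exists k.
  have sb n x : `|s n x| <= 1.
    by rewrite sE indicE; case: (_ \in _); rewrite ?normr1 ?normr0.
  have h1 := Il _ _ _ bs bU sb ls; have h2 := Jl _ _ _ bs bU sb ls.
  apply: cvg_eqlim h1 h2 => n.
  by rewrite !bfunctional_sum//; apply: eq_bigr => k _.
Qed.

(** Adding the bound [M] makes [f] nonnegative, hence an increasing limit of simple functions
    bounded by 2M; the constant is subtracted at the end. *)
Lemma bfunctional_eq_fun :
  (forall A : set R, measurable A -> I \1_A = J \1_A) ->
  forall f, bm f -> I f = J f.
Proof.
move=> eA f bf; have [mf [M fM]] := bf.
have [ID IZ _ Il] := fI; have [JD JZ _ Jl] := fJ.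
pose g x := f x + M.
have g0 x : 0 <= g x by have := fM x; rewrite ler_norml /g => /andP[? _]; lra.
have bg : bm g by apply: bmD => //; exact: bm_cst.
have [h [hnd hl]] := @approximation _ _ _ setT measurableT (EFin \o g)
  (ltac:(by apply/measurable_EFinP; case: bg)) (ltac:(by move=> x _ /=; rewrite lee_fin)).
have hg n x : h n x <= g x.
  have : (h m x)%:E @[m --> \oo] --> (g x)%:E by exact: hl.
  move/fine_cvg => /= hx.
  rewrite -(cvg_lim _ hx)//; apply: nondecreasing_cvgn_le.
    by move=> a b ab; have /lefP := hnd a b ab; apply.
  by apply/cvg_ex; exists (g x).
have bh n : bm (h n).
  split => //; exists (M + M) => x; rewrite ger0_norm//.
  rewrite (le_trans (hg n x))// /g lerD2r.
  by have := fM x; rewrite ler_norml => /andP[].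
have eh n : I (h n) = J (h n).
  have hE : (h n : R -> R) = fun x => \sum_(y <- finmap.enum_fset (fset_set (range (h n)))) y * \1_(h n @^-1` [set y]) x.
    by apply/funext => x; rewrite fimfunE fsbig_finite//.
  have mh y : measurable (h n @^-1` [set y]) by apply: measurable_funPTI; exact: measurable_set1.
  rewrite hE !bfunctional_sum//.
  + apply: eq_bigr => y _; rewrite IZ ?JZ ?eA//; exact: bm_indic.
  + by move=> y; apply: bmZ; exact: bm_indic.
  + by move=> y; apply: bmZ; exact: bm_indic.
have hb n x : `|h n x| <= M + M.
  rewrite ger0_norm// (le_trans (hg n x))// /g lerD2r.
  by have := fM x; rewrite ler_norml => /andP[].
have lh x : h n x @[n --> \oo] --> g x.
  by have : (h m x)%:E @[m --> \oo] --> (g x)%:E by [exact: hl]; move/fine_cvg.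
have eg : I g = J g.
  have h1 := Il _ _ _ bh bg hb lh; have h2 := Jl _ _ _ bh bg hb lh.
  exact: cvg_eqlim h1 h2.
have e1 : I (cst 1) = J (cst 1) by have := eA setT measurableT; rewrite indicT.
have fE : f = fun x => g x + (- M) * cst 1 x by apply/funext => x; rewrite /g /= mulr1 addrK.
have c1 : bm (cst 1 : R -> R) by exact: bm_cst.
have cM := bmZ (- M) c1.
have [a1 a2] := (ID g _ bg cM, JD g _ bg cM). have [a3 a4] := (IZ (- M) _ c1, JZ (- M) _ c1). rewrite fE a1 a2 a3 a4 eg e1. done.
Qed.

Lemma bfunctional_eq : I (fun _ => 1) = J (fun _ => 1) ->
  (forall t, I \1_(`]t, +oo[%classic) = J \1_(`]t, +oo[%classic)) ->
  forall f, bm f -> I f = J f.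
Proof. by move=> e1 et; apply: bfunctional_eq_fun; exact: bfunctional_eq_indic. Qed.

End agreement.

(** Powers of [clamp x] are bounded on the whole line, so moments can be tested on a functional that
    is not known to be carried by [0,1]. *)
Definition clamp (x : R) : R := Num.max 0 (Num.min 1 x).

Lemma clamp01 x : 0 <= clamp x <= 1.
Proof. by rewrite /clamp le_max lexx/= ge_max ler01 ge_min lexx. Qed.

Lemma clamp_id x : 0 <= x <= 1 -> clamp x = x.
Proof. by move=> /andP[x0 x1]; rewrite /clamp (min_idPr x1) (max_idPr x0). Qed.

Lemma measurable_clamp : measurable_fun setT clamp.
Proof. by apply: measurable_maxr => //; apply: measurable_minr. Qed.

Lemma bm_clamp f : bm f -> bm (f \o clamp).
Proof. by apply: bm_comp; exact: measurable_clamp. Qed.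

(* Bernstein polynomials, by de Casteljau's recursion. *)
Fixpoint bern (n : nat) (phi : nat -> R) : {poly R} :=
  if n is m.+1 then 'X * bern m (phi \o S) + (1 - 'X) * bern m phi
  else (phi 0%N)%:P.

Lemma bernS n phi x : (bern n.+1 phi).[x] =
  x * (bern n (phi \o S)).[x] + (1 - x) * (bern n phi).[x].
Proof. by rewrite /= hornerD !hornerM hornerD hornerN hornerX hornerC. Qed.

Lemma bern_lin n a phi psi x : (bern n (fun k => a * phi k + psi k)).[x] =
  a * (bern n phi).[x] + (bern n psi).[x].
Proof.
elim: n phi psi => [|n IH] phi psi; first by rewrite /= !hornerC.
rewrite !bernS.
rewrite (_ : _ \o S = fun k => a * (phi \o S) k + (psi \o S) k)//.
by rewrite !IH; ring.
Qed.

Lemma bern_cst n c x : (bern n (fun _ => c)).[x] = c.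
Proof.
elim: n => [|n IH]; first by rewrite /= hornerC.
by rewrite bernS (_ : _ \o S = fun=> c)// IH; ring.
Qed.

Lemma bern_le n phi psi x : 0 <= x <= 1 -> (forall k, phi k <= psi k) ->
  (bern n phi).[x] <= (bern n psi).[x].
Proof.
move=> /andP[x0 x1]; elim: n phi psi => [|n IH] phi psi le.
  by rewrite /= !hornerC.
by rewrite !bernS lerD// ler_wpM2l ?subr_ge0// IH// => k; exact: le.
Qed.

(** The value of [bern n phi] at x is E phi(B) for a binomial (n, x) variable B; the formula is
    variance plus squared bias. *)
Lemma bern_var n a x : (bern n (fun k => (k%:R - a) ^+ 2)).[x] =
  n%:R * x * (1 - x) + (n%:R * x - a) ^+ 2.
Proof.
elim: n a => [|n IH] a; first by rewrite /= hornerC; ring.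
rewrite bernS IH.
have -> : (fun k => (k%:R - a) ^+ 2) \o S = fun k => (k%:R - (a - 1)) ^+ 2 :> R.
  by apply/funext => k /=; rewrite -natr1; ring.
by rewrite IH -natr1; ring.
Qed.

Lemma bern_approx (g : R -> R) (L : R) (m : nat) (x : R) :
  0 <= L -> (forall y z, `|g y - g z| <= L * `|y - z|) -> 0 <= x <= 1 ->
  forall n, n = (m.+1 ^ 2)%N -> `|(bern n (fun k => g (k%:R / n%:R))).[x] - g x| <= 2 * L / m.+1%:R.
Proof.
move=> L0 gL x01 n nE0.
set c := g x.
have m0 : 0 < m.+1%:R :> R by [].
have n0 : 0 < n%:R :> R by rewrite nE0 ltr0n expn_gt0.
have nE : n%:R = m.+1%:R ^+ 2 :> R by rewrite nE0 natrX.
(* The bound |y| <= (m+1) y^2 + 1/(m+1), for y = k/n - x, replaces the Lipschitz estimate by a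
   quadratic one, whose Bernstein mean is known. With n = (m+1)^2 both terms have order L/(m+1). *)
pose psi k : R := L * m.+1%:R / n%:R ^+ 2 * (k%:R - n%:R * x) ^+ 2 + L / m.+1%:R.
have hk k : `|g (k%:R / n%:R) - c| <= psi k.
  rewrite (le_trans (gL _ _))// /psi.
  set y := k%:R / n%:R - x.
  have -> : k%:R - n%:R * x = n%:R * y by rewrite /y mulrBr mulrCA divff ?gt_eqF// mulr1.
  rewrite exprMn -mulrA (mulrA (n%:R ^+ 2)^-1) mulVf ?mul1r ?expf_neq0 ?gt_eqF//.
  rewrite -mulrA -mulrDr ler_wpM2l//.
  rewrite -(real_normK (num_real y)).
  have : 0 <= m.+1%:R^-1 * ((m.+1%:R * `|y| - 1) ^+ 2 + m.+1%:R * `|y|).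
    by rewrite mulr_ge0 ?invr_ge0// ?addr_ge0 ?sqr_ge0 ?mulr_ge0.
  have -> : m.+1%:R^-1 * ((m.+1%:R * `|y| - 1) ^+ 2 + m.+1%:R * `|y|) =
     m.+1%:R * `|y| ^+ 2 + m.+1%:R^-1 - `|y|.
    by field.
  by rewrite subr_ge0.
have bpsi : (bern n psi).[x] <= 2 * L / m.+1%:R.
  have -> : psi = fun k => L * m.+1%:R / n%:R ^+ 2 * (fun k => (k%:R - n%:R * x) ^+ 2) k +
     (fun=> L / m.+1%:R) k by [].
  rewrite bern_lin bern_cst bern_var subrr expr0n addr0.
  have -> : L * m.+1%:R / n%:R ^+ 2 * (n%:R * x * (1 - x)) =
    L / m.+1%:R * (x * (1 - x)).
    by rewrite nE; field.
  have /andP[x0 x1] := x01.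
  have xx : x * (1 - x) <= 1 by nra.
  have c0 : 0 <= L / m.+1%:R by rewrite divr_ge0.
  rewrite (_ : 2 * L / m.+1%:R = L / m.+1%:R + L / m.+1%:R); last by ring.
  have := ler_wpM2l c0 xx. by rewrite mulr1 lerD2r.
move: (2 * L / m.+1%:R) bpsi => E bpsi.
rewrite ler_norml; apply/andP; split.
- rewrite lerBrDr; apply: (@le_trans _ _ (bern n (fun k => (-1) * psi k + c)).[x]).
    rewrite (_ : (fun k => _) = (fun k => (-1) * psi k + (fun=> c) k))//.
    by rewrite bern_lin bern_cst; lra.
  by apply: bern_le => // k; have := hk k; rewrite ler_norml => /andP[]; lra.
- rewrite lerBlDr; apply: (@le_trans _ _ (bern n (fun k => 1 * psi k + c)).[x]).
    by apply: bern_le => // k; have := hk k; rewrite ler_norml => /andP[]; lra.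
  rewrite (_ : (fun k => _) = (fun k => 1 * psi k + (fun=> c) k))//.
  by rewrite bern_lin bern_cst; lra.
Qed.

Definition ramp (t : R) (k : nat) (x : R) : R := clamp (k%:R * (x - t)).

Lemma clamp_lip (x y : R) : `|clamp x - clamp y| <= `|x - y|.
Proof.
wlog xy : x y / x <= y => [hw|].
  have [/hw//|/ltW/hw] := leP x y.
  by rewrite distrC (distrC y).
have /andP[h0 h1] : 0 <= clamp y - clamp x <= y - x.
  have l01 : 0 <= 1 :> R by [].
  rewrite /clamp; case: (leP 1 x) => ?; case: (leP 1 y) => ?; apply/andP; split;
  do 2?[rewrite (max_idPr l01)]; case: (leP 0 x) => ?; case: (leP 0 y) => ?; lra.
by rewrite distrC ger0_norm// distrC ger0_norm// subr_ge0.
Qed.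

Lemma ramp_lip t k x y : `|ramp t k x - ramp t k y| <= k%:R * `|x - y|.
Proof.
rewrite /ramp (le_trans (clamp_lip _ _))// -mulrBr opprB addrA subrK.
by rewrite normrM ger0_norm.
Qed.

Lemma ramp_cvg t x : ramp t k x @[k --> \oo] --> (\1_(`]t, +oo[%classic) x : R).
Proof.
rewrite indicE; have [|] := boolP (x \in _).
  rewrite inE/= in_itv/= andbT => tx; apply: cvg_near_cst.
  near=> k; rewrite /ramp /clamp.
  have k1 : 1 <= k%:R * (x - t).
    rewrite -ler_pdivrMr ?subr_gt0//; near: k; exact: nbhs_infty_ger.
  by rewrite (min_idPl k1) (max_idPr ler01).
rewrite notin_setE/= in_itv/= andbT => /negP; rewrite -leNgt => xt.
apply: cvg_near_cst; apply: nearW => k; rewrite /ramp /clamp.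
have k0 : k%:R * (x - t) <= 0 by rewrite mulr_ge0_le0// subr_le0.
by rewrite (min_idPr _) ?(max_idPl _)//; exact: le_trans ler01.
Unshelve. all: by end_near. Qed.

Lemma cvg_eq_of_small (a b : R) (e : nat -> R) :
  (forall m, `|a - b| <= e m) -> e m @[m --> \oo] --> (0 : R) -> a = b.
Proof.
move=> h he; apply/eqP; rewrite -subr_eq0 -normr_eq0 -[_ == 0]orbF.
apply/orP; left; rewrite eq_le normr_ge0 andbT -(cvg_lim _ he)//.
apply: limr_ge; first by apply/cvg_ex; exists 0.
exact: nearW.
Qed.

Lemma cvg_harmonicZ (c : R) : c / m.+1%:R @[m --> \oo] --> (0 : R).
Proof.
rewrite -[X in _ --> X](mulr0 c); apply: cvgM; first exact: cvg_cst.
exact: cvg_harmonic.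
Qed.

Section moments.
Variables I J : (R -> R) -> R.
Hypotheses (fI : bfunctional I) (fJ : bfunctional J).
Hypothesis IJ : forall n, I (fun x => clamp x ^+ n) = J (fun x => clamp x ^+ n).

Lemma bm_clampX n : bm (fun x : R => clamp x ^+ n).
Proof.
apply: bmX; apply: bm01; [exact: measurable_clamp|exact: clamp01].
Qed.

Lemma bm_horner_clamp (p : {poly R}) : bm (fun x : R => p.[clamp x]).
Proof.
rewrite (_ : (fun x => _) = fun x => \sum_(i < size p) p`_i * clamp x ^+ i).
  by apply: bm_sum => i _; apply: bmZ; exact: bm_clampX.
by apply/funext => x; rewrite horner_coef.
Qed.

Lemma moments_poly (p : {poly R}) : I (fun x => p.[clamp x]) = J (fun x => p.[clamp x]).
Proof.
have -> : (fun x => p.[clamp x]) = fun x => \sum_(i < size p) p`_i * clamp x ^+ i.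
  by apply/funext => x; rewrite horner_coef.
have b (i : 'I_(size p)) : bm (fun x => p`_i * clamp x ^+ i).
  by apply: bmZ; exact: bm_clampX.
rewrite !bfunctional_sum//; apply: eq_bigr => i _.
have [_ ZI _ _] := fI; have [_ ZJ _ _] := fJ; have bc := bm_clampX i.
by rewrite ZI// ZJ// IJ.
Qed.

Lemma bfunctional_norm (K : (R -> R) -> R) f (M : R) : bfunctional K -> bm f ->
  (forall x, `|f x| <= M) -> `|K f| <= M * K (cst 1).
Proof.
move=> [KD KZ K0 _] bf fM; have c1 : bm (cst 1 : R -> R) by exact: bm_cst.
have cM := bmZ M c1; have cN := bmZ (-1) bf.
rewrite ler_norml; apply/andP; split.
  have : 0 <= K (fun x => f x + M * cst 1 x).
    apply: K0; first exact: bmD.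
    by move=> x /=; rewrite mulr1; have := fM x; rewrite ler_norml => /andP[]; lra.
  by rewrite KD// ?KZ//; lra.
have : 0 <= K (fun x => M * cst 1 x + (-1) * f x).
  apply: K0; first exact: bmD.
  by move=> x /=; rewrite mulr1; have := fM x; rewrite ler_norml => /andP[]; lra.
by rewrite KD// !KZ//; lra.
Qed.

Lemma bfunctional_clamp (K : (R -> R) -> R) : bfunctional K ->
  bfunctional (fun f => K (f \o clamp)).
Proof.
move=> [KD KZ K0 Kl]; split.
- by move=> f g bf bg; apply: KD; exact: bm_clamp.
- by move=> c f bf; apply: KZ; exact: bm_clamp.
- by move=> f bf f0; apply: K0 => [|x]; [exact: bm_clamp|exact: f0].
- move=> f_ f M bf_ bf hM hl; apply: (Kl _ _ M).
  + by move=> n; exact: bm_clamp.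
  + exact: bm_clamp.
  + by move=> n x; exact: hM.
  + by move=> x; exact: hl.
Qed.

Lemma moments_lip (g : R -> R) (L : R) : 0 <= L -> bm g ->
  (forall y z, `|g y - g z| <= L * `|y - z|) ->
  I (g \o clamp) = J (g \o clamp).
Proof.
move=> L0 bg gL; have bgc := bm_clamp bg.
set C := I (cst 1) + J (cst 1).
apply: (@cvg_eq_of_small _ _ (fun m => (2 * L * C) / m.+1%:R)); last exact: cvg_harmonicZ.
move=> m; set n := (m.+1 ^ 2)%N.
set p := bern n (fun k => g (k%:R / n%:R)).
have bp := bm_horner_clamp p.
have hK (K : (R -> R) -> R) : bfunctional K ->
    `|K (g \o clamp) - K (fun x => p.[clamp x])| <= 2 * L / m.+1%:R * K (cst 1).
  move=> fK; have [KD KZ _ _] := fK.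
  have -> : K (g \o clamp) - K (fun x => p.[clamp x]) =
      K (fun x => (g \o clamp) x + (-1) * p.[clamp x]).
    by rewrite KD// ?KZ ?mulN1r//; exact: bmZ.
  apply: bfunctional_norm => //; first by apply: bmD => //; exact: bmZ.
  by move=> x; rewrite mulN1r distrC; apply: bern_approx => //; exact: clamp01.
have h1 := hK _ fI; have h2 := hK _ fJ.
rewrite (_ : I _ - J _ = (I (g \o clamp) - I (fun x => p.[clamp x])) -
   (J (g \o clamp) - J (fun x => p.[clamp x]))); last by rewrite moments_poly; ring.
rewrite (le_trans (ler_normB _ _))// (le_trans (lerD h1 h2))//.
by rewrite -mulrDr -/C mulrAC.
Qed.

(** Bernstein approximation passes from polynomials to Lipschitz functions, ramps pass from these to
    indicators of rays, and rays determine the functional. *)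
Lemma bfunctional_eq_moments f : bm f -> I (f \o clamp) = J (f \o clamp).
Proof.
move=> bf; pose I' f := I (f \o clamp); pose J' f := J (f \o clamp).
have fI' : bfunctional I' by exact: bfunctional_clamp.
have fJ' : bfunctional J' by exact: bfunctional_clamp.
apply: (bfunctional_eq fI' fJ') => //.
  by have := IJ 0; under eq_fun do rewrite expr0.
move=> t.
have br k : bm (ramp t k).
  apply: bm01; last by move=> x; exact: clamp01.
  apply: (measurableT_comp measurable_clamp); apply: measurable_funM => //.
  exact: measurable_funB.
have bi : bm (\1_(`]t, +oo[%classic) : R -> R) by apply: bm_indic.
have rb n x : `|ramp t n x| <= 1.
  by have /andP[? ?] := clamp01 (n%:R * (x - t)); rewrite ger0_norm.
have [_ _ _ lI] := fI'; have [_ _ _ lJ] := fJ'.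
have h1 := lI _ _ _ br bi rb (@ramp_cvg t).
have h2 := lJ _ _ _ br bi rb (@ramp_cvg t).
apply: (cvg_eqlim _ h1 h2) => k; apply: (@moments_lip _ k%:R) => //.
by move=> y z; exact: ramp_lip.
Qed.

End moments.
End functionals.

(** * Moments of power sums under stick breaking and under regeneration *)

Section rising.
Context (R : realType).
Implicit Types (x a b : R).

Definition rf x (n : nat) : R := \prod_(i < n) (x + i%:R).

Lemma rf0 x : rf x 0 = 1. Proof. by rewrite /rf big_ord0. Qed.

Lemma rfS x n : rf x n.+1 = rf x n * (x + n%:R).
Proof. by rewrite /rf big_ord_recr. Qed.

Lemma rfSl x n : rf x n.+1 = x * rf (x + 1) n.
Proof.
rewrite /rf big_ord_recl /= addr0; congr (_ * _); apply: eq_bigr => i _.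
by rewrite /= /bump /= natrD addrA.
Qed.

Lemma rf_gt0 x n : 0 < x -> 0 < rf x n.
Proof. by move=> x0; apply: prodr_gt0 => i _; rewrite ltr_wpDr. Qed.

Lemma rf_neq0 x n : 0 < x -> rf x n != 0.
Proof. by move=> /(rf_gt0 n) /gt_eqF ->. Qed.

(* E [W^m (1 - W)^k] for W with the beta(a, b) law. *)
Definition bmom a b (m k : nat) : R := rf a m * rf b k / rf (a + b) (m + k).

Lemma bmom00 a b : bmom a b 0 0 = 1.
Proof. by rewrite /bmom !rf0 mulr1 divr1. Qed.

Lemma bmom_split a b m k : 0 < a -> 0 < b ->
  bmom a b m k = bmom a b m.+1 k + bmom a b m k.+1.
Proof.
move=> a0 b0; rewrite /bmom addSn addnS !rfS.
have h1 := rf_neq0 (m + k) (addr_gt0 a0 b0).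
have h2 : a + b + (m + k)%:R != 0 by rewrite gt_eqF// ltr_wpDr// addr_gt0.
by move: h2; rewrite natrD => h2; field; rewrite h1 h2.
Qed.

End rising.

Section power_sum_moments.
Context (R : realType) (alpha : R).
Hypothesis alpha01 : 0 <= alpha < 1.
Context (I : finType) (lam : I -> nat).
Hypothesis lam_gt0 : forall i, (0 < lam i)%N.
Implicit Types (J S Q : {set I}) (v : R).

Definition wt S : nat := \sum_(i in S) lam i.

Lemma wt0 : wt finset.set0 = 0%N. Proof. by rewrite /wt big_set0. Qed.

Lemma wt_gt0 S i : i \in S -> (0 < wt S)%N.
Proof. by move=> iS; rewrite /wt (bigD1 i)//= ltn_addr. Qed.

Lemma wtD J S : S \subset J -> wt J = (wt S + wt (J :\: S))%N.
Proof.
move=> SJ; rewrite /wt (big_setID S) /=; congr addn.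
by apply: eq_bigl => i; rewrite inE andb_idl// => /(fintype.subsetP SJ).
Qed.

(** The mixed moment E [W^s (1 - W)^t] of the first stick W of the (alpha, v) stick breaking; what
    remains after it has parameters (alpha, v + alpha). *)
Definition wght v (s t : nat) : R := bmom (1 - alpha) (v + alpha) s t.

(* [Mh v J] is E prod_(i in J) p_(lam i), where p_b is the sum of the b-th powers
   of the (alpha, v) stick-breaking frequencies: size-biased, the first stick
   contains a chosen i in J. The value does not depend on i ([Mh_any]). *)
Fixpoint mhat (fuel : nat) v J : R :=
  if fuel is f.+1 then
    if [pick i in J] is Some i then
      \sum_(S : {set I} | (S \subset J) && (i \in S))
        wght v (wt S).-1 (wt (J :\: S)) * mhat f (v + alpha) (J :\: S)
    else 1
  else 1.

Lemma card_setD_lt J S i : i \in S -> S \subset J -> (#|J :\: S| < #|J|)%N.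
Proof.
move=> iS SJ; rewrite proper_card// properE subsetDl/=; apply/fintype.subsetPn.
by exists i; rewrite ?inE ?iS//; exact: (fintype.subsetP SJ).
Qed.

Lemma mhat_fuel f v J : (#|J| <= f)%N -> mhat f v J = mhat #|J| v J.
Proof.
elim: {f}_.+1 {-2}f (ltnSn f) v J => // N IH f fN v J Jf.
case: f => [|f] in fN Jf *; first by move: Jf; rewrite leqn0 => /eqP ->.
case E : #|J| => [|c].
  by rewrite /=; case: pickP => // i; rewrite (cards0_eq E) inE.
rewrite /=; case: pickP => // i iJ; apply: eq_bigr => S /andP[SJ iS]; congr (_ * _).
have lt := card_setD_lt iS SJ; rewrite E ltnS in lt.
rewrite (IH f)//; last by rewrite (leq_trans lt)// -ltnS -E.
by rewrite (IH c)// -E (leq_trans Jf).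
Qed.

Definition Mh v J : R := mhat #|J| v J.

Lemma Mh0 v : Mh v finset.set0 = 1. Proof. by rewrite /Mh cards0. Qed.

Lemma Mh_pick v J : J != finset.set0 -> exists2 i, i \in J &
  Mh v J = \sum_(S : {set I} | (S \subset J) && (i \in S))
        wght v (wt S).-1 (wt (J :\: S)) * Mh (v + alpha) (J :\: S).
Proof.
move=> J0; rewrite /Mh; case E : #|J| => [|c]; first by rewrite (cards0_eq E) eqxx in J0.
rewrite /=; case: pickP => [i iJ|J00]; last first.
  by move/finset.set0Pn : J0 => [i]; rewrite J00.
exists i => //; apply: eq_bigr => S /andP[SJ iS]; congr (_ * _).
by rewrite mhat_fuel// -ltnS -E (card_setD_lt iS SJ).
Qed.

(** Two successive size-biased picks, one receiving weight s and the other weight q, have the same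
    weight in both orders. This is the invariance of the frequencies under size-biased
    permutation. *)
Lemma wght_sym v s q t : 0 < v + alpha -> (0 < s)%N -> (0 < q)%N ->
  wght v s.-1 (q + t) * wght (v + alpha) q.-1 t =
  wght v q.-1 (s + t) * wght (v + alpha) s.-1 t.
Proof.
move=> v0; have /andP[a0 a1] := alpha01.
case: s => // s _; case: q => // q _ /=; rewrite /wght /bmom !addSn.
have -> : (1 - alpha + (v + alpha)) = v + 1 by ring.
have -> : (1 - alpha + (v + alpha + alpha)) = v + alpha + 1 by ring.
rewrite !(rfSl (v + alpha)) !addnS (addnCA q s t).
have v1 : 0 < v + 1 by lra. have v2 : 0 < v + alpha + 1 by lra.
have := rf_neq0 (s + (q + t)).+1 v1; have := rf_neq0 (s + t) v2.
have := rf_neq0 (q + t) v2 => h1 h2 h3.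
by field; rewrite h1 h2 h3.
Qed.

Lemma pair_sum_swap (J : {set I}) (p q : pred {set I}) (F : {set I} -> {set I} -> R) :
  \sum_(S : {set I} | (S \subset J) && p S)
    \sum_(Q : {set I} | (Q \subset J :\: S) && q Q) F S Q =
  \sum_(Q : {set I} | (Q \subset J) && q Q)
    \sum_(S : {set I} | (S \subset J :\: Q) && p S) F S Q.
Proof.
rewrite (exchange_big_dep (fun Q : {set I} => (Q \subset J) && q Q)) /=.
  apply: eq_bigr => Q /andP[QJ qQ]; apply: eq_bigl => S.
  rewrite !finset.subsetD QJ qQ (fintype.disjoint_sym (mem Q) (mem S)) /= andbT.
  by case: (S \subset J); case: (p S); rewrite ?andbT ?andbF.
by move=> S Q /andP[SJ pS] /andP[]; rewrite finset.subsetD => /andP[-> _] ->.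
Qed.

(** Compare the expansions at i and at j. The sets containing both indices contribute equally. For a
    set containing only one, the remaining factor is expanded at the other index by induction; both
    sides become sums over pairs of disjoint sets, exchanged by [wght_sym]. *)
Lemma Mh_any v J i : 0 < v + alpha -> i \in J ->
  Mh v J = \sum_(S : {set I} | (S \subset J) && (i \in S))
        wght v (wt S).-1 (wt (J :\: S)) * Mh (v + alpha) (J :\: S).
Proof.
have /andP[a0 a1] := alpha01.
elim: {J}_.+1 {-2}J (ltnSn #|J|) v i => // N IH J JN v i v0 iJ.
have [|j jJ ->] := @Mh_pick v J; first by apply/finset.set0Pn; exists i.
have [->//|ij] := eqVneq i j.
have hs (k l : I) : k \in J -> l \in J -> k != l ->
  \sum_(S : {set I} | (S \subset J) && (k \in S))
        wght v (wt S).-1 (wt (J :\: S)) * Mh (v + alpha) (J :\: S) =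
  \sum_(S : {set I} | (S \subset J) && ((k \in S) && (l \in S)))
        wght v (wt S).-1 (wt (J :\: S)) * Mh (v + alpha) (J :\: S) +
  \sum_(S : {set I} | (S \subset J) && ((k \in S) && (l \notin S)))
   \sum_(Q : {set I} | (Q \subset J :\: S) && ((l \in Q) && (k \notin Q)))
     wght v (wt S).-1 (wt Q + wt (J :\: S :\: Q)) *
     wght (v + alpha) (wt Q).-1 (wt (J :\: S :\: Q)) *
     Mh (v + alpha + alpha) (J :\: S :\: Q).
  move=> kJ lJ kl; rewrite (bigID (fun S : {set I} => l \in S)) /=; congr (_ + _).
    by apply: eq_bigl => S; rewrite andbA.
  rewrite (eq_bigl (fun S : {set I} => (S \subset J) && ((k \in S) && (l \notin S)))).
    2: by move=> S; rewrite andbA.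
  apply: eq_bigr => S /and3P[SJ kS lS].
  rewrite (IH (J :\: S) _ (v + alpha) l).
  - rewrite big_distrr /=.
    rewrite (eq_bigl (fun Q : {set I} => (Q \subset J :\: S) && ((l \in Q) && (k \notin Q)))).
      by apply: eq_bigr => Q /andP[QJ _]; rewrite (wtD QJ) mulrA.
    move=> Q /=; have [QJ|//] := boolP (Q \subset _).
    have -> : k \notin Q by apply/negP => /(fintype.subsetP QJ); rewrite inE kS.
    by rewrite andbT.
  - by rewrite (leq_trans (card_setD_lt kS SJ))// -ltnS.
  - by rewrite ltr_wpDr.
  - by rewrite inE lS.
rewrite (hs j i)// ?(hs i j)//; last by rewrite eq_sym.
congr (_ + _); first by apply: eq_bigl => S; rewrite (andbC (j \in S)).
rewrite pair_sum_swap; apply: eq_bigr => Q /and3P[QJ iQ jQ].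
apply: eq_bigr => S /and3P[SJ jS iS].
rewrite !finset.setDDl (finset.setUC S Q) -!finset.setDDl wght_sym//.
- exact: wt_gt0 jS.
- exact: wt_gt0 iQ.
Qed.

(** This is the recursion obtained by writing each power sum as a power of the first stick plus the
    rest. Fix i in J. The size-biased terms exceed the terms with i in S here by moments with one
    more factor 1 - W ([bmom_split]). This excess must match the terms with i outside S: the former
    is expanded by induction, the latter by [Mh_any] at i. *)
Lemma Mh_stick v J : 0 < v + alpha ->
  Mh v J = \sum_(S : {set I} | S \subset J)
    wght v (wt S) (wt (J :\: S)) * Mh (v + alpha) (J :\: S).
Proof.
have /andP[a0 a1] := alpha01.
elim: {J}_.+1 {-2}J (ltnSn #|J|) v => // N IH J JN v v0.
have [->|/finset.set0Pn[i iJ]] := eqVneq J finset.set0.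
  rewrite (big_pred1 finset.set0); last by move=> S /=; rewrite finset.subset0.
  by rewrite finset.setDv wt0 !Mh0 /wght bmom00 mulr1.
rewrite (Mh_any v0 iJ) [RHS](bigID (fun S : {set I} => i \in S)) /=.
apply/eqP; rewrite addrC -subr_eq -sumrB; apply/eqP.
have a10 : 0 < 1 - alpha by lra.
transitivity (\sum_(S : {set I} | (S \subset J) && (i \in S))
   \sum_(Q : {set I} | (Q \subset J :\: S) && (i \notin Q))
     wght v (wt S).-1 (wt Q + wt (J :\: S :\: Q)).+1 *
     wght (v + alpha) (wt Q) (wt (J :\: S :\: Q)) *
     Mh (v + alpha + alpha) (J :\: S :\: Q)).
  apply: eq_bigr => S /andP[SJ iS].
  rewrite -mulrBl; have /prednK e := wt_gt0 iS.
  have -> : wght v (wt S).-1 (wt (J :\: S)) - wght v (wt S) (wt (J :\: S)) =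
      wght v (wt S).-1 (wt (J :\: S)).+1.
    by rewrite /wght (bmom_split (wt S).-1 _ a10 v0) e addrAC subrr add0r.
  rewrite IH; [|by rewrite (leq_trans (card_setD_lt iS SJ))// -ltnS|by rewrite ltr_wpDr].
  rewrite big_distrr /=.
  rewrite (eq_bigl (fun Q : {set I} => (Q \subset J :\: S) && (i \notin Q))).
    by apply: eq_bigr => Q /andP[QJ _]; rewrite (wtD QJ) mulrA.
  move=> Q /=; have [QJ|//] := boolP (Q \subset _).
  by apply/esym/negP => /(fintype.subsetP QJ); rewrite inE iS.
rewrite pair_sum_swap; apply: eq_bigr => Q /andP[QJ iQ].
rewrite (@Mh_any (v + alpha) _ i); [|by rewrite ltr_wpDr|by rewrite inE iQ].
rewrite big_distrr /=; apply: eq_bigr => S /andP[SJ iS].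
rewrite (wtD SJ) mulrA; congr (_ * _); last by rewrite !finset.setDDl finset.setUC.
rewrite !finset.setDDl (finset.setUC S Q); set t := wt (_ :\: _).
have := wt_gt0 iS; case: (wt S) => // s _; rewrite /=.
rewrite /wght /bmom !addSn.
have -> : (1 - alpha + (v + alpha)) = v + 1 by ring.
have -> : (1 - alpha + (v + alpha + alpha)) = v + alpha + 1 by ring.
rewrite !(rfSl (v + alpha)) !addnS (addnCA s).
have v1 : 0 < v + 1 by lra. have v2 : 0 < v + alpha + 1 by lra.
have := rf_neq0 (wt Q + (s + t)).+1 v1; have := rf_neq0 (s + t) v2.
have := rf_neq0 (wt Q + t) v2 => h1 h2 h3.
by field; rewrite h1 h2 h3.
Qed.

(* Up to a common constant, int (1 - e^-y)^m e^(-k y) nu(dy) and the Laplace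
   exponent int (1 - e^(-n y)) nu(dy) of the subordinator. *)
Definition levyD theta (k m : nat) : R :=
  rf (1 - alpha) m.-1 * rf theta k / rf (1 - alpha + theta) (k + m) *
  (k%:R * alpha + m%:R * theta).

Definition levyPhi theta (n : nat) : R :=
  n%:R * rf theta n / rf (1 - alpha + theta) n.

(** At parameter theta - alpha, the size-biased recursion summed over i in J with weights [lam i]
    gives [wt J] times the moment, and so does [wt J] times the stick recursion. In the difference
    only moments at theta survive; the term of the empty set gives the left side. *)
Lemma Mh_regen theta J : 0 < theta ->
  levyPhi theta (wt J) * Mh theta J =
  \sum_(S : {set I} | (S \subset J) && (S != finset.set0))
    levyD theta (wt (J :\: S)) (wt S) * Mh theta (J :\: S).
Proof.
move=> t0; have /andP[a0 a1] := alpha01.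
have v0 : 0 < theta - alpha + alpha by rewrite subrK.
have h1 := Mh_stick J v0.
rewrite (bigD1 finset.set0) ?finset.sub0set//= wt0 finset.setD0 !subrK in h1.
have h2 : (wt J)%:R * Mh (theta - alpha) J =
  \sum_(S : {set I} | (S \subset J) && (S != finset.set0))
    (wt S)%:R * (wght (theta - alpha) (wt S).-1 (wt (J :\: S)) * Mh theta (J :\: S)).
  rewrite {1}/wt natr_sum big_distrl /=.
  under eq_bigr => i iJ do rewrite (Mh_any v0 iJ) subrK big_distrr /=.
  rewrite (exchange_big_dep (fun S : {set I} => (S \subset J) && (S != finset.set0))) /=.
    apply: eq_bigr => S /andP[SJ S0]; rewrite /wt natr_sum big_distrl /=.
    by apply: eq_bigl => i; rewrite SJ /= andb_idl// => /(fintype.subsetP SJ).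
  by move=> i S iJ /andP[-> iS] /=; apply/finset.set0Pn; exists i.
transitivity ((wt J)%:R * (wght (theta - alpha) 0 (wt J) * Mh theta J)).
  rewrite /levyPhi /wght /bmom rf0 subrK add0n mul1r; ring.
have h0 : wght (theta - alpha) 0 (wt J) * Mh theta J = Mh (theta - alpha) J -
   \sum_(S : {set I} | (S \subset J) && (S != finset.set0))
        wght (theta - alpha) (wt S) (wt (J :\: S)) * Mh theta (J :\: S).
  by apply/eqP; rewrite eq_sym subr_eq; apply/eqP.
rewrite h0 mulrBr h2 big_distrr /= -sumrB; apply: eq_bigr => S /andP[SJ /finset.set0Pn[i iS]].
rewrite !mulrA -mulrBl; congr (_ * _).
rewrite (wtD SJ); have := wt_gt0 iS; case: (wt S) => // s _; set k := wt _.
rewrite /levyD /wght /bmom subrK /= !addSn (addnS k) (addnC k s) !rfS.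
have b0 : 0 < 1 - alpha + theta by lra.
have h3 := rf_neq0 (s + k) b0.
have h4 : 1 - alpha + theta + (s + k)%:R != 0 by rewrite gt_eqF// ltr_wpDr.
move: h4; rewrite natrD -!(addn1 (_ + _)) !natrD -natr1 => h4.
by field; rewrite h3 h4.
Qed.

End power_sum_moments.

Section numeric_limits.
Context (R : realType).

Lemma cvg_sumr (J : Type) (r : seq J) (p : pred J) (F : J -> nat -> R) (a : J -> R) :
  (forall j, p j -> F j n @[n --> \oo] --> a j) ->
  \sum_(j <- r | p j) F j n @[n --> \oo] --> \sum_(j <- r | p j) a j.
Proof.
move=> h; elim: r => [|j r IH].
  by under eq_fun do rewrite big_nil; rewrite big_nil; exact: cvg_cst.
under eq_fun do rewrite big_cons; rewrite big_cons.
by case: (boolP (p j)) => // pj; apply: cvgD => //; exact: h.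
Qed.

(** The limit L solves L = l + a L, and each step contracts the distance to L by the factor a, up to
    an error that becomes small. *)
Lemma cvg_affine_rec (e c : nat -> R) (a l : R) : 0 <= a < 1 ->
  (forall K, e K.+1 = c K + a * e K) -> c K @[K --> \oo] --> l ->
  e K @[K --> \oo] --> l / (1 - a).
Proof.
move=> /andP[a0 a1] eS cl; set L := l / (1 - a).
have L1 : L = l + a * L by rewrite /L; field; rewrite subr_eq0 gt_eqF.
apply/cvgrPdist_le => /= eps eps0.
have a1' : 0 < 1 - a by rewrite subr_gt0.
have /cvgrPdist_le /(_ (eps / 2 * (1 - a))) h : c K @[K --> \oo] --> l by [].
have e2 : 0 < eps / 2 * (1 - a) by rewrite mulr_gt0// divr_gt0.
have {h} [N _ hN] := h e2.
have bnd j : `|L - e (N + j)%N| <= eps / 2 + a ^+ j * `|L - e N|.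
  elim: j => [|j IH].
    by rewrite addn0 expr0 mul1r lerDr divr_ge0// ltW.
  rewrite addnS eS {1}L1.
  have -> : l + a * L - (c (N + j)%N + a * e (N + j)%N) =
     (l - c (N + j)%N) + a * (L - e (N + j)%N) by ring.
  rewrite (le_trans (ler_normD _ _))// normrM (ger0_norm a0).
  have := hN (N + j)%N (leq_addr _ _) => /=.
  have := ler_wpM2l a0 IH; rewrite exprS.
  move: (`|_ - c _|) (`|_ - e (N + j)%N|) (`|L - e N|) (a ^+ j) => x y z t h1 h2.
  nra.
have : a ^+ j * `|L - e N| @[j --> \oo] --> (0 : R).
  rewrite -[X in _ --> X](mul0r `|L - e N|); apply: cvgM; last exact: cvg_cst.
  by apply: cvg_expr; rewrite ger0_norm.
have e3 : 0 < eps / 2 by rewrite divr_gt0.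
move/cvgrPdist_le => /(_ _ e3) [N' _ hN'].
exists (N + N')%N => // K /= NK.
have NK' : (N <= K)%N by rewrite (leq_trans _ NK)// leq_addr.
have := bnd (K - N)%N; rewrite subnKC// => /le_trans; apply.
have := hN' (K - N)%N; rewrite /= leq_subRL// => /(_ NK).
by rewrite sub0r normrN ger0_norm; [lra|rewrite mulr_ge0// exprn_ge0].
Qed.

(** The product is at most 1/(1 + sum), because (1 - y)(1 + s + y) <= 1 + s for y, s >= 0. *)
Lemma prod_onem_cvg0 (x : nat -> R) : (forall j, 0 <= x j <= 1) ->
  series x n @[n --> \oo] --> +oo ->
  \prod_(j < n) (1 - x j) @[n --> \oo] --> (0 : R).
Proof.
move=> x01 xoo.
have bnd n : 0 <= \prod_(j < n) (1 - x j) <= (1 + series x n)^-1.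
  have h1 : 0 <= \prod_(j < n) (1 - x j).
    by apply: prodr_ge0 => j _; have /andP[] := x01 j; lra.
  have s0 : 0 <= series x n by apply: sumr_ge0 => j _; have /andP[] := x01 j.
  rewrite h1 /= -[leRHS]mul1r ler_pdivlMr; last lra.
  elim: n {h1 s0} => [|n IH]; first by rewrite big_ord0 /series /= big_geq// mul1r addr0.
  rewrite big_ord_recr /= /series /= big_nat_recr//=.
  have s0 : 0 <= series x n by apply: sumr_ge0 => j _; have /andP[] := x01 j.
  have h1 : 0 <= \prod_(j < n) (1 - x j).
    by apply: prodr_ge0 => j _; have /andP[] := x01 j; lra.
  move: IH s0 h1; rewrite /series /=; move: (\prod_(_ < _) _) (\sum_(_ <= _ < _) _) => p s.
  have := x01 n; move: (x n) => y /andP[y0 y1] h s0 p0.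
  have : 0 <= p * (y * (s + y)) by apply: mulr_ge0 => //; nra.
  nra.
apply: (@squeeze_cvgr _ _ _ _ (fun=> 0) (fun n => (1 + series x n)^-1)).
- by apply: nearW => n; exact: bnd.
- exact: cvg_cst.
- apply/gtr0_cvgV0.
    by apply: nearW => n; rewrite ltr_wpDr// sumr_ge0// => j _; have /andP[] := x01 j.
  apply/cvgryPge => A; have /cvgryPge/(_ A) := xoo.
  by apply: filterS => n; lra.
Qed.

Lemma dvg_series_harmonic_like (x : nat -> R) (c : R) : 0 < c ->
  (forall j, c / j.+1%:R <= x j) -> series x n @[n --> \oo] --> +oo.
Proof.
move=> c0 hx; have := @dvg_harmonic R.
have nd : nondecreasing_seq (series (@harmonic R)).
  by apply: nondecreasing_series => n _ _; rewrite /harmonic /= invr_ge0.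
move=> /(nondecreasing_dvgn_lt nd) h.
apply/cvgryPge => A; have /cvgryPge/(_ (A / c)) := h.
apply: filterS => n; rewrite ler_pdivrMr// => /le_trans; apply.
rewrite mulrC /series /= big_distrr /=; apply: ler_sum => j _.
exact: hx.
Qed.

End numeric_limits.

(** * Recursions for sequences of cells and their limits *)

Section stick_recursions.
Context (R : realType) (I : finType) (lam : I -> nat).
Hypothesis lam_gt0 : forall i, (0 < lam i)%N.
Implicit Types (J S : {set I}) (b : nat -> nat -> R) (beta : nat -> nat -> nat -> R).

(* E prod_(i in J) sum_(a < K) (z_a - z_(a+1))^(lam i) for z_a = r_0 ... r_(a-1) with
   independent r_a such that E [(1 - r_a)^m r_a^k] = beta a k m. *)
Fixpoint Mk beta K J : R :=
  if K is K'.+1 then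
    \sum_(S : {set I} | S \subset J) beta 0%N (wt lam (J :\: S)) (wt lam S) *
       Mk (fun i => beta i.+1) K' (J :\: S)
  else (J == finset.set0)%:R.

Definition Minf b J : R := limn (fun K => Mk (fun=> b) K J).

Section homogeneous.
Variable b : nat -> nat -> R.
Hypotheses (b00 : b 0%N 0%N = 1) (b1 : forall n, (0 < n)%N -> 0 <= b n 0%N < 1).

Lemma Mk_rec K J : J != finset.set0 -> Mk (fun=> b) K.+1 J =
  \sum_(S : {set I} | (S \subset J) && (S != finset.set0))
     b (wt lam (J :\: S)) (wt lam S) * Mk (fun=> b) K (J :\: S) +
  b (wt lam J) 0 * Mk (fun=> b) K J.
Proof.
move=> J0; rewrite /= (bigD1 finset.set0) ?finset.sub0set//= addrC.
by rewrite wt0 finset.setD0.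
Qed.

Lemma Mk_cvg J : Mk (fun=> b) K J @[K --> \oo] --> Minf b J.
Proof.
suff [l hl] : exists l : R, Mk (fun=> b) K J @[K --> \oo] --> l.
  by rewrite /Minf (cvg_lim _ hl).
elim: {J}_.+1 {-2}J (ltnSn #|J|) => // N IH J JN.
have [->|J0] := eqVneq J finset.set0.
  exists 1; rewrite (_ : (fun K => _) = fun=> 1); first exact: cvg_cst.
  apply/funext; elim=> [|K IHK]; first by rewrite /= eqxx.
  rewrite /= (big_pred1 finset.set0); last by move=> S /=; rewrite finset.subset0.
  by rewrite finset.setDv wt0 b00 mul1r IHK.
have /choice [l hl] : forall S : {set I}, exists l : R, (S \subset J) && (S != finset.set0) ->
    Mk (fun=> b) K (J :\: S) @[K --> \oo] --> l.
  move=> S; have [/andP[SJ /finset.set0Pn[i iS]]|_] := boolP (_ && _); last by exists 0.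
  have [|l hl] := IH (J :\: S); last by exists l.
  by rewrite (leq_trans (card_setD_lt iS SJ)).
have /finset.set0Pn[i iJ] := J0.
eexists; apply: (@cvg_affine_rec _ _ (fun K => \sum_(S : {set I} | (S \subset J) && (S != finset.set0))
     b (wt lam (J :\: S)) (wt lam S) * Mk (fun=> b) K (J :\: S))
   (b (wt lam J) 0%N)).
- by apply: b1; exact: wt_gt0 iJ.
- by move=> K; rewrite Mk_rec.
- apply: cvg_sumr => S hS; apply: cvgM; first exact: cvg_cst.
  exact: hl hS.
Qed.

Lemma Minf0 : Minf b finset.set0 = 1.
Proof.
apply: cvg_lim => //; rewrite (_ : (fun K => _) = fun=> 1); first exact: cvg_cst.
apply/funext; elim=> [|K IHK]; first by rewrite /= eqxx.
rewrite /= (big_pred1 finset.set0); last by move=> S /=; rewrite finset.subset0.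
by rewrite finset.setDv wt0 b00 mul1r IHK.
Qed.

(** In the limit, the term of the empty set (no exponent uses the first cell) reproduces the unknown
    with factor [b (wt lam J) 0]; solving for it gives the denominator. *)
Lemma Minf_rec J : J != finset.set0 -> Minf b J =
  \sum_(S : {set I} | (S \subset J) && (S != finset.set0))
     b (wt lam (J :\: S)) (wt lam S) / (1 - b (wt lam J) 0) * Minf b (J :\: S).
Proof.
move=> J0; have /finset.set0Pn[i iJ] := J0.
have := @Mk_cvg J; set s := (X in _ -> _ = X) => h.
rewrite -(cvg_lim _ h)//; apply: cvg_lim => //.
have -> : s = (\sum_(S : {set I} | (S \subset J) && (S != finset.set0))
     b (wt lam (J :\: S)) (wt lam S) * Minf b (J :\: S)) / (1 - b (wt lam J) 0).
  by rewrite /s big_distrl /=; apply: eq_bigr => S _; rewrite mulrAC.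
apply: (@cvg_affine_rec _ _ (fun K => \sum_(S : {set I} | (S \subset J) && (S != finset.set0))
     b (wt lam (J :\: S)) (wt lam S) * Mk (fun=> b) K (J :\: S))
   (b (wt lam J) 0%N)).
- by apply: b1; exact: wt_gt0 iJ.
- by move=> K; rewrite Mk_rec.
- apply: cvg_sumr => S hS; apply: cvgM; first exact: cvg_cst.
  exact: Mk_cvg.
Qed.

End homogeneous.

(** The coefficients of [Minf_rec] converge to those of [Mh_regen] divided by [levyPhi], so
    induction on the number of exponents identifies the limit. *)
Lemma Minf_cvg (alpha theta : R) (b_ : nat -> nat -> nat -> R) J :
  0 <= alpha < 1 -> 0 < theta ->
  (forall N, b_ N 0%N 0%N = 1) ->
  (forall N n, (0 < n)%N -> 0 <= b_ N n 0%N < 1) ->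
  (forall k m, (0 < m)%N -> b_ N k m / (1 - b_ N (k + m)%N 0%N) @[N --> \oo] -->
      levyD alpha theta k m / levyPhi alpha theta (k + m)) ->
  Minf (b_ N) J @[N --> \oo] --> Mh alpha lam theta J.
Proof.
move=> a01 t0 b00 b1 hb; have /andP[a0 a1] := a01.
elim: {J}_.+1 {-2}J (ltnSn #|J|) => // n IH J JN.
have [->|J0] := eqVneq J finset.set0.
  rewrite Mh0 (_ : (fun N => _) = fun=> 1); first exact: cvg_cst.
  by apply/funext => N; rewrite Minf0.
have /finset.set0Pn[i iJ] := J0.
have P0 : levyPhi alpha theta (wt lam J) != 0.
  rewrite /levyPhi gt_eqF// divr_gt0 ?mulr_gt0 ?ltr0n ?rf_gt0//; last lra.
  exact: wt_gt0 iJ.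
have -> : Mh alpha lam theta J = \sum_(S : {set I} | (S \subset J) && (S != finset.set0))
    levyD alpha theta (wt lam (J :\: S)) (wt lam S) / levyPhi alpha theta (wt lam J)
    * Mh alpha lam theta (J :\: S).
  apply: (mulfI P0); rewrite Mh_regen// big_distrr /=; apply: eq_bigr => S _.
  by rewrite mulrA; congr (_ * _); rewrite mulrC mulfVK.
rewrite (_ : (fun N => _) = fun N => \sum_(S : {set I} | (S \subset J) && (S != finset.set0))
     b_ N (wt lam (J :\: S)) (wt lam S) / (1 - b_ N (wt lam J) 0%N) * Minf (b_ N) (J :\: S)).
  apply: cvg_sumr => S /andP[SJ /finset.set0Pn[j jS]]; apply: cvgM.
    by rewrite (wtD lam SJ) addnC; apply: hb; exact: wt_gt0 jS.
  by apply: IH; rewrite (leq_trans (card_setD_lt jS SJ)).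
by apply/funext => N; rewrite -(Minf_rec (b00 N) (b1 N)).
Qed.

(* The ordered version of [Mk]: the probability that the nonempty cells among the
   first K contain, in this order, s_0, s_1, ... sample points. *)
Fixpoint kap beta K (s : seq nat) : R :=
  if s is m :: s' then
    if K is K'.+1 then
      beta 0%N (sumn s) 0%N * kap (fun i => beta i.+1) K' s +
      'C(sumn s, m)%:R * beta 0%N (sumn s') m * kap (fun i => beta i.+1) K' s'
    else 0
  else 1.

(** The limit of [kap] for infinitely many cells with the same law: summing over the number of empty
    cells before the first occupied one gives the geometric denominator. *)
Fixpoint kinf b (s : seq nat) : R :=
  if s is m :: s' then
    'C(sumn s, m)%:R * b (sumn s') m / (1 - b (sumn s) 0%N) * kinf b s'
  else 1.

Lemma kap_nil beta K : kap beta K [::] = 1. Proof. by case: K. Qed.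

Lemma kap_cvg b s : (forall n, (0 < n)%N -> 0 <= b n 0%N < 1) -> all (leq 1) s ->
  kap (fun=> b) K s @[K --> \oo] --> kinf b s.
Proof.
move=> b1; elim: s => [_|m s IH /= /andP[m0 s0]].
  rewrite (_ : (fun K => _) = fun=> 1); first exact: cvg_cst.
  by apply/funext => K; rewrite kap_nil.
rewrite mulrAC; apply: (@cvg_affine_rec _ _ (fun K => 'C(m + sumn s, m)%:R * b (sumn s) m *
    kap (fun=> b) K s) (b (m + sumn s)%N 0%N)).
- by apply: b1; rewrite addn_gt0 m0.
- by move=> K /=; rewrite addrC.
- by apply: cvgM; [exact: cvg_cst|exact: IH].
Qed.

(* The law of the (alpha, theta) regenerative composition, read from the right. *)
Fixpoint creg (alpha theta : R) (s : seq nat) : R :=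
  if s is m :: s' then
    'C(sumn s, m)%:R * levyD alpha theta (sumn s') m / levyPhi alpha theta (sumn s) *
    creg alpha theta s'
  else 1.

Lemma kinf_cvg (alpha theta : R) (b_ : nat -> nat -> nat -> R) s :
  (forall k m, (0 < m)%N -> b_ N k m / (1 - b_ N (k + m)%N 0%N) @[N --> \oo] -->
      levyD alpha theta k m / levyPhi alpha theta (k + m)) ->
  all (leq 1) s -> kinf (b_ N) s @[N --> \oo] --> creg alpha theta s.
Proof.
move=> hb; elim: s => [_|m s IH /= /andP[m0 s0]]; first exact: cvg_cst.
apply: cvgM; last exact: IH.
under eq_fun do rewrite -mulrA; rewrite -[_ * _ / levyPhi _ _ _]mulrA.
by apply: cvgM; [exact: cvg_cst|rewrite addnC; exact: hb].
Qed.

End stick_recursions.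

(** * Recursions for the sampling formula of the two-parameter partitions *)

Section partition_weights.
Context (R : realType) (alpha : R).
Hypothesis alpha01 : 0 <= alpha < 1.
Implicit Types (v theta : R) (s : seq nat).

Definition rfa v k : R := \prod_(j < k) (v + j%:R * alpha).

Definition cmult s : nat := \prod_(a <- undup s) (count_mem a s)`!.

Definition blockw s : R := \prod_(a <- s) (rf (1 - alpha) a.-1 / a`!%:R).

(* Pitman's sampling formula: the law of the (alpha, v) partition structure. *)
Definition partw v s : R :=
  (sumn s)`!%:R * rfa v (size s) / rf v (sumn s) * blockw s / (cmult s)%:R.

Lemma cmult_iota s B : (forall a, a \in s -> (a < B)%N) ->
  cmult s = (\prod_(0 <= a < B) (count_mem a s)`!)%N.
Proof.
move=> sB; rewrite /cmult -[RHS](big_rmcond_in (fun a => a \in s)).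
  rewrite -[RHS]big_filter; apply: perm_big; apply: uniq_perm.
  - exact: undup_uniq.
  - by rewrite filter_uniq// iota_uniq.
  - move=> a; rewrite mem_undup mem_filter mem_index_iota.
    by case: (boolP (a \in s)) => // /sB ->.
by move=> a _ /count_memPn ->.
Qed.

Lemma cmult_rem m s : m \in s -> cmult s = (count_mem m s * cmult (rem m s))%N.
Proof.
move=> ms; pose B := (\max_(a <- s) a).+1.
have sB a : a \in s -> (a < B)%N by move=> aS; rewrite ltnS leq_bigmax_seq.
rewrite (cmult_iota sB) (@cmult_iota (rem m s) B); last first.
  by move=> a /mem_rem; exact: sB.
rewrite !big_mkord (bigD1 (Ordinal (sB m ms)))//= [in RHS](bigD1 (Ordinal (sB m ms)))//=.
rewrite mulnA; congr (_ * _)%N.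
  rewrite count_rem ms /= eqxx.
  by have : (0 < count_mem m s)%N; [rewrite -has_count has_pred1|case: (count_mem m s) => // n _; rewrite subn1 factS].
apply: eq_bigr => a am; congr (_ `!); rewrite count_rem ms /= (_ : m == a = false) ?subn0//.
by apply: contraNF am => /eqP e; apply/eqP; apply: val_inj; rewrite /= e.
Qed.

Lemma sum_count (F : nat -> R) s :
  \sum_(m <- undup s) (count_mem m s)%:R * F m = \sum_(a <- s) F a.
Proof.
rewrite -[RHS](@big_undup_iterop_count _ _ _ _ s xpredT F).
by apply: eq_bigr => m _; rewrite mulr_natl.
Qed.

Lemma sumn_rem m s : m \in s -> sumn s = (m + sumn (rem m s))%N.
Proof. by move=> /perm_to_rem/perm_sumn ->. Qed.

Lemma size_rem1 m s : m \in s -> size s = (size (rem m s)).+1.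
Proof. by move=> /perm_to_rem/perm_size ->. Qed.

Lemma rfa_gt0 v k : 0 < v -> 0 < rfa v k.
Proof.
move=> v0; have /andP[a0 _] := alpha01.
by apply: prodr_gt0 => j _; rewrite ltr_wpDr// mulr_ge0.
Qed.

Lemma rfaS v k : rfa v k.+1 = rfa v k * (v + k%:R * alpha).
Proof. by rewrite /rfa big_ord_recr. Qed.

Lemma rfaSl v k : rfa v k.+1 = v * rfa (v + alpha) k.
Proof.
rewrite /rfa big_ord_recl /= mul0r addr0; congr (_ * _); apply: eq_bigr => i _.
by rewrite /= /bump /= natrD; ring.
Qed.

Lemma fact_neq0 n : n`!%:R != 0 :> R.
Proof. by rewrite pnatr_eq0 -lt0n fact_gt0. Qed.

Lemma cmult_neq0 s : (cmult s)%:R != 0 :> R.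
Proof.
rewrite pnatr_eq0 -lt0n /cmult; elim: (undup s) => [|a l IH]; rewrite ?big_nil// big_cons.
by rewrite muln_gt0 fact_gt0.
Qed.

Lemma bin_factR n m : (m <= n)%N -> 'C(n, m)%:R = n`!%:R / (m`!%:R * (n - m)`!%:R) :> R.
Proof.
move=> mn; rewrite -(bin_fact mn) !natrM mulfK// mulf_neq0//; exact: fact_neq0.
Qed.

(** The multiplicity of m is factored out, so that sums over distinct parts become sums over all
    entries of [s] through [sum_count]. *)
Lemma partw_rem v s m : 0 < v -> (0 < m)%N -> m \in s ->
  'C(sumn s, m)%:R * partw v (rem m s) =
  (count_mem m s)%:R * ((sumn s)`!%:R * rfa v (size s).-1 / rf v (sumn s - m) *
   blockw s / (cmult s)%:R / rf (1 - alpha) m.-1).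
Proof.
move=> v0 m0 ms; have /andP[a0 a1] := alpha01.
have bE : blockw s = rf (1 - alpha) m.-1 / m`!%:R * blockw (rem m s).
  by rewrite /blockw (perm_big _ (perm_to_rem ms)) big_cons.
have c0 := cmult_neq0 s.
rewrite /partw bE (cmult_rem ms) natrM in c0 *.
move: c0; rewrite mulf_eq0 negb_or => /andP[c1 c2].
rewrite (sumn_rem ms) (size_rem1 ms) /= bin_factR ?leq_addr// addKn.
have h1 : rf v (sumn (rem m s)) != 0 by exact: rf_neq0.
have h2 : rf (1 - alpha) m.-1 != 0 by apply: rf_neq0; lra.
have h3 := fact_neq0 m; have h4 := fact_neq0 (sumn (rem m s)).
by field; rewrite h1 h2 h3 h4 c1 c2.
Qed.

Lemma sum_const_seq s (c : R) : \sum_(a <- s) c = (size s)%:R * c.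
Proof. by rewrite big_const_seq count_predT iter_addr_0 mulr_natl. Qed.

Lemma natr_sumn s : (sumn s)%:R = \sum_(a <- s) a%:R :> R.
Proof. by rewrite sumnE natr_sum. Qed.

(** After [partw_rem] the term of a part m is proportional to n alpha + m (theta - alpha), where n
    is the sum of [s]. Over the k entries these add up to n (theta + (k - 1) alpha), the
    normalization put in [X]. *)
Lemma partw_regen theta s : 0 < theta -> s != [::] -> all (leq 1) s ->
  partw theta s = \sum_(m <- undup s)
    'C(sumn s, m)%:R * levyD alpha theta (sumn s - m) m / levyPhi alpha theta (sumn s) *
    partw theta (rem m s).
Proof.
move=> t0 s0 /allP sp; have /andP[a0 a1] := alpha01.
have n0 : (0 < sumn s)%N.
  by case: s s0 sp => // a l _ /(_ a (mem_head _ _)) a0' /=; rewrite addn_gt0 a0'.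
have k0 : (0 < size s)%N by rewrite lt0n size_eq0.
have hn : (sumn s)%:R != 0 :> R by rewrite pnatr_eq0 -lt0n.
have ht : rf theta (sumn s) != 0 by exact: rf_neq0.
have hta : rf (1 - alpha + theta) (sumn s) != 0 by apply: rf_neq0; lra.
have hk : theta + (size s).-1%:R * alpha != 0 by rewrite gt_eqF// ltr_wpDr// mulr_ge0.
pose X := partw theta s / ((sumn s)%:R * (theta + (size s).-1%:R * alpha)).
transitivity (\sum_(m <- undup s) (count_mem m s)%:R *
   (X * ((sumn s)%:R * alpha + m%:R * (theta - alpha)))); last first.
  rewrite big_seq [RHS]big_seq; apply: eq_bigr => m; rewrite mem_undup => ms.
  have mle : (m <= sumn s)%N by rewrite (sumn_rem ms) leq_addr.
  have h2 : rf (1 - alpha) m.-1 != 0 by apply: rf_neq0; lra.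
  have h5 : rf theta (sumn s - m) != 0 by exact: rf_neq0.
  have cm := cmult_neq0 s.
  have -> : 'C(sumn s, m)%:R * levyD alpha theta (sumn s - m) m /
      levyPhi alpha theta (sumn s) * partw theta (rem m s) =
    levyD alpha theta (sumn s - m) m / levyPhi alpha theta (sumn s) *
    ('C(sumn s, m)%:R * partw theta (rem m s)) by ring.
  rewrite partw_rem ?(sp m)// [RHS]mulrCA; congr (_ * _).
  rewrite /levyD /levyPhi subnK// natrB// /X /partw.
  have -> : rfa theta (size s) = rfa theta (size s).-1 * (theta + (size s).-1%:R * alpha).
    by rewrite -rfaS prednK.
  by field; rewrite hn ht hta hk h2 h5 cm.
rewrite sum_count -mulr_sumr big_split /= sum_const_seq -mulr_suml -natr_sumn.
have -> : (size s)%:R = (size s).-1%:R + 1 :> R by rewrite natr1 prednK.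
by rewrite /X; field; rewrite hn hk.
Qed.

(** Either the first stick contains no sample point, or it contains the m points of one block. The
    corresponding terms are proportional to v + k alpha and to m - alpha for each of the k entries;
    their total is v + n. *)
Lemma partw_stick v s : 0 < v -> s != [::] -> all (leq 1) s ->
  partw v s = wght alpha v 0 (sumn s) * partw (v + alpha) s +
   \sum_(m <- undup s) 'C(sumn s, m)%:R * wght alpha v m (sumn s - m) *
    partw (v + alpha) (rem m s).
Proof.
move=> v0 s0 /allP sp; have /andP[a0 a1] := alpha01.
have n0 : (0 < sumn s)%N.
  by case: s s0 sp => // a l _ /(_ a (mem_head _ _)) a0' /=; rewrite addn_gt0 a0'.
have k0 : (0 < size s)%N by rewrite lt0n size_eq0.
have va0 : 0 < v + alpha by lra.
have hv : rf v (sumn s) != 0 by exact: rf_neq0.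
have hv0 : v != 0 by rewrite gt_eqF.
have hvn : v + (sumn s)%:R != 0 by rewrite gt_eqF// ltr_wpDr.
have hv1 : rf (v + 1) (sumn s) != 0 by apply: rf_neq0; lra.
have hva : rf (v + alpha) (sumn s) != 0 by exact: rf_neq0.
have hra : rfa (v + alpha) (size s).-1 != 0 by rewrite gt_eqF// rfa_gt0.
have e1 : rf v (sumn s) * (v + (sumn s)%:R) = v * rf (v + 1) (sumn s).
  by rewrite -rfS -rfSl.
have e1' : rf (v + 1) (sumn s) = rf v (sumn s) * (v + (sumn s)%:R) / v.
  by rewrite e1; field.
have e2 : rfa v (size s) = v * rfa (v + alpha) (size s).-1.
  by rewrite -rfaSl prednK.
have e3 : rfa (v + alpha) (size s) = rfa (v + alpha) (size s).-1 * (v + (size s)%:R * alpha).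
  have kE : (size s)%:R = (size s).-1%:R + 1 :> R by rewrite natr1 prednK.
  by rewrite kE -[X in rfa _ X = _](prednK k0) rfaS; congr (_ * _); ring.
pose X := partw v s / (v + (sumn s)%:R).
have cm := cmult_neq0 s.
have -> : \sum_(m <- undup s) 'C(sumn s, m)%:R * wght alpha v m (sumn s - m) *
    partw (v + alpha) (rem m s) =
  \sum_(m <- undup s) (count_mem m s)%:R * (X * (m%:R - alpha)).
  rewrite big_seq [RHS]big_seq; apply: eq_bigr => m; rewrite mem_undup => ms.
  have mle : (m <= sumn s)%N by rewrite (sumn_rem ms) leq_addr.
  have m0 := sp m ms.
  have h2 : rf (1 - alpha) m.-1 != 0 by apply: rf_neq0; lra.
  have h5 : rf (v + alpha) (sumn s - m) != 0 by exact: rf_neq0.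
  rewrite mulrAC partw_rem// -[LHS]mulrA; congr (_ * _).
  rewrite /wght /bmom (_ : 1 - alpha + (v + alpha) = v + 1); last by ring.
  rewrite subnKC// e1' /X /partw e2.
  have -> : rf (1 - alpha) m = rf (1 - alpha) m.-1 * (m%:R - alpha).
    have mE : m%:R = m.-1%:R + 1 :> R by rewrite natr1 prednK.
    by rewrite mE -[X in rf _ X = _](prednK m0) rfS; congr (_ * _); ring.
  by field; rewrite hv hv0 hvn h2 h5 cm.
rewrite sum_count -mulr_sumr big_split /= sum_const_seq -natr_sumn.
rewrite /X /wght /bmom rf0 add0n (_ : 1 - alpha + (v + alpha) = v + 1); last by ring.
rewrite e1' /partw e2 e3.
by field; rewrite hv hv0 hvn hva cm.
Qed.

Lemma big_permutations (f : seq nat -> R) s : s != [::] ->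
  \sum_(mu <- permutations s) f mu =
  \sum_(m <- undup s) \sum_(mu <- permutations (rem m s)) f (m :: mu).
Proof.
move=> s0.
transitivity (\sum_(t <- [seq m :: mu | m <- undup s, mu <- permutations (rem m s)]) f t);
  last by rewrite big_allpairs_dep.
apply: perm_big; apply: uniq_perm; first exact: permutations_uniq.
  apply: allpairs_uniq_dep; first exact: undup_uniq.
    by move=> m _; exact: permutations_uniq.
  by move=> [m mu] [m' mu'] _ _ /= [-> ->].
move=> t; rewrite mem_permutations; apply/idP/idP.
  case: t => [/perm_size/esym/size0nil st|m mu h].
    by rewrite st eqxx in s0.
  have ms : m \in s by rewrite -(perm_mem h) mem_head.
  apply/allpairsPdep; exists m, mu; split; rewrite ?mem_undup// mem_permutations.
  by rewrite -(perm_cons m) (permPl h) perm_to_rem.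
move=> /allpairsPdep[m [mu [ms hmu ->]]]; rewrite mem_undup in ms.
rewrite mem_permutations in hmu.
by rewrite (permPr (perm_to_rem ms)) perm_cons.
Qed.

Lemma partw_nil v : partw v [::] = 1.
Proof.
by rewrite /partw /blockw /cmult /= !big_nil /rfa /rf !big_ord0 fact0 !invr1 !mulr1.
Qed.

(** Forgetting the order of the regenerative composition leaves the (alpha, theta) partition:
    splitting the sum by the first part turns the definition of [creg] into [partw_regen]. *)
Lemma sum_creg theta s : 0 < theta -> all (leq 1) s ->
  \sum_(mu <- permutations s) creg alpha theta mu = partw theta s.
Proof.
move=> t0; elim: {s}_.+1 {-2}s (ltnSn (size s)) => // N IH s sN sp.
have [->|s0] := eqVneq s [::].
  by rewrite (_ : permutations [::] = [:: [::]])// big_seq1 /= partw_nil.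
rewrite big_permutations// (partw_regen t0 s0 sp).
rewrite big_seq [RHS]big_seq; apply: eq_bigr => m; rewrite mem_undup => ms.
rewrite -(IH (rem m s)).
- rewrite big_distrr /= big_seq [RHS]big_seq; apply: eq_bigr => mu.
  rewrite mem_permutations => /perm_sumn e /=.
  by rewrite e -(sumn_rem ms) (sumn_rem ms) addKn.
- by rewrite -ltnS -(size_rem1 ms).
- by apply/allP => a /mem_rem; exact: (allP sp).
Qed.

Lemma bmom_ge0 (a b : R) m k : 0 < a -> 0 < b -> 0 <= bmom a b m k.
Proof.
by move=> a0 b0; rewrite /bmom ltW// divr_gt0 ?mulr_gt0 ?rf_gt0// addr_gt0.
Qed.

Lemma bmom_le (a b : R) m k m' k' : 0 < a -> 0 < b -> (m <= m')%N -> (k <= k')%N ->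
  bmom a b m' k' <= bmom a b m k.
Proof.
move=> a0 b0 mm kk; apply: (@le_trans _ _ (bmom a b m' k)).
  rewrite -(subnKC kk); elim: (k' - k)%N => [|j IH]; first by rewrite addn0.
  rewrite (le_trans _ IH)// (bmom_split m' (k + j) a0 b0) addnS lerDr.
  exact: bmom_ge0.
rewrite -(subnKC mm); elim: (m' - m)%N => [|j IH]; first by rewrite addn0.
rewrite (le_trans _ IH)// (bmom_split (m + j) k a0 b0) addnS lerDl.
exact: bmom_ge0.
Qed.

(** For W in [0,1], W^m (1 - W)^(n-m) <= W (1 - W) = (1 - W) - (1 - W)^2. The right side is arranged
    to complete E (1 - W)^n to E (1 - W) in [ksum_bound]. *)
Lemma bmom_gap (a b : R) m n : 0 < a -> 0 < b -> (0 < m < n)%N ->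
  bmom a b m (n - m) <= bmom a b 0 1 - bmom a b 0 n.
Proof.
move=> a0 b0 /andP[m0 mn].
have h2 : bmom a b 1 1 <= bmom a b 0 1 - bmom a b 0 2.
  by rewrite (bmom_split 0 1 a0 b0) addrK.
have h3 : bmom a b 0 n <= bmom a b 0 2 by apply: bmom_le => //; lia.
have h4 : bmom a b m (n - m) <= bmom a b 1 1 by apply: bmom_le => //; lia.
lra.
Qed.

(** Moments of the stick of index i, from 0, in the argument order of [beta] in [Mk]: k is the power
    of 1 - W and m the power of W. *)
Definition stickb v (i k m : nat) : R := wght alpha (v + i%:R * alpha) m k.

Definition ksum K v s : R := \sum_(mu <- permutations s) kap (stickb v) K mu.

Lemma stickb_shift v : (fun i => stickb v i.+1) = stickb (v + alpha).
Proof.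
by apply/funext => i; rewrite /stickb -natr1 mulrDl mul1r (addrC (_ * _)) addrA.
Qed.

Lemma ksum_rec K v s : s != [::] -> ksum K.+1 v s =
  wght alpha v 0 (sumn s) * ksum K (v + alpha) s +
  \sum_(m <- undup s) 'C(sumn s, m)%:R * wght alpha v m (sumn s - m) *
    ksum K (v + alpha) (rem m s).
Proof.
move=> s0; have [b0 bE] : (forall k m, stickb v 0 k m = wght alpha v m k) /\ True.
  by split=> // k m; rewrite /stickb mul0r addr0.
rewrite /ksum [LHS]big_permutations// [in X in _ * X + _]big_permutations//.
rewrite big_distrr -big_split /= big_seq [RHS]big_seq; apply: eq_bigr => m.
rewrite mem_undup => ms; rewrite !big_distrr -big_split /= big_seq [RHS]big_seq.
apply: eq_bigr => mu; rewrite mem_permutations => /perm_sumn e.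
rewrite /= e -(sumn_rem ms) stickb_shift !b0; congr (_ + _ * _ * _).
by rewrite (sumn_rem ms) addKn.
Qed.

Lemma rfa_le v k n : 0 < v -> (0 < k)%N -> (k <= n)%N -> rfa v k <= rf v n.
Proof.
move=> v0 k0 kn; have /andP[a0 a1] := alpha01.
apply: (@le_trans _ _ (rf v k)).
  apply: ler_prod => j _; rewrite addr_ge0 ?(ltW v0) ?mulr_ge0//=.
  by rewrite lerD2l ler_piMr// ltW.
rewrite -(subnKC kn); elim: (n - k)%N => [|j IH]; first by rewrite addn0.
rewrite (le_trans IH)// addnS rfS ler_peMr ?(ltW (rf_gt0 _ _))//.
by rewrite -[leLHS]add0r lerD ?(ltW v0)// ler1n addn_gt0 k0.
Qed.

Lemma size_le_sumn s : all (leq 1) s -> (size s <= sumn s)%N.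
Proof. by elim: s => //= a s IH /andP[a1 /IH]; lia. Qed.

Lemma ksum_nil K v : ksum K v [::] = 1.
Proof. by rewrite /ksum (_ : permutations [::] = [:: [::]])// big_seq1 kap_nil. Qed.

Lemma blockw_ge0 s : 0 <= blockw s.
Proof.
have /andP[a0 a1] := alpha01.
apply: prodr_ge0 => a _; rewrite divr_ge0// ltW// rf_gt0//; lra.
Qed.

(** The bound is uniform in v > 0 because the recursion moves v to v + alpha. Subtracting [ksum_rec]
    from [partw_stick], the term without points has coefficient E (1 - W)^n and, by [bmom_gap], the
    others are controlled by E (1 - W) - E (1 - W)^n; so each stick costs one factor E (1 - W). *)
Lemma ksum_bound s : all (leq 1) s -> exists2 H : R, 0 <= H & forall K v, 0 < v ->
  `|partw v s - ksum K v s| <= H * \prod_(j < K) wght alpha (v + j%:R * alpha) 0 1.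
Proof.
have /andP[a0 a1] := alpha01; have a10 : 0 < 1 - alpha by lra.
elim: {s}_.+1 {-2}s (ltnSn (size s)) => // N IH s sN sp.
have [->|s0] := eqVneq s [::].
  by exists 0 => // K v v0; rewrite partw_nil ksum_nil subrr normr0 mul0r.
have n0 : (0 < sumn s)%N.
  case: (s) s0 sp => // a l _ /= /andP[a0' _]; rewrite addn_gt0 a0' //.
(* If removing m leaves nothing, the remaining error is exactly 0. This is the case m = n, which
   [bmom_gap] excludes. *)
have /choice[H hH] : forall m, exists H : R, 0 <= H /\ (m \in s -> forall K v, 0 < v ->
    `|partw v (rem m s) - ksum K v (rem m s)| <=
       (if rem m s == [::] then 0 else H) * \prod_(j < K) wght alpha (v + j%:R * alpha) 0 1).
  move=> m; have [ms|ms] := boolP (m \in s); last by exists 0.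
  have [->|_] := eqVneq (rem m s) [::].
    by exists 0; split=> // _ K v v0; rewrite partw_nil ksum_nil subrr normr0 mul0r.
  have [||h h0 hh] := IH (rem m s); last by exists h.
    by rewrite -ltnS -(size_rem1 ms).
  by apply/allP => a /mem_rem; exact: (allP sp).
pose H0 := (sumn s)`!%:R * blockw s / (cmult s)%:R.
have H00 : 0 <= H0 by rewrite /H0 divr_ge0 ?mulr_ge0// blockw_ge0.
pose G m := 'C(sumn s, m)%:R * H m.
have G0 m : 0 <= G m by rewrite mulr_ge0//; case: (hH m).
exists (H0 + \sum_(m <- undup s) G m); first by rewrite addr_ge0// sumr_ge0.
elim=> [|K IHK] v v0.
  rewrite big_ord0 mulr1.
  have -> : ksum 0 v s = 0.
    rewrite /ksum big_permutations// big1// => m _; rewrite big1//.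
  have n_gt0 := rf_gt0 (sumn s) v0.
  rewrite subr0 ger0_norm; last first.
    by rewrite /partw divr_ge0 ?mulr_ge0 ?blockw_ge0 ?invr_ge0 ?(ltW (rfa_gt0 _ _)) ?(ltW n_gt0).
  rewrite (@le_trans _ _ H0)//; last by rewrite lerDl sumr_ge0.
  rewrite /partw /H0 ler_wpM2r ?invr_ge0// ler_wpM2r ?blockw_ge0//.
  rewrite -mulrA ler_piMr// ler_pdivrMr// mul1r rfa_le//.
    by rewrite lt0n size_eq0.
  exact: size_le_sumn.
have va0 : 0 < v + alpha by lra.
rewrite ksum_rec// (partw_stick v0 s0 sp) big_ord_recl /= mul0r addr0.
set P := (X in _ <= _ * (_ * X)).
have PE : P = \prod_(j < K) wght alpha (v + alpha + j%:R * alpha) 0 1.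
  apply: eq_bigr => j _; rewrite /bump /= natrD; congr wght; ring.
have P0 : 0 <= P by rewrite PE prodr_ge0// => j _; apply: bmom_ge0 => //; rewrite ltr_wpDr// ltr_wpDr// mulr_ge0.
have -> : wght alpha v 0 (sumn s) * partw (v + alpha) s +
   (\sum_(m <- undup s) 'C(sumn s, m)%:R * wght alpha v m (sumn s - m) *
    partw (v + alpha) (rem m s)) - (wght alpha v 0 (sumn s) * ksum K (v + alpha) s +
   \sum_(m <- undup s) 'C(sumn s, m)%:R * wght alpha v m (sumn s - m) *
    ksum K (v + alpha) (rem m s)) =
   wght alpha v 0 (sumn s) * (partw (v + alpha) s - ksum K (v + alpha) s) +
   \sum_(m <- undup s) 'C(sumn s, m)%:R * wght alpha v m (sumn s - m) *
     (partw (v + alpha) (rem m s) - ksum K (v + alpha) (rem m s)).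
  rewrite opprD addrACA -mulrBr -sumrB; congr (_ + _).
  by apply: eq_bigr => m _; rewrite mulrBr.
have w0 : 0 <= wght alpha v 0 (sumn s) by exact: bmom_ge0.
have hs : `|\sum_(m <- undup s) 'C(sumn s, m)%:R * wght alpha v m (sumn s - m) *
     (partw (v + alpha) (rem m s) - ksum K (v + alpha) (rem m s))| <=
   (wght alpha v 0 1 - wght alpha v 0 (sumn s)) * P * \sum_(m <- undup s) G m.
  rewrite (le_trans (ler_norm_sum _ _ _))// big_distrr /= big_seq [leRHS]big_seq.
  apply: ler_sum => m; rewrite mem_undup => ms.
  have [Hm0 hm] := hH m; have {}hm := hm ms K _ va0; rewrite -PE in hm.
  have ww : 0 <= wght alpha v m (sumn s - m) by exact: bmom_ge0.
  rewrite normrM ger0_norm; last by rewrite mulr_ge0.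
  have [re|rn] := eqVneq (rem m s) [::].
    rewrite re eqxx mul0r in hm; rewrite re.
    have -> : `|partw (v + alpha) [::] - ksum K (v + alpha) [::]| = 0.
      by apply/eqP; rewrite eq_le normr_ge0 andbT.
    rewrite mulr0 mulr_ge0// mulr_ge0// subr_ge0; apply: bmom_le => //.
  rewrite (negbTE rn) in hm.
  have m0 : (0 < m)%N := allP sp m ms.
  have mn : (m < sumn s)%N.
    rewrite (sumn_rem ms) -[ltnLHS]addn0 ltn_add2l.
    case: (rem m s) rn (@mem_rem _ m s) => // a l _ /(_ a (mem_head _ _))/(allP sp) /= a0'.
    by rewrite addn_gt0 a0'.
  have gap := @bmom_gap (1 - alpha) (v + alpha) m (sumn s) a10 va0 ltac:(by rewrite m0 mn).
  rewrite /G.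
  apply: (@le_trans _ _ ('C(sumn s, m)%:R * wght alpha v m (sumn s - m) * (H m * P))).
    by rewrite ler_wpM2l// mulr_ge0.
  have -> : 'C(sumn s, m)%:R * wght alpha v m (sumn s - m) * (H m * P) =
     wght alpha v m (sumn s - m) * (P * ('C(sumn s, m)%:R * H m)) by ring.
  by rewrite -[leRHS]mulrA ler_wpM2r// mulr_ge0// mulr_ge0.
have := IHK _ va0; rewrite -PE => hK.
rewrite (le_trans (ler_normD _ _))// (le_trans (lerD (le_refl _) hs))//.
rewrite normrM (ger0_norm w0).
have w1 : wght alpha v 0 (sumn s) <= wght alpha v 0 1 by apply: bmom_le.
have := ler_wpM2l w0 hK; move: hs w0 w1 => _.
have SG0 : 0 <= \sum_(m <- undup s) G m by apply: sumr_ge0.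
move: (`|_ - _|) (wght _ _ _ (sumn s)) (wght _ _ _ 1) (\sum_(m <- undup s) G m) SG0.
move=> x w w' g g0 w0 w1 hx.
have : 0 <= (w' - w) * (H0 * P) by rewrite mulr_ge0 ?subr_ge0// mulr_ge0.
nra.
Qed.

Lemma ksum_cvg v s : 0 < v -> all (leq 1) s ->
  ksum K v s @[K --> \oo] --> partw v s.
Proof.
move=> v0 sp; have /andP[a0 a1] := alpha01.
have [H H0 hH] := ksum_bound sp.
pose c K := H * \prod_(j < K) wght alpha (v + j%:R * alpha) 0 1.
have cc : c K @[K --> \oo] --> (0 : R).
  rewrite -[X in _ --> X](mulr0 H); apply: cvgM; first exact: cvg_cst.
  (* The mean of the stick of index j. It is at least a constant times 1/(j+1), so the means have
     infinite sum. *)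
  pose x (j : nat) := (1 - alpha) / (v + 1 + j%:R * alpha).
  have d0 (j : nat) : 0 < v + 1 + j%:R * alpha by rewrite ltr_wpDr ?mulr_ge0//; lra.
  have wE (j : nat) : wght alpha (v + j%:R * alpha) 0 1 = 1 - x j.
    rewrite /wght /bmom rf0 add0n mul1r /rf !big_ord1 /= !addr0 /x.
    have h1 := d0 j; have -> : 1 - alpha + (v + j%:R * alpha + alpha) = v + 1 + j%:R * alpha by ring.
    by field; rewrite gt_eqF.
  under eq_fun do under eq_bigr do rewrite wE.
  apply: prod_onem_cvg0.
    move=> j; rewrite /x divr_ge0 ?(ltW (d0 j))//=; last lra.
    rewrite ler_pdivrMr// mul1r; have : 0 <= j%:R * alpha by rewrite mulr_ge0.
    lra.
  apply: (@dvg_series_harmonic_like _ _ ((1 - alpha) / (v + 1))).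
    by rewrite divr_gt0//; lra.
  move=> j; rewrite /x -mulrA -invfM ler_wpM2l//; first lra.
  have j1 : 0 < j.+1%:R :> R by [].
  rewrite lef_pV2 ?posrE// ?mulr_gt0//; last lra.
  rewrite -natr1; have : 0 <= j%:R * (1 + v - alpha) by rewrite mulr_ge0//; lra.
  lra.
apply/cvgrPdist_le => /= e e0; have /cvgrPdist_le/(_ e e0) := cc.
apply: filterS => K; rewrite sub0r normrN => /(le_trans _); apply.
by rewrite (le_trans (hH K v v0))// ler_norm.
Qed.

End partition_weights.

(** * Sample compositions from cells of a decreasing sequence *)

Section sample_composition_labels.
Context (R : realType).
Implicit Types (Z : set R) (u : nat -> R).

Definition fibers (n K : nat) (l : 'I_n -> nat) : seq nat :=
  [seq #|[pred i : 'I_n | l i == a]| | a <- iota 0 K].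

Lemma undup_map_in (A B : eqType) (f : A -> B) (s : seq A) :
  {in s &, injective f} -> undup (map f s) = map f (undup s).
Proof.
elim: s => //= x s IH inj.
have -> : (f x \in map f s) = (x \in s).
  apply/mapP/idP => [[y ys e]|xs]; last by exists x.
  by rewrite (inj x y)// ?mem_head// in_cons ys orbT.
have h : {in s &, injective f}.
  by move=> y z ys zs; apply: inj; rewrite in_cons ?ys ?zs orbT.
by case: ifP => _; rewrite /= IH.
Qed.

Lemma undup_sorted_iota (K : nat) (t : seq nat) : sorted leq t ->
  (forall a, a \in t -> (a < K)%N) -> undup t = [seq a <- iota 0 K | a \in t].
Proof.
move=> st tK; apply: (sorted_eq leq_trans anti_leq).
- exact: (subseq_sorted leq_trans (undup_subseq t) st).
- by apply: sorted_filter; [exact: leq_trans|exact: iota_sorted].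
- apply: uniq_perm; [exact: undup_uniq|by rewrite filter_uniq// iota_uniq|].
  move=> a; rewrite mem_undup mem_filter mem_iota /= add0n.
  by case: (boolP (a \in t)) => // /tK ->.
Qed.

Lemma sample_composition_fibers Z n u K (l : 'I_n -> nat) :
  (forall i j : 'I_n, same_class Z u i j = (l i == l j)) ->
  (forall i j : 'I_n, u i <= u j -> (l i <= l j)%N) ->
  (forall i, (l i < K)%N) ->
  sample_composition Z n u = [seq c <- fibers K l | (0 < c)%N].
Proof.
move=> cl mono lK; rewrite /sample_composition.
set s := sort _ _.
have sE : [seq [set j | same_class Z u i j]%SET | i <- s] =
    [seq [set j | l j == a]%SET | a <- map l s].
  rewrite -map_comp; apply: eq_map => i /=; apply/setP => j.
  by rewrite !inE cl eq_sym.
have ms i : i \in s by rewrite mem_sort mem_enum.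
have mt a : a \in map l s -> exists i, l i = a.
  by move=> /mapP[i _ ->]; exists i.
rewrite sE undup_map_in; last first.
  move=> a b /mt[i <-] /mt[j <-] /setP/(_ i); rewrite !inE eqxx => /esym/eqP.
  by [].
rewrite (@undup_sorted_iota K); last 2 first.
- rewrite sorted_map.
  apply: (@sub_sorted _ (fun i j : 'I_n => u i <= u j)).
    by move=> i j /=; exact: mono.
  by apply: sort_sorted => i j; exact: le_total.
- by move=> a /mt[i <-].
have h (a : nat) : (a \in map l s) = (0 < #|[pred i | l i == a]|)%N.
  apply/mapP/card_gt0P => [[i _ ->]|[i]]; first by exists i; rewrite inE.
  by rewrite inE => /eqP <-; exists i.
rewrite -map_comp /fibers filter_map (eq_filter h); apply: eq_map => a /=.
by apply: eq_card => i; rewrite !inE.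
Qed.

Fixpoint decn (c : seq nat) (a : nat) : seq nat :=
  match c, a with
  | [::], _ => [::]
  | x :: c', 0 => x.-1 :: c'
  | x :: c', a'.+1 => x :: decn c' a'
  end.

Lemma sum_delete_ball (F : seq nat -> R) (c : seq nat) :
  \sum_(j < sumn c) F (delete_ball [seq x <- c | (0 < x)%N] j) =
  \sum_(a < size c) (nth 0 c a)%:R * F [seq x <- decn c a | (0 < x)%N].
Proof.
elim: c F => [|x c IH] F; first by rewrite !big_ord0.
rewrite /= [RHS]big_ord_recl /=.
case: x => [|x].
  rewrite add0n mul0r add0r /= IH; apply: eq_bigr => a _.
  by [].
rewrite -(big_mkord xpredT (fun j => F (delete_ball _ j))).
rewrite (big_cat_nat _ (n := x.+1))//= ?leq_addr//; congr (_ + _).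
  rewrite big_nat (eq_bigr (fun=> F [seq x <- x :: c | (0 < x)%N])); last first.
    move=> j /= jx; rewrite jx eqSS; case: x {jx} => [|x] //=.
  by rewrite -big_nat big_const_nat subn0 iter_addr_0 mulr_natl.
rewrite -{1}[x.+1]add0n big_addn addKn big_mkord.
rewrite -(IH (fun s => F (x.+1 :: s))); apply: eq_bigr => j _ /=.
by rewrite ltnNge leq_addl /= addnK.
Qed.

Lemma fibers_lift n K (l : 'I_n.+1 -> nat) (i : 'I_n.+1) : (l i < K)%N ->
  fibers K (fun k => l (lift i k)) = decn (fibers K l) (l i).
Proof.
have h (a : nat) : #|[pred k | l (lift i k) == a]| =
   (#|[pred j | l j == a]| - (l i == a))%N.
  rewrite [in RHS](cardD1 i) inE addKn -(fintype.card_image (@lift_inj _ i)).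
  apply: eq_card => j; rewrite !inE; apply/fintype.imageP/andP => /=.
    by move=> [k kE ->]; rewrite eq_sym neq_lift.
  move=> [ji lj]; have [k jE] : exists k, j = lift i k.
    by case: (unliftP i j) => [k ->|ji']; [exists k|rewrite ji' eqxx in ji].
  by exists k => //; rewrite inE -jE.
rewrite /fibers; under eq_map do rewrite h.
pose f a := #|[pred j | l j == a]|.
have gen K0 : forall m b, (b < K0)%N -> [seq (f a - (m + b == a))%N | a <- iota m K0] =
    decn [seq f a | a <- iota m K0] b.
  elim: K0 => // K' IH m b bK /=.
  case: b bK => [_|b bK] /=.
    rewrite addn0 eqxx subn1; congr (_ :: _); apply/eq_in_map => a.
    rewrite mem_iota => /andP[ma _]; rewrite (_ : m == a = false) ?subn0//.
    by apply/negbTE; rewrite neq_ltn ma.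
  rewrite (_ : (m + b.+1 == m)%N = false) ?subn0; last by lia.
  by congr (_ :: _); rewrite -IH//; apply: eq_map => a; rewrite addSnnS.
exact: (gen K 0%N (l i)).
Qed.

Lemma sumn_fibers n K (l : 'I_n -> nat) : (forall i, (l i < K)%N) ->
  sumn (fibers K l) = n.
Proof.
move=> lK; rewrite sumnE big_map -[RHS](card_ord n) -sum1_card.
rewrite (partition_big (fun i => Ordinal (lK i)) xpredT)//=.
rewrite -[X in _ = X](big_mkord xpredT (fun a => \sum_(i | l i == a) 1)%N) /index_iota subn0.
by apply: eq_bigr => a _; rewrite -sum1_card; apply: eq_bigl => i; rewrite inE.
Qed.

Lemma sum_fibers n K (l : 'I_n -> nat) (F : nat -> R) : (forall i, (l i < K)%N) ->
  \sum_(i < n) F (l i) = \sum_(a < K) (nth 0 (fibers K l) a)%:R * F a.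
Proof.
move=> lK; rewrite (partition_big (fun i => Ordinal (lK i)) xpredT)//=.
apply: eq_bigr => a _; rewrite (eq_bigr (fun=> F a)); last by move=> i /eqP <-.
rewrite /fibers (nth_map 0) ?size_iota// nth_iota// add0n mulr_natl -sumr_const.
by apply: eq_bigl => i; rewrite !inE.
Qed.

(** Ball j counted from the left is in general not sample point j, but only the box of a deleted
    ball matters. Both sums therefore count each box as many times as it has balls, and they agree
    pathwise. *)
Lemma sum_delete_sample Z n u K (l : 'I_n.+1 -> nat) (F : seq nat -> R) :
  (forall i j : 'I_n.+1, same_class Z u i j = (l i == l j)) ->
  (forall i j : 'I_n.+1, u i <= u j -> (l i <= l j)%N) ->
  (forall i, (l i < K)%N) ->
  \sum_(j < n.+1) F (delete_ball (sample_composition Z n.+1 u) j) =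
  \sum_(i < n.+1) F (sample_composition Z n (fun k => u (bump i k))).
Proof.
move=> cl mono lK.
have e := sum_delete_ball F (fibers K l); rewrite (sumn_fibers lK) in e.
rewrite (sample_composition_fibers cl mono lK) e.
rewrite (_ : size _ = K); last by rewrite /fibers size_map size_iota.
have e2 (i : 'I_n.+1) : sample_composition Z n (fun k => u (bump i k)) =
   [seq x <- decn (fibers K l) (l i) | (0 < x)%N].
  rewrite -fibers_lift//; apply: sample_composition_fibers => //.
  - move=> k k'; rewrite /same_class.
    have := cl (lift i k) (lift i k'); rewrite /same_class /= => <-.
    by rewrite (inj_eq (@lift_inj _ i)).
  - by move=> k k' h; apply: mono.
under [RHS]eq_bigr do rewrite e2.
by rewrite (sum_fibers (fun a => F [seq x <- decn (fibers K l) a | (0 < x)%N]) lK).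
Qed.

End sample_composition_labels.

(** * Sampling uniform points into the cells of a nonincreasing sequence *)

Section interval_labels.
Context (R : realType).
Implicit Types (z : nat -> R).

(** As [z] decreases, cells are numbered from right to left, whereas compositions are read from left
    to right; this is the origin of every [rev] below. *)
Definition cell z a (x : R) : bool := z a.+1 < x <= z a.

Definition cellcount (n : nat) (A : {set 'I_n}) z (u : nat -> R) K : seq nat :=
  [seq #|[pred i in A | cell z a (u i)]| | a <- iota 0 K].

(* All the points u_i, i in A, lie in the first K cells, and the positive cell counts
   are s. *)
Definition ev (n : nat) K (A : {set 'I_n}) z (u : nat -> R) (s : seq nat) : bool :=
  [forall i in A, z K < u i <= z 0%N] && ([seq c <- cellcount A z u K | (0 < c)%N] == s).

(** The number of the cell of x among the first K, and K itself if x lies below all of them. *)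
Definition lab z K (x : R) : nat := find (fun a => z a.+1 < x) (iota 0 K).

Lemma noninc_le z : (forall a, z a.+1 <= z a) -> forall a b, (a <= b)%N -> z b <= z a.
Proof.
move=> nz a b ab; rewrite -(subnKC ab); elim: (b - a)%N => [|j IH]; first by rewrite addn0.
by rewrite addnS (le_trans (nz _)).
Qed.

Lemma labP z K x : (forall a, z a.+1 <= z a) -> z K < x <= z 0%N ->
  (lab z K x < K)%N /\ cell z (lab z K x) x.
Proof.
move=> nz /andP[zK z0].
have hK : (0 < K)%N.
  by rewrite lt0n; apply/eqP => K0; move: zK; rewrite K0 ltNge z0.
have hh : has (fun a => z a.+1 < x) (iota 0 K).
  by apply/hasP; exists K.-1; rewrite ?mem_iota ?prednK//= add0n ltn_predL.
have lK : (lab z K x < K)%N by move: hh; rewrite has_find size_iota.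
split=> //; rewrite /cell; apply/andP; split.
  by have := nth_find 0 hh; rewrite -/(lab z K x) nth_iota.
case E : (lab z K x) => [//|a]; rewrite leNgt.
have aK : (a < lab z K x)%N by rewrite E.
by have := before_find 0 aK; rewrite nth_iota ?add0n => [->//|]; rewrite (ltn_trans aK).
Qed.

Lemma cell_lab z K x a : (forall a, z a.+1 <= z a) -> z K < x <= z 0%N ->
  cell z a x = (lab z K x == a).
Proof.
move=> nz xz; have [lK /andP[c1 c2]] := labP nz xz.
apply/idP/eqP => [/andP[h1 h2]|<-]; last by rewrite /cell c1 c2.
have [h|h|//] := ltngtP (lab z K x) a.
  by move: c1; rewrite ltNge (le_trans h2 (noninc_le nz h)).
by move: h1; rewrite ltNge (le_trans c2 (noninc_le nz h)).
Qed.

Lemma lab_le z K x y : x <= y -> (lab z K y <= lab z K x)%N.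
Proof.
move=> xy; rewrite leqNgt; apply/negP => h.
have := before_find 0 h.
have xs : (lab z K x < size (iota 0 K))%N.
  by rewrite (leq_trans h)// /lab find_size.
have hh : has (fun a => z a.+1 < x) (iota 0 K) by rewrite has_find.
by have := nth_find 0 hh; rewrite -/(lab z K x) => /lt_le_trans -> .
Qed.

Lemma rev_map_iota (T : Type) (f : nat -> T) K :
  rev [seq f a | a <- iota 0 K] = [seq f (K.-1 - a)%N | a <- iota 0 K].
Proof.
case: K => // K; have x0 := f 0%N.
apply: (@eq_from_nth _ x0) => [|i]; first by rewrite size_rev !size_map.
rewrite size_rev size_map size_iota => iK.
rewrite nth_rev ?size_map ?size_iota// !(nth_map 0) ?size_iota ?nth_iota ?add0n//; try lia.
Qed.

Lemma ev_sample_composition (Z : set R) n z (u : nat -> R) K s : (forall a, z a.+1 <= z a) ->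
  (forall i : 'I_n, z K < u i <= z 0%N) ->
  (forall i j : 'I_n, same_class Z u i j = (lab z K (u i) == lab z K (u j))) ->
  ev K (finset.setTfor 'I_n) z u s = (sample_composition Z n u == rev s).
Proof.
move=> nz uz cl.
pose l (i : 'I_n) := (K.-1 - lab z K (u i))%N.
have lK i : (l i < K)%N.
  rewrite /l; have [h _] := labP nz (uz i); lia.
have lE i j : (l i == l j) = (lab z K (u i) == lab z K (u j)).
  rewrite /l; have [h _] := labP nz (uz i); have [h' _] := labP nz (uz j).
  by apply/eqP/eqP; lia.
rewrite (@sample_composition_fibers _ _ _ _ K l); first last.
- exact: lK.
- by move=> i j ij; rewrite /l leq_sub2l// lab_le.
- by move=> i j; rewrite lE cl.
rewrite /ev (_ : [forall _ in _, _]); last by apply/'forall_implyP => i _; exact: uz.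
rewrite /= -[RHS](inj_eq (can_inj (@revK nat))) revK -filter_rev /fibers rev_map_iota.
congr (_ == _); congr ([seq c <- _ | (0 < c)%N]); apply/eq_in_map => a; rewrite mem_iota => /= aK.
apply: eq_card => i; rewrite !inE /= (cell_lab _ nz (uz i)) /l.
by have [h _] := labP nz (uz i); apply/eqP/eqP; lia.
Qed.

Lemma ev_nil n K z u : ev K (finset.set0 : {set 'I_n}) z u [::].
Proof.
rewrite /ev; apply/andP; split; first by apply/'forall_implyP => i; rewrite inE.
rewrite /cellcount; elim: (iota 0 K) => //= a l /eqP IH.
by rewrite (_ : #|_| = 0%N) ?IH//; apply: eq_card0 => i; rewrite !inE.
Qed.

Lemma ev0 n (A : {set 'I_n}) z u s : A != finset.set0 -> ev 0 A z u s = false.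
Proof.
move=> /finset.set0Pn[i iA]; apply/negbTE; rewrite negb_and; apply/orP; left.
apply/negP => /'forall_implyP/(_ i iA)/andP[h1]; by rewrite leNgt h1.
Qed.

(** At most one S in the sum has a nonzero term, the actual content of the first cell. The first
    cell is either empty, and [m :: s] must be realized further on, or it holds exactly m points. *)
Lemma ev_peel n K (A : {set 'I_n}) z u m s : (forall a, z a.+1 <= z a) -> (0 < m)%N ->
  (ev K.+1 A z u (m :: s))%:R = (ev K A (z \o succn) u (m :: s))%:R +
  \sum_(S : {set 'I_n} | (S \subset A) && (#|S| == m))
     ([forall i in S, cell z 0 (u i)] && ev K (A :\: S) (z \o succn) u s)%:R :> R.
Proof.
move=> nz m0.
pose S0 : {set 'I_n} := [set i in A | cell z 0 (u i)]%SET.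
have S0A : S0 \subset A by apply/fintype.subsetP => i; rewrite inE => /andP[].
have cc : cellcount A z u K.+1 = #|S0| :: cellcount A (z \o succn) u K.
  rewrite /cellcount /= (iotaDl 1 0 K).
  congr (_ :: _); first by apply: eq_card => i; rewrite !inE.
  by rewrite -map_comp; apply: eq_map => a.
have cD (S : {set 'I_n}) : S \subset A -> [forall i in S, cell z 0 (u i)] ->
    cellcount (A :\: S) (z \o succn) u K = cellcount A (z \o succn) u K.
  move=> SA /'forall_implyP hS; apply: eq_map => a; apply: eq_card => i.
  rewrite !inE; case: (boolP (i \in S)) => iS; rewrite ?andbF ?andbT //=.
  apply/esym/negbTE; rewrite negb_and; apply/orP; right; have /andP[h1 h2] := hS i iS; rewrite /cell /= negb_and.
  apply/orP; right; rewrite -ltNge (le_lt_trans _ h1)//.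
  exact: (noninc_le nz (isT : (1 <= a.+1)%N)).
have zero : forall Q : {set 'I_n}, (Q \subset A) && (#|Q| == m) -> Q != S0 ->
   ([forall i in Q, cell z 0 (u i)] && ev K (A :\: Q) (z \o succn) u s) = false.
  move=> Q /andP[QA _] SS0; apply/negbTE/negP => /andP[/'forall_implyP hS /andP[/'forall_implyP hA _]].
  case/eqP : SS0; apply/setP => i; rewrite inE; apply/idP/andP => [iS|[iA ci]].
    by split; [exact: (fintype.subsetP QA)|exact: hS].
  apply/negPn/negP => iS; have := hA i; rewrite inE iS iA => /(_ isT)/andP[_] /=.
  by have /andP[h1 _] := ci; rewrite leNgt h1.
have hall : [forall i in A, z K.+1 < u i <= z 0%N] ->
   [forall i in (A :\: S0), z K.+1 < u i <= z 1%N].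
  move=> /'forall_implyP h; apply/'forall_implyP => i; rewrite !inE => /andP[h1 iA].
  have /andP[h2 h3] := h i iA; rewrite h2 leNgt; apply: contra h1 => h1.
  by rewrite iA /cell h1 h3.
have hall2 : [forall i in (A :\: S0), z K.+1 < u i <= z 1%N] ->
   [forall i in A, z K.+1 < u i <= z 0%N].
  move=> /'forall_implyP h; apply/'forall_implyP => i iA.
  have [iS|iS] := boolP (i \in S0).
    move: iS; rewrite inE => /andP[_ /andP[h1 ->]]; rewrite andbT.
    by rewrite (le_lt_trans _ h1)//; exact: (noninc_le nz (isT : (1 <= K.+1)%N)).
  have := h i; rewrite !inE iA andbT => /(_ _)/andP[|-> h2].
    by move: iS; rewrite inE iA.
  by rewrite (le_trans h2).
have [S00|S0n] := eqVneq #|S0| 0%N.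
  rewrite big1 ?addr0; last first.
    move=> S hS; rewrite zero//; apply/eqP => SE; move: hS; rewrite SE S00 => /andP[_ /eqP m00].
    by rewrite -m00 in m0.
  congr (_%:R); congr nat_of_bool; rewrite /ev cc /= S00 /=; congr (_ && _).
  have S0e : S0 = finset.set0 by apply: cards0_eq.
  by rewrite S0e finset.setD0 in hall hall2; apply/idP/idP.
have -> : ev K A (z \o succn) u (m :: s) = false.
  apply/negbTE/negP => /andP[/'forall_implyP h _].
  have /card_gt0P[i] : (0 < #|S0|)%N by rewrite lt0n.
  rewrite inE => /andP[iA /andP[h1 _]]; have /andP[_] := h i iA.
  by rewrite /= leNgt h1.
rewrite add0r.
have hS0 : [forall i in S0, cell z 0 (u i)].
  by apply/'forall_implyP => i; rewrite inE => /andP[].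
have [S0m|S0m] := eqVneq #|S0| m; last first.
  rewrite big1; last first.
    move=> S hS; rewrite zero//; apply/eqP => SE; move: hS; rewrite SE => /andP[_ /eqP].
    by move/eqP; rewrite (negbTE S0m).
  rewrite /ev cc /= lt0n S0n eqseq_cons (negbTE S0m) andbF.
  by [].
rewrite (bigD1 S0) /=; last by rewrite S0A S0m eqxx.
rewrite big1 ?addr0; last by move=> S /andP[hS SS0]; rewrite zero.
congr (_%:R); congr nat_of_bool; rewrite hS0 /= /ev cc /= lt0n S0n eqseq_cons S0m eqxx /=.
rewrite cD//; congr (_ && _); apply/idP/idP; [exact: hall|exact: hall2].
Qed.

(* The probability of [ev] for independent uniform points, given the cells. *)
Fixpoint gK K z (s : seq nat) : R :=
  if s is m :: s' then
    if K is K'.+1 then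
      gK K' (z \o succn) s +
      'C(sumn s, m)%:R * (z 0%N - z 1%N) ^+ m * gK K' (z \o succn) s'
    else 0
  else 1.

Section law.
Context (d : measure_display) (T : measurableType d) (P : probability T R).
Variables (n : nat) (U : nat -> T -> R).
Hypothesis mU : forall i, measurable_fun setT (U i).
Hypothesis Urect : forall B : 'I_n -> set R, (forall i, measurable (B i)) ->
  Ex P (fun w => \prod_(i < n) \1_(B i) (U i w)) =
  \prod_(i < n) Ex P (fun w => \1_(B i) (U i w)).
Hypothesis Uitv : forall i (a b : R), 0 <= a -> a <= b -> b <= 1 ->
  Ex P (fun w => \1_(`]a, b]%classic) (U i w)) = b - a.

(** The points outside [A] have already been assigned to sets [B i]. Carrying them along lets the
    induction peel off one cell after another while using independence only once, at the end. *)
Let bB (B : 'I_n -> set R) (A : {set 'I_n}) (w : T) : R :=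
  \prod_(i < n | i \notin A) \1_(B i) (U i w).

Let bmB (B : 'I_n -> set R) A : (forall i, measurable (B i)) -> bm (bB B A).
Proof.
move=> mB; apply: bm_prod => i _.
have h : bm (\1_(B i) : R -> R) by apply: bm_indic; exact: mB.
exact: (bm_comp (mU i) h).
Qed.

Lemma peel K (A : {set 'I_n}) z (B : 'I_n -> set R) s :
  (forall a, z a.+1 <= z a) -> (forall a, 0 <= z a <= 1) ->
  (forall i, measurable (B i)) -> all (leq 1) s -> sumn s = #|A| ->
  bm (fun w => bB B A w * (ev K A z (U^~ w) s)%:R) /\
  Ex P (fun w => bB B A w * (ev K A z (U^~ w) s)%:R) =
  \prod_(i < n | i \notin A) Ex P (fun w => \1_(B i) (U i w)) * gK K z s.
Proof.
elim: K A z B s => [|K IH] A z B s nz z01 mB.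
all: case: s => [_ /esym/cards0_eq A0|m s /= /andP[m0 s0] sA].
- rewrite A0; have -> : (fun w => bB B finset.set0 w * (ev 0 (finset.set0 : {set 'I_n}) z (U^~ w) [::])%:R) = bB B finset.set0.
    by apply/funext => w; rewrite ev_nil mulr1.
  split; first exact: bmB.
  rewrite /= mulr1 [RHS](eq_bigl xpredT) => [|i]; last by rewrite inE.
  by rewrite -Urect//; congr Ex; apply/funext => w; apply: eq_bigl => i; rewrite inE.
- have An : A != finset.set0 by rewrite -card_gt0 -sA addn_gt0 m0.
  have -> : (fun w => bB B A w * (ev 0 A z (U^~ w) (m :: s))%:R) = fun=> 0.
    by apply/funext => w; rewrite ev0// mulr0.
  by split; [exact: bm_cst|rewrite Ex_cst mulr0].
- rewrite A0; have -> : (fun w => bB B finset.set0 w * (ev K.+1 (finset.set0 : {set 'I_n}) z (U^~ w) [::])%:R) = bB B finset.set0.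
    by apply/funext => w; rewrite ev_nil mulr1.
  split; first exact: bmB.
  rewrite /= mulr1 [RHS](eq_bigl xpredT) => [|i]; last by rewrite inE.
  by rewrite -Urect//; congr Ex; apply/funext => w; apply: eq_bigl => i; rewrite inE.
(* The points of S are now assigned to the first cell; the other assignments are kept. *)
pose BS (S : {set 'I_n}) i : set R := if i \in S then `]z 1%N, z 0%N]%classic else B i.
have mBS S i : measurable (BS S i) by rewrite /BS; case: ifP.
have nz' a : (z \o succn) a.+1 <= (z \o succn) a by exact: nz.
have z01' a : 0 <= (z \o succn) a <= 1 by exact: z01.
have E : (fun w => bB B A w * (ev K.+1 A z (U^~ w) (m :: s))%:R) = fun w =>
    bB B A w * (ev K A (z \o succn) (U^~ w) (m :: s))%:R +
    \sum_(S : {set 'I_n} | (S \subset A) && (#|S| == m))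
      bB (BS S) (A :\: S) w * (ev K (A :\: S) (z \o succn) (U^~ w) s)%:R.
  apply/funext => w; rewrite ev_peel// mulrDr mulr_sumr; congr (_ + _).
  apply: eq_bigr => S /andP[SA _]; rewrite -mulnb natrM mulrA; congr (_ * _).
  rewrite /bB [RHS](bigID (fun i => i \in A)) /= mulrC; congr (_ * _).
    rewrite (eq_bigl (fun i => i \in S)); last first.
      move=> i; rewrite !inE negb_and negbK; case: (boolP (i \in S)) => [/(fintype.subsetP SA)->//|_].
      by case: (i \in A).
    have [h0|h] := boolP [forall i in S, cell z 0 (U i w)].
      have h := elimT 'forall_implyP h0.
      rewrite big1// => i iS; rewrite /BS iS indicE mem_set//=.
      by rewrite in_itv/=; exact: h.
    have [i /andP[iS ci]] : exists i, (i \in S) && ~~ cell z 0 (U i w).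
      by move: h; rewrite negb_forall => /existsP[i]; rewrite negb_imply => h; exists i.
    rewrite (bigD1 i)//= /BS iS indicE memNset ?mul0r//= in_itv/=.
    exact/negP.
  apply: eq_big => i.
    rewrite !inE negb_and negbK; case: (boolP (i \in A)) => iA; rewrite ?andbF//= orbT//.
  move=> iA; rewrite /BS; case: ifP => // /(fintype.subsetP SA).
  by rewrite (negbTE iA).
have [b1 e1] := IH A (z \o succn) B (m :: s) nz' z01' mB ltac:(by rewrite /= m0) sA.
have hS : forall S : {set 'I_n}, (S \subset A) && (#|S| == m) ->
    bm (fun w => bB (BS S) (A :\: S) w * (ev K (A :\: S) (z \o succn) (U^~ w) s)%:R) /\
    Ex P (fun w => bB (BS S) (A :\: S) w * (ev K (A :\: S) (z \o succn) (U^~ w) s)%:R) =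
    \prod_(i < n | i \notin A) Ex P (fun w => \1_(B i) (U i w)) *
      ((z 0%N - z 1%N) ^+ m * gK K (z \o succn) s).
  move=> S /andP[SA /eqP Sm].
  have [|bS ->] := IH (A :\: S) (z \o succn) (BS S) s nz' z01' (mBS S) s0.
    by rewrite cardsD (finset.setIidPr SA) Sm -sA addKn.
  split=> //; rewrite mulrA; congr (_ * _).
  rewrite (bigID (fun i => i \in A)) /= mulrC; congr (_ * _).
    apply: eq_big => i.
      rewrite !inE negb_and negbK; case: (boolP (i \in A)) => iA; rewrite ?andbF//= orbT//.
    move=> /andP[_ iA]; rewrite /BS; case: ifP => // /(fintype.subsetP SA).
    by rewrite (negbTE iA).
  rewrite (eq_bigl (fun i => i \in S)); last first.
    move=> i; rewrite !inE negb_and negbK; case: (boolP (i \in S)) => [/(fintype.subsetP SA)->//|_].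
    by case: (i \in A).
  rewrite (eq_bigr (fun=> z 0%N - z 1%N)) ?prodr_const ?Sm//.
  move=> i iS; rewrite /BS iS Uitv//.
  - by have /andP[] := z01 1%N.
  - by have /andP[] := z01 0%N.
rewrite E; split.
  by apply: bmD => //; apply: bm_sum => S /hS[].
rewrite ExD//; last by apply: bm_sum => S /hS[].
rewrite e1 Ex_sum; last by move=> S /hS[].
rewrite (eq_bigr _ (fun S h => proj2 (hS S h))) sumr_const mulrDr; congr (_ + _).
have -> : #|[pred S : {set 'I_n} | (S \subset A) && (#|S| == m)]| = 'C(m + sumn s, m).
  by rewrite sA -cards_draws; apply: eq_card => S; rewrite !inE.
by rewrite -mulr_natr; ring.
Qed.

Lemma label_law K z s : (forall a, z a.+1 <= z a) -> (forall a, 0 <= z a <= 1) ->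
  all (leq 1) s -> sumn s = n ->
  bm (fun w => (ev K (finset.setTfor 'I_n) z (U^~ w) s)%:R : R) /\
  Ex P (fun w => (ev K (finset.setTfor 'I_n) z (U^~ w) s)%:R) = gK K z s.
Proof.
move=> nz z01 s0 sn.
have [|b e] := @peel K (finset.setTfor 'I_n) z (fun=> setT) s nz z01 (fun=> measurableT) s0.
  by rewrite cardsT card_ord.
have E : (fun w => bB (fun=> setT) (finset.setTfor 'I_n) w * (ev K (finset.setTfor 'I_n) z (U^~ w) s)%:R) =
   fun w => (ev K (finset.setTfor 'I_n) z (U^~ w) s)%:R.
  by apply/funext => w; rewrite /bB big_pred0 ?mul1r// => i; rewrite inE.
move: b e; rewrite E => b ->; split => //.
by rewrite big_pred0 ?mul1r// => i; rewrite inE.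
Qed.

End law.
End interval_labels.

(** * Expectations for cells cut out by products of independent ratios *)

Section stick_breaking.
Context (R : realType).
Implicit Types (r z : nat -> R).

Definition zr r (n : nat) : R := \prod_(i < n) r i.

Lemma zr0 r : zr r 0 = 1. Proof. by rewrite /zr big_ord0. Qed.

Lemma zr1 r : zr r 1 = r 0%N. Proof. by rewrite /zr big_ord1. Qed.

Lemma zrSl r : zr r \o succn = fun a => r 0%N * zr (r \o succn) a.
Proof. by apply/funext => a; rewrite /zr /= big_ord_recl. Qed.

Lemma gK_scale K c z s : gK K (fun a => c * z a) s = c ^+ sumn s * gK K z s.
Proof.
elim: K z s => [|K IH] z [|m s] /=; rewrite ?expr0 ?mul1r ?mulr0//.
rewrite (_ : (fun a => c * z a) \o succn = fun a => c * (z \o succn) a)//.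
by rewrite !IH /= -mulrBr exprMn exprD; ring.
Qed.

Lemma gK_zr K r m s : gK K.+1 (zr r) (m :: s) =
  r 0%N ^+ (m + sumn s) * gK K (zr (r \o succn)) (m :: s) +
  'C(m + sumn s, m)%:R * ((1 - r 0%N) ^+ m * r 0%N ^+ sumn s) * gK K (zr (r \o succn)) s.
Proof.
rewrite [LHS]/= zrSl !gK_scale zr0 zr1; congr (_ + _).
by ring.
Qed.

Definition pK K r (b : nat) : R := \sum_(a < K) (zr r a - zr r a.+1) ^+ b.

Lemma pKS K r b : pK K.+1 r b = (1 - r 0%N) ^+ b + r 0%N ^+ b * pK K (r \o succn) b.
Proof.
rewrite /pK big_ord_recl /= zr0 zr1; congr (_ + _).
rewrite big_distrr /=; apply: eq_bigr => a _.
have e c : zr r c.+1 = r 0%N * zr (r \o succn) c by rewrite -[LHS]/((zr r \o succn) c) zrSl.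
by rewrite -exprMn mulrBr -!e.
Qed.

Context (d : measure_display) (T : measurableType d).

Lemma bm_gK K (z : T -> nat -> R) s : (forall a, bm (fun w => z w a)) ->
  bm (fun w => gK K (z w) s).
Proof.
elim: K z s => [|K IH] z [|m s] bz /=; try exact: bm_cst.
have bz' a : bm (fun w => (z w \o succn) a) by exact: bz.
apply: bmD; first exact: IH.
by apply: bmM; [apply: bmZ; apply: bmX; exact: bmB|exact: IH].
Qed.

Lemma bm_zr (r : nat -> T -> R) a : (forall i, bm (r i)) -> bm (fun w => zr (r^~ w) a).
Proof. by move=> br; apply: bm_prod. Qed.

Lemma bm_pK (r : nat -> T -> R) K b : (forall i, bm (r i)) -> bm (fun w => pK K (r^~ w) b).
Proof. by move=> br; apply: bm_sum => a _; apply: bmX; apply: bmB; exact: bm_zr. Qed.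

Variables (P : probability T R) (r : nat -> T -> R) (beta : nat -> nat -> nat -> R).
Hypothesis br : forall i, bm (r i).
(** Independence is used only in this moment form, as [gK] and [pK] are polynomials in the
    ratios. *)
Hypothesis fact : forall n (mm kk : nat -> nat),
  Ex P (fun w => \prod_(i < n) ((1 - r i w) ^+ mm i * r i w ^+ kk i)) =
  \prod_(i < n) beta i (kk i) (mm i).

(** A monomial in the first j ratios, those already processed. The inductions move the next ratio
    out of [gK] or [pK] into this monomial, with exponents updated by [upd]. *)
Let H j (mm kk : nat -> nat) w : R := \prod_(i < j) ((1 - r i w) ^+ mm i * r i w ^+ kk i).

Let bH j mm kk : bm (H j mm kk).
Proof.
apply: bm_prod => i _; apply: bmM; apply: bmX => //.
by apply: bmB => //; exact: bm_cst.
Qed.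

Let upd j (f : nat -> nat) (v i : nat) : nat := if (i < j)%N then f i else v.

Let HS j mm kk m k w : H j mm kk w * ((1 - r j w) ^+ m * r j w ^+ k) =
  H j.+1 (upd j mm m) (upd j kk k) w.
Proof.
rewrite /H big_ord_recr /= /upd ltnn; congr (_ * _).
by apply: eq_bigr => i _; rewrite ltn_ord.
Qed.

Let betaS j mm kk m k : \prod_(i < j.+1) beta i (upd j kk k i) (upd j mm m i) =
  \prod_(i < j) beta i (kk i) (mm i) * beta j k m.
Proof.
rewrite big_ord_recr /= /upd ltnn; congr (_ * _).
by apply: eq_bigr => i _; rewrite ltn_ord.
Qed.

Let shiftr j w : (fun i => r (j + i)%N w) \o succn = fun i => r (j.+1 + i)%N w.
Proof. by apply/funext => i; rewrite /= addnS. Qed.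

Let shiftb j : (fun i => beta (j + i.+1)%N) = fun i => beta (j.+1 + i)%N.
Proof. by apply/funext => i; rewrite addnS. Qed.

Let bz j a : bm (fun w => zr (fun i => r (j + i)%N w) a).
Proof. exact: (@bm_zr (fun i => r (j + i)%N)). Qed.

Let kap_expect_gen K j s mm kk :
  Ex P (fun w => H j mm kk w * gK K (zr (fun i => r (j + i)%N w)) s) =
  \prod_(i < j) beta i (kk i) (mm i) * kap (fun i => beta (j + i)%N) K s.
Proof.
elim: K j s mm kk => [|K IH] j [|m s] mm kk.
- by rewrite /= mulr1 -fact; congr Ex; apply/funext => w; rewrite mulr1.
- rewrite /= mulr0 -[RHS](Ex_cst P); congr Ex; apply/funext => w; exact: mulr0.
- by rewrite /= mulr1 -fact; congr Ex; apply/funext => w; rewrite mulr1.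
pose n := (m + sumn s)%N.
have -> : (fun w => H j mm kk w * gK K.+1 (zr (fun i => r (j + i)%N w)) (m :: s)) =
  fun w => H j.+1 (upd j mm 0) (upd j kk n) w * gK K (zr (fun i => r (j.+1 + i)%N w)) (m :: s) +
   'C(n, m)%:R * (H j.+1 (upd j mm m) (upd j kk (sumn s)) w * gK K (zr (fun i => r (j.+1 + i)%N w)) s).
  by apply/funext => w; rewrite gK_zr shiftr -!HS addn0 expr0 /n; ring.
have b1 s' a b : bm (fun w => H j.+1 a b w * gK K (zr (fun i => r (j.+1 + i)%N w)) s').
  by apply: bmM => //; apply: bm_gK => c; exact: bz.
rewrite ExD ?ExZ//; last exact: bmZ.
rewrite !IH !betaS /= addn0 shiftb /n; ring.
Qed.

Lemma kap_expect K s : Ex P (fun w => gK K (zr (r^~ w)) s) = kap beta K s.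
Proof.
have := kap_expect_gen K 0 s (fun=> 0%N) (fun=> 0%N); rewrite big_ord0 mul1r => <-.
by congr Ex; apply/funext => w; rewrite /H big_ord0 mul1r.
Qed.

Context (I : finType) (lam : I -> nat).
Implicit Types (J S : {set I}).

Lemma prodrD_sub J (F G : I -> R) :
  \prod_(i in J) (F i + G i) =
  \sum_(S : {set I} | S \subset J) (\prod_(i in S) F i * \prod_(i in J :\: S) G i).
Proof.
pose F' i := if i \in J then F i else 0.
pose G' i := if i \in J then G i else 1.
transitivity (\prod_i (F' i + G' i)).
  rewrite big_mkcond /=; apply: eq_bigr => i _.
  by rewrite /F' /G'; case: ifP => // _; rewrite add0r.
rewrite bigA_distr (bigID (fun S : {set I} => S \subset J)) /= [X in _ + X]big1 ?addr0.
  apply: eq_bigr => S SJ; rewrite (bigID (fun i => i \in S)) /=; congr (_ * _).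
    apply: eq_bigr => i iS; rewrite iS /F' (fintype.subsetP SJ)//.
  rewrite [RHS]big_mkcond [LHS]big_mkcond /=; apply: eq_bigr => i _.
  by rewrite inE /G'; case: (i \in S) => //=.
move=> S /fintype.subsetPn[i iS iJ]; rewrite (bigD1 i)//= iS /F' (negbTE iJ).
by rewrite mul0r.
Qed.

Lemma prod_exp_wt (x : R) S : \prod_(i in S) x ^+ lam i = x ^+ wt lam S.
Proof. by rewrite /wt -expr_sum. Qed.

Let Mk_expect_gen K j J mm kk :
  Ex P (fun w => H j mm kk w * \prod_(i in J) pK K (fun i => r (j + i)%N w) (lam i)) =
  \prod_(i < j) beta i (kk i) (mm i) * Mk lam (fun i => beta (j + i)%N) K J.
Proof.
elim: K j J mm kk => [|K IH] j J mm kk.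
  rewrite /=; have [->|/finset.set0Pn[i iJ]] := eqVneq J finset.set0.
    by rewrite mulr1 -fact; congr Ex; apply/funext => w; rewrite big_set0 mulr1.
  rewrite mulr0 -[RHS](Ex_cst P); congr Ex; apply/funext => w.
  by rewrite (bigD1 i)//= {1}/pK big_ord0 mul0r mulr0.
have -> : (fun w => H j mm kk w * \prod_(i in J) pK K.+1 (fun i => r (j + i)%N w) (lam i)) =
  fun w => \sum_(S : {set I} | S \subset J)
    H j.+1 (upd j mm (wt lam S)) (upd j kk (wt lam (J :\: S))) w *
    \prod_(i in J :\: S) pK K (fun i => r (j.+1 + i)%N w) (lam i).
  apply/funext => w; under eq_bigr do rewrite pKS shiftr addn0.
  rewrite prodrD_sub big_distrr /=; apply: eq_bigr => S SJ.
  by rewrite big_split /= !prod_exp_wt -HS; ring.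
have b1 S a b : bm (fun w => H j.+1 a b w * \prod_(i in S) pK K (fun i => r (j.+1 + i)%N w) (lam i)).
  by apply: bmM => //; apply: bm_prod => i _; exact: (@bm_pK (fun i => r (j.+1 + i)%N)).
rewrite Ex_sum//= big_distrr /=; apply: eq_bigr => S SJ.
by rewrite IH betaS addn0 shiftb mulrA.
Qed.

(* the power [m] of the first stick plays the role of the meander *)
Lemma Mk_expect_mark K J m :
  Ex P (fun w => (1 - r 0%N w) ^+ m * \prod_(i in J) pK K.+1 (r^~ w) (lam i)) =
  \sum_(S : {set I} | S \subset J) beta 0%N (wt lam (J :\: S)) (m + wt lam S) *
     Mk lam (fun i => beta i.+1) K (J :\: S).
Proof.
have -> : (fun w => (1 - r 0%N w) ^+ m * \prod_(i in J) pK K.+1 (r^~ w) (lam i)) =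
  fun w => \sum_(S : {set I} | S \subset J)
    H 1 (fun=> m + wt lam S)%N (fun=> wt lam (J :\: S)) w *
    \prod_(i in J :\: S) pK K (fun i => r (1 + i)%N w) (lam i).
  apply/funext => w; under eq_bigr do rewrite pKS.
  rewrite prodrD_sub big_distrr /=; apply: eq_bigr => S SJ.
  by rewrite big_split /= !prod_exp_wt /H big_ord1 exprD; ring.
have b1 S a b : bm (fun w => H 1 a b w * \prod_(i in S) pK K (fun i => r (1 + i)%N w) (lam i)).
  by apply: bmM => //; apply: bm_prod => i _; exact: (@bm_pK (fun i => r (1 + i)%N)).
rewrite Ex_sum//=; apply: eq_bigr => S SJ.
by rewrite Mk_expect_gen big_ord1.
Qed.

End stick_breaking.

Section independence.
Context (d : measure_display) (T : measurableType d) (R : realType) (P : probability T R).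

(** Mutual independence speaks of indicators. They are replaced by the functions [g i] one
    coordinate at a time, the other factors forming the weight of a bounded functional. *)
Lemma indep_Ex (f : nat -> T -> R) (g : nat -> R -> R) n :
  (forall i, measurable_fun setT (f i)) -> mutually_independent P f ->
  (forall i, bm (g i)) -> (forall i x, 0 <= g i x) ->
  Ex P (fun w => \prod_(i < n) g i (f i w)) = \prod_(i < n) Ex P (fun w => g i (f i w)).
Proof.
move=> mf indf bg g0.
pose h a (B : nat -> set R) i : R -> R := if (i < a)%N then g i else \1_(B i).
have bh a B i : (forall i, measurable (B i)) -> bm (h a B i).
  by move=> mB; rewrite /h; case: ifP => // _; apply: bm_indic; exact: mB.
have bhf a B i : (forall i, measurable (B i)) -> bm (fun w => h a B i (f i w)).
  by move=> mB; exact: (bm_comp (mf i) (bh a B i mB)).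
have h0 a B i x : 0 <= h a B i x by rewrite /h; case: ifP => // _; rewrite indicE.
have main a : (a <= n)%N -> forall B, (forall i, measurable (B i)) ->
    Ex P (fun w => \prod_(i < n) h a B i (f i w)) = \prod_(i < n) Ex P (fun w => h a B i (f i w)).
  elim: a => [_|a IH an] B mB.
    have mA i : measurable (f i @^-1` B i) by rewrite -[X in measurable X]setTI; apply: mf.
    have -> : (fun w => \prod_(i < n) h 0 B i (f i w)) =
        \1_[set w | forall i, i \in iota 0 n -> B i (f i w)].
      apply/funext => w; rewrite /h /= indicE.
      have [wB|wB] := boolP (w \in _).
        rewrite big1// => i _; rewrite indicE mem_set//.
        by rewrite inE in wB; apply: wB; rewrite mem_iota add0n /=.
      apply/eqP; rewrite prodf_seq_eq0; apply/hasP.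
      move: wB; rewrite notin_setE /= => /existsNP[i /not_implyP[]].
      rewrite mem_iota add0n /= => iN nB.
      by exists (Ordinal iN); rewrite ?mem_index_enum//= indicE memNset.
    have mI : measurable [set w | forall i, i \in iota 0 n -> B i (f i w)].
      rewrite (_ : [set w | _] = \bigcap_(i in [set i | (i < n)%N]) (f i @^-1` B i)).
        by apply: bigcap_measurableType.
      apply/seteqP; split => w /= h1 i; first by move=> iN; apply: h1; rewrite mem_iota.
      by rewrite mem_iota add0n => /h1.
    rewrite Ex_indic// indf ?iota_uniq//=.
    rewrite (_ : iota 0 n = index_iota 0 n); last by rewrite /index_iota subn0.
    rewrite big_mkord.
    apply: eq_bigr => i _; rewrite /h /= -(Ex_indic P (mA i)); congr Ex.
  pose c := \prod_(i < n | i != Ordinal an) Ex P (fun w => h a B i (f i w)).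
  pose G w := \prod_(i < n | i != Ordinal an) h a B i (f i w).
  have bG : bm G by apply: bm_prod => i _; exact: bhf.
  have G0 w : 0 <= G w by apply: prodr_ge0.
  have c0 : 0 <= c by apply: prodr_ge0 => i _; apply: Ex_ge0.
  have fI := bfunctional_Ex P bG G0 (mf a).
  have fJ := bfunctional_Ex P (bm_cst c) (fun=> c0) (mf a).
  have := bfunctional_eq_fun fI fJ _ (bg a); move=> /(_ _)/wrap[A mA|].
    pose B' i := if i == a then A else B i.
    have mB' i : measurable (B' i) by rewrite /B'; case: ifP.
    have := IH (ltnW an) B' mB'; rewrite (bigD1 (Ordinal an))//=.
    have e0 : h a B' a = \1_A by rewrite /h ltnn /B' eqxx.
    have e1 (i : 'I_n) : i != Ordinal an -> h a B' i = h a B i.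
      move=> ia; rewrite /h; case: ifP => // _; rewrite /B'.
      by rewrite (_ : (i : nat) == a = false)//; apply: contraNF ia => /eqP e; apply/eqP/val_inj.
    rewrite e0 => e2; transitivity (c * Ex P (fun w => \1_A (f a w))).
      transitivity (Ex P (fun w => \prod_(i < n) h a B' i (f i w))).
        congr Ex; apply/funext => w; rewrite (bigD1 (Ordinal an))//= e0 mulrC; congr (_ * _).
        by apply: eq_bigr => i /e1 ->.
      rewrite e2 mulrC; congr (_ * _); apply: eq_bigr => i /e1 e; congr Ex.
      by apply/funext => w; rewrite e.
    rewrite -ExZ//; apply: (bm_comp (mf a)); apply: bm_indic; exact: mA.
  have e1 (i : 'I_n) : i != Ordinal an -> h a.+1 B i = h a B i.
    move=> ia; rewrite /h ltnS leq_eqVlt (_ : (i : nat) == a = false)//.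
    by apply: contraNF ia => /eqP e; apply/eqP/val_inj.
  have e0 : h a.+1 B a = g a by rewrite /h ltnSn.
  move=> E; rewrite (bigD1 (Ordinal an))//= e0.
  rewrite (eq_bigr (fun i : 'I_n => Ex P (fun w => h a B i (f i w)))); last first.
    by move=> i /e1 e; congr Ex; apply/funext => w; rewrite e.
  rewrite -/c mulrC -ExZ; last exact: (bm_comp (mf a) (bg a)).
  rewrite -E; congr Ex; apply/funext => w; rewrite (bigD1 (Ordinal an))//= e0 mulrC.
  by congr (_ * _); apply: eq_bigr => i /e1 ->.
have := main n (leqnn n) (fun=> setT) (fun=> measurableT).
have hE (i : 'I_n) : h n (fun=> setT) i = g i by rewrite /h ltn_ord.
have -> : (fun w => \prod_(i < n) h n (fun=> setT) i (f i w)) = fun w => \prod_(i < n) g i (f i w).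
  by apply/funext => w; apply: eq_bigr => i _; rewrite hE.
by move=> ->; apply: eq_bigr => i _; rewrite hE.
Qed.

Lemma measurable_sigma_rv (I : Type) (D : set I) (f : I -> T -> R) i : D i ->
  @measurable_fun _ _ (g_sigma_algebraType
     (\bigcup_(i in D) preimage_set_system setT (f i) measurable)) (measurableTypeR R) setT (f i).
Proof.
move=> Di _ B mB; apply: sub_sigma_algebra; exists i => //.
by exists B.
Qed.

(** The delay is put in front of the increments: an event on finitely many increments belongs to the
    sigma-algebra of [Y], so its independence of [X] splits off one factor. *)
Lemma mutually_independent_pair (X : T -> R) (Y : R -> T -> R) (t : nat -> R) :
  measurable_fun setT X -> (forall s, measurable_fun setT (Y s)) ->
  indep_systems P (sigma_rv [set: unit] (fun _ => X)) (sigma_rv [set s : R | 0 <= s] Y) ->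
  (forall k, 0 <= t k) ->
  mutually_independent P (fun k w => Y (t k.+1) w - Y (t k) w) ->
  mutually_independent P (fun k w => if k is j.+1 then Y (t j.+1) w - Y (t j) w else X w).
Proof.
move=> mX mY iXY t0 iY J B uJ mB.
pose f k w := if k is j.+1 then Y (t j.+1) w - Y (t j) w else X w.
pose J' := [seq k.-1 | k <- J & (0 < k)%N].
have uJ' : uniq J'.
  rewrite map_inj_in_uniq ?filter_uniq// => a b.
  by rewrite !mem_filter => /andP[a0 _] /andP[b0 _]; lia.
have memJ' k : (k \in J') = (k.+1 \in J).
  apply/mapP/idP => [[a]|kJ]; last by exists k.+1 => //; rewrite mem_filter.
  by rewrite mem_filter => /andP[a0 aJ] ->; rewrite prednK.
have eJ := iY J' (fun k => B k.+1) uJ' (fun k => mB k.+1).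
pose EY := [set w | forall k, k \in J' -> B k.+1 (Y (t k.+1) w - Y (t k) w)].
have prodJ' : \prod_(k <- J') fine (P ((fun w => Y (t k.+1) w - Y (t k) w) @^-1` B k.+1)) =
    \prod_(k <- J | (0 < k)%N) fine (P (f k @^-1` B k)).
  rewrite big_map big_filter; apply: eq_bigr => k k0.
  by case: k k0 => //.
have [J0|J0] := boolP (0%N \in J); last first.
  rewrite (_ : [set w | _] = EY).
    rewrite eJ prodJ'; congr EFin; rewrite big_seq_cond [RHS]big_seq_cond.
    apply: eq_bigl => k; rewrite andbT andbC; case: (boolP (k \in J)) => kJ; rewrite ?andbF//.
    by rewrite lt0n andbT; apply: contraNneq J0 => <-.
  apply/seteqP; split => w /= h k.
    by rewrite memJ' => /h.
  by case: k => [|k]; [rewrite (negbTE J0)|rewrite -memJ' => /h].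
rewrite (_ : [set w | _] = (X @^-1` B 0%N) `&` EY); last first.
  apply/seteqP; split => w /=.
    by move=> h; split; [exact: (h 0%N)|move=> k; rewrite memJ' => /h].
  by move=> [h1 h2] [|k]; [|rewrite -memJ' => /h2].
rewrite iXY.
- rewrite eJ prodJ' [in RHS](perm_big _ (perm_to_rem J0)) big_cons /= EFinM; congr (_ * _)%E.
    rewrite fineP//; rewrite -[X in measurable X]setTI; exact: mX.
  congr EFin; rewrite big_mkcond (perm_big _ (perm_to_rem J0)) big_cons /= mul1r.
  rewrite big_seq [RHS]big_seq; apply: eq_bigr => k; rewrite mem_rem_uniq// inE => /andP[k0 _].
  by rewrite lt0n k0.
- apply: sub_sigma_algebra; exists tt => //; exists (B 0%N) => //.
  by rewrite setTI.
- rewrite (_ : EY = \bigcap_(k in [set k | k \in J'])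
      ((fun w => Y (t k.+1) w - Y (t k) w) @^-1` B k.+1)); last first.
    by apply/seteqP; split.
  apply: (@bigcap_measurableType _ (g_sigma_algebraType
     (\bigcup_(i in [set s : R | 0 <= s]) preimage_set_system setT (Y i) measurable))).
  move=> k _; rewrite -[X in measurable X]setTI.
  apply: (measurable_funB _ _ measurableT (mB k.+1)).
    by apply: measurable_sigma_rv; exact: t0.
  by apply: measurable_sigma_rv; exact: t0.
Qed.

End independence.

(** * Beta integrals and the Lévy measure *)

Section density.
Context (R : realType).
Local Notation mu := (@lebesgue_measure R).
Variables (D : set R) (rho : R -> R).
Hypotheses (mD : measurable D) (rho0 : forall x, D x -> 0 <= rho x).
Hypothesis irho : mu.-integrable D (EFin \o rho).

Let mrho : measurable_fun D rho.
Proof. by case/integrableP : irho => /measurable_EFinP. Qed.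

Lemma dens_integrable (g : R -> R) : bm g ->
  mu.-integrable D (EFin \o (fun x => g x * rho x)).
Proof.
move=> [mg [M gM]].
have mgr : measurable_fun D (fun x => g x * rho x).
  by apply: measurable_funM => //; exact: measurable_funTS.
have iM : mu.-integrable D (fun x => M%:E * (EFin \o rho) x)%E by exact: integrableZl.
apply: (@le_integrable _ _ _ mu D mD _ (fun x => M%:E * (EFin \o rho) x)%E) => //; first exact/measurable_EFinP.
move=> x Dx /=; rewrite lee_fin !normrM ler_wpM2r//.
by rewrite (le_trans (gM x))// ler_norm.
Qed.

Lemma bfunctional_dens : bfunctional (fun g : R -> R => \int[mu]_(x in D) (g x * rho x)).
Proof.
split.
- move=> f g bf bg; rewrite -RintegralD//; [|exact: dens_integrable|exact: dens_integrable].
  by apply: eq_Rintegral => x _; rewrite mulrDl.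
- move=> c f bf; rewrite -RintegralZl//; last exact: dens_integrable.
  by apply: eq_Rintegral => x _; rewrite mulrA.
- by move=> f bf f0; apply: Rintegral_ge0 => x Dx; rewrite mulr_ge0// rho0.
move=> f_ f M bf_ bf hM hl.
have := @dominated_convergence _ _ _ mu D mD
  (fun n => EFin \o (fun x => f_ n x * rho x)) (EFin \o (fun x => f x * rho x))
  (fun x => M%:E * (EFin \o rho) x)%E.
case.
- by move=> n; have /integrableP[] := dens_integrable (bf_ n).
- by have /integrableP[] := dens_integrable bf.
- apply: aeW => x Dx; apply: cvg_EFin; first exact: nearW.
  by apply: cvgM; [exact: hl|exact: cvg_cst].
- exact: integrableZl.
- apply: aeW => x n Dx /=; rewrite lee_fin normrM (ger0_norm (rho0 Dx)).
  by rewrite ler_wpM2r ?rho0.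
move=> _ _ h; apply: fine_cvg; rewrite fineK//.
by apply: integrable_fin_num => //; exact: dens_integrable.
Qed.

Lemma dens_indic (A : set R) : measurable A ->
  (\int[mu]_(x in D) (\1_A x * rho x))%:E = (\int[mu]_(x in A `&` D) (rho x)%:E)%E.
Proof.
move=> mA; rewrite /Rintegral fineK; last first.
  by apply: integrable_fin_num => //; apply: dens_integrable; exact: bm_indic.
rewrite setIC integral_mkcondr; apply: eq_integral => x _.
rewrite patchE indicE; case: ifPn => xA; first by rewrite mul1r.
by rewrite mul0r.
Qed.

Lemma dens_Ex (d : measure_display) (T : measurableType d) (P : probability T R) (X : T -> R) :
  measurable_fun setT X ->
  (forall A : set R, measurable A -> P (X @^-1` A) = (\int[mu]_(x in A `&` D) (rho x)%:E)%E) ->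
  forall g, bm g -> Ex P (fun w => g (X w)) = \int[mu]_(x in D) (g x * rho x).
Proof.
move=> mX hX g bg.
have fI := bfunctional_Ex P (bm_cst 1) (fun=> ler01) mX.
have := bfunctional_eq_fun fI bfunctional_dens _ bg.
under eq_fun do rewrite mul1r.
move=> -> // A mA.
apply: EFin_inj; rewrite dens_indic// -hX//.
rewrite -(fineP P); last by rewrite -[X in measurable X]setTI; exact: mX.
congr EFin; rewrite -Ex_indic; last by rewrite -[X in measurable X]setTI; exact: mX.
by congr Ex; apply/funext => w; rewrite mul1r.
Qed.

End density.

(** * Improper integrals of continuous functions and integration by parts *)

Section improper_ftc.
Context (R : realType).
Local Notation mu := (@lebesgue_measure R).
Implicit Types f g F : R -> R.

Lemma ftc_cc F f (a b : R) : a < b ->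
  (forall x, `[a, b]%classic x -> {for x, continuous f}) ->
  (forall x, `[a, b]%classic x -> is_derive x 1 F (f x)) ->
  (\int[mu]_(x in `[a, b]) (f x)%:E = (F b - F a)%:E)%E.
Proof.
move=> ab cf dF.
have cF x : `[a, b]%classic x -> {for x, continuous F}.
  move=> xab; apply: differentiable_continuous; apply/derivable1_diffP.
  by have [] := dF x xab.
have aab : `[a, b]%classic a by rewrite /= in_itv/= lexx ltW.
have bab : `[a, b]%classic b by rewrite /= in_itv/= lexx ltW.
rewrite (@continuous_FTC2 _ f F)//.
- by apply: continuous_in_subspaceT => x /[!inE]; exact: cf.
- split.
  + by move=> x xab; have [] := dF x (subset_itv_oo_cc xab).
  + by apply: cvg_at_right_filter; exact: cF.
  + by apply: cvg_at_left_filter; exact: cF.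
- by move=> x xab; rewrite derive1E; have [] := dF x (subset_itv_oo_cc xab).
Qed.

Variables (a b : nat -> R) (D : set R).
Hypotheses (ab : forall n, a n < b n) (na : forall n, a n.+1 <= a n)
  (nb : forall n, b n <= b n.+1) (DE : D = \bigcup_n `[a n, b n]%classic).

Let I n : set R := `[a n, b n]%classic.

Let ID n x : I n x -> D x. Proof. by rewrite DE => h; exists n. Qed.

Let ndI : nondecreasing_seq I.
Proof.
apply/nondecreasing_seqP => n; apply/subsetPset => x; rewrite /I /= !in_itv/= => /andP[h1 h2].
by rewrite (le_trans (na n) h1) (le_trans h2 (nb n)).
Qed.

Let mDD : measurable D. Proof. by rewrite DE; apply: bigcup_measurable. Qed.

Lemma improper_measurable f : (forall x, D x -> {for x, continuous f}) -> measurable_fun D f.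
Proof.
move=> cf; apply: subspace_continuous_measurable_fun => //.
by apply: continuous_in_subspaceT => x /[!inE]; exact: cf.
Qed.

Lemma improper_cvg f : (forall x, D x -> {for x, continuous f}) -> (forall x, D x -> 0 <= f x) ->
  (\int[mu]_(x in I n) (f x)%:E)%E @[n --> \oo] --> (\int[mu]_(x in D) (f x)%:E)%E.
Proof.
move=> cf f0; rewrite DE; apply: ge0_nondecreasing_set_cvg_integral => //.
- by move=> n; exact: measurable_itv.
- move=> n; apply/measurable_EFinP; apply: measurable_funS (improper_measurable cf) => //.
  exact: ID.
- by move=> n x /ID/f0; rewrite lee_fin.
Qed.

Lemma improper_integrable F f (M : R) : (forall x, D x -> {for x, continuous f}) ->
  (forall x, D x -> 0 <= f x) -> (forall x, D x -> is_derive x 1 F (f x)) ->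
  (forall x, D x -> `|F x| <= M) -> mu.-integrable D (EFin \o f).
Proof.
move=> cf f0 dF FM; have mf := improper_measurable cf.
apply/integrableP; split; first exact/measurable_EFinP.
apply: (@le_lt_trans _ _ (M + M)%:E); last exact: ltry.
have -> : (\int[mu]_(x in D) `|(EFin \o f) x| = \int[mu]_(x in D) (f x)%:E)%E.
  by apply: eq_integral => x; rewrite inE => Dx /=; rewrite ger0_norm ?f0.
have h := improper_cvg cf f0.
rewrite -(cvg_lim _ h)//; apply: lime_le; first by apply/cvg_ex; eexists; exact: h.
apply: nearW => n.
have e := @ftc_cc F f _ _ (ab n) (fun x h => cf x (ID h)) (fun x h => dF x (ID h)).
rewrite e lee_fin.
have an : `[a n, b n]%classic (a n) by rewrite /= in_itv/= lexx ltW.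
have bn : `[a n, b n]%classic (b n) by rewrite /= in_itv/= lexx ltW.
have := FM _ (ID an); have := FM _ (ID bn); rewrite !ler_norml => /andP[? ?] /andP[? ?].
lra.
Qed.

(** [F] vanishes at both ends, so its derivative has integral 0. The derivative is given as a
    difference of two nonnegative integrable functions so that each integral is the limit over the
    compact intervals. *)
Lemma ibp_vanish F g1 g2 : (forall x, D x -> {for x, continuous g1}) ->
  (forall x, D x -> {for x, continuous g2}) ->
  (forall x, D x -> 0 <= g1 x) -> (forall x, D x -> 0 <= g2 x) ->
  mu.-integrable D (EFin \o g1) -> mu.-integrable D (EFin \o g2) ->
  (forall x, D x -> is_derive x 1 F (g1 x - g2 x)) ->
  F (a n) @[n --> \oo] --> 0 -> F (b n) @[n --> \oo] --> 0 ->
  \int[mu]_(x in D) g1 x = \int[mu]_(x in D) g2 x.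
Proof.
move=> c1 c2 p1 p2 i1 i2 dF Fa Fb.
have iI n g : mu.-integrable D (EFin \o g) -> mu.-integrable (I n) (EFin \o g).
  by move=> ig; apply: (@integrableS _ _ _ mu D) => //; [exact: measurable_itv|move=> x; exact: ID].
have e n : \int[mu]_(x in I n) g1 x - \int[mu]_(x in I n) g2 x = F (b n) - F (a n).
  rewrite -RintegralB//; [|exact: measurable_itv|exact: iI|exact: iI].
  have cB x : I n x -> {for x, continuous (fun x => g1 x - g2 x)}.
    by move=> /ID Dx; apply: continuousB; [exact: c1|exact: c2].
  by rewrite /Rintegral (@ftc_cc F (fun x => g1 x - g2 x) _ _ (ab n) cB (fun x h => dF x (ID h))).
have l g : (forall x, D x -> {for x, continuous g}) -> (forall x, D x -> 0 <= g x) ->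
    mu.-integrable D (EFin \o g) ->
    \int[mu]_(x in I n) g x @[n --> \oo] --> \int[mu]_(x in D) g x.
  move=> cg g0 ig; apply: fine_cvg; rewrite fineK; last exact: integrable_fin_num.
  exact: improper_cvg.
have l12 : \int[mu]_(x in I n) g1 x - \int[mu]_(x in I n) g2 x @[n --> \oo] -->
    \int[mu]_(x in D) g1 x - \int[mu]_(x in D) g2 x.
  by apply: cvgB; exact: l.
have l0 : F (b n) - F (a n) @[n --> \oo] --> 0 - (0 : R) by exact: cvgB.
by apply/eqP; rewrite -subr_eq0 (cvg_eqlim e l12 l0) subrr.
Qed.

End improper_ftc.

Section beta_integrals.
Context (R : realType).
Local Notation mu := (@lebesgue_measure R).
Local Notation D := (`]0, 1[%classic : set R).

Let an (n : nat) : R := n.+3%:R^-1.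
Let bn (n : nat) : R := 1 - an n.

Let an_gt0 n : 0 < an n. Proof. by rewrite /an invr_gt0. Qed.

Let an_lt n : an n < 2^-1.
Proof. by rewrite /an ltf_pV2 ?posrE// ltr_nat. Qed.

Let an_cvg : an n @[n --> \oo] --> (0 : R).
Proof.
have := @cvg_harmonic R; rewrite -(@cvg_shiftn 2) /= => h.
by apply: cvg_trans h; apply: near_eq_cvg; apply: nearW => n; rewrite /an /harmonic /= addn2.
Qed.

Let anbn n : an n < bn n.
Proof. by have := an_lt n; rewrite /bn; lra. Qed.

Let an_dec n : an n.+1 <= an n.
Proof. by rewrite /an lef_pV2 ?posrE// ler_nat. Qed.

Let bn_inc n : bn n <= bn n.+1.
Proof. by have := an_dec n; rewrite /bn; lra. Qed.

Let DE : D = \bigcup_n `[an n, bn n]%classic.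
Proof.
apply/seteqP; split => x.
  rewrite /= in_itv/= => /andP[x0 x1].
  have : \forall n \near \oo, an n < Num.min x (1 - x).
    have m0 : 0 < Num.min x (1 - x) by rewrite lt_min x0 subr_gt0.
    have /cvgrPdist_lt/(_ _ m0) := an_cvg; apply: filterS => n.
    by rewrite sub0r normrN ger0_norm// ltW.
  move=> [N _ /(_ N (leqnn N))]; rewrite /= lt_min => /andP[h1 h2].
  by exists N => //=; rewrite in_itv/= /bn; apply/andP; split; lra.
move=> [n _]; rewrite /= !in_itv/= /bn => /andP[h1 h2].
by have h0 := an_gt0 n; apply/andP; split; lra.
Qed.

Lemma powR_seq_cvg0 (u : nat -> R) (p : R) : 0 < p -> (forall n, 0 < u n) ->
  u n @[n --> \oo] --> (0 : R) -> u n `^ p @[n --> \oo] --> (0 : R).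
Proof. by move=> p0 u0 ul; have /cvg_at_rightP/(_ u) := powR_cvg0 p0; apply. Qed.

Let cpow (p x : R) : 0 < x -> {for x, continuous (fun y : R => y `^ p)}.
Proof.
move=> x0; apply: differentiable_continuous; apply/derivable1_diffP.
by apply: derivable_powR; rewrite in_itv/= andbT.
Qed.

Let conem (p x : R) : x < 1 -> {for x, continuous (fun y : R => (1 - y) `^ p)}.
Proof.
move=> x1.
have h1 : {for x, continuous (fun y : R => 1 - y)}.
  by apply: continuousB; [exact: cst_continuous|exact: cvg_id].
have h2 : {for 1 - x, continuous (fun y : R => y `^ p)} by apply: cpow; rewrite subr_gt0.
exact: (@continuous_comp _ _ _ _ (fun y : R => y `^ p) x h1 h2).
Qed.

Lemma beta_continuous (p q x : R) : D x ->
  {for x, continuous (fun y : R => y `^ p * (1 - y) `^ q)}.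
Proof.
rewrite /= in_itv/= => /andP[x0 x1].
by apply: continuousM; [exact: cpow|exact: conem].
Qed.

Let dpow (p x : R) : D x -> is_derive x 1 (fun y : R => y `^ p) (p * x `^ (p - 1)).
Proof. by rewrite /= in_itv/= => /andP[x0 _]; exact: is_derive1_powR. Qed.

Let donem (p x : R) : D x ->
  is_derive x 1 (fun y : R => (1 - y) `^ p) (- (p * (1 - x) `^ (p - 1))).
Proof.
rewrite /= in_itv/= => /andP[_ x1].
have h1 : 0 < 1 - x by rewrite subr_gt0.
have d1 := @is_derive1_powR R p (1 - x) h1.
have d2 : is_derive x 1 (fun y : R => 1 - y) (-1).
  by have := is_deriveB (is_derive_cst (1 : R) x 1) (is_derive_id x 1); rewrite sub0r.
have d3 := @is_derive1_comp _ (fun y => y `^ p) (fun y => 1 - y) x _ _ d1 d2.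
by rewrite mulrN1 in d3.
Qed.

Let pow_le1 (p x : R) : D x -> 0 <= p -> x `^ p <= 1.
Proof.
rewrite /= in_itv/= => /andP[x0 x1] p0; have e : 1 `^ p = 1 :> R by rewrite powR1.
rewrite -[leRHS]e.
by apply: ge0_ler_powR => //; rewrite ?nnegrE ltW.
Qed.

Let onemD (x : R) : D x -> D (1 - x).
Proof. by rewrite /= !in_itv/= => /andP[? ?]; apply/andP; split; lra. Qed.

Let i1 (p : R) : 0 < p -> mu.-integrable D (EFin \o (fun x => x `^ (p - 1))).
Proof.
move=> p0; apply: (improper_integrable anbn an_dec bn_inc DE (F := fun x => p^-1 * x `^ p) (M := p^-1)).
- by move=> x; rewrite /= in_itv/= => /andP[x0 _]; exact: cpow.
- by move=> x _; exact: powR_ge0.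
- move=> x Dx; have := @is_deriveZ _ _ _ _ p^-1 x 1 _ (dpow p Dx).
  by rewrite /GRing.scale /= mulrA mulVf ?mul1r// gt_eqF.
- move=> x Dx; rewrite ger0_norm ?mulr_ge0 ?powR_ge0 ?invr_ge0 ?(ltW p0)//.
  by rewrite ler_piMr ?invr_ge0 ?(ltW p0)// pow_le1// ltW.
Qed.

Let i2 (p : R) : 0 < p -> mu.-integrable D (EFin \o (fun x => (1 - x) `^ (p - 1))).
Proof.
move=> p0; apply: (improper_integrable anbn an_dec bn_inc DE (F := fun x => (- p^-1) * (1 - x) `^ p) (M := p^-1)).
- by move=> x; rewrite /= in_itv/= => /andP[_ x1]; exact: conem.
- by move=> x _; exact: powR_ge0.
- move=> x Dx; have := @is_deriveZ _ _ _ _ (- p^-1) x 1 _ (donem p Dx).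
  by rewrite /GRing.scale /= mulrNN mulrA mulVf ?mul1r// gt_eqF.
- move=> x Dx; rewrite mulNr normrN ger0_norm ?mulr_ge0 ?powR_ge0 ?invr_ge0 ?(ltW p0)//.
  by rewrite ler_piMr ?invr_ge0 ?(ltW p0)// pow_le1 ?ltW//; exact: onemD.
Qed.

Lemma beta_weight_ge0 (a b x : R) : 0 <= beta_weight a b x.
Proof. by rewrite /beta_weight mulr_ge0// powR_ge0. Qed.

Lemma beta_weight_integrable (a b : R) : 0 < a -> 0 < b ->
  mu.-integrable D (EFin \o beta_weight a b).
Proof.
move=> a0 b0.
(* For x <= 1/2 the factor (1 - x)^(b-1) is at most 2, and for x > 1/2 the factor x^(a-1) is; hence
   this dominating function. *)
have iS : mu.-integrable D (fun x => 2%:E * ((x `^ (a - 1))%:E + ((1 - x) `^ (b - 1))%:E))%E.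
  by apply: integrableZl => //; apply: integrableD => //; [exact: i1|exact: i2].
apply: (@le_integrable _ _ _ mu D _ _ _ _ _ iS) => //.
  apply/measurable_EFinP; apply: (improper_measurable DE).
  by move=> x; exact: beta_continuous.
move=> x Dx; have Dx' := onemD Dx; have := Dx; rewrite /= in_itv/= => /andP[x0 x1].
rewrite /= lee_fin (ger0_norm (beta_weight_ge0 _ _ _)).
have p0 : 0 <= x `^ (a - 1) := powR_ge0 _ _; have q0 : 0 <= (1 - x) `^ (b - 1) := powR_ge0 _ _.
rewrite ger0_norm ?mulr_ge0 ?addr_ge0// /beta_weight.
have e1 := mulr_powRB1 (ltW x0) a0; have l1 := pow_le1 Dx (ltW a0).
have x1' : 0 <= 1 - x by rewrite subr_ge0 ltW.
have e2 := mulr_powRB1 x1' b0; have l2 := pow_le1 Dx' (ltW b0).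
rewrite -e1 in l1; rewrite -e2 in l2.
have [xh|xh] := leP x 2^-1; nra.
Qed.

Definition betaI (a b : R) : R := \int[mu]_(y in D) beta_weight a b y.

Lemma betaI_gt0 (a b : R) : 0 < a -> 0 < b -> 0 < betaI a b.
Proof.
move=> a0 b0.
have ib := beta_weight_integrable a0 b0.
rewrite lt_neqAle Rintegral_ge0 ?andbT; last by move=> x _; exact: beta_weight_ge0.
apply/eqP => e; have [_ mb] : measurable D /\ measurable_fun D (EFin \o beta_weight a b).
  by split=> //; case/integrableP : ib.
have e0 : (\int[mu]_(x in D) (beta_weight a b x)%:E = 0)%E.
  rewrite -[LHS]fineK; [congr EFin; exact/esym|exact: integrable_fin_num].
have [+ _] := @ae_eq_integral_abs _ _ _ mu D (measurable_itv _) (EFin \o beta_weight a b) mb.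
have -> : (\int[mu]_(x in D) `|(EFin \o beta_weight a b) x| = 0)%E.
  rewrite -e0; apply: eq_integral => x _ /=; rewrite ger0_norm//; exact: beta_weight_ge0.
move=> /(_ erefl) [N [mN N0 sN]].
have : (mu D <= mu N)%E.
  apply: le_measure; rewrite ?inE//; apply: subset_trans sN => x Dx /=.
  move=> /(_ Dx) /= e1; have {}e1 : beta_weight a b x = 0 by case: e1.
  move: Dx e1; rewrite /= in_itv/= => /andP[x0 x1] /eqP.
  by rewrite /beta_weight mulf_eq0 !gt_eqF// powR_gt0// subr_gt0.
by rewrite N0 lebesgue_measure_itv/= lte_fin ltr01 sube0 lee_fin ler10.
Qed.

Lemma betaI_split (a b : R) : 0 < a -> 0 < b ->
  betaI a b = betaI (a + 1) b + betaI a (b + 1).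
Proof.
move=> a0 b0; rewrite /betaI -RintegralD//.
- apply: eq_Rintegral => x; rewrite inE /= in_itv/= => /andP[x0 x1].
  rewrite /beta_weight !addrK.
  rewrite -(mulr_powRB1 (ltW x0) a0) -(@mulr_powRB1 _ (1 - x) b)//; first by ring.
  by rewrite subr_ge0 ltW.
- by apply: beta_weight_integrable => //; rewrite addr_gt0.
- by apply: beta_weight_integrable => //; rewrite addr_gt0.
Qed.

Lemma betaI_ibp (a b : R) : 0 < a -> 0 < b ->
  a * betaI a (b + 1) = b * betaI (a + 1) b.
Proof.
move=> a0 b0.
have a1 : 0 < a + 1 by rewrite addr_gt0.
have b1 : 0 < b + 1 by rewrite addr_gt0.
have ia := beta_weight_integrable a0 b1; have ib := beta_weight_integrable a1 b0.
rewrite /betaI -(@RintegralZl _ _ _ mu D _ a (measurable_itv _) ia) -(@RintegralZl _ _ _ mu D _ b (measurable_itv _) ib).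
pose F x : R := x `^ a * (1 - x) `^ b.
have bw (p q x : R) : D x -> {for x, continuous (beta_weight p q)}.
  by move=> Dx; exact: beta_continuous.
have Fb n : 0 <= F (an n) <= an n `^ a.
  have Da : D (an n) by rewrite /= in_itv/= an_gt0 (lt_trans (an_lt n))// invf_lt1// ltr1n.
  rewrite /F mulr_ge0 ?powR_ge0//= ler_piMr ?powR_ge0// pow_le1 ?ltW//; exact: onemD.
have Fb' n : 0 <= F (bn n) <= an n `^ b.
  have Da : D (an n) by rewrite /= in_itv/= an_gt0 (lt_trans (an_lt n))// invf_lt1// ltr1n.
  rewrite /F /bn mulr_ge0 ?powR_ge0//= (_ : 1 - (1 - an n) = an n); last by ring.
  by rewrite ler_piMl ?powR_ge0// pow_le1 ?ltW//; exact: onemD.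
apply: (ibp_vanish anbn an_dec bn_inc DE (F := F)).
- by move=> x Dx; apply: continuousM; [exact: cst_continuous|exact: bw].
- by move=> x Dx; apply: continuousM; [exact: cst_continuous|exact: bw].
- by move=> x Dx; rewrite mulr_ge0 ?beta_weight_ge0 ?ltW.
- by move=> x Dx; rewrite mulr_ge0 ?beta_weight_ge0 ?ltW.
- by have := @integrableZl _ _ _ mu D (measurable_itv _) a _ ia.
- by have := @integrableZl _ _ _ mu D (measurable_itv _) b _ ib.
- move=> x Dx; have d1 := dpow a Dx; have d2 := donem b Dx.
  apply: is_derive_eq; rewrite /beta_weight !addrK /GRing.scale /=; ring.
- apply: (squeeze_cvgr _ (cvg_cst 0) (powR_seq_cvg0 a0 an_gt0 an_cvg)).
  by apply: nearW => n; exact: Fb.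
- apply: (squeeze_cvgr _ (cvg_cst 0) (powR_seq_cvg0 b0 an_gt0 an_cvg)).
  by apply: nearW => n; exact: Fb'.
Qed.

(** The identity x + (1 - x) = 1 and an integration by parts determine all mixed moments from the
    total mass. The beta integrals and the delay are both identified in this way, without Gamma
    functions. *)
Lemma moment_ratio (J : nat -> nat -> R) (a b : R) : 0 < a -> 0 < b ->
  (forall m k, J m k = J m.+1 k + J m k.+1) ->
  (forall m k, (a + m%:R) * J m k.+1 = (b + k%:R) * J m.+1 k) ->
  forall m k, J m k = J 0%N 0%N * bmom a b m k.
Proof.
move=> a0 b0 hs hi.
have hm m k : (a + b + (m + k)%:R) * J m.+1 k = (a + m%:R) * J m k.
  by rewrite (hs m k) mulrDr hi natrD; ring.
have hk m k : (a + b + (m + k)%:R) * J m k.+1 = (b + k%:R) * J m k.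
  by rewrite (hs m k) [in RHS]mulrDr -hi natrD; ring.
have ab0 : 0 < a + b by rewrite addr_gt0.
have n0 (j : nat) : a + b + j%:R != 0 by rewrite gt_eqF// ltr_wpDr.
elim=> [|m IH] k; last first.
  apply: (mulfI (n0 (m + k)%N)); rewrite hm IH /bmom addSn !rfS.
  have h := rf_neq0 (m + k) ab0; move: (n0 (m + k)%N); move: (a + b + _) => t t0.
  by field; rewrite h t0.
elim: k => [|k IH]; first by rewrite bmom00 mulr1.
apply: (mulfI (n0 (0 + k)%N)); rewrite hk IH /bmom addnS !rfS.
have h := rf_neq0 (0 + k) ab0; move: (n0 (0 + k)%N); move: (a + b + _) => t t0.
by field; rewrite h t0.
Qed.

Lemma betaI_moment (a b : R) m k : 0 < a -> 0 < b ->
  betaI (a + m%:R) (b + k%:R) = betaI a b * bmom a b m k.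
Proof.
move=> a0 b0.
pose J m k := betaI (a + m%:R) (b + k%:R).
have pos (x : R) n : 0 < x -> 0 < x + n%:R by move=> x0; rewrite ltr_wpDr.
have hs m' k' : J m' k' = J m'.+1 k' + J m' k'.+1.
  by rewrite /J (betaI_split (pos a m' a0) (pos b k' b0)) -!addrA !natr1.
have hi m' k' : (a + m'%:R) * J m' k'.+1 = (b + k'%:R) * J m'.+1 k'.
  by rewrite /J -!natr1 !addrA (betaI_ibp (pos a m' a0) (pos b k' b0)).
by have := moment_ratio a0 b0 hs hi m k; rewrite /J !addr0.
Qed.

End beta_integrals.

Section sigma_finite_pack.
Context d (T : measurableType d) (R : realType) (m : {measure set T -> \bar R}).
Hypothesis hm : sigma_finite setT m.

(** An alias on which the sigma-finite structure can be declared, so that Tonelli's theorem applies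
    to the given Lévy measure. *)
Definition sfm_of (_ : sigma_finite setT m) : set T -> \bar R := m.

HB.instance Definition _ := Measure.copy (sfm_of hm) m.
HB.instance Definition _ := @Measure_isSigmaFinite.Build _ _ _ (sfm_of hm) hm.

Lemma sfm_exists : exists m' : {sigma_finite_measure set T -> \bar R}, (m' : {measure set T -> \bar R}) = m.
Proof.
exists (sfm_of hm).
by apply: eq_measure; apply/funext.
Qed.

End sigma_finite_pack.

(** * Moments of the delay and Laplace exponent of the subordinator *)

Section delay_and_levy_measure.
Context (R : realType) (alpha theta : R).
Hypotheses (alpha01 : 0 <= alpha < 1) (theta0 : 0 < theta).
Local Notation mu := (@lebesgue_measure R).
Local Notation D := (`]0, +oo[%classic : set R).
Variable nu : {measure set R -> \bar R}.
Hypothesis hnu : is_levy_measure alpha theta nu.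

(** This is x^-alpha (1 - x)^theta at x = 1 - e^-y, that is, the mass of [y, oo[ under nu; up to a
    constant it is the density of the delay. *)
Definition tailfun (y : R) : R := (1 - expR (- y)) `^ (- alpha) * expR (- (theta * y)).

Lemma onem_expRN (y : R) : 0 < y -> 0 < 1 - expR (- y) < 1.
Proof.
by move=> y0; rewrite subr_gt0 expR_lt1 oppr_lt0 y0 /= ltrBlDr ltrDl expR_gt0.
Qed.

Lemma nu_tail (y : R) : 0 < y -> nu `[y, +oo[%classic = (tailfun y)%:E.
Proof.
move=> y0; have /andP[x0 x1] := onem_expRN y0.
have [_ /(_ (1 - expR (- y)))] := hnu; rewrite x0 (ltW x1) => /(_ isT).
rewrite /pushforward /tailfun (_ : _ @^-1` _ = `[y, +oo[%classic).
  move=> ->; congr (_ * _)%:E.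
  by rewrite opprD opprK addrA subrr add0r -expRM mulNr mulrC.
apply/seteqP; split => z /=; rewrite !in_itv/= ?andbT.
  by rewrite lerD2l lerN2 ler_expR lerN2 => /andP[].
by move=> yz; rewrite lerD2l lerN2 ler_expR lerN2 yz /= gerDl oppr_le0 expR_ge0.
Qed.

Lemma tailfun_ge0 y : 0 <= tailfun y.
Proof. by rewrite /tailfun mulr_ge0 ?powR_ge0 ?expR_ge0. Qed.

Let an (n : nat) : R := n.+3%:R^-1.
Let bn (n : nat) : R := n.+1%:R.

Let an_gt0 n : 0 < an n. Proof. by rewrite /an invr_gt0. Qed.

Let an_cvg : an n @[n --> \oo] --> (0 : R).
Proof.
have := @cvg_harmonic R; rewrite -(@cvg_shiftn 2) /= => h.
by apply: cvg_trans h; apply: near_eq_cvg; apply: nearW => n; rewrite /an /harmonic /= addn2.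
Qed.

Let anbn n : an n < bn n.
Proof.
rewrite (@lt_le_trans _ _ 1)// /bn ?ler1n//.
by rewrite /an invf_lt1// ltr1n.
Qed.

Let an_dec n : an n.+1 <= an n.
Proof. by rewrite /an lef_pV2 ?posrE// ler_nat. Qed.

Let bn_inc n : bn n <= bn n.+1.
Proof. by rewrite /bn ler_nat. Qed.

Let DE : D = \bigcup_n `[an n, bn n]%classic.
Proof.
apply/seteqP; split => x.
  rewrite /= in_itv/= andbT => x0.
  have h1 : \forall n \near \oo, an n <= x.
    have /cvgrPdist_lt/(_ _ x0) := an_cvg; apply: filterS => n.
    by rewrite sub0r normrN ger0_norm ?(ltW (an_gt0 n))// => /ltW.
  have h2 : \forall n \near \oo, x <= bn n.
    have [N _ hN] := nbhs_infty_ger x; exists N => // n /= Nn.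
    by rewrite (le_trans (hN n Nn))// /bn ler_nat.
  have [N _ /(_ N (leqnn N)) [h3 h4]] := filterI h1 h2.
  by exists N => //=; rewrite in_itv/= h3 h4.
move=> [n _]; rewrite /= !in_itv/= andbT => /andP[h1 h2].
exact: lt_le_trans (an_gt0 n) h1.
Qed.

Section delay.
Context (d : measure_display) (T : measurableType d) (P : probability T R).
Variable X : T -> R.
Hypotheses (mX : measurable_fun setT X) (hX : has_stationary_delay_law P nu X).

Let c0 : R := (fine (\int[nu]_(y in D) y%:E)%E)^-1.

Let c0_ge0 : 0 <= c0.
Proof.
rewrite /c0 invr_ge0 fine_ge0//; apply: integral_ge0 => y /=.
by rewrite in_itv/= andbT lee_fin => /ltW.
Qed.

Let rho y : R := c0 * tailfun y.

Let hX' (A : set R) : measurable A -> P (X @^-1` A) = (\int[mu]_(y in A `&` D) (rho y)%:E)%E.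
Proof.
move=> mA; rewrite hX//; apply: eq_integral => y; rewrite inE => -[_].
by rewrite /= in_itv/= andbT => y0; rewrite nu_tail// /rho mulrC EFinM.
Qed.

Lemma delay_gt0 : P [set w | X w <= 0] = 0%E.
Proof.
have -> : [set w | X w <= 0] = X @^-1` `]-oo, 0]%classic.
  by apply/seteqP; split => w /=; rewrite in_itv.
rewrite hX'// (_ : _ `&` _ = set0) ?integral_set0//.
apply/seteqP; split => // y [] /=; rewrite !in_itv/= andbT => h1 h2.
by move: h2; rewrite ltNge h1.
Qed.

Let u (m k : nat) (y : R) : R :=
  (1 - expR (- y)) `^ (m%:R - alpha) * expR (- ((k%:R + theta) * y)).

Let uE m k y : D y -> (1 - expR (- y)) ^+ m * expR (- y) ^+ k * rho y = c0 * u m k y.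
Proof.
rewrite /= in_itv/= andbT => y0; have /andP[x0 x1] := onem_expRN y0.
rewrite /rho /u /tailfun powRD; last by apply/implyP => _; rewrite gt_eqF.
have -> : expR (- ((k%:R + theta) * y)) = expR (- y) ^+ k * expR (- (theta * y)).
  by rewrite -expRM_natl -expRD; congr expR; ring.
rewrite powR_mulrn ?(ltW x0)//; ring.
Qed.

Let cF (p q y : R) : D y -> {for y, continuous (fun y : R => (1 - expR (- y)) `^ p * expR (- (q * y)))}.
Proof.
rewrite /= in_itv/= andbT => y0; have /andP[x0 x1] := onem_expRN y0.
have e1 : {for y, continuous (fun y : R => expR (- y))}.
  have h1 : {for y, continuous (fun y : R => - y)} by apply: continuousN; exact: cvg_id.
  exact: (@continuous_comp _ _ _ _ (@expR R) y h1 (@continuous_expR R _)).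
apply: continuousM.
  have h1 : {for y, continuous (fun y : R => 1 - expR (- y))}.
    by apply: continuousB => //; exact: cst_continuous.
  have h2 : {for 1 - expR (- y), continuous (fun y : R => y `^ p)}.
    apply: differentiable_continuous; apply/derivable1_diffP.
    by apply: derivable_powR; rewrite in_itv/= andbT.
  exact: (@continuous_comp _ _ _ _ (fun y : R => y `^ p) y h1 h2).
have h1 : {for y, continuous (fun y : R => - (q * y))}.
  by apply: continuousN; apply: continuousM; [exact: cst_continuous|exact: cvg_id].
exact: (@continuous_comp _ _ _ _ (@expR R) y h1 (@continuous_expR R _)).
Qed.

Let irho : mu.-integrable D (EFin \o rho).
Proof.
apply/integrableP; split.
  apply/measurable_EFinP; apply: (improper_measurable DE) => y Dy.
  by apply: continuousM; [exact: cst_continuous|exact: cF].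
have -> : (\int[mu]_(x in D) `|(EFin \o rho) x| = \int[mu]_(x in D) (rho x)%:E)%E.
  by apply: eq_integral => x _ /=; rewrite ger0_norm// mulr_ge0// tailfun_ge0.
have := hX' measurableT; rewrite setTI => <-.
by rewrite (le_lt_trans (probability_le1 P _))// ?ltry// -[X in measurable X]setTI; exact: mX.
Qed.

Let rho_ge0 y : D y -> 0 <= rho y.
Proof. by rewrite /rho mulr_ge0// tailfun_ge0. Qed.

(** Replacing X by max(X, 0) changes nothing almost surely and makes the ratio [0,1]-valued
    everywhere. The same device is used for the increments of [Y]. *)
Definition delay_ratio (w : T) : R := expR (- Num.max (X w) 0).

Let g m k (y : R) : R := (1 - expR (- Num.max y 0)) ^+ m * expR (- Num.max y 0) ^+ k.

Lemma expRN_max01 (y : R) : 0 <= expR (- Num.max y 0) <= 1.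
Proof. by rewrite expR_ge0/= expR_le1 oppr_le0 le_max lexx orbT. Qed.

Lemma bm_expRN_max : bm (fun y : R => expR (- Num.max y 0)).
Proof.
apply: bm01; last exact: expRN_max01.
apply: (measurableT_comp (@measurable_expR R)); apply: measurableT_comp => //.
exact: measurable_maxr.
Qed.

Let bg m k : bm (g m k).
Proof.
apply: bmM; apply: bmX; last exact: bm_expRN_max.
by apply: bmB; [exact: bm_cst|exact: bm_expRN_max].
Qed.

Let J m k : R := Ex P (fun w => g m k (X w)).

Let JE m k : J m k = \int[mu]_(y in D) (c0 * u m k y).
Proof.
rewrite /J (dens_Ex (measurable_itv _) rho_ge0 irho mX hX' (bg m k)).
apply: eq_Rintegral => y; rewrite inE => Dy; rewrite -uE// /g.
by move: Dy; rewrite /= in_itv/= andbT => y0; rewrite (max_idPl (ltW y0)).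
Qed.

Let iu m k : mu.-integrable D (EFin \o (fun y => c0 * u m k y)).
Proof.
have := dens_integrable (measurable_itv _) irho (bg m k).
apply: eq_integrable => // y; rewrite inE => Dy /=; rewrite -uE// /g.
by move: Dy; rewrite /= in_itv/= andbT => y0; rewrite (max_idPl (ltW y0)).
Qed.

Let dF (p q y : R) : D y -> is_derive y 1 (fun y : R => (1 - expR (- y)) `^ p * expR (- (q * y)))
  (p * (1 - expR (- y)) `^ (p - 1) * expR (- y) * expR (- (q * y)) -
   q * (1 - expR (- y)) `^ p * expR (- (q * y))).
Proof.
rewrite /= in_itv/= andbT => y0; have /andP[x0 x1] := onem_expRN y0.
have e0 := @is_derive1_comp _ (@expR R) (fun y : R => - y) y _ _ (is_derive_expR _) (is_deriveNid y 1).
have e1 := is_deriveB (is_derive_cst (1 : R) y 1) e0.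
have e2 := @is_derive1_comp _ (fun z => z `^ p) (fun y => 1 - expR (- y)) y _ _
   (@is_derive1_powR R p _ x0) e1.
have e3 := is_deriveN (@is_deriveZ _ _ _ _ q y 1 _ (is_derive_id y 1)).
have e4 := @is_derive1_comp _ (@expR R) (fun y : R => - (q * y)) y _ _ (is_derive_expR _) e3.
have e5 := is_deriveM e2 e4.
apply: (@is_derive_eq _ _ _ _ _ _ _ _ e5).
rewrite /GRing.scale /=; ring.
Qed.

Let ibp m k : (1 - alpha + m%:R) * J m k.+1 = (theta + k%:R) * J m.+1 k.
Proof.
have /andP[a0 a1] := alpha01.
have p0 : 0 < m%:R + 1 - alpha by have := ler0n R m; lra.
have q0 : 0 < k%:R + theta by rewrite ltr_wpDl.
rewrite !JE -(@RintegralZl _ _ _ mu D _ (1 - alpha + m%:R) (measurable_itv _) (iu m k.+1)).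
rewrite -(@RintegralZl _ _ _ mu D _ (theta + k%:R) (measurable_itv _) (iu m.+1 k)).
(* Its derivative is the difference of the two integrands. The power vanishes at 0 since its
   exponent is positive, the exponential vanishes at infinity. *)
pose F y := c0 * ((1 - expR (- y)) `^ (m%:R + 1 - alpha) * expR (- ((k%:R + theta) * y))).
have cu m' k' y : D y -> {for y, continuous (fun y => c0 * u m' k' y)}.
  by move=> Dy; apply: continuousM; [exact: cst_continuous|exact: cF].
have u0 m' k' y : 0 <= c0 * u m' k' y.
  by rewrite mulr_ge0// mulr_ge0// ?powR_ge0 ?expR_ge0.
have Fle y : 0 < y -> 0 <= F y <= c0 * y `^ (m%:R + 1 - alpha) /\ F y <= c0 * expR (- ((k%:R + theta) * y)).
  move=> y0; have /andP[x0 x1] := onem_expRN y0.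
  have p1 : (1 - expR (- y)) `^ (m%:R + 1 - alpha) <= 1.
    have e : 1 `^ (m%:R + 1 - alpha) = 1 :> R by rewrite powR1.
    by rewrite -[leRHS]e ge0_ler_powR ?nnegrE ?(ltW p0) ?(ltW x0) ?(ltW x1).
  have p2 : (1 - expR (- y)) `^ (m%:R + 1 - alpha) <= y `^ (m%:R + 1 - alpha).
    rewrite ge0_ler_powR ?nnegrE ?(ltW p0) ?(ltW x0) ?(ltW y0)//.
    by have := expR_ge1Dx (- y); lra.
  have e1 : expR (- ((k%:R + theta) * y)) <= 1 by rewrite expR_le1 oppr_le0 mulr_ge0 ?ltW.
  have e0 : 0 <= expR (- ((k%:R + theta) * y)) by exact: expR_ge0.
  have w0 : 0 <= (1 - expR (- y)) `^ (m%:R + 1 - alpha) by exact: powR_ge0.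
  split; last by rewrite ler_wpM2l// ler_piMl.
  rewrite mulr_ge0 ?mulr_ge0//= ler_wpM2l// (le_trans _ p2)// ler_piMr//.
apply: (ibp_vanish anbn an_dec bn_inc DE (F := F)).
- by move=> y Dy; apply: continuousM; [exact: cst_continuous|exact: cu].
- by move=> y Dy; apply: continuousM; [exact: cst_continuous|exact: cu].
- move=> y Dy; rewrite mulr_ge0//; have := ler0n R m; lra.
- by move=> y Dy; rewrite mulr_ge0// addr_ge0 ?(ltW theta0).
- by have := @integrableZl _ _ _ mu D (measurable_itv _) (1 - alpha + m%:R) _ (iu m k.+1).
- by have := @integrableZl _ _ _ mu D (measurable_itv _) (theta + k%:R) _ (iu m.+1 k).
- move=> y Dy; have := @is_deriveZ _ _ _ _ c0 y 1 _ (dF (m%:R + 1 - alpha) (k%:R + theta) Dy).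
  move=> h; apply: (@is_derive_eq _ _ _ _ _ _ _ _ h).
  rewrite /GRing.scale /= /u.
  have -> : m%:R + 1 - alpha - 1 = m%:R - alpha by ring.
  have -> : m.+1%:R - alpha = m%:R + 1 - alpha by rewrite -natr1.
  have -> : expR (- ((k.+1%:R + theta) * y)) = expR (- y) * expR (- ((k%:R + theta) * y)).
    by rewrite -expRD; congr expR; rewrite -natr1; ring.
  ring.
- have l0 : c0 * an n `^ (m%:R + 1 - alpha) @[n --> \oo] --> (0 : R).
    rewrite -[X in _ --> X](mulr0 c0); apply: cvgM; first exact: cvg_cst.
    exact: powR_seq_cvg0.
  apply: (squeeze_cvgr _ (cvg_cst 0) l0).
  by apply: nearW => n; have [] := Fle _ (an_gt0 n).
- have l0 : c0 * (expR (- (k%:R + theta)) ^+ n.+1) @[n --> \oo] --> (0 : R).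
    rewrite -[X in _ --> X](mulr0 c0); apply: cvgM; first exact: cvg_cst.
    have h : expR (- (k%:R + theta)) ^+ n @[n --> \oo] --> (0 : R).
      by apply: cvg_expr; rewrite ger0_norm ?expR_ge0// expR_lt1 oppr_lt0.
    by have := h; rewrite -(@cvg_shiftS _ (fun n => expR (- (k%:R + theta)) ^+ n)).
  apply: (squeeze_cvgr _ (cvg_cst 0) l0).
  apply: nearW => n; have [/andP[-> _] h] := Fle (bn n) (ltr0Sn _ _).
  by rewrite (le_trans h)// /bn -mulNr expRM_natr.
Qed.

(** Thus 1 - e^-X has the moments of beta(1 - alpha, theta), the law of the first stick of the
    (alpha, theta - alpha) stick breaking. *)
Lemma delay_moment m k :
  Ex P (fun w => (1 - delay_ratio w) ^+ m * delay_ratio w ^+ k) = bmom (1 - alpha) theta m k.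
Proof.
have /andP[a0 a1] := alpha01.
have h := @moment_ratio _ J (1 - alpha) theta ltac:(by lra) theta0.
rewrite -[LHS]/(J m k) h.
- rewrite (_ : J 0 0 = 1) ?mul1r// /J -[RHS](Ex_cst P); congr Ex.
  by apply/funext => w; rewrite /g !expr0 mulr1.
- move=> m' k'; rewrite /J -ExD; [|exact: (bm_comp mX)|exact: (bm_comp mX)].
  by congr Ex; apply/funext => w; rewrite /g !exprS; ring.
- exact: ibp.
Qed.

(** An infinite mean would have real part 0 by convention, with inverse 0, and the law of [X] would
    have mass 0. So the law of [X] itself forces the mean of nu to be finite and positive. *)
Lemma c0_gt0 : 0 < c0.
Proof.
rewrite lt_neqAle c0_ge0 andbT; apply/eqP => c00.
have := hX' measurableT; rewrite setTI preimage_setT probability_setT.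
under eq_integral do rewrite /rho -c00 mul0r.
by rewrite integral0 => /eqP; rewrite onee_eq0.
Qed.

Lemma delay_diffuse (a : R) : P [set w | X w = a] = 0%E.
Proof.
rewrite -[LHS]/(P (X @^-1` [set a])) hX'//.
apply: null_set_integral => //; first exact: measurableI.
- apply/measurable_EFinP; apply: (@measurable_funS _ _ _ _ D) => //.
  by case/integrableP : irho => /measurable_EFinP.
- apply: (@subset_measure0 _ _ _ mu _ [set a]) => //; first exact: measurableI.
  by have := lebesgue_measure_set1 a.
Qed.

Let sigma_finite_nu : sigma_finite setT nu.
Proof.
have [n0 _] := hnu.
exists (fun n => `]-oo, 0]%classic `|` `[n.+1%:R^-1, +oo[%classic).
  apply/esym; rewrite -subTset => x _.
  have [x0|x0] := leP x 0; first by exists 0%N => //; left; rewrite /= in_itv.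
  have /cvgrPdist_lt/(_ _ x0) [N _ /(_ N (leqnn N))] := @cvg_harmonic R.
  rewrite /= sub0r normrN ger0_norm// => /ltW h.
  by exists N => //; right; rewrite /= in_itv/= andbT.
move=> n; split; first exact: measurableU.
apply: (le_lt_trans (measureU2 _ _ _)) => //; apply: lte_add_pinfty.
  by apply: (@le_lt_trans _ _ 0%E); [rewrite le_eqVlt; apply/orP; left; apply/eqP; exact: n0|exact: ltry].
apply: (@le_lt_trans _ _ (tailfun n.+1%:R^-1)%:E); last exact: ltry.
by rewrite le_eqVlt; apply/orP; left; apply/eqP; apply: nu_tail; rewrite invr_gt0.
Qed.

(** Write 1 - e^(-ky) as the integral of k e^(-ks) over 0 < s <= y. Tonelli's theorem leaves the
    tail of nu at s, which is the density of the delay up to [c0]; the exponent is thus k times a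
    delay moment, already known. *)
Lemma levy_exponent k : (0 < k)%N ->
  (\int[nu]_(y in D) (1 - expR (- k%:R * y))%:E = (c0^-1 * levyPhi alpha theta k)%:E)%E.
Proof.
move=> k0; have [nus nusE] := sfm_exists sigma_finite_nu.
pose f (ys : R * R) : \bar R := if 0 < ys.2 <= ys.1 then (k%:R * expR (- k%:R * ys.2))%:E else 0%E.
have f0 x : (0 <= f x)%E.
  by rewrite /f; case: ifP => // _; rewrite lee_fin mulr_ge0 ?expR_ge0.
have mf : measurable_fun [set: measurableTypeR R * measurableTypeR R] f.
  apply: measurable_fun_ifT.
  - apply: measurable_and; [exact: measurable_fun_ltr|exact: measurable_fun_ler].
  - apply/measurable_EFinP; apply: measurable_funM => //.
    apply: (measurableT_comp (@measurable_expR R)).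
    by apply: measurable_funM => //; exact: measurable_snd.
  - exact: measurable_cst.
have kR : 0 < k%:R :> R by rewrite ltr0n.
have in1 y : ((\int[mu]_s f (y, s)) = if (0 < y)%R then (1 - expR (- k%:R * y))%:E else 0)%E.
  have -> : ((\int[mu]_s f (y, s)) = \int[mu]_(s in `]0%R, y]) (k%:R * expR (- k%:R * s))%:E)%E.
    rewrite [RHS]integral_mkcond; apply: eq_integral => s _; rewrite patchE /f /=.
    by rewrite (_ : (s \in _) = (0 < s <= y))//; apply/idP/idP; rewrite ?inE/= ?in_itv.
  case: ifPn => y0; last first.
    rewrite (_ : `]0, y]%classic = set0) ?integral_set0//.
    apply/seteqP; split => // s; rewrite /= in_itv/= => /andP[h1 h2].
    by move/negP : y0; apply; rewrite (lt_le_trans h1).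
  have ce (s : R) : {for s, continuous (fun s : R => expR (- k%:R * s))}.
    have h1 : {for s, continuous (fun s : R => - k%:R * s)}.
      by apply: continuousM; [exact: cst_continuous|exact: cvg_id].
    exact: (@continuous_comp _ _ _ _ (@expR R) s h1 (@continuous_expR R _)).
  have de (s : R) : is_derive s 1 (fun s : R => - expR (- k%:R * s)) (k%:R * expR (- k%:R * s)).
    have e3 := @is_deriveZ _ _ _ _ (- k%:R) s 1 _ (is_derive_id s 1).
    have e4 := is_deriveN (@is_derive1_comp _ (@expR R) (fun s : R => - k%:R * s) s _ _ (is_derive_expR _) e3).
    apply: (@is_derive_eq _ _ _ _ _ _ _ _ e4).
    rewrite /GRing.scale /=; ring.
  rewrite integral_itv_obnd_cbnd; last first.
    apply/measurable_EFinP; apply: measurable_funTS; apply: measurable_funM => //.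
    by apply: (measurableT_comp (@measurable_expR R)); apply: measurable_funM.
  have cke (x : R) : {for x, continuous (fun s : R => k%:R * expR (- k%:R * s))}.
    by apply: continuousM; [exact: cst_continuous|exact: ce].
  have e := @ftc_cc _ (fun s : R => - expR (- k%:R * s)) (fun s => k%:R * expR (- k%:R * s)) _ _ y0
    (fun x _ => cke x) (fun x _ => de x).
  by rewrite e mulr0 expR0 opprK addrC.
have in2 s : ((\int[nus]_y f (y, s)) = if (0 < s)%R then (k%:R * expR (- k%:R * s) * tailfun s)%:E else 0)%E.
  case: ifPn => s0; last first.
    by rewrite integral0_eq// => y _; rewrite /f /= (negbTE s0).
  have -> : ((\int[nus]_y f (y, s)) = \int[nus]_(y in `[s, +oo[) (k%:R * expR (- k%:R * s))%:E)%E.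
    rewrite [RHS]integral_mkcond; apply: eq_integral => y _; rewrite patchE /f /= s0 /=.
    by rewrite (_ : (y \in _) = (s <= y))//; apply/idP/idP; rewrite ?inE/= ?in_itv/= ?andbT.
  rewrite integral_cst// [X in (_ * X)%E](_ : _ = (tailfun s)%:E) ?EFinM//.
  exact: etrans (congr1 (fun z : {measure set R -> \bar R} => z `[s, +oo[%classic) nusE) (nu_tail s0).
transitivity (\int[nus]_y \int[mu]_s f (y, s))%E.
  rewrite -nusE [LHS]integral_mkcond; apply: eq_integral => y _; rewrite in1 patchE.
  by rewrite (_ : (y \in D) = (0 < y))//; apply/idP/idP; rewrite ?inE/= ?in_itv/= ?andbT.
have := @fubini_tonelli _ _ _ _ _ nus mu f mf f0; rewrite /fubini_F /fubini_G => ->.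
have c00 := c0_gt0.
transitivity (\int[mu]_(s in D) ((k%:R / c0) * (c0 * u 0 k s))%:E)%E.
  rewrite [RHS]integral_mkcond; apply: eq_integral => s _; rewrite in2 patchE.
  have -> : (s \in D) = (0 < s) by apply/idP/idP; rewrite ?inE/= ?in_itv/= ?andbT.
  case: ifPn => // s0; congr EFin; rewrite -uE/= ?in_itv/= ?s0// expr0 mul1r /rho -expRM_natl.
  by rewrite mulrN -mulNr (mulrCA (expR _) c0) [RHS]mulrA divfK ?gt_eqF// [RHS]mulrA.
have iu' := @integrableZl _ _ _ mu D (measurable_itv _) (k%:R / c0) _ (iu 0 k).
rewrite -[LHS]fineK; last by apply: integrable_fin_num => //.
congr EFin; rewrite -[LHS]/(\int[mu]_(s in D) ((k%:R / c0) * (c0 * u 0 k s))) RintegralZl//.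
rewrite -JE; have -> : J 0 k = bmom (1 - alpha) theta 0 k by exact: delay_moment.
rewrite /bmom /levyPhi rf0 add0n; ring.
Qed.

End delay.
End delay_and_levy_measure.

(** * Gaps of a closed set *)

Section gap_geometry.
Context (R : realType).
Implicit Types (Z C : set R) (u v x y z : R).
Local Notation mu := (@lebesgue_measure R).

(** Connected subsets of the line are intervals, so a component of the complement is described by
    the absence of points of [Z] in between. *)
Lemma gap_atP Z u v : gap_at Z u v <->
  [/\ 0 <= u <= 1, 0 <= v <= 1 & forall z, Num.min u v <= z <= Num.max u v -> ~ Z z].
Proof.
split.
  case=> B [Bu BA Bc] Bv.
  have iB := (connected_intervalP B).1 Bc.
  have sub z : Num.min u v <= z <= Num.max u v -> B z.
    by case: (leP u v) => uv => zz; apply: (iB _ _ _ _ z zz).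
  have := BA _ Bu; have := BA _ Bv; rewrite /= !in_itv/= => -[v01 _] [u01 _].
  split=> // z /sub/BA[]; by [].
move=> [u01 v01 h].
exists `[Num.min u v, Num.max u v]%classic.
  split.
  - by rewrite /= in_itv/= ge_min lexx le_max lexx.
  - move=> z /=; rewrite in_itv/= => zz; split; last exact: h.
    move: zz u01 v01; rewrite in_itv/= ge_min le_max => /andP[/orP h1 /orP h2] /andP[u0 u1] /andP[v0 v1].
    apply/andP; split; [case: h1 => h1|case: h2 => h2]; lra.
  - by apply/connected_intervalP; exact: interval_is_interval.
by rewrite /= in_itv/= ge_min lexx orbT le_max lexx orbT.
Qed.

Lemma gap_at_sym Z u v : gap_at Z u v -> gap_at Z v u.
Proof. by move=> /gap_atP[h1 h2 h3]; apply/gap_atP; split=> //; rewrite minC maxC. Qed.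

Lemma gap_at_refl Z u : gap_at Z u u <-> 0 <= u <= 1 /\ ~ Z u.
Proof.
split.
  by move=> /gap_atP[h1 _]; rewrite minxx maxxx => /(_ u); rewrite lexx => /(_ isT).
move=> [h1 h2]; apply/gap_atP; split=> // z; rewrite minxx maxxx => /le_anti <- //.
Qed.

Lemma gap_at_trans Z u v z : gap_at Z u v -> gap_at Z v z -> gap_at Z u z.
Proof.
move=> /gap_atP[u01 v01 h1] /gap_atP[_ z01 h2]; apply/gap_atP; split=> // t.
rewrite ge_min le_max => /andP[/orP k1 /orP k2].
case: (leP (Num.min u v) t) => e1; last first.
  apply: h2; apply/andP; split; rewrite ?ge_min ?le_max; apply/orP.
    by move: e1; rewrite lt_min => /andP[e1 e2]; case: k1 => k1; [lra|right].
  by move: e1; rewrite lt_min => /andP[e1 e2]; left; apply: ltW.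
case: (leP t (Num.max u v)) => e2; first by apply: h1; rewrite e1 e2.
apply: h2; apply/andP; split; rewrite ?ge_min ?le_max; apply/orP.
  by move: e2; rewrite gt_max => /andP[e2 e3]; left; apply: ltW.
by move: e2; rewrite gt_max => /andP[e2 e3]; case: k2 => k2; [lra|right].
Qed.

Lemma gap_at_eq Z u v : gap_at Z u v -> gap_at Z u = gap_at Z v.
Proof.
move=> uv; apply/seteqP; split => z h; first exact: gap_at_trans (gap_at_sym uv) h.
exact: gap_at_trans uv h.
Qed.

Lemma gap_at_mem Z u v : gap_at Z u v -> [/\ 0 <= u <= 1, 0 <= v <= 1, ~ Z u & ~ Z v].
Proof.
move=> /gap_atP[h1 h2 h3]; split => //; apply: h3; rewrite ge_min le_max lexx ?orbT//.
Qed.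

Lemma gap_at_itv Z u : is_interval (gap_at Z u).
Proof.
move=> a b ga gb z zz; have ab := gap_at_trans (gap_at_sym ga) gb.
apply: (gap_at_trans ga); have [a01 b01 h] := (gap_atP _ _ _).1 ab.
have azb : a <= z <= b by [].
have ab' : a <= b by case/andP : azb => h1 h2; exact: le_trans h1 h2.
apply/gap_atP; split => //; first by case/andP: azb => h1 h2; move: a01 b01 => /andP[? ?] /andP[? ?]; apply/andP; split; lra.
move=> t; rewrite (min_idPl _) ?(max_idPr _) //; try by case/andP : azb.
move=> /andP[h1 h2]; apply: h; rewrite (min_idPl ab') (max_idPr ab') h1/=.
by case/andP: azb => _ h3; exact: le_trans h2 h3.
Qed.

Lemma measurable_gap Z u : measurable (gap_at Z u).
Proof. by apply: is_interval_measurable; exact: gap_at_itv. Qed.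

Lemma gap_sub01 Z u : gap_at Z u `<=` `[0, 1]%classic.
Proof. by move=> v /gap_at_mem[_ h _ _]; rewrite /= in_itv. Qed.

Lemma measure_le_itv (A : set R) (a b : R) : measurable A -> a <= b -> A `<=` `[a, b]%classic ->
  (mu A <= (b - a)%:E)%E.
Proof.
move=> mA ab sub; have <- : mu `[a, b]%classic = (b - a)%:E.
  rewrite lebesgue_measure_itv/= lte_fin; case: ifPn => [_|]; first by rewrite EFinN -EFinB.
  by rewrite -leNgt => ba; rewrite (le_anti (introT andP (conj ab ba))) subrr.
by apply: le_measure => //; rewrite inE.
Qed.

Lemma measure_ge_itv (A : set R) (a b : R) : measurable A -> a < b -> `]a, b[%classic `<=` A ->
  ((b - a)%:E <= mu A)%E.
Proof.
move=> mA ab sub; have <- : mu `]a, b[%classic = (b - a)%:E.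
  by rewrite lebesgue_measure_itv/= lte_fin ab EFinN -EFinB.
by apply: le_measure => //; rewrite inE.
Qed.

Lemma gap_measure_le1 Z u : (mu (gap_at Z u) <= 1%:E)%E.
Proof.
by rewrite -[X in X%:E](subr0 1); apply: measure_le_itv => //; [exact: measurable_gap|exact: gap_sub01].
Qed.

Lemma gap_measure_fin Z u : mu (gap_at Z u) = (gap_length (gap_at Z u))%:E.
Proof.
rewrite /gap_length fineK// ge0_fin_numE ?measure_ge0//.
by rewrite (le_lt_trans (gap_measure_le1 _ _))// ltry.
Qed.

Lemma gap_length01 Z u : 0 <= gap_length (gap_at Z u) <= 1.
Proof.
rewrite -!lee_fin -gap_measure_fin gap_measure_le1 measure_ge0//.
Qed.

Lemma gap_length_gtP Z u x : 0 <= x -> closed Z ->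
  x < gap_length (gap_at Z u) <->
  0 <= u <= 1 /\ exists p q : R, [/\ p < u, u < q, x < Num.min q 1 - Num.max p 0 &
    forall z, p < z < q -> ~ Z z].
Proof.
move=> x0 cZ; split; last first.
  move=> [u01 [p [q [pu uq xpq hf]]]].
  rewrite -lte_fin -gap_measure_fin.
  have sub : `]Num.max p 0, Num.min q 1[%classic `<=` gap_at Z u.
    move=> v; rewrite /= in_itv/= gt_max lt_min => /andP[/andP[pv v0] /andP[vq v1]].
    apply/gap_atP; split => //; first by rewrite !ltW.
    move=> z /andP[h1 h2]; apply: hf; rewrite (lt_le_trans _ h1) ?lt_min ?pu ?pv//=.
    by rewrite (le_lt_trans h2) ?gt_max ?uq ?vq.
  have lt : Num.max p 0 < Num.min q 1 by rewrite -subr_gt0 (le_lt_trans x0).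
  by apply: (lt_le_trans _ (measure_ge_itv (measurable_gap Z u) lt sub)); rewrite lte_fin.
move=> xL.
have [a [b [ga gb xab]]] : exists a b, [/\ gap_at Z u a, gap_at Z u b & x < b - a].
  apply: contrapT => hn.
  have hle a b : gap_at Z u a -> gap_at Z u b -> b - a <= x.
    by move=> ga gb; rewrite leNgt; apply/negP => h; apply: hn; exists a, b.
  move: xL; rewrite ltNge => /negP; apply.
  rewrite -lee_fin -gap_measure_fin.
  have [->|/set0P[v gv]] := eqVneq (gap_at Z u) set0; first by rewrite measure0.
  pose i := inf (gap_at Z u).
  have lbi : has_lbound (gap_at Z u).
    by exists 0 => y /gap_sub01; rewrite /= in_itv/= => /andP[].
  have sub : gap_at Z u `<=` `[i, i + x]%classic.
    move=> y gy; rewrite /= in_itv/=; apply/andP; split; first exact: ge_inf.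
    rewrite -lerBlDr; apply: lb_le_inf; first by exists v.
    by move=> a ga; rewrite lerBlDr -lerBlDl; exact: hle.
  have ii : i <= i + x by rewrite lerDl.
  by apply: (le_trans (measure_le_itv (measurable_gap Z u) ii sub)); rewrite lee_fin addrAC subrr add0r.
have [u01 a01 nZu nZa] := gap_at_mem ga; have [_ b01 _ nZb] := gap_at_mem gb.
split=> //.
pose a' := Num.min a u; pose b' := Num.max b u.
have a'u : a' <= u by rewrite ge_min lexx orbT.
have ub' : u <= b' by rewrite le_max lexx orbT.
have guu : gap_at Z u u by apply/gap_at_refl.
have ga' : gap_at Z u a' by rewrite /a'; case: (leP a u).
have gb' : gap_at Z u b' by rewrite /b'; case: (leP b u).
have ab' : a' <= b' by exact: le_trans ub'.
have [_ _ hf] := (gap_atP _ _ _).1 (gap_at_trans (gap_at_sym ga') gb').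
rewrite (min_idPl ab') (max_idPr ab') in hf.
have xab' : x < b' - a'.
  apply: (lt_le_trans xab); apply: lerB; first by rewrite le_max lexx.
  by rewrite ge_min lexx.
have opn v : ~ Z v -> exists2 e : R, 0 < e & forall z, v - e < z < v + e -> ~ Z z.
  move=> nZv; have oZ : open (~` Z) by rewrite openC.
  have /nbhs_ballP[e e0 he] : nbhs v (~` Z) by move: oZ; rewrite openE => /(_ v nZv).
  by exists e => // z zz; apply: he; rewrite /ball/= ltr_distlC.
have [_ a'01 _ nZa'] := gap_at_mem ga'; have [_ b'01 _ nZb'] := gap_at_mem gb'.
have [e e0 he] := opn _ nZa'; have [e' e'0 he'] := opn _ nZb'.
exists (a' - e), (b' + e'); split.
- by rewrite (lt_le_trans _ a'u)// ltrBlDr ltrDl.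
- by rewrite (le_lt_trans ub')// ltrDl.
- apply: (lt_le_trans xab'); apply: lerB.
    by rewrite le_min; case/andP: b'01 => _ ->; rewrite andbT lerDl ltW.
  by rewrite ge_max; case/andP: a'01 => -> _; rewrite andbT gerBl ltW.
- move=> z /andP[h1 h2].
  have [za|az] := ltP z a'; first by apply: he; rewrite h1 (lt_trans za)// ltrDl.
  have [bz|zb] := ltP b' z; last by apply: hf; rewrite az zb.
  by apply: he'; rewrite h2 andbT (lt_trans _ bz)// ltrBlDr ltrDl.
Qed.

(** Rational endpoints make the event a countable union of events on which [Z] misses a fixed
    interval; this gives measurability. *)
Lemma gap_length_gt_ratP Z u x : 0 <= x -> closed Z ->
  x < gap_length (gap_at Z u) <->
  0 <= u <= 1 /\ exists p q : rat, [/\ ratr p < u, u < ratr q,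
    x < Num.min (ratr q) 1 - Num.max (ratr p) 0 &
    Z `&` `]ratr p, ratr q[%classic = set0].
Proof.
move=> x0 cZ; rewrite gap_length_gtP//; split => -[u01 [p [q [pu uq xpq hf]]]]; split => //; last first.
  exists (ratr p), (ratr q); split => // z zz Zz.
  have : (Z `&` `]ratr p, ratr q[%classic) z by split => //; rewrite /= in_itv.
  by rewrite hf.
pose e := (Num.min q 1 - Num.max p 0 - x) / 2.
have e0 : 0 < e by rewrite divr_gt0// subr_gt0.
have e2 : e + e = Num.min q 1 - Num.max p 0 - x by rewrite /e; field.
have h1 : p < Num.min u (p + e) by rewrite lt_min pu ltrDl.
have h2 : Num.max u (q - e) < q by rewrite gt_max uq ltrBlDr ltrDl.
have [p' +] := rat_in_itvoo h1; rewrite in_itv/= lt_min => /andP[pp' /andP[p'u p'e]].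
have [q' +] := rat_in_itvoo h2; rewrite in_itv/= gt_max => /andP[/andP[uq' eq'] q'q].
exists p', q'; split => //.
  have k1 : Num.min q 1 - e < Num.min (ratr q') 1.
    rewrite lt_min; apply/andP; split.
      by rewrite (le_lt_trans _ eq')// lerB// ge_min lexx.
    by rewrite ltrBlDr (le_lt_trans (y := 1)) ?ge_min ?lexx ?orbT// ltrDl.
  have k2 : Num.max (ratr p') 0 < Num.max p 0 + e.
    rewrite gt_max; apply/andP; split.
      by rewrite (lt_le_trans p'e)// lerD// le_max lexx.
    by rewrite ltr_wpDl// le_max lexx orbT.
  lra.
apply/seteqP; split => // z [Zz]; rewrite /= in_itv/= => /andP[h3 h4].
by apply: (hf z) => //; rewrite (lt_trans pp' h3) (lt_trans h4 q'q).
Qed.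

Lemma gap_at_ratP Z u v : closed Z ->
  gap_at Z u v <-> [/\ 0 <= u <= 1, 0 <= v <= 1 & exists p q : rat,
    [/\ ratr p < u, ratr p < v, u < ratr q, v < ratr q &
        Z `&` `]ratr p, ratr q[%classic = set0]].
Proof.
move=> cZ; split; last first.
  move=> [u01 v01 [p [q [pu pv uq vq hf]]]]; apply/gap_atP; split => // z /andP[h1 h2] Zz.
  suff : (Z `&` `]ratr p, ratr q[%classic) z by rewrite hf.
  split => //; rewrite /= in_itv/= (lt_le_trans _ h1) ?lt_min ?pu ?pv//=.
  by rewrite (le_lt_trans h2) ?gt_max ?uq ?vq.
wlog uv : u v / u <= v.
  move=> hw g; have [uv|vu] := leP u v; first exact: hw.
  have [h1 h2 [p [q [k1 k2 k3 k4 k5]]]] := hw v u (ltW vu) (gap_at_sym g).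
  by split => //; exists p, q.
move=> g; have [u01 v01 hf] := (gap_atP _ _ _).1 g; split => //.
rewrite (min_idPl uv) (max_idPr uv) in hf.
have opn y : ~ Z y -> exists2 e : R, 0 < e & forall z, y - e < z < y + e -> ~ Z z.
  move=> nZv; have oZ : open (~` Z) by rewrite openC.
  have /nbhs_ballP[e e0 he] : nbhs y (~` Z) by move: oZ; rewrite openE => /(_ y nZv).
  by exists e => // z zz; apply: he; rewrite /ball/= ltr_distlC.
have nZu : ~ Z u by apply: hf; rewrite lexx.
have nZv : ~ Z v by apply: hf; rewrite lexx andbT.
have [e e0 he] := opn _ nZu; have [e' e'0 he'] := opn _ nZv.
have h1 : u - e < u by rewrite ltrBlDr ltrDl.
have h2 : v < v + e' by rewrite ltrDl.
have [p] := rat_in_itvoo h1; rewrite in_itv/= => /andP[ep pu].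
have [q] := rat_in_itvoo h2; rewrite in_itv/= => /andP[vq qe].
exists p, q; split => //; first exact: lt_le_trans uv.
  exact: le_lt_trans uv vq.
apply/seteqP; split => // z [Zz]; rewrite /= in_itv/= => /andP[h3 h4].
have [zu|uz] := ltP z u.
  by apply: (he z) => //; rewrite (lt_trans ep h3) (lt_trans zu)// ltrDl.
have [vz|zv] := ltP v z; last by apply: (hf z) => //; rewrite uz zv.
by apply: (he' z) => //; rewrite (lt_trans h4 qe) andbT (lt_trans _ vz)// ltrBlDr ltrDl.
Qed.

Lemma gap_length_notin Z u : ~ (0 <= u <= 1 /\ ~ Z u) -> gap_length (gap_at Z u) = 0.
Proof.
move=> h; rewrite (_ : gap_at Z u = set0) ?/gap_length ?measure0//.
by apply/seteqP; split => // v /gap_at_mem[h1 h2 h3 h4]; apply: h.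
Qed.

Lemma meander_top Z s : 0 < s < 1 -> Z s -> (forall z, Z z -> z <= s) -> closed Z ->
  meander_length Z = 1 - s /\ gap_length (gap_at Z 1) = 1 - s.
Proof.
move=> /andP[s0 s1] Zs Zle cZ; split.
  rewrite /meander_length; congr (_ - _); apply/eqP; rewrite eq_le; apply/andP; split.
    apply: ge_sup; first by exists s; split => //; rewrite /= in_itv/= !ltW.
    by move=> z [/Zle].
  apply: ub_le_sup; first by exists s => z [/Zle].
  by split => //; rewrite /= in_itv/= !ltW.
have -> : gap_at Z 1 = `]s, 1]%classic.
  apply/seteqP; split => v.
    move=> /gap_atP[_ /andP[v0 v1] h]; rewrite /= in_itv/= v1 andbT ltNge; apply/negP => vs.
    by apply: (h s) => //; rewrite (min_idPr v1) (max_idPl v1) vs ltW.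
  rewrite /= in_itv/= => /andP[sv v1]; apply/gap_atP; split.
  - by rewrite lexx ler01.
  - by rewrite v1 ltW// (lt_trans s0).
  move=> z; rewrite (min_idPr v1) (max_idPl v1) => /andP[vz _] /Zle zs.
  by have := lt_le_trans sv vz; rewrite ltNge zs.
by rewrite /gap_length lebesgue_measure_itv/= lte_fin s1 EFinN -EFinB.
Qed.

Lemma gap_length_scale Z s u : closed Z -> 0 < s < 1 -> Z 1 -> (forall z, Z z -> z <= 1) ->
  let Z' := [set s * z | z in Z] in u < s ->
  gap_length (gap_at Z' u) = s * gap_length (gap_at Z (u / s)).
Proof.
move=> cZ /andP[s0 s1] Z1 Zle Z' us.
have Z'E z : Z' z <-> Z (z / s).
  split=> [[y Zy <-]|h]; first by rewrite mulrC mulKf ?gt_eqF.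
  by exists (z / s) => //; rewrite mulrC divfK ?gt_eqF.
have cZ' : closed Z'.
  have -> : Z' = (fun z => z / s) @^-1` Z by apply/seteqP; split => z /Z'E.
  apply: preimage_closed cZ => // z _.
  by apply: cvgM; [exact: cvg_id|exact: cvg_cst].
have main x : 0 <= x -> s * x < gap_length (gap_at Z' u) <-> x < gap_length (gap_at Z (u / s)).
  move=> x0; have sx0 : 0 <= s * x by rewrite mulr_ge0 ?(ltW s0).
  have P1 := gap_length_gtP u sx0 cZ'; have P2 := gap_length_gtP (u / s) x0 cZ.
  split.
    move=> /P1[/andP[u0 u1] [p [q [pu uq xpq hf]]]]; apply/P2; split.
      by rewrite divr_ge0 ?(ltW s0)//= ler_pdivrMr// mul1r ltW.
    have qs : q <= s.
      rewrite leNgt; apply/negP => sq; apply: (hf s); first by rewrite (lt_trans pu us).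
      by apply/Z'E; rewrite divff ?gt_eqF.
    exists (p / s), (q / s); split; rewrite ?ltr_pM2r ?invr_gt0//.
      have e1 : Num.min (q / s) 1 = q / s by apply/min_idPl; rewrite ler_pdivrMr// mul1r.
      have e2 : Num.max (p / s) 0 = Num.max p 0 / s.
        by rewrite -[in LHS](mul0r s^-1) -maxr_pMl ?invr_ge0 ?ltW.
      rewrite e1 e2 -mulrBl ltr_pdivlMr// mulrC (lt_le_trans xpq)// lerB//.
      by rewrite ge_min lexx.
    move=> z /andP[h1 h2] Zz; apply: (hf (s * z)); last by exists z.
    by rewrite mulrC -ltr_pdivrMr// h1 -ltr_pdivlMr.
  move=> /P2[/andP[u0 u1] [p [q [pu uq xpq hf]]]]; apply/P1; split.
    move: u0; rewrite pmulr_lge0 ?invr_gt0// => ->/=; exact: ltW (lt_trans us s1).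
  have q1 : q <= 1.
    rewrite leNgt; apply/negP => sq; apply: (hf 1) => //; rewrite sq andbT (lt_trans pu)//.
    by rewrite ltr_pdivrMr// mul1r.
  exists (s * p), (s * q); split.
  - by rewrite mulrC -ltr_pdivlMr.
  - by rewrite [s * q]mulrC -ltr_pdivrMr.
  - have e1 : Num.min (s * q) 1 = s * q.
      by apply/min_idPl; rewrite (le_trans (ler_piMr (ltW s0) q1))// ltW.
    have e2 : Num.max (s * p) 0 = s * Num.max p 0.
      by rewrite -[in LHS](mulr0 s) -maxr_pMr ?ltW.
    rewrite e1 e2 -mulrBr ltr_pM2l// (lt_le_trans xpq)// lerB//.
    by rewrite ge_min lexx.
  - move=> z /andP[h1 h2] /Z'E; apply: hf.
    by rewrite ltr_pdivlMr// ltr_pdivrMr// ![_ * s]mulrC h1 h2.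
apply/eqP; rewrite eq_le; apply/andP; split; rewrite leNgt; apply/negP => h.
  have /andP[h0 _] := gap_length01 Z (u / s).
  have := (main _ h0).1 h; by rewrite ltxx.
have /andP[h0 _] := gap_length01 Z' u.
have h0' : 0 <= gap_length (gap_at Z' u) / s by rewrite divr_ge0 ?(ltW s0).
have : gap_length (gap_at Z' u) / s < gap_length (gap_at Z (u / s)).
  by rewrite ltr_pdivrMr// mulrC.
by move/(main _ h0').2; rewrite mulrC divfK ?gt_eqF// ltxx.
Qed.

End gap_geometry.

Lemma measurable_fun_rays (R : realType) d (T : measurableType d) (f : T -> R) :
  (forall x, measurable (f @^-1` `]x, +oo[%classic)) -> measurable_fun setT f.
Proof.
move=> h; apply: (@measurability _ _ _ _ _ f (@RGenOInfty.G R)).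
  exact: RGenOInfty.measurableE.
by move=> _ [_ [x ->] <-]; rewrite setTI; exact: h.
Qed.

Section independent_pair.
Context (R : realType) (d d1 d2 : measure_display).
Context (T : measurableType d) (T1 : measurableType d1) (T2 : measurableType d2).
Variables (P : probability T R) (i1 : T -> T1) (i2 : T -> T2).
Hypotheses (m1 : measurable_fun setT i1) (m2 : measurable_fun setT i2).
Hypothesis ind : forall A B, measurable A -> measurable B ->
  P (i1 @^-1` A `&` i2 @^-1` B) = (P (i1 @^-1` A) * P (i2 @^-1` B))%E.

Lemma distribution_exists d' (T' : measurableType d') (f : T -> T') : measurable_fun setT f ->
  exists P' : probability T' R, forall A, P' A = P (f @^-1` A).
Proof. by move=> mf; exists (distribution P (mfun_Sub (mem_set mf))). Qed.

(** The joint law of the pair is a product by uniqueness on rectangles. The target spaces may be the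
    original space with smaller sigma-algebras, which is how it is used. *)
Lemma Ex_independent_pair (f : T1 * T2 -> R) : bm f ->
  Ex P (fun w => f (i1 w, i2 w)) = Ex P (fun w => Ex P (fun w' => f (i1 w, i2 w'))).
Proof.
move=> bf.
have [P1 P1E] := distribution_exists m1; have [P2 P2E] := distribution_exists m2.
have m12 : measurable_fun setT (fun w => (i1 w, i2 w)) by exact: measurable_fun_pair.
have [P12 P12E] := distribution_exists m12.
have eP A : measurable A -> (P1 \x P2)%E A = P ((fun w => (i1 w, i2 w)) @^-1` A).
  move=> mA; rewrite -P12E; apply: product_measure_unique => // B C mB mC.
  apply: (etrans (P12E _)); apply: (etrans (ind mB mC)).
  by congr (_ * _)%E; apply: esym; [exact: P1E|exact: P2E].
rewrite -(Ex_pushforward m12 eP bf) Ex_fubini//.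
rewrite (Ex_pushforward m1 (fun A _ => P1E A)); last exact: bm_fubini.
congr Ex; apply/funext => w.
by rewrite (Ex_pushforward m2 (fun A _ => P2E A))//; exact: bm_section1.
Qed.

End independent_pair.

(** * Measurability for random closed sets *)

Section random_closed_set.
Context (R : realType) (d1 d2 : measure_display).
Context (T1 : measurableType d1) (T2 : measurableType d2).
Variable Z : T1 -> set R.
Hypothesis cZ : forall w, closed (Z w).
Hypothesis hitZ : forall G : set R, open G -> measurable [set w | Z w `&` G !=set0].

Lemma measurable_miss (p q : R) : measurable [set w | Z w `&` `]p, q[%classic = set0].
Proof.
rewrite (_ : [set w | _] = ~` [set w | Z w `&` `]p, q[%classic !=set0]).
  by apply: measurableC; apply: hitZ; exact: itv_open.
apply/seteqP; split => w /=; first by move=> -> [].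
by move=> h; apply: contrapT => hn; apply: h; apply/set0P; exact/eqP.
Qed.

Lemma measurable_gap_length (f : T2 -> R) : measurable_fun setT f ->
  measurable_fun setT (fun x : T1 * T2 => gap_length (gap_at (Z x.1) (f x.2))).
Proof.
move=> mf; apply: measurable_fun_rays => x.
have [x0|x0] := ltP x 0.
  rewrite (_ : _ @^-1` _ = setT) //; apply/seteqP; split => // w _ /=.
  by rewrite in_itv/= andbT (lt_le_trans x0)//; case/andP: (gap_length01 (Z w.1) (f w.2)).
rewrite (_ : _ @^-1` _ = \bigcup_(p : rat) \bigcup_(q : rat)
  (if x < Num.min (ratr q) 1 - Num.max (ratr p) 0 :> R then
   [set w | Z w `&` `]ratr p, ratr q[%classic = set0] `*`
   (f @^-1` (`]ratr p, ratr q[%classic `&` `[0, 1]%classic)) else set0)).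
  apply: bigcupT_measurable_rat => p; apply: bigcupT_measurable_rat => q.
  case: ifPn => // _; apply: measurableX; first exact: measurable_miss.
  by rewrite -[X in measurable X]setTI; apply: mf => //; exact: measurableI.
apply/seteqP; split => w.
  rewrite /= in_itv/= andbT => /(gap_length_gt_ratP _ x0 (@cZ _)) [u01 [p [q [pu uq xpq hf]]]].
  exists p => //; exists q => //; rewrite xpq; split => //=.
  by split; rewrite /= in_itv/= ?pu ?uq.
move=> [p _ [q _]]; case: ifPn => // xpq [/= hf []]; rewrite !in_itv/= andbT => /andP[pu uq] u01.
by apply/(gap_length_gt_ratP _ x0 (@cZ _)); split => //; exists p, q.
Qed.

Lemma measurable_gap_at (f g : T2 -> R) : measurable_fun setT f -> measurable_fun setT g ->
  measurable [set x : T1 * T2 | gap_at (Z x.1) (f x.2) (g x.2)].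
Proof.
move=> mf mg.
rewrite (_ : mkset _ = \bigcup_(p : rat) \bigcup_(q : rat)
   ([set w | Z w `&` `]ratr p, ratr q[%classic = set0] `*`
   ((f @^-1` (`]ratr p, ratr q[%classic `&` `[0, 1]%classic)) `&`
    (g @^-1` (`]ratr p, ratr q[%classic `&` `[0, 1]%classic))))).
  apply: bigcupT_measurable_rat => p; apply: bigcupT_measurable_rat => q.
  apply: measurableX; first exact: measurable_miss.
  apply: measurableI; rewrite -[X in measurable X]setTI; [apply: mf|apply: mg] => //; exact: measurableI.
apply/seteqP; split => w.
  move=> /(gap_at_ratP _ _ (@cZ _)) [u01 v01 [p [q [pu pv uq vq hf]]]].
  exists p => //; exists q => //; split => //=.
  by split; split; rewrite /= in_itv/= ?pu ?uq ?pv ?vq.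
move=> [p _ [q _]] [/= hf [[]]]; rewrite !in_itv/= => /andP[pu uq] u01 [/andP[pv vq] v01].
by apply/(gap_at_ratP _ _ (@cZ _)); split => //; exists p, q.
Qed.

(** The composition is a function of the finite table [M] of comparisons and class coincidences
    between sample points, and each entry of the table is an event. *)
Lemma measurable_sample_composition n (u : nat -> T2 -> R) (s : seq nat) :
  (forall i, measurable_fun setT (u i)) ->
  measurable [set x : T1 * T2 | sample_composition (Z x.1) n (fun i => u i x.2) = s].
Proof.
move=> mu.
pose M (x : T1 * T2) : {ffun 'I_n * 'I_n -> bool * bool} :=
  [ffun ij : 'I_n * 'I_n => (u ij.1 x.2 <= u ij.2 x.2, same_class (Z x.1) (fun i => u i x.2) ij.1 ij.2)].
pose F (m : {ffun 'I_n * 'I_n -> bool * bool}) : seq nat :=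
  [seq #|pred_of_set B| | B <- undup [seq [set j | (m (i, j)).2]%SET |
     i <- sort (fun i j : 'I_n => (m (i, j)).1) (enum 'I_n)]].
have FM x : sample_composition (Z x.1) n (fun i => u i x.2) = F (M x).
  rewrite /sample_composition /F; congr (map _ (undup _)).
  have -> : (fun i j : 'I_n => (M x (i, j)).1) = (fun i j : 'I_n => u i x.2 <= u j x.2).
    by apply/funext => i; apply/funext => j; rewrite ffunE.
  by apply/eq_in_map => i _; apply/setP => j; rewrite !finset.inE ffunE.
rewrite (_ : mkset _ = \bigcup_(m in [set m | F m = s]) \bigcap_(ij in setT) [set x | M x ij = m ij]).
  apply: fin_bigcup_measurable; first exact: finite_finset.
  move=> m _; apply: fin_bigcap_measurable; first exact: finite_finset.
  move=> [i j] _.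
  rewrite (_ : mkset _ = [set x | (u i x.2 <= u j x.2) = (m (i, j)).1] `&`
    [set x | same_class (Z x.1) (fun i => u i x.2) i j = (m (i, j)).2]); last first.
    apply/seteqP; split => x /=; rewrite ffunE/=; first by move=> <-.
    by case: (m (i, j)) => a b /= [-> ->].
  have m1 : measurable [set x : T1 * T2 | u i x.2 <= u j x.2].
    rewrite (_ : mkset _ = setT `*` [set w | u i w <= u j w]); last first.
      by apply/seteqP; split => x //= -[].
    apply: measurableX => //.
    have mB := measurable_funB (mu i) (mu j).
    rewrite (_ : mkset _ = (fun w => u i w - u j w) @^-1` `]-oo, 0]%classic).
      by rewrite -[X in measurable X]setTI; exact: mB.
    by apply/seteqP; split => w /=; rewrite in_itv/= subr_le0.
  have m2 : measurable [set x : T1 * T2 | same_class (Z x.1) (fun i => u i x.2) i j].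
    rewrite /same_class; case: (i == j) => /=; first by rewrite (_ : mkset _ = setT) //; apply/seteqP.
    rewrite (_ : mkset _ = [set x : T1 * T2 | gap_at (Z x.1) (u i x.2) (u j x.2)]).
      exact: measurable_gap_at.
    by apply/seteqP; split => x /=; rewrite asboolE.
  have bs (b : T1 * T2 -> bool) c : measurable [set x | b x] -> measurable [set x | b x = c].
    case: c => // mb; rewrite (_ : mkset _ = ~` [set x | b x]); first exact: measurableC.
    by apply/seteqP; split => x /=; [move=> ->|move/negP/negbTE].
  by apply: measurableI; exact: bs.
apply/seteqP; split => x /=; rewrite FM.
  by move=> h; exists (M x).
move=> [m /= <- h]; congr F; apply/ffunP => ij; exact: h.
Qed.

End random_closed_set.


Section hitting.
Context (R : realType).

Lemma dyadic_dense (a b : R) : 0 <= a -> a < b ->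
  exists N j : nat, a < j%:R / 2 ^+ N < b.
Proof.
move=> a0 ab; have ba : 0 < b - a by rewrite subr_gt0.
have iba : 0 <= (b - a)^-1 by rewrite invr_ge0 ltW.
pose N := Num.bound (b - a)^-1.
have N2 : (b - a)^-1 < 2 ^+ N.
  rewrite (lt_le_trans (archi_boundP iba))// -/N -natrX ler_nat.
  by rewrite ltnW// ltn_expl.
have p2 : 0 < 2 ^+ N :> R by rewrite exprn_gt0.
have /andP[t1 t2] := truncn_itv (mulr_ge0 a0 (ltW p2)).
exists N, (Num.truncn (a * 2 ^+ N)).+1; rewrite ltr_pdivlMr// t2/= ltr_pdivrMr//.
have : 1 < (b - a) * 2 ^+ N by rewrite -ltr_pdivrMl// mulr1.
rewrite mulrBl -natr1; lra.
Qed.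

Variables (x : R) (y : R -> R).
Hypothesis y_rc : forall t, 0 <= t -> y s @[s --> t^'+] --> y t.
Let Z := exp_neg_set (stationary_range x y).

Lemma exp_neg_set_ge0 z : Z z -> 0 <= z.
Proof. by case=> [->//|[w _ <-]]; exact: expR_ge0. Qed.

Lemma exp_neg_set_gt0 z : Z z -> 0 < z -> stationary_range x y (- ln z).
Proof.
case=> [->|[w sw <-] _]; first by rewrite ltxx.
by rewrite expRK opprK.
Qed.

Lemma exp_neg_set_time t : 0 <= t -> Z (expR (- (x + y t))).
Proof.
by move=> t0; right; exists (x + y t) => //; apply: subset_closure; exists t.
Qed.

Lemma continuous_expRN : continuous (fun w : R => expR (- w)).
Proof.
move=> w; have h1 : {for w, continuous (fun y : R => - y)} by apply: continuousN; exact: cvg_id.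
exact: (@continuous_comp _ _ _ _ (@expR R) w h1 (@continuous_expR R _)).
Qed.

Lemma closed_exp_neg_set : closed Z.
Proof.
move=> z cz; have [z0|z0|->] := ltgtP z 0; [|right|by left].
  have : nbhs z [set t : R | t < 0] by apply: open_nbhs_nbhs; split => //; exact: open_lt.
  by move=> /cz[t [/exp_neg_set_ge0 t0]] /=; rewrite ltNge t0.
exists (- ln z); last by rewrite opprK lnK// posrE.
suff : closure (stationary_range x y) (- ln z).
  by rewrite /stationary_range -(closure_id _).1//; exact: closed_closure.
move=> V nV.
have cl : {for z, continuous (fun t : R => - ln t)} by apply: continuousN; exact: continuous_ln.
have h1 : nbhs z (fun t : R => V (- ln t)) by exact: cl.
have h2 : nbhs z [set t : R | 0 < t] by apply: open_nbhs_nbhs; split => //; exact: open_gt.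
have [t [Zt [Vt t0]]] := cz _ (filterI h1 h2).
by exists (- ln t); split => //; exact: exp_neg_set_gt0.
Qed.

(** An open set meeting the closure meets the range itself, and right continuity moves the time to a
    dyadic one. The point 0, which always belongs to the set, is excluded from [G]. *)
Lemma exp_neg_set_hitP (G : set R) : open G -> ~ G 0 ->
  (Z `&` G !=set0) <-> exists N j : nat, G (expR (- (x + y (j%:R / 2 ^+ N)))).
Proof.
move=> oG nG0; split; last first.
  move=> [N [j h]]; exists (expR (- (x + y (j%:R / 2 ^+ N)))); split => //.
  by apply: exp_neg_set_time; rewrite divr_ge0 ?exprn_ge0.
move=> [z [[z0|[w sw wz]] Gz]]; first by move: Gz; rewrite z0.
have nG v : G (expR (- v)) -> nbhs v (fun v => G (expR (- v))).
  move=> Gv; apply: continuous_expRN; exact: open_nbhs_nbhs.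
have [_ [[t t0 <-] Gt]] := sw _ (nG w (ltac:(by rewrite wz))).
have cv : x + y s @[s --> t^'+] --> x + y t by apply: cvgD; [exact: cvg_cst|exact: y_rc].
have : \forall s \near t^'+, G (expR (- (x + y s))) by exact: cv (nG _ Gt).
move=> /nbhs_ballP[e /= e0 he].
have te : t < t + e by rewrite ltrDl.
have [N [j /andP[j1 j2]]] := dyadic_dense t0 te.
exists N, j; apply: he => //; rewrite /ball/= ltr_distlC j2 andbT (lt_trans _ j1)// ltrBlDr ltrDl//.
Qed.

End hitting.

Lemma measurable_hit (R : realType) d (T : measurableType d) (X : T -> R) (Y : R -> T -> R) (G : set R) :
  (forall w t, 0 <= t -> Y s w @[s --> t^'+] --> Y t w) ->
  measurable_fun setT X -> (forall t, 0 <= t -> measurable_fun setT (Y t)) -> open G ->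
  measurable [set w | exp_neg_set (stationary_range (X w) (fun t => Y t w)) `&` G !=set0].
Proof.
move=> rc mX mY oG; have [G0|G0] := pselect (G 0).
  rewrite (_ : mkset _ = setT)//; apply/seteqP; split => // w _; exists 0; split => //.
  by left.
rewrite (_ : mkset _ = \bigcup_N \bigcup_j
    ((fun w => expR (- (X w + Y (j%:R / 2 ^+ N) w))) @^-1` G)).
  apply: bigcupT_measurable => N; apply: bigcupT_measurable => j.
  rewrite -[X in measurable X]setTI.
  have mf : measurable_fun setT (fun w => expR (- (X w + Y (j%:R / 2 ^+ N) w))).
    apply: (measurableT_comp (@measurable_expR R)); apply: measurableT_comp => //.
    by apply: measurable_funD => //; apply: mY; rewrite divr_ge0 ?exprn_ge0.
  by apply: mf => //; exact: open_measurable.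
apply/seteqP; split => w.
  by move=> /(exp_neg_set_hitP _ (rc w) oG G0) [N [j h]]; exists N => //; exists j.
by move=> [N _ [j _ h]]; apply/(exp_neg_set_hitP _ (rc w) oG G0); exists N, j.
Qed.

(** * Counting and ranking the gaps of a closed set *)

Section counting_gaps.
Context (R : realType) (d : measure_display) (T : measurableType d).
Variables (P : probability T R) (U : T -> R) (Z : set R).
Hypothesis mU : measurable_fun setT U.
Hypothesis Umu : forall A : set R, measurable A -> A `<=` `[0, 1]%classic ->
  P (U @^-1` A) = lebesgue_measure A.
Hypothesis cZ : closed Z.
Local Notation gl u := (gap_length (gap_at Z u)).

(* The number of gaps whose length satisfies B: a uniform point falls into a gap with
   probability its length, and is weighted by the inverse of that length. *)
Definition gap_count (B : R -> bool) : R :=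
  Ex P (fun w => if B (gl (U w)) then (gl (U w))^-1 else 0).

Lemma gap_sample C : is_gap Z C -> measurable C /\ fine (P (U @^-1` C)) = gap_length C.
Proof.
move=> [u _ ->]; split; first exact: measurable_gap.
by rewrite Umu//; [exact: measurable_gap|exact: gap_sub01].
Qed.

Lemma gap_count_sum n (C : 'I_n -> set R) (x : R) : 0 < x -> (forall i, is_gap Z (C i)) ->
  (forall i, x < gap_length (C i)) ->
  let h := fun u => \sum_(i < n) \1_(C i) u * (gap_length (C i))^-1 in
  bm (fun w => h (U w)) /\ Ex P (fun w => h (U w)) = n%:R.
Proof.
move=> x0 gC xC h.
have b1 i : bm (fun w => \1_(C i) (U w) : R).
  apply: (bm_comp mU); apply: bm_indic; by have [] := gap_sample (gC i).
have b2 i : bm (fun w => \1_(C i) (U w) * (gap_length (C i))^-1).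
  by apply: bmM => //; exact: bm_cst.
split; first exact: bm_sum.
rewrite /h Ex_sum//; transitivity (\sum_(i < n) (1 : R)); last by rewrite sumr_const card_ord.
apply: eq_bigr => i _; rewrite ExZr//.
have [mC PC] := gap_sample (gC i).
have -> : Ex P (fun w => \1_(C i) (U w)) = fine (P (U @^-1` C i)).
  rewrite -Ex_indic; last by rewrite -[X in measurable X]setTI; exact: mU.
  by congr Ex; apply/funext => w; rewrite !indicE; congr (_ %:R); apply/idP/idP; rewrite !inE.
by rewrite PC divff// gt_eqF// (lt_trans x0).
Qed.

Lemma gap_family_val n (C : 'I_n -> set R) u : injective C -> (forall i, is_gap Z (C i)) ->
  \sum_(i < n) \1_(C i) u * (gap_length (C i))^-1 =
  if `[< exists i, C i u >] then (gl u)^-1 else 0.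
Proof.
move=> iC gC; case: asboolP => [[i Ciu]|h]; last first.
  apply: big1 => i _; rewrite indicE memNset ?mul0r// => Ciu; by apply: h; exists i.
have eqC j : C j u -> C j = gap_at Z u.
  by move=> Cju; have [v _ e] := gC j; move: Cju; rewrite e => /gap_at_eq.
rewrite (bigD1 i)//= indicE mem_set// mul1r big1 ?addr0; first by rewrite (eqC i).
move=> j ji; rewrite indicE memNset ?mul0r// => Cju; move/eqP : ji; apply; apply: iC.
by rewrite (eqC i)// (eqC j).
Qed.

(** At most 1/x gaps are longer than x, so a maximal family of gaps satisfying [B] exists. By
    maximality, the integrand of [gap_count] is the sum over the family of the indicator of C
    divided by the length of C. *)
Lemma gap_countP (B : R -> bool) (x : R) : 0 < x -> (forall l, B l -> x < l) ->
  exists n (C : 'I_n -> set R), [/\ injective C, forall i, is_gap Z (C i) /\ B (gap_length (C i)),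
    forall G, is_gap Z G -> B (gap_length G) -> exists i, G = C i & gap_count B = n%:R].
Proof.
move=> x0 Bx.
pose fam n := `[< exists C : 'I_n -> set R, injective C /\ forall i, is_gap Z (C i) /\ B (gap_length (C i)) >].
have fam0 : exists n, fam n.
  by exists 0%N; apply/asboolP; exists (fun _ => set0); split => [[]|[]].
have famle n : fam n -> (n <= Num.bound x^-1)%N.
  move=> /asboolP[C [iC gC]]; rewrite -(ler_nat R).
  have gC1 i := (gC i).1; have xC i : x < gap_length (C i) by apply: Bx; have [] := gC i.
  have [bh <-] := gap_count_sum x0 gC1 xC.
  rewrite (@le_trans _ _ x^-1)//; last by rewrite ltW// archi_boundP// invr_ge0 ltW.
  rewrite -[leRHS](Ex_cst P); apply: Ex_le => //; first exact: bm_cst.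
  move=> w; rewrite gap_family_val//; case: asboolP => [[i Ci]|_]; last by rewrite invr_ge0 ltW.
  have [v _ e] := gC1 i; have gv : gap_at Z v (U w) by rewrite -e.
  by rewrite lef_pV2 ?posrE -?(gap_at_eq gv) -?e ?(ltW (xC i))// (lt_trans x0).
pose n := ex_maxn fam0 famle.
have [/asboolP[C [iC gC]] nmax] : fam n /\ forall m, fam m -> (m <= n)%N.
  by rewrite /n; case: ex_maxnP.
have exC G : is_gap Z G -> B (gap_length G) -> exists i, G = C i.
  move=> gG BG; apply: contrapT => hn.
  have : fam n.+1.
    apply/asboolP; exists (fun i => oapp C G (unlift ord0 i)); split.
      move=> i j; case: unliftP => [i'|] ->; case: unliftP => [j'|] -> //=.
      - by move=> /iC ->.
      - by move=> e; case: hn; exists i'.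
      - by move=> e; case: hn; exists j'.
    by move=> i; case: unliftP => [i'|] _ /=; [exact: gC|].
  by move=> /nmax; rewrite ltnn.
exists n, C; split => //.
have gC1 i := (gC i).1; have xC i : x < gap_length (C i) by apply: Bx; have [] := gC i.
have [bh <-] := gap_count_sum x0 gC1 xC.
rewrite /gap_count; congr Ex; apply/funext => w; rewrite gap_family_val//.
case: asboolP => [[i Ci]|h].
  have [v _ e] := gC1 i; have gv : gap_at Z v (U w) by rewrite -e.
  by have [_] := gC i; rewrite e (gap_at_eq gv) => ->.
case: ifPn => // Bu; case: h.
have [u01 nZu] : 0 <= U w <= 1 /\ ~ Z (U w).
  apply: contrapT => hu; have := Bx _ Bu.
  by rewrite gap_length_notin// ltNge ltW.
have gg : is_gap Z (gap_at Z (U w)) by exists (U w) => //; split => //; rewrite /= in_itv.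
have [i e] := exC _ gg Bu; exists i; rewrite -e.
by apply/gap_at_refl.
Qed.

Lemma gap_count_ge (B : R -> bool) (x : R) n (C : 'I_n -> set R) : 0 < x -> (forall l, B l -> x < l) ->
  injective C -> (forall i, is_gap Z (C i) /\ B (gap_length (C i))) -> n%:R <= gap_count B.
Proof.
move=> x0 Bx iC gC; have [m [D [iD gD exD ->]]] := gap_countP x0 Bx.
have h i : exists j, C i = D j by apply: exD; have [] := gC i.
pose f i := projT1 (cid (h i)); have fE i : C i = D (f i) by exact: projT2 (cid (h i)).
have injf : injective f by move=> i j e; apply: iC; rewrite !fE e.
by rewrite ler_nat; have := leq_card f injf; rewrite !card_ord.
Qed.

Lemma gap_count_le (B B' : R -> bool) (x : R) : 0 < x -> (forall l, B l -> x < l) ->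
  (forall l, B' l -> x < l) -> (forall C, is_gap Z C -> B (gap_length C) -> B' (gap_length C)) ->
  gap_count B <= gap_count B'.
Proof.
move=> x0 Bx B'x BB'; have [m [D [iD gD exD ->]]] := gap_countP x0 Bx.
apply: (gap_count_ge x0 B'x iD) => i; have [h1 h2] := gD i; split => //; exact: BB'.
Qed.

Lemma finite_lower n (f : 'I_n -> R) x : (forall i, x < f i) -> exists2 y, x < y & forall i, y <= f i.
Proof.
elim: n f => [|n IHn] f hf; first by exists (x + 1); [rewrite ltrDl|move=> []].
have [y xy hy] := IHn (fun i => f (lift ord0 i)) (fun i => hf _).
exists (Num.min y (f ord0)); first by rewrite lt_min xy hf.
move=> i; rewrite ge_min; case: (unliftP ord0 i) => [j|] ->; first by rewrite hy.
by rewrite lexx orbT.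
Qed.

Let S k := [set x : R | exists C : 'I_k.+1 -> set R,
    [/\ injective C, forall i, is_gap Z (C i) & forall i, x <= gap_length (C i)]].

Let ubS k : has_ubound (S k).
Proof.
exists 1 => x [C [_ gC xC]]; apply: (le_trans (xC ord0)).
by have [u _ ->] := gC ord0; case/andP: (gap_length01 Z u).
Qed.

Lemma ranked_gap_ge0 k : 0 <= ranked_gap Z k.
Proof.
rewrite /ranked_gap -/(S k); have [->|/set0P[x [C [iC gC xC]]]] := eqVneq (S k) set0.
  by rewrite sup0.
apply: ub_le_sup => //; exists C; split => // i.
by have [u _ ->] := gC i; case/andP: (gap_length01 Z u).
Qed.

Lemma ranked_gap_le1 k : ranked_gap Z k <= 1.
Proof.
rewrite /ranked_gap -/(S k); have [->|/set0P ne] := eqVneq (S k) set0.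
  by rewrite sup0.
apply: ge_sup => // x [C [_ gC xC]]; apply: (le_trans (xC ord0)).
by have [u _ ->] := gC ord0; case/andP: (gap_length01 Z u).
Qed.

Lemma ranked_gap_gtP k x : 0 < x ->
  x < ranked_gap Z k <-> k.+1%:R <= gap_count (fun l => x < l).
Proof.
move=> x0; rewrite /ranked_gap -/(S k); split.
  have [->|/set0P ne] := eqVneq (S k) set0; first by rewrite sup0 ltNge ltW.
  move=> /(sup_gt ne)[y [C [iC gC yC]] xy].
  apply: (gap_count_ge x0 _ iC) => // i; split => //; exact: lt_le_trans (yC i).
have [n [D [iD gD exD ->]]] := @gap_countP (fun l => x < l) _ x0 (fun _ h => h).
rewrite ler_nat => kn.
have [y xy hy] := finite_lower (fun i => (gD (widen_ord kn i)).2).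
apply: (lt_le_trans xy); apply: ub_le_sup => //.
exists (fun i => D (widen_ord kn i)); split => //.
  by move=> i j /iD/(congr1 val)/= e; apply: val_inj.
by move=> i; have [] := gD (widen_ord kn i).
Qed.

Lemma ranked_gap_geP k v : 0 < v ->
  v <= ranked_gap Z k <-> k.+1%:R <= gap_count (fun l => v <= l).
Proof.
move=> v0; have v20 : 0 < v / 2 by rewrite divr_gt0.
have v2v : v / 2 < v by rewrite ltr_pdivrMr// ltr_pMr// ltr1n.
have gv2 l : v <= l -> v / 2 < l by exact: lt_le_trans.
split; last first.
  move=> h; rewrite leNgt; apply/negP => hlt.
  pose y := Num.max (ranked_gap Z k) (v / 2).
  have yv : y < v by rewrite gt_max hlt.
  have y0 : 0 < y by rewrite lt_max v20 orbT.
  have : y < ranked_gap Z k.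
    apply/ranked_gap_gtP => //; apply: (le_trans h).
    apply: (gap_count_le v20) => //.
    - by move=> l yl; apply: le_lt_trans yl; rewrite le_max lexx orbT.
    - by move=> C _ /=; exact: lt_le_trans.
  by rewrite ltNge le_max lexx.
move=> vr.
have [n [D [iD gD exD _]]] := @gap_countP (fun l => v / 2 < l) _ v20 (fun _ h => h).
(* Finitely many gaps exceed v/2, so some e > 0 separates v from the lengths below v. The value 1
   for the other gaps imposes no constraint of its own. *)
pose f i := if gap_length (D i) < v then v - gap_length (D i) else 1.
have f0 i : 0 < f i by rewrite /f; case: ifPn => //; rewrite subr_gt0.
have [e e0 he] := finite_lower f0.
pose y := Num.max (v / 2) (v - e).
have yv : y < v by rewrite gt_max v2v ltrBlDr ltrDl.
have y0 : 0 < y by rewrite lt_max v20.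
have := (ranked_gap_gtP k y0).1 (lt_le_trans yv vr).
move=> h; apply: (le_trans h); apply: (gap_count_le v20) => //.
  by move=> l yl; apply: le_lt_trans yl; rewrite le_max lexx.
move=> C gC /= yC; rewrite leNgt; apply/negP => Cv.
have v2y : v / 2 <= y by rewrite le_max lexx.
have [i Ci] := exD C gC (le_lt_trans v2y yC).
have := he i; rewrite /f -Ci Cv lerBrDr -lerBrDl => h2.
by move: yC; rewrite ltNge le_max h2 orbT.
Qed.

Hypothesis mgl : measurable_fun setT (fun w => gl (U w)).

Lemma gap_count_split v : 0 < v ->
  gap_count (fun l => v <= l) = gap_count (fun l => v < l) + gap_count (fun l => l == v).
Proof.
move=> v0.
have bB (B : R -> bool) : measurable [set l | B l] -> (forall l, B l -> v <= l) ->
    bm (fun w => if B (gl (U w)) then (gl (U w))^-1 else 0).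
  move=> mB Bv; apply: (bm_comp mgl (f := fun l => if B l then l^-1 else 0)).
  have -> : (fun l => if B l then l^-1 else 0) = (fun l => \1_[set l | B l] l * (Num.max l v)^-1).
    apply/funext => l; rewrite indicE; case: ifPn => Bl; last by rewrite memNset ?mul0r//; exact/negP.
    by rewrite mem_set// mul1r (max_idPl (Bv _ Bl)).
  apply: bmM; first exact: bm_indic.
  split; last first.
    exists v^-1 => l; rewrite ger0_norm ?invr_ge0 ?le_max ?(ltW v0) ?orbT//.
    by rewrite lef_pV2 ?posrE ?lt_max ?v0 ?orbT// le_max lexx orbT.
  apply: continuous_measurable_fun => l.
  apply: cvgV; first by rewrite gt_eqF// lt_max v0 orbT.
  have h : continuous (fun l : R => Num.max l v).
    move=> z; apply: continuous_max; [exact: cvg_id|exact: cvg_cst].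
  exact: h.
rewrite /gap_count -ExD.
- congr Ex; apply/funext => w; case: ltgtP => //; rewrite ?addr0 ?add0r//.
- by apply: bB => [|l /ltW//]; rewrite (_ : mkset _ = `]v, +oo[%classic)//; apply/seteqP; split => l /=; rewrite in_itv/= andbT.
- by apply: (bB (fun l => l == v)) => [|l /eqP->//]; rewrite (_ : mkset _ = [set v])//; apply/seteqP; split => l /= /eqP.
Qed.

Lemma gap_count_nat (B : R -> bool) (x : R) : 0 < x -> (forall l, B l -> x < l) ->
  exists n : nat, gap_count B = n%:R.
Proof. by move=> x0 Bx; have [n [D [_ _ _ h]]] := gap_countP x0 Bx; exists n. Qed.

(* With no tie at rank k the level set {gl = v} is one gap. *)
Lemma ranked_gap_level k : (forall j, ranked_gap Z j = ranked_gap Z j.+1 -> ranked_gap Z j = 0) ->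
  0 < ranked_gap Z k -> gap_count (fun l => l == ranked_gap Z k) = 1.
Proof.
move=> notie v0; set v := ranked_gap Z k in v0 *.
have v20 : 0 < v / 2 by rewrite divr_gt0.
have v2v : v / 2 < v by rewrite ltr_pdivrMr// ltr_pMr// ltr1n.
have [a ha] := gap_count_nat v20 (fun l (h : v <= l) => lt_le_trans v2v h).
have [b hb] := gap_count_nat v0 (fun l (h : v < l) => h).
have h1 : k.+1%:R <= gap_count (fun l => v <= l) by apply/ranked_gap_geP.
have h2 : ~ (k.+2%:R <= gap_count (fun l => v <= l)).
  move=> /(ranked_gap_geP k.+1 v0) h.
  have : v = ranked_gap Z k.+1.
    apply/eqP; rewrite eq_le h/= leNgt; apply/negP => lt.
    have k1 : 0 < ranked_gap Z k.+1 by exact: lt_trans lt.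
    have := (ranked_gap_gtP k.+1 v0).1 lt => e.
    have : v < ranked_gap Z k by apply/ranked_gap_gtP => //; apply: le_trans e; rewrite ler_nat.
    by rewrite ltxx.
  by move=> /notie e; move: v0; rewrite /v e ltxx.
have h3 : ~ (k.+1%:R <= gap_count (fun l => v < l)).
  by move=> /(ranked_gap_gtP k v0); rewrite ltxx.
have h4 : k%:R <= gap_count (fun l => v < l).
  have [k0|k0] := posnP k.
    by rewrite k0; have [c ->] := gap_count_nat v0 (fun l (h : v < l) => h); rewrite ler_nat.
  have [k' kE] : exists k', k = k'.+1 by exists k.-1; rewrite prednK.
  rewrite kE; apply/(ranked_gap_gtP k' v0); rewrite lt_neqAle; apply/andP; split.
    apply/eqP => e; have e' := notie k'; rewrite -kE in e'.
    by move: v0; rewrite e (e' (esym e)) ltxx.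
  by apply/(ranked_gap_geP k' v0); apply: le_trans h1; rewrite ler_nat kE.
have := gap_count_split v0; rewrite ha hb => e.
move: h1 h2 h3 h4; rewrite ha hb !ler_nat => h1 h2 h3 h4.
have ab : a = b.+1 by lia.
by move: e; rewrite ab -natr1 => /addrI <-.
Qed.

Lemma ranked_gap_tie k : 0 < ranked_gap Z k -> ranked_gap Z k = ranked_gap Z k.+1 ->
  2%:R <= gap_count (fun l => l == ranked_gap Z k).
Proof.
move=> v0 e; set v := ranked_gap Z k in v0 e *.
have v20 : 0 < v / 2 by rewrite divr_gt0.
have v2v : v / 2 < v by rewrite ltr_pdivrMr// ltr_pMr// ltr1n.
have [a ha] := gap_count_nat v20 (fun l (h : v <= l) => lt_le_trans v2v h).
have [b hb] := gap_count_nat v0 (fun l (h : v < l) => h).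
have h1 : k.+2%:R <= gap_count (fun l => v <= l) by apply/ranked_gap_geP => //; rewrite -e.
have h3 : ~ (k.+1%:R <= gap_count (fun l => v < l)).
  by move=> /(ranked_gap_gtP k v0); rewrite ltxx.
have := gap_count_split v0; rewrite ha hb => e'.
move: h1 h3; rewrite ha hb !ler_nat => h1 h3.
have [c hc] : exists c : nat, gap_count (fun l => l == v) = c%:R.
  by apply: (gap_count_nat v20) => l /eqP ->.
move: e'; rewrite hc -natrD => /eqP; rewrite eqr_nat => /eqP e'.
by rewrite ler_nat; lia.
Qed.

(** The rank, counted from 0, is the number of strictly longer gaps. *)
Lemma gap_length_ranked u : 0 < gl u -> exists k, ranked_gap Z k = gl u.
Proof.
move=> v0; set v := gl u in v0 *.
have v20 : 0 < v / 2 by rewrite divr_gt0.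
have v2v : v / 2 < v by rewrite ltr_pdivrMr// ltr_pMr// ltr1n.
have [b hb] := gap_count_nat v0 (fun l (h : v < l) => h).
exists b; apply/eqP; rewrite eq_le; apply/andP; split.
  rewrite leNgt; apply/negP => /(ranked_gap_gtP b v0); rewrite hb ler_nat; lia.
apply/ranked_gap_geP => //; rewrite gap_count_split// hb -natr1 lerD2l.
apply: (@gap_count_ge _ (v / 2) 1%N (fun _ => gap_at Z u)) => //.
- by move=> l /eqP ->.
- by move=> i j _; rewrite !ord1.
- move=> _; split => //; exists u => //.
  apply: contrapT => hu; move: v0; rewrite /v gap_length_notin ?ltxx// => -[h1 h2].
Qed.

End counting_gaps.

Section uniform_variable.
Context (R : realType) (d : measure_display) (T : measurableType d) (P : probability T R).

Definition is_uniform (U : T -> R) : Prop := measurable_fun setT U /\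
  forall A : set R, measurable A -> P (U @^-1` A) = lebesgue_measure (A `&` `[0, 1]%classic).

Lemma is_uniform_prob (U : {RV P >-> R}) :
  (forall A : set R, measurable A -> distribution P U A = uniform_prob (@ltr01 R) A) ->
  is_uniform U.
Proof.
move=> h; split; first exact: measurable_funPT.
move=> A mA; rewrite -[LHS]/(distribution P U A) h// /uniform_prob.
transitivity (\int[lebesgue_measure]_(x in A) (\1_(`[0, 1]%classic : set R) x)%:E)%E.
  apply: eq_integral => x _; rewrite /uniform_pdf indicE subr0 invr1.
  by congr EFin; case: ifPn => h1; [rewrite mem_set|rewrite memNset//= in_itv; apply/negP].
by rewrite integral_indic// setIC.
Qed.

Variable U : T -> R.
Hypothesis uU : is_uniform U.

Lemma is_uniform_sub (A : set R) : measurable A -> A `<=` `[0, 1]%classic ->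
  P (U @^-1` A) = lebesgue_measure A.
Proof. by move=> mA sA; rewrite uU.2// setIidl. Qed.

Lemma is_uniform_gt (t : R) : 0 <= t <= 1 -> P (U @^-1` `]t, +oo[%classic) = (1 - t)%:E.
Proof.
move=> /andP[t0 t1]; rewrite uU.2//.
have -> : `]t, +oo[%classic `&` `[0, 1]%classic = `]t, 1]%classic :> set R.
  apply/seteqP; split => x /=; rewrite !in_itv/= ?andbT.
    by move=> [-> /andP[_ ->]].
  by move=> /andP[tx ->]; rewrite tx (le_trans t0)// ltW.
rewrite lebesgue_measure_itv/= lte_fin; case: ifPn => [_|]; first by rewrite EFinN -EFinB.
by rewrite -leNgt => t1'; rewrite (le_anti (introT andP (conj t1 t1'))) subrr.
Qed.

Lemma is_uniform_itv (a b : R) : 0 <= a -> a <= b -> b <= 1 ->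
  Ex P (fun w => \1_(`]a, b]%classic : set R) (U w)) = b - a.
Proof.
move=> a0 ab b1.
have -> : (fun w => \1_(`]a, b]%classic : set R) (U w)) = (\1_(U @^-1` `]a, b]%classic) : T -> R).
  by apply/funext => w; rewrite !indicE; congr ((nat_of_bool _)%:R); apply/idP/idP; rewrite !inE.
rewrite Ex_indic; last by rewrite -[X in measurable X]setTI; exact: uU.1.
rewrite is_uniform_sub//; last first.
  by move=> x /=; rewrite !in_itv/= => /andP[h1 h2]; rewrite (le_trans a0 (ltW h1)) (le_trans h2).
rewrite lebesgue_measure_itv/= lte_fin; case: ifPn => [_|]; first by rewrite EFinN -EFinB.
by rewrite -leNgt => t1'; rewrite (le_anti (introT andP (conj ab t1'))) subrr.
Qed.

Lemma is_uniform_point (c : R) : P [set w | U w = c] = 0%E.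
Proof.
rewrite -[LHS]/(P (U @^-1` [set c])) uU.2//; apply: (@subset_measure0 _ _ _ (@lebesgue_measure R) _ [set c]) => //.
- exact: measurableI.
- by have := lebesgue_measure_set1 c.
Qed.

Lemma is_uniform_01 : P [set w | ~ (0 < U w < 1)] = 0%E.
Proof.
have -> : [set w | ~ (0 < U w < 1)] = U @^-1` (~` `]0, 1[%classic).
  by apply/seteqP; split => w /=; rewrite in_itv.
rewrite uU.2; last exact: measurableC.
have sub : ~` `]0, 1[%classic `&` `[0, 1]%classic `<=` [set 0] `|` [set (1 : R)].
  move=> x [/negP]; rewrite /= !in_itv/= negb_and -!leNgt => /orP[h|h] /andP[h1 h2].
    by left; apply/eqP; rewrite eq_le h h1.
  by right; apply/eqP; rewrite eq_le h h2.
apply: (@subset_measure0 _ _ _ (@lebesgue_measure R) _ ([set 0] `|` [set 1])) => //.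
- by apply: measurableI => //; exact: measurableC.
- exact: measurableU.
- by apply: null_set_setU => //; [have := lebesgue_measure_set1 (0 : R)|have := lebesgue_measure_set1 (1 : R)].
Qed.

End uniform_variable.

Lemma indic_ray_le (R : realType) (x z : R) : \1_(`]-oo, x]%classic) z = (z <= x)%R%:R :> R.
Proof. by rewrite indicE; congr ((nat_of_bool _)%:R); apply/idP/idP; rewrite inE/= in_itv. Qed.

Lemma indic_ray_gt (R : realType) (x z : R) : \1_(`]x, +oo[%classic) z = (x < z)%R%:R :> R.
Proof. by rewrite indicE; congr ((nat_of_bool _)%:R); apply/idP/idP; rewrite inE/= in_itv/= andbT. Qed.

(** * Beta laws with real parameters: moments, determinacy, quantiles *)

Section beta_law.
Context (R : realType) (a b : R).
Hypotheses (a0 : 0 < a) (b0 : 0 < b).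
Local Notation D := (`]0, 1[%classic : set R).
Local Notation mu := (@lebesgue_measure R).

Let rho (x : R) := beta_weight a b x / betaI a b.

Let rho_ge0 x : D x -> 0 <= rho x.
Proof. by move=> _; rewrite /rho divr_ge0 ?beta_weight_ge0// ltW// betaI_gt0. Qed.

Let irho : mu.-integrable D (EFin \o rho).
Proof.
have := @integrableZl _ _ _ mu D (measurable_itv _) (betaI a b)^-1 _ (beta_weight_integrable a0 b0).
by apply: eq_integrable => // x _ /=; rewrite /rho mulrC EFinM.
Qed.

Definition beta_functional (g : R -> R) : R := \int[mu]_(x in D) (g x * rho x).

Lemma bfunctional_beta : bfunctional beta_functional.
Proof. exact: bfunctional_dens. Qed.

Lemma beta_functional_moment m k :
  beta_functional (fun x => clamp x ^+ m * (1 - clamp x) ^+ k) = bmom a b m k.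
Proof.
have B0 := betaI_gt0 a0 b0.
have am : 0 < a + m%:R by rewrite ltr_wpDr.
have bk : 0 < b + k%:R by rewrite ltr_wpDr.
apply: (@mulfI _ (betaI a b)); first by rewrite gt_eqF.
rewrite -betaI_moment// /beta_functional -RintegralZl//; last first.
  apply: dens_integrable => //; apply: bmM; apply: bmX.
    by apply: bm01; [exact: measurable_clamp|exact: clamp01].
  by apply: bmB; [exact: bm_cst|apply: bm01; [exact: measurable_clamp|exact: clamp01]].
rewrite [RHS]/betaI; apply: eq_Rintegral => x; rewrite inE => Dx.
have /andP[x0 x1] : 0 < x < 1 by move: Dx; rewrite /= in_itv.
rewrite clamp_id ?(ltW x0) ?(ltW x1)// /rho /beta_weight.
have y0 : 0 < 1 - x by rewrite subr_gt0.
have -> : a + m%:R - 1 = m%:R + (a - 1) by ring.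
have -> : b + k%:R - 1 = k%:R + (b - 1) by ring.
have pD (z : R) (n : nat) e : 0 < z -> z `^ (n%:R + e) = z ^+ n * z `^ e.
  by move=> z0; rewrite powRD ?powR_mulrn ?ltW//; apply/implyP => _; rewrite gt_eqF.
rewrite !pD//.
move: (x ^+ m) ((1 - x) ^+ k) (x `^ (a - 1)) ((1 - x) `^ (b - 1)) (betaI a b) B0 => p q X Y B B0.
field.
by rewrite gt_eqF.
Qed.

Lemma beta_functional1 : beta_functional (fun _ => 1) = 1.
Proof.
rewrite -[RHS](bmom00 a b) -beta_functional_moment; congr beta_functional.
by apply/funext => x; rewrite !expr0 mulr1.
Qed.

Section law.
Context (d : measure_display) (T : measurableType d) (P : probability T R).

Lemma has_beta_law_Ex f g : has_beta_law P f a b -> bm g ->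
  Ex P (fun w => g (f w)) = beta_functional g.
Proof.
move=> [mf hf] bg; apply: dens_Ex => // A mA; rewrite hf//.
Qed.

Lemma has_beta_law_indic (f : T -> R) : measurable_fun setT f ->
  (forall A : set R, measurable A -> Ex P (fun w => 1 * \1_A (f w)) = beta_functional \1_A) ->
  has_beta_law P f a b.
Proof.
move=> mf h; split => // A mA.
have mfA : measurable (f @^-1` A) by rewrite -[X in measurable X]setTI; exact: mf.
rewrite -(fineP P mfA) -Ex_indic//.
rewrite -[RHS](@dens_indic _ D rho (measurable_itv _) irho A mA); congr EFin.
rewrite -[RHS]/(beta_functional \1_A) -h//; congr Ex; apply/funext => w.
by rewrite mul1r !indicE; congr ((nat_of_bool _)%:R); apply/idP/idP; rewrite !inE.
Qed.

Lemma has_beta_law_moments (f : T -> R) : measurable_fun setT f -> (forall w, 0 <= f w <= 1) ->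
  (forall n, Ex P (fun w => f w ^+ n) = bmom a b n 0) -> has_beta_law P f a b.
Proof.
move=> mf f01 hm.
have fI := bfunctional_Ex P (bm_cst 1) (fun _ => ler01) mf.
have main g : bm g -> Ex P (fun w => 1 * g (f w)) = beta_functional (g \o @clamp R).
  move=> bg; rewrite -(bfunctional_eq_moments fI bfunctional_beta) => [|n|//].
    by congr Ex; apply/funext => w; rewrite /= clamp_id.
  transitivity (beta_functional (fun x => clamp x ^+ n * (1 - clamp x) ^+ 0)).
    rewrite beta_functional_moment -hm; congr Ex; apply/funext => w /=.
    by rewrite mul1r clamp_id.
  by congr beta_functional; apply/funext => x; rewrite expr0 mulr1.
apply: has_beta_law_indic => // A mA; rewrite main; last exact: bm_indic.
apply: eq_Rintegral => x; rewrite inE /= in_itv/= => /andP[x0 x1].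
by rewrite clamp_id// !ltW.
Qed.

End law.

Let F x := beta_functional \1_(`]-oo, x]%classic).

Let F_le x y : x <= y -> F x <= F y.
Proof.
move=> xy; have [ID IZ I0 _] := bfunctional_beta.
rewrite -subr_ge0 /F -mulN1r -IZ; last exact: bm_indic.
rewrite -ID; [|exact: bm_indic|by apply: bmZ; exact: bm_indic].
apply: I0 => [|z]; first by apply: bmD; [|apply: bmZ]; exact: bm_indic.
rewrite mulN1r subr_ge0 !indic_ray_le ler_nat; case: (leP z x) => // h.
by rewrite (le_trans h xy).
Qed.

Let F01 x : 0 <= F x <= 1.
Proof.
have [ID IZ I0 _] := bfunctional_beta; apply/andP; split.
  by apply: I0 => [|z]; [exact: bm_indic|rewrite indicE ler0n].
rewrite -beta_functional1 -subr_ge0 /F -mulN1r -IZ; last exact: bm_indic.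
rewrite -ID; [|exact: bm_cst|by apply: bmZ; exact: bm_indic].
apply: I0 => [|z]; first by apply: bmD; [exact: bm_cst|apply: bmZ; exact: bm_indic].
by rewrite mulN1r subr_ge0 indicE lern1 leq_b1.
Qed.

Let F_rc x : F (x + n.+1%:R^-1) @[n --> \oo] --> F x.
Proof.
have [_ _ _ Il] := bfunctional_beta.
apply: (Il _ _ 1); [by move=> n; exact: bm_indic|exact: bm_indic| |].
  by move=> n z; rewrite indicE ger0_norm ?ler0n// lern1 leq_b1.
move=> z; have [zx|xz] := leP z x.
  apply: cvg_near_cst; apply: nearW => n; rewrite !indic_ray_le zx.
  by rewrite (le_trans zx)// lerDl invr_ge0.
apply: cvg_near_cst; have zx0 : 0 < z - x by rewrite subr_gt0.
have /cvgrPdist_lt/(_ _ zx0) := @cvg_harmonic R; apply: filterS => n.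
rewrite /= sub0r normrN ger0_norm ?invr_ge0// => h.
by rewrite !indic_ray_le [z <= x]leNgt xz leNgt -ltrBrDl h.
Qed.

(** The quantile at level u is the supremum of this set. Restricting to [0,1] and always admitting 0
    keeps the set bounded and nonempty for every real u. *)
Let S u := [set x | 0 <= x <= 1 /\ (x = 0 \/ F x < u)].
Let q u := sup (S u).

Let S0 u : S u 0. Proof. by split; [rewrite lexx ler01|left]. Qed.
Let ubS u : has_ubound (S u). Proof. by exists 1 => x [/andP[]]. Qed.

Let q01 u : 0 <= q u <= 1.
Proof.
apply/andP; split; first exact: ub_le_sup.
by apply: ge_sup; [exists 0|move=> x [/andP[]]].
Qed.

Let q_gt x u : 0 <= x < 1 -> x < q u <-> F x < u.
Proof.
move=> /andP[x0 x1]; split.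
  have ne : S u !=set0 by exists 0.
  move=> /(sup_gt ne)[y [_ [->|]]]; first by rewrite ltNge x0.
  move=> h xy; exact: le_lt_trans (F_le (ltW xy)) h.
move=> Fu.
have h1 : \forall n \near \oo, F (x + n.+1%:R^-1) < u by apply: (cvgr_lt _ (@F_rc x)).
have h2 : \forall n \near \oo, n.+1%:R^-1 < 1 - x.
  have x10 : 0 < 1 - x by rewrite subr_gt0.
  have /cvgrPdist_lt/(_ _ x10) := @cvg_harmonic R; apply: filterS => n.
  by rewrite /= sub0r normrN ger0_norm ?invr_ge0.
have [N _ /(_ N (leqnn N)) [h3 h4]] := filterI h1 h2.
have iN : 0 < N.+1%:R^-1 :> R by rewrite invr_gt0.
rewrite (@lt_le_trans _ _ (x + N.+1%:R^-1)) ?ltrDl//.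
apply: ub_le_sup => //; split; last by right.
by rewrite addr_ge0 ?(ltW iN)//= -lerBrDl ltW.
Qed.

(** This supplies the sticks as functions of uniform variables. One quantile function serves on all
    probability spaces, so it can be chosen before the variables. *)
Lemma beta_quantile : exists q : R -> R, [/\ measurable_fun setT q, forall u, 0 <= q u <= 1 &
  forall (d : measure_display) (T : measurableType d) (P : probability T R) (U : T -> R),
    is_uniform P U -> has_beta_law P (fun w => q (U w)) a b].
Proof.
have qray x : q @^-1` `]x, +oo[%classic =
    if x < 0 then setT else if x < 1 then `]F x, +oo[%classic else set0.
  apply/seteqP; split => u /=; rewrite in_itv/= andbT.
    move=> xq; case: ltP => // x0; case: ltP => x1.
      by rewrite /= in_itv/= andbT; apply/q_gt => //; rewrite x0 x1.
    by have /andP[_ q1] := q01 u; move: (le_lt_trans x1 xq); rewrite ltNge q1.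
  case: ltP => x0; first by move=> _; case/andP : (q01 u) => h _; exact: lt_le_trans h.
  case: ltP => x1 //=; rewrite in_itv/= andbT => h; apply/q_gt => //; by rewrite x0 x1.
have mq : measurable_fun setT q.
  apply: measurable_fun_rays => x; rewrite qray; case: ifP => // _; case: ifP => // _.
exists q; split => // d T P U uU.
have mqU : measurable_fun setT (fun w => q (U w)) by apply: (measurableT_comp mq); exact: uU.1.
apply: has_beta_law_indic => //.
have fI := bfunctional_Ex P (bm_cst 1) (fun _ => ler01) mqU.
have [ID IZ I0 _] := bfunctional_beta.
apply: (bfunctional_eq_indic fI bfunctional_beta).
  by rewrite beta_functional1 mul1r Ex_cst.
move=> t.
have -> : Ex P (fun w => 1 * \1_(`]t, +oo[%classic) (q (U w))) =
    fine (P (U @^-1` (q @^-1` `]t, +oo[%classic))).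
  rewrite -Ex_indic; last first.
    rewrite -[X in measurable X]setTI; apply: uU.1 => //.
    by rewrite -[X in measurable X]setTI; exact: mq.
  congr Ex; apply/funext => w; rewrite mul1r.
  by [].
rewrite qray; case: ltP => t0.
  transitivity (1 : R); first exact: (congr1 fine (probability_setT P)).
  rewrite -beta_functional1; apply: eq_Rintegral => x.
  by rewrite inE /= in_itv/= => /andP[x0 x1]; rewrite indic_ray_gt (lt_trans t0 x0).
case: ltP => t1; last first.
  rewrite preimage_set0 measure0/=.
  transitivity (beta_functional (fun x => 0 * 1)).
    by rewrite IZ ?mul0r//; exact: bm_cst.
  apply: eq_Rintegral => x; rewrite inE /= in_itv/= => /andP[x0 x1]; rewrite indic_ray_gt.
  by rewrite ltNge (le_trans (ltW x1) t1)/= !mul0r.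
rewrite (is_uniform_gt uU)//=; apply/eqP; rewrite subr_eq; apply/eqP.
rewrite /F -ID; [|exact: bm_indic|exact: bm_indic].
rewrite -beta_functional1; congr beta_functional; apply/funext => x.
rewrite indic_ray_le indic_ray_gt; case: (leP x t) => xt; rewrite ?addr0 ?add0r//.
Qed.

End beta_law.

Section generic_lemmas.
Context (R : realType).

Lemma Ex_same_law d d' (T : measurableType d) (T' : measurableType d') (P : probability T R)
    (P' : probability T' R) (f : T -> R) (f' : T' -> R) g :
  measurable_fun setT f -> measurable_fun setT f' ->
  (forall A : set R, measurable A -> P (f @^-1` A) = P' (f' @^-1` A)) -> bm g ->
  Ex P (fun w => g (f w)) = Ex P' (fun w => g (f' w)).
Proof.
move=> mf mf' h bg; have [Q QE] := distribution_exists P mf.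
rewrite -(Ex_pushforward mf (fun A _ => QE A) bg).
by apply: Ex_pushforward => // A mA; rewrite QE h.
Qed.

(** The lower bound [k0] lets the number of cells grow fast enough for the grid to reach arbitrarily
    late times. *)
Lemma diagonal_choice (a : nat -> nat -> R) (l : nat -> R) (L : R) (k0 : nat -> nat) :
  (forall N, a N K @[K --> \oo] --> l N) -> l N @[N --> \oo] --> L ->
  exists K : nat -> nat, (forall N, (k0 N <= K N)%N) /\ a N (K N) @[N --> \oo] --> L.
Proof.
move=> al lL.
have h N : exists K, (k0 N <= K)%N /\ `|l N - a N K| < N.+1%:R^-1.
  have e0 : 0 < N.+1%:R^-1 :> R by rewrite invr_gt0.
  have /cvgrPdist_lt/(_ _ e0)[M _ hM] := al N.
  exists (maxn (k0 N) M); split; first exact: leq_maxl.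
  by apply: hM; exact: leq_maxr.
pose K N := projT1 (cid (h N)); exists K.
have hK N : (k0 N <= K N)%N /\ `|l N - a N (K N)| < N.+1%:R^-1 := projT2 (cid (h N)).
split; first by move=> N; have [] := hK N.
have d0 : l N - a N (K N) @[N --> \oo] --> (0 : R).
  apply/cvgrPdist_lt => e e0; have /cvgrPdist_lt/(_ _ e0) := @cvg_harmonic R.
  apply: filterS => N; rewrite !sub0r !normrN => h1; apply: le_lt_trans h1.
  rewrite /harmonic /= [leRHS]ger0_norm ?invr_ge0//.
  by have [_ /ltW] := hK N.
have : l N - (l N - a N (K N)) @[N --> \oo] --> L - 0 by exact: (cvgB lL d0).
by rewrite subr0; under eq_fun do rewrite opprB addrC subrK.
Qed.

Lemma onem_expRN_bounds (y : R) : 0 <= y -> y - y ^+ 2 <= 1 - expR (- y) <= y.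
Proof.
move=> y0; apply/andP; split; last by have := expR_ge1Dx (- y); lra.
have y1 : 0 < 1 + y by lra.
have h : expR (- y) <= (1 + y)^-1.
  by rewrite expRN lef_pV2 ?posrE ?expR_gt0//; exact: expR_ge1Dx.
have : (1 + y)^-1 <= 1 - y + y ^+ 2.
  rewrite -[leLHS]mul1r ler_pdivrMr//.
  have -> : (1 - y + y ^+ 2) * (1 + y) = 1 + y ^+ 3 by ring.
  by rewrite lerDl exprn_ge0.
by move=> h2; lra.
Qed.

Lemma cvg_onem_expRN (x : R) (h : nat -> R) : 0 <= x -> (forall n, 0 < h n) ->
  h n @[n --> \oo] --> (0 : R) -> (1 - expR (- (x * h n))) / h n @[n --> \oo] --> x.
Proof.
move=> x0 h0 hc.
have lo : x - x ^+ 2 * h n @[n --> \oo] --> x.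
  rewrite -[X in _ --> X]subr0 -[X in _ - X](mulr0 (x ^+ 2)).
  by apply: cvgB; [exact: cvg_cst|apply: cvgM; [exact: cvg_cst|]].
apply: (squeeze_cvgr _ lo (cvg_cst x)); apply: nearW => n.
have /andP[k1 k2] := onem_expRN_bounds (mulr_ge0 x0 (ltW (h0 n))).
rewrite ler_pdivlMr// ler_pdivrMr// k2 andbT (le_trans _ k1)//.
rewrite mulrBl (_ : x ^+ 2 * h n * h n = (x * h n) ^+ 2)//; ring.
Qed.

Lemma cvg_half_pow : (2 ^+ N)^-1 @[N --> \oo] --> (0 : R).
Proof.
under eq_fun do rewrite -exprVn.
by apply: cvg_expr; rewrite ger0_norm ?invr_ge0// invf_lt1// ltr1n.
Qed.

Lemma levyPhi_gt0 (alpha theta : R) n : 0 <= alpha < 1 -> 0 < theta -> (0 < n)%N ->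
  0 < levyPhi alpha theta n.
Proof.
move=> /andP[a0 a1] t0 n0; rewrite /levyPhi divr_gt0 ?mulr_gt0 ?ltr0n// rf_gt0//; lra.
Qed.

Lemma levyPhi0 (alpha theta : R) : levyPhi alpha theta 0 = 0.
Proof. by rewrite /levyPhi mul0r mul0r. Qed.

(** With [levyDS], this says that [levyD] obeys the difference relations satisfied by the moments of
    one increment. The rates as the mesh tends to 0 therefore follow from the Laplace transform
    alone. *)
Lemma levyD1 (alpha theta : R) k : 0 <= alpha < 1 -> 0 < theta ->
  levyD alpha theta k 1 = levyPhi alpha theta k.+1 - levyPhi alpha theta k.
Proof.
move=> /andP[a0 a1] t0; rewrite /levyD /levyPhi addn1 /= !rfS rf0 -natr1.
have c0 : 0 < 1 - alpha + theta by lra.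
have h1 := rf_neq0 k c0.
have h2 : 1 - alpha + theta + k%:R != 0 by rewrite gt_eqF// ltr_wpDr.
by field; rewrite h1 h2.
Qed.

Lemma levyDS (alpha theta : R) k m : 0 <= alpha < 1 -> 0 < theta -> (0 < m)%N ->
  levyD alpha theta k m.+1 = levyD alpha theta k m - levyD alpha theta k.+1 m.
Proof.
move=> /andP[a0 a1] t0; case: m => // m _; rewrite /levyD /= addSn !addnS !rfS -!natr1.
have c0 : 0 < 1 - alpha + theta by lra.
have h1 := rf_neq0 (k + m) c0.
have h2 : 1 - alpha + theta + (k + m)%:R != 0 by rewrite gt_eqF// ltr_wpDr.
have h3 : 1 - alpha + theta + ((k + m)%:R + 1) != 0.
  by rewrite gt_eqF// natr1 ltr_wpDr.
move: h2 h3; rewrite natrD => h2 h3.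
by field; rewrite h1 h2 h3.
Qed.

End generic_lemmas.

(** * Discretization of the subordinator *)

Section subordinator.
Context (R : realType) (alpha theta : R).
Hypotheses (alpha01 : 0 <= alpha < 1) (theta0 : 0 < theta).
Context (d : measure_display) (T : measurableType d) (P : probability T R).
Variables (nu : {measure set R -> \bar R}) (Y : R -> {RV P >-> R}) (X : {RV P >-> R}).
Hypotheses (hnu : is_levy_measure alpha theta nu) (hY : is_subordinator nu Y)
  (hX : has_stationary_delay_law P nu X).
Hypothesis hXY : indep_systems P (sigma_rv [set: unit] (fun _ => X))
             (sigma_rv [set t : R | 0 <= t] (fun t => Y t)).

Let Y00 w : Y 0 w = 0. Proof. by have [[-> _]] := hY. Qed.

Let Yle w s t : 0 <= s -> s <= t -> Y s w <= Y t w.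
Proof. by have [[_ h] _ _ _ _] := hY; exact: h. Qed.

Lemma subordinator_ge0 w t : 0 <= t -> 0 <= Y t w.
Proof. by move=> t0; rewrite -(Y00 w); exact: Yle. Qed.

Lemma subordinator_laplace : exists2 c : R, 0 < c & forall (t : R) k, 0 <= t ->
  Ex P (fun w => expR (- Num.max (Y t w) 0) ^+ k) = expR (- (t * (c * levyPhi alpha theta k))).
Proof.
have c0 := c0_gt0 hnu hX.
set c := (X in 0 < X) in c0; exists c^-1; first by rewrite invr_gt0.
move=> t [|k] t0.
  rewrite levyPhi0 !mulr0 oppr0 expR0; under eq_fun do rewrite expr0.
  exact: Ex_cst.
have [_ _ _ _ hL] := hY.
have := hL t k.+1%:R t0 (ler0n _ _).
rewrite (levy_exponent alpha01 theta0 hnu (measurable_funPT X) hX (ltn0Sn k)) -/c.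
have bf : bm (fun w => expR (- Num.max (Y t w) 0) ^+ k.+1).
  apply: bmX; apply: (bm_comp (measurable_funPT (Y t)) (f := fun y : R => expR (- Num.max y 0))).
  exact: bm_expRN_max.
have -> : (\int[P]_w (expR (- k.+1%:R * Y t w))%:E = \int[P]_w (expR (- Num.max (Y t w) 0) ^+ k.+1)%:E)%E.
  apply: eq_integral => w _; rewrite (max_idPl (subordinator_ge0 _ t0)).
  by rewrite -expRM_natl mulrN mulNr.
by rewrite (ExE P bf) /= => -[].
Qed.

(** By Markov's inequality, the probability that e^(-Y_n) stays above 1/(m+1) for all n is at most
    (m+1) e^(-n c Phi(1)) for each n. *)
Lemma subordinator_vanish : {ae P, forall w, forall e : R, 0 < e -> exists n : nat, expR (- Y n%:R w) < e}.
Proof.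
have [c c0 hc] := subordinator_laplace.
pose A m := [set w | forall n : nat, m.+1%:R^-1 <= expR (- Num.max (Y n%:R w) 0)].
have bf t : bm (fun w => expR (- Num.max (Y t w) 0)).
  apply: (bm_comp (measurable_funPT (Y t)) (f := fun y : R => expR (- Num.max y 0))).
  exact: bm_expRN_max.
have mA m : measurable (A m).
  have -> : A m = \bigcap_n ((fun w => expR (- Num.max (Y n%:R w) 0)) @^-1` `[m.+1%:R^-1, +oo[%classic).
    apply/seteqP; split => w /= h n; first by move=> _; rewrite /= in_itv/= andbT.
    by have := h n Logic.I; rewrite /= in_itv/= andbT.
  apply: bigcapT_measurable => n; rewrite -[X in measurable X]setTI; exact: (bf _).1.
have PA m : P (A m) = 0%E.
  rewrite -fineP// -(Ex_indic P (mA m)); congr EFin.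
  apply/eqP; rewrite eq_le Ex_ge0 ?andbT; last by move=> w; rewrite indicE ler0n.
  have lim : m.+1%:R * expR (- (c * levyPhi alpha theta 1)) ^+ n @[n --> \oo] --> (0 : R).
    rewrite -[X in _ --> X](mulr0 m.+1%:R); apply: cvgM; first exact: cvg_cst.
    apply: cvg_expr; rewrite ger0_norm ?expR_ge0// expR_lt1 oppr_lt0 mulr_gt0//.
    exact: levyPhi_gt0.
  rewrite -(cvg_lim _ lim)//; apply: limr_ge; first by apply/cvg_ex; exists 0.
  apply: nearW => n.
  have -> : expR (- (c * levyPhi alpha theta 1)) ^+ n = Ex P (fun w => expR (- Num.max (Y n%:R w) 0) ^+ 1).
    by rewrite hc// -expRM_natl mulrN.
  rewrite -ExZ; last by apply: bmX.
  apply: Ex_le; [exact: bm_indic|by apply: bmZ; apply: bmX|].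
  move=> w; rewrite expr1 indicE; case: (boolP (w \in A m)) => [|_].
    by rewrite inE => /(_ n) h; rewrite -ler_pdivrMl// mulr1.
  by rewrite mulr_ge0 ?expR_ge0.
have : {ae P, forall w, forall m, ~ A m w}.
  apply: ae_foralln => m; exists (A m); split; [exact: mA|exact: PA|by move=> w /contrapT].
apply: filterS => w hw e e0; apply: contrapT => hn.
have /cvgrPdist_lt/(_ _ e0) [m _ /(_ m (leqnn m))] := @cvg_harmonic R.
rewrite /= sub0r normrN ger0_norm// => h; apply: (hw m) => n.
rewrite (max_idPl (subordinator_ge0 _ (ler0n _ _))) (le_trans (ltW h))// leNgt; apply/negP => h2.
by apply: hn; exists n.
Qed.

(** Dyadic grids are nested: a dyadic time, once reached, belongs to all finer grids. *)
Definition grid (N k : nat) : R := k%:R / 2 ^+ N.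

Lemma grid_ge0 N k : 0 <= grid N k.
Proof. by rewrite divr_ge0 ?exprn_ge0. Qed.

Lemma grid_le N k : grid N k <= grid N k.+1.
Proof. by rewrite ler_pM2r ?invr_gt0 ?exprn_gt0// ler_nat. Qed.

(* Successive ratios of the points 1, e^-X, e^-(X+Y_h), e^-(X+Y_2h), ... for h = 2^-N. *)
Definition ratio N (i : nat) (w : T) : R :=
  expR (- Num.max (if i is j.+1 then Y (grid N j.+1) w - Y (grid N j) w else X w) 0).

Let inc N (i : nat) (w : T) : R := if i is j.+1 then Y (grid N j.+1) w - Y (grid N j) w else X w.

Let minc N i : measurable_fun setT (inc N i).
Proof. by case: i => [|i]; [exact: measurable_funPT|apply: measurable_funB; exact: measurable_funPT]. Qed.

Lemma bm_ratio N i : bm (ratio N i).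
Proof. exact: (bm_comp (minc N i) (f := fun y : R => expR (- Num.max y 0)) (bm_expRN_max R)). Qed.

Lemma ratio01 N i w : 0 <= ratio N i w <= 1.
Proof. exact: expRN_max01. Qed.

Definition incb N k m : R :=
  Ex P (fun w => (1 - expR (- Num.max (Y (2 ^+ N)^-1 w) 0)) ^+ m * expR (- Num.max (Y (2 ^+ N)^-1 w) 0) ^+ k).

Definition ratiob N (i k m : nat) : R := if i is _.+1 then incb N k m else bmom (1 - alpha) theta m k.

Let g mm kk (x : R) : R := (1 - expR (- Num.max x 0)) ^+ mm * expR (- Num.max x 0) ^+ kk.

Let bg mm kk : bm (g mm kk).
Proof.
apply: bmM; apply: bmX; last exact: bm_expRN_max.
by apply: bmB; [exact: bm_cst|exact: bm_expRN_max].
Qed.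

Lemma ratio_fact N n (mm kk : nat -> nat) :
  Ex P (fun w => \prod_(i < n) ((1 - ratio N i w) ^+ mm i * ratio N i w ^+ kk i)) =
  \prod_(i < n) ratiob N i (kk i) (mm i).
Proof.
have [_ _ hind hst _] := hY.
have ind : mutually_independent P (inc N).
  apply: (mutually_independent_pair (Y := fun t => Y t) (t := grid N)) => //.
  - by move=> k; exact: grid_ge0.
  - by apply: hind => [|k]; [exact: grid_ge0|exact: grid_le].
have g0 i x : 0 <= g (mm i) (kk i) x.
  rewrite /g; have /andP[h0 h1] := expRN_max01 x.
  by rewrite mulr_ge0 ?exprn_ge0 ?subr_ge0.
rewrite (indep_Ex n (minc N) ind (fun i => bg (mm i) (kk i)) g0).
apply: eq_bigr => -[[|i] _] _ /=.
  exact: (delay_moment alpha01 theta0 hnu (measurable_funPT X) hX).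
rewrite /incb; apply: (Ex_same_law (g := g (mm i.+1) (kk i.+1))) => //.
- exact: (minc N i.+1).
- move=> A mA; have h0 : 0 <= (2 ^+ N)^-1 :> R by rewrite invr_ge0 exprn_ge0.
  have := hst _ _ (grid_ge0 N i) h0 A mA.
  by rewrite /inc (_ : grid N i + (2 ^+ N)^-1 = grid N i.+1)// /grid -[i.+1%:R]natr1 mulrDl mul1r.
Qed.

(** With h = 2^-N, 1 - [incb N n 0] is equivalent to h c Phi(n) and, by differences, [incb N k m] to
    h c D(k, m). Both h and the unknown constant c cancel in the quotient. *)
Lemma incb_rates : [/\ forall N, incb N 0 0 = 1,
  forall N n, (0 < n)%N -> 0 <= incb N n 0 < 1 &
  forall k m, (0 < m)%N -> incb N k m / (1 - incb N (k + m) 0) @[N --> \oo] -->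
      levyD alpha theta k m / levyPhi alpha theta (k + m)].
Proof.
have [c c0 hc] := subordinator_laplace.
pose h N : R := (2 ^+ N)^-1.
have h0 N : 0 < h N by rewrite /h invr_gt0 exprn_gt0.
have e0 N n : incb N n 0 = expR (- (h N * (c * levyPhi alpha theta n))).
  rewrite -hc ?ltW// /incb; congr Ex; apply/funext => w; by rewrite expr0 mul1r.
have eS N k m : incb N k m.+1 = incb N k m - incb N k.+1 m.
  rewrite /incb -ExB; [|exact: (bm_comp (measurable_funPT _) (bg m k))|exact: (bm_comp (measurable_funPT _) (bg m k.+1))].
  by congr Ex; apply/funext => w; rewrite !exprS; ring.
have lim0 n : (1 - incb N n 0) / h N @[N --> \oo] --> c * levyPhi alpha theta n.
  rewrite (_ : (fun N => _) = (fun N => (1 - expR (- (c * levyPhi alpha theta n * h N))) / h N)).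
    apply: cvg_onem_expRN => //; last exact: cvg_half_pow.
    case: n => [|n]; first by rewrite levyPhi0 mulr0.
    by rewrite mulr_ge0 ?(ltW c0)// ltW// levyPhi_gt0.
  by apply/funext => N; rewrite e0 [h N * _]mulrC.
have lim k m : (0 < m)%N -> incb N k m / h N @[N --> \oo] --> c * levyD alpha theta k m.
  elim: m k => // m IH k _.
  have [->|m0] := posnP m.
    rewrite levyD1// mulrBr.
    rewrite (_ : (fun N => _) = (fun N => (1 - incb N k.+1 0) / h N - (1 - incb N k 0) / h N)).
      exact: cvgB.
    by apply/funext => N; rewrite eS -mulrBl; congr (_ * _); ring.
  rewrite levyDS// mulrBr; under eq_fun do rewrite eS mulrBl.
  by apply: cvgB; exact: IH.
split.
- by move=> N; rewrite e0 levyPhi0 !mulr0 oppr0 expR0.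
- move=> N n n0; rewrite e0 expR_ge0/= expR_lt1 oppr_lt0 mulr_gt0// mulr_gt0//.
  exact: levyPhi_gt0.
- move=> k m m0; have km : (0 < k + m)%N by rewrite addn_gt0 m0 orbT.
  have p0 := levyPhi_gt0 alpha01 theta0 km.
  have -> : levyD alpha theta k m / levyPhi alpha theta (k + m) =
      (c * levyD alpha theta k m) / (c * levyPhi alpha theta (k + m)).
    by rewrite -[RHS]mulf_div divff ?mul1r// gt_eqF.
  have hh : (fun N => incb N k m / (1 - incb N (k + m) 0)) =
      (fun N => (incb N k m / h N) / ((1 - incb N (k + m) 0) / h N)).
    by apply/funext => N; rewrite invf_div mulrA divfK// gt_eqF.
  rewrite hh; apply: cvgM; first exact: lim.
  by apply: cvgV => //; rewrite gt_eqF// mulr_gt0.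
Qed.

Lemma zr_ratio N a w : 0 <= X w -> zr (ratio N ^~ w) a.+1 = expR (- (X w + Y (grid N a) w)).
Proof.
move=> X0; elim: a => [|a IH].
  rewrite zr1 /ratio (max_idPl X0) (_ : grid N 0 = 0) ?Y00 ?addr0//.
  by rewrite /grid mul0r.
have -> : zr (ratio N ^~ w) a.+2 = zr (ratio N ^~ w) a.+1 * ratio N a.+1 w.
  by rewrite /zr big_ord_recr.
rewrite IH /ratio (max_idPl _); last by rewrite subr_ge0 Yle ?grid_ge0 ?grid_le.
by rewrite -expRD; congr expR; ring.
Qed.

End subordinator.

(** * Convergence of grid cells to gaps *)

Section one_sided_points.
Context (R : realType).
Implicit Types (Z : set R) (u : R).

(** At such a point of [Z] the grid cells shrink to 0, which is the gap length there by convention.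
    A point isolated on its left would keep a cell as long as the gap on its left. *)
Definition two_sided Z u : Prop := forall e : R, 0 < e ->
  (Z `&` `]u - e, u[%classic !=set0) /\ (Z `&` `]u, u + e[%classic !=set0).

(** A point of [Z] isolated on one side is the first point of [Z] after some rational or the last
    one before it. There are countably many such points, and a uniform variable avoids them. *)
Lemma one_sided_null Z d (T : measurableType d) (P : probability T R) (U : T -> R) : is_uniform P U ->
  {ae P, forall w, Z (U w) -> two_sided Z (U w)}.
Proof.
move=> uU.
pose L (r : R) u := [/\ Z u, r < u & Z `&` `]r, u[%classic = set0].
pose Q (r : R) u := [/\ Z u, u < r & Z `&` `]u, r[%classic = set0].
have sub r : (forall u v, L r u -> L r v -> u = v) /\ (forall u v, Q r u -> Q r v -> u = v).
  have hL u v : L r u -> L r v -> u <= v.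
    move=> [Zu ru eu] [Zv rv ev]; rewrite leNgt; apply/negP => vu.
    suff : (Z `&` `]r, u[%classic) v by rewrite eu.
    by split => //; rewrite /= in_itv/= rv vu.
  have hQ u v : Q r u -> Q r v -> u <= v.
    move=> [Zu ru eu] [Zv rv ev]; rewrite leNgt; apply/negP => vu.
    suff : (Z `&` `]v, r[%classic) u by rewrite ev.
    by split => //; rewrite /= in_itv/= vu ru.
  by split => u v hu hv; apply/eqP; rewrite eq_le; apply/andP; split; first [exact: hL|exact: hQ].
have null (S : R -> Prop) : (forall u v, S u -> S v -> u = v) -> {ae P, forall w, ~ S (U w)}.
  move=> hS; have [[c Sc]|hn] := pselect (exists c, S c); last first.
    by apply: aeW => w Sw; apply: hn; exists (U w).
  exists [set w | U w = c]; split.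
  - have := uU.1 measurableT [set c] (measurable_set1 c); by rewrite setTI.
  - exact: is_uniform_point.
  - by move=> w /= /contrapT h; apply: hS.
have hn : {ae P, forall w, forall n : nat, if unpickle n is Some r then
    ~ L (ratr (r : rat)) (U w) /\ ~ Q (ratr r) (U w) else True}.
  apply: ae_foralln => n; case: (unpickle n) => [rr|]; last exact: aeW.
  have [h1 h2] := sub (ratr rr).
  by apply: filterS2 (null _ h1) (null _ h2) => w.
apply: filterS hn => w hw Zu e e0.
have h (r : rat) : ~ L (ratr r) (U w) /\ ~ Q (ratr r) (U w).
  by have := hw (pickle r); rewrite pickleK.
have k1 : U w - e < U w by rewrite ltrBlDr ltrDl.
have k2 : U w < U w + e by rewrite ltrDl.
split.
  have [r] := rat_in_itvoo k1; rewrite in_itv/= => /andP[r1 r2].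
  have [hr _] := h r; apply/set0P/eqP => E; apply: hr; split => //.
  apply/seteqP; split => // v [Zv]; rewrite /= in_itv/= => /andP[v1 v2].
  suff : (Z `&` `]U w - e, U w[%classic) v by rewrite E.
  by split => //; rewrite /= in_itv/= v2 (lt_trans r1).
have [r] := rat_in_itvoo k2; rewrite in_itv/= => /andP[r1 r2].
have [_ hr] := h r; apply/set0P/eqP => E; apply: hr; split => //.
apply/seteqP; split => // v [Zv]; rewrite /= in_itv/= => /andP[v1 v2].
suff : (Z `&` `]U w, U w + e[%classic) v by rewrite E.
by split => //; rewrite /= in_itv/= v1 (lt_trans v2).
Qed.

(** A bracket slightly wider than the gap, so that points of [Z] separate u from its ends. The
    alternatives p < 0 and 1 < q cover gaps reaching the boundary of [0,1]. *)
Lemma gap_sides Z u (e : R) : 0 <= u <= 1 -> (Z u -> two_sided Z u) -> 0 < e ->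
  exists p q, [/\ p < u, u < q, q - p < gap_length (gap_at Z u) + e,
    p < 0 \/ 0 <= p /\ Z `&` `]p, u[%classic !=set0 &
    1 < q \/ Z `&` `]u, q[%classic !=set0].
Proof.
move=> u01 h2 e0; have /andP[u0 u1] := u01.
have e4 : 0 < e / 4 by rewrite divr_gt0.
have e8 : 0 < e / 8 by rewrite divr_gt0.
have ee : e = e / 4 + e / 4 + e / 4 + e / 4 by field.
have e48 : e / 8 < e / 4 by lra.
have [Zu|nZu] := pselect (Z u).
  exists (u - e / 4), (u + e / 4); have [k1 k2] := h2 Zu _ e4; split.
  - lra.
  - lra.
  - by have /andP[g0 _] := gap_length01 Z u; lra.
  - by have [p0|p0] := ltP (u - e / 4) 0; [left|right].
  - by right.
pose I := gap_at Z u.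
have Iu : I u by apply/gap_at_refl.
have lbI : has_lbound I by exists 0 => y /gap_sub01; rewrite /= in_itv/= => /andP[].
have ubI : has_ubound I by exists 1 => y /gap_sub01; rewrite /= in_itv/= => /andP[].
pose i := inf I; pose s := sup I.
have iu : i <= u by exact: ge_inf.
have us : u <= s by exact: ub_le_sup.
have i0 : 0 <= i.
  by apply: lb_le_inf; [exists u|move=> y /gap_sub01; rewrite /= in_itv/= => /andP[]].
have s1 : s <= 1.
  by apply: ge_sup; [exists u|move=> y /gap_sub01; rewrite /= in_itv/= => /andP[]].
have len : s - i <= gap_length I.
  have [->|si] := eqVneq s i; first by rewrite subrr; case/andP: (gap_length01 Z u).
  have is' : i < s by rewrite lt_neqAle eq_sym si (le_trans iu).
  rewrite -lee_fin -gap_measure_fin; apply: measure_ge_itv => //; first exact: measurable_gap.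
  move=> y; rewrite /= in_itv/= => /andP[iy ys].
  have [a Ia ay] : exists2 a, I a & a < y.
    by apply: (inf_lt (ex_intro (fun z => I z) u Iu) iy).
  have [b Ib yb] : exists2 b, I b & y < b by apply: sup_gt => //; exists u.
  by apply: (@gap_at_itv _ Z u a b Ia Ib); rewrite !ltW.
exists (i - e / 4), (s + e / 4); split.
- lra.
- lra.
- rewrite -/I; lra.
- have [p0|p0] := ltP (i - e / 4) 0; [by left|right; split => //].
  (* Testing at distance e/8 below the infimum of the gap gives a point of [Z] no lower than that,
     hence strictly above p, which lies e/4 below. *)
  have nt : ~ I (i - e / 8).
    by move=> /(ge_inf lbI); rewrite -/i; lra.
  have : exists z, [/\ Z z, i - e / 8 <= z & z <= u].
    apply: contrapT => hn; apply: nt; apply/gap_atP; split => //; first by apply/andP; split; lra.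
    move=> z; rewrite (min_idPr _) ?(max_idPl _); [|lra|lra].
    by move=> /andP[k1 k2] Zz; apply: hn; exists z.
  move=> [z [Zz k1 k2]]; exists z; split => //; rewrite /= in_itv/=.
  have zu : z != u by apply/eqP => E; apply: nZu; rewrite -E.
  by rewrite [z < u]lt_neqAle zu k2 andbT; lra.
- have [q1|q1] := ltP 1 (s + e / 4); [by left|right].
  have nt : ~ I (s + e / 8).
    by move=> /(ub_le_sup ubI); rewrite -/s; lra.
  have : exists z, [/\ Z z, u <= z & z <= s + e / 8].
    apply: contrapT => hn; apply: nt; apply/gap_atP; split => //; first by apply/andP; split; lra.
    move=> z; rewrite (min_idPl _) ?(max_idPr _); [|lra|lra].
    by move=> /andP[k1 k2] Zz; apply: hn; exists z.
  move=> [z [Zz k1 k2]]; exists z; split => //; rewrite /= in_itv/=.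
  have zu : u != z by apply/eqP => E; apply: nZu; rewrite E.
  by rewrite [u < z]lt_neqAle zu k1 /=; lra.
Qed.

End one_sided_points.

Section grid_approximation.
Context (R : realType) (x : R) (y : R -> R).
Hypotheses (x0 : 0 < x) (y0 : y 0 = 0) (yle : forall s t, 0 <= s -> s <= t -> y s <= y t)
  (y_rc : forall t, 0 <= t -> y s @[s --> t^'+] --> y t)
  (y_vanish : forall e : R, 0 < e -> exists n : nat, expR (- y n%:R) < e).
Variable K : nat -> nat.
(** The last point used on grid N is e^-(x + y t) with t >= N; the additional 1 accounts for the
    initial point 1 of [zgrid]. *)
Hypothesis K_ge : forall N, ((N * 2 ^ N).+1 <= K N)%N.

Let Z := exp_neg_set (stationary_range x y).

Definition zgrid N (a : nat) : R := if a is a'.+1 then expR (- (x + y (grid R N a'))) else 1.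

Lemma zgrid_noninc N a : zgrid N a.+1 <= zgrid N a.
Proof.
case: a => [|a] /=.
  have g0 : grid R N 0 = 0 by rewrite /grid mul0r.
  by rewrite expR_le1 oppr_le0 g0 y0 addr0 ltW.
by rewrite ler_expR lerN2 lerD2l yle ?grid_ge0// grid_le.
Qed.

Lemma zgrid01 N a : 0 < zgrid N a <= 1.
Proof.
apply/andP; split; first by case: a => [|a] /=; rewrite ?expR_gt0.
exact: (noninc_le (zgrid_noninc N) (leq0n a)).
Qed.

Lemma zgridZ N a : Z (zgrid N a.+1).
Proof. by apply: exp_neg_set_time; exact: grid_ge0. Qed.

Lemma zgrid_vanish e : 0 < e -> \forall N \near \oo, zgrid N (K N) < e.
Proof.
move=> e0; have [n hn] := y_vanish e0; exists n => // N /= nN.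
have := K_ge N; case: (K N) => // k; rewrite ltnS => hk /=.
apply: le_lt_trans hn; rewrite ler_expR lerN2.
have h : n%:R <= grid R N k.
  by rewrite /grid ler_pdivlMr ?exprn_gt0// -natrX -natrM ler_nat (leq_trans _ hk)// leq_mul2r nN orbT.
by rewrite (le_trans (yle _ h))// lerDr ltW.
Qed.

Lemma zgrid_dense p q : 0 <= p -> Z `&` `]p, q[%classic !=set0 ->
  \forall N \near \oo, exists a, p < zgrid N a.+1 < q.
Proof.
move=> p0 ne; have oG : open (`]p, q[%classic : set R) by exact: itv_open.
have G0 : ~ (`]p, q[%classic : set R) 0 by rewrite /= in_itv/= ltNge p0.
have [M [j]] := (exp_neg_set_hitP x y_rc oG G0).1 ne; rewrite /= in_itv/= => h.
exists M => // N /= MN; exists (j * 2 ^ (N - M))%N; rewrite /= (_ : grid R N _ = j%:R / 2 ^+ M)//.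
have e : 2 ^+ N = 2 ^+ (N - M) * 2 ^+ M :> R by rewrite -exprD subnK.
by rewrite /grid natrM natrX e [j%:R * _]mulrC -mulf_div divff ?mul1r// gt_eqF// exprn_gt0.
Qed.

Let ell N u : R := zgrid N (lab (zgrid N) (K N) u) - zgrid N (lab (zgrid N) (K N) u).+1.

Lemma zgrid_between N u a : zgrid N (K N) < u <= 1 ->
  (zgrid N a < u -> zgrid N a <= zgrid N (lab (zgrid N) (K N) u).+1) /\
  (u <= zgrid N a -> zgrid N (lab (zgrid N) (K N) u) <= zgrid N a).
Proof.
move=> hu; have [_ /andP[c1 c2]] := labP (zgrid_noninc N) (hu : _ < _ <= zgrid N 0).
split=> h; apply: noninc_le; try exact: zgrid_noninc; rewrite leqNgt; apply/negP => hb.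
  by move: h; rewrite ltNge (le_trans c2)//; apply: (noninc_le (zgrid_noninc N)).
by move: h; rewrite leNgt (le_lt_trans _ c1)//; apply: (noninc_le (zgrid_noninc N)).
Qed.

(** Grid points other than 1 belong to [Z], so an interval around u free of [Z], cut to [0,1], stays
    inside the cell: the cell is at least as long as the gap. Conversely, grid points eventually
    enter both sides of the bracket of [gap_sides]. *)
Lemma zgrid_cell_length u : 0 < u < 1 -> (Z u -> two_sided Z u) ->
  (\forall N \near \oo, zgrid N (K N) < u) /\
  ell N u @[N --> \oo] --> gap_length (gap_at Z u).
Proof.
move=> /andP[u0 u1] h2; have hK := zgrid_vanish u0; split => //.
apply/cvgrPdist_lt => e e0.
have u01 : 0 <= u <= 1 by rewrite !ltW.
have [p [q [pu uq pq hp hq]]] := gap_sides u01 h2 e0.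
have hp' : \forall N \near \oo, p < 0 \/ exists a, p < zgrid N a.+1 < u.
  case: hp => [pneg|[p0 /(zgrid_dense p0)]]; first by apply: nearW => N; left.
  by apply: filterS => N; right.
have hq' : \forall N \near \oo, 1 < q \/ exists a, u < zgrid N a.+1 < q.
  case: hq => [q1|/(zgrid_dense (ltW u0))]; first by apply: nearW => N; left.
  by apply: filterS => N; right.
near=> N.
have uK : zgrid N (K N) < u <= 1 by rewrite (ltW u1) andbT; near: N.
have [lK /andP[c1 c2]] := labP (zgrid_noninc N) (uK : _ < _ <= zgrid N 0).
rewrite /ell; set b := lab _ _ _ in lK c1 c2 *.
have lo : gap_length (gap_at Z u) <= zgrid N b - zgrid N b.+1.
  rewrite leNgt; apply/negP.
  have l0 : 0 <= zgrid N b - zgrid N b.+1 by rewrite subr_ge0 zgrid_noninc.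
  move=> /(gap_length_gtP u l0 (@closed_exp_neg_set _ x y)) [_ [p' [q' [p'u uq' lpq hf]]]].
  have k1 : zgrid N b.+1 <= Num.max p' 0.
    rewrite le_max; apply/orP; left; rewrite leNgt; apply/negP => h.
    by apply: (hf (zgrid N b.+1)); [rewrite h (lt_trans c1)|exact: zgridZ].
  have k2 : Num.min q' 1 <= zgrid N b.
    rewrite ge_min; case: (b) c2 => [|b'] c2 /=; first by rewrite lexx orbT.
    apply/orP; left; rewrite leNgt; apply/negP => h.
    by apply: (hf (zgrid N b'.+1)); [rewrite h andbT (lt_le_trans p'u)|exact: zgridZ].
  by move: lpq; rewrite ltNge lerB.
have k1 : p < zgrid N b.+1.
  have : p < 0 \/ exists a, p < zgrid N a.+1 < u by near: N.
  move=> [pn|[a /andP[pa au]]]; first by rewrite (lt_trans pn)//; case/andP: (zgrid01 N b.+1).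
  by rewrite (lt_le_trans pa)//; apply: (zgrid_between a.+1 uK).1.
have k2 : zgrid N b < q.
  have : 1 < q \/ exists a, u < zgrid N a.+1 < q by near: N.
  move=> [pn|[a /andP[pa au]]]; first by rewrite (le_lt_trans _ pn)//; case/andP: (zgrid01 N b).
  by rewrite (le_lt_trans _ au)//; apply: (zgrid_between a.+1 uK).2; exact: ltW.
rewrite distrC ger0_norm ?subr_ge0//; lra.
Unshelve. all: by end_near.
Qed.

(** No grid point separates two points of one gap. Two points in different gaps have a point of [Z]
    strictly between them, hence eventually a grid point. *)
Lemma zgrid_labels (n : nat) (u : nat -> R) : (forall i, 0 < u i < 1 /\ ~ Z (u i)) ->
  \forall N \near \oo, (forall i : 'I_n, zgrid N (K N) < u i <= zgrid N 0) /\
    forall i j : 'I_n, same_class Z u i j =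
      (lab (zgrid N) (K N) (u i) == lab (zgrid N) (K N) (u j)).
Proof.
move=> hu.
have hK (i : nat) : \forall N \near \oo, zgrid N (K N) < u i.
  by apply: zgrid_vanish; have [/andP[]] := hu i.
have dich (a b : R) : ~ gap_at Z a b -> 0 < a < 1 -> 0 < b < 1 -> ~ Z a -> ~ Z b -> a <= b ->
    \forall N \near \oo, exists c, a < zgrid N c.+1 < b.
  move=> ng /andP[a0 a1] /andP[b0 b1] nZa nZb ab; apply: zgrid_dense; first exact: ltW.
  apply: contrapT => hn; apply: ng; apply/gap_atP; rewrite (min_idPl ab) (max_idPr ab).
  split; [by rewrite !ltW|by rewrite !ltW|].
  move=> z /andP[az zb] Zz; apply: hn; exists z; split => //; rewrite /= in_itv/= !lt_neqAle az zb !andbT.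
  by apply/andP; split; apply/eqP => E; [apply: nZa|apply: nZb]; rewrite ?E// -E.
have sep (i j : nat) : ~ gap_at Z (u i) (u j) -> \forall N \near \oo,
    exists c, Num.min (u i) (u j) < zgrid N c.+1 < Num.max (u i) (u j).
  move=> ng; have [ui nZi] := hu i; have [uj nZj] := hu j.
  have [ij|/ltW ji] := leP (u i) (u j); first exact: dich.
  by apply: dich => // g; apply: ng; exact: gap_at_sym.
have main (i j : 'I_n) : \forall N \near \oo, zgrid N (K N) < u i <= 1 ->
    zgrid N (K N) < u j <= 1 -> same_class Z u i j =
      (lab (zgrid N) (K N) (u i) == lab (zgrid N) (K N) (u j)).
  rewrite /same_class; have [<-|ij] := eqVneq i j.
    by apply: nearW => N _ _; rewrite eqxx.
  case: asboolP => g /=.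
    apply: nearW => N ui uj.
    have [_ /andP[c1 c2]] := labP (zgrid_noninc N) (ui : _ < _ <= zgrid N 0).
    set b := lab _ _ (u i) in c1 c2 *.
    have [_ _ hf] := (gap_atP _ _ _).1 g.
    apply/esym; rewrite eq_sym -cell_lab//; last exact: zgrid_noninc.
    rewrite /cell; apply/andP; split.
      rewrite ltNge; apply/negP => h; apply: (hf (zgrid N b.+1)); last exact: zgridZ.
      by rewrite ge_min h orbT le_max (ltW c1).
    case: (b) c2 => [|b'] c2 /=; first by case/andP: uj.
    rewrite leNgt; apply/negP => h; apply: (hf (zgrid N b'.+1)); last exact: zgridZ.
    by rewrite ge_min c2 /= le_max (ltW h) orbT.
  apply: filterS (sep i j g) => N [c hc] ui uj; apply/esym/negP => /eqP E.
  have [h1 h2] := zgrid_between c.+1 ui; have [h3 h4] := zgrid_between c.+1 uj.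
  have [_ /andP[c1 c2]] := labP (zgrid_noninc N) (ui : _ < _ <= zgrid N 0).
  have [_ /andP[c3 c4]] := labP (zgrid_noninc N) (uj : _ < _ <= zgrid N 0).
  move: hc; rewrite -E in h3 h4 c3 c4; case: (leP (u i) (u j)) => _ /andP[k1 k2].
    by have := h3 k2; rewrite leNgt (lt_trans c1 k1).
  by have := h1 k2; rewrite leNgt (lt_trans c3 k1).
have hKa : \forall N \near \oo, forall i : 'I_n, zgrid N (K N) < u i.
  by apply: filter_forall => i; exact: hK.
have maina : \forall N \near \oo, forall i j : 'I_n, zgrid N (K N) < u i <= 1 ->
    zgrid N (K N) < u j <= 1 -> same_class Z u i j =
      (lab (zgrid N) (K N) (u i) == lab (zgrid N) (K N) (u j)).
  by apply: filter_forall => i; apply: filter_forall => j; exact: main.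
apply: filterS2 hKa maina => N h1 h2.
have h3 (i : 'I_n) : zgrid N (K N) < u i <= zgrid N 0.
  by rewrite h1 /=; have [/andP[_ /ltW]] := hu i.
by split => // i j; apply: h2; exact: h3.
Qed.

End grid_approximation.

Section cells.
Context (R : realType).
Implicit Types z : nat -> R.

Lemma cvg_exprn (u : nat -> R) (a : R) b : u n @[n --> \oo] --> a -> u n ^+ b @[n --> \oo] --> a ^+ b.
Proof.
move=> ua; elim: b => [|b IH]; first by under eq_fun do rewrite expr0; rewrite expr0; exact: cvg_cst.
by under eq_fun do rewrite exprS; rewrite exprS; exact: cvgM.
Qed.

Lemma cvg_prodr (J : Type) (r : seq J) (p : pred J) (F : J -> nat -> R) (a : J -> R) :
  (forall j, p j -> F j n @[n --> \oo] --> a j) ->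
  \prod_(j <- r | p j) F j n @[n --> \oo] --> \prod_(j <- r | p j) a j.
Proof.
move=> h; elim: r => [|j r IH].
  by under eq_fun do rewrite big_nil; rewrite big_nil; exact: cvg_cst.
under eq_fun do rewrite big_cons; rewrite big_cons; case: ifPn => // pj.
by apply: cvgM => //; exact: h.
Qed.

(** Power sums of cell lengths with exponent b + 1 are means of this function over a uniform u.
    Their convergence is thereby reduced to that of the cell around one point, with bound 1. *)
Definition cellval z K b (u : R) : R :=
  if z K < u <= z 0%N then (z (lab z K u) - z (lab z K u).+1) ^+ b else 0.

Lemma cellval_sum z K b u : (forall a, z a.+1 <= z a) ->
  cellval z K b u = \sum_(a < K) \1_(`]z a.+1, z a]%classic) u * (z a - z a.+1) ^+ b.
Proof.
move=> nz; rewrite /cellval; case: ifPn => [hu|hu].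
  have [lK _] := labP nz hu.
  rewrite (bigD1 (Ordinal lK))//= indicE mem_set ?mul1r; last first.
    by have [_] := labP nz hu; rewrite /cell /= in_itv.
  rewrite big1 ?addr0// => a al; rewrite indicE memNset ?mul0r//= in_itv/= -/(cell z a u) (cell_lab _ nz hu).
  by apply/negP; rewrite eq_sym.
rewrite big1// => a _; rewrite indicE memNset ?mul0r//= in_itv/= => /andP[h1 h2].
move/negP: hu; apply; apply/andP; split.
  by apply: le_lt_trans h1; apply: noninc_le.
by apply: (le_trans h2); apply: noninc_le.
Qed.

Lemma cellval01 z K b u : (forall a, z a.+1 <= z a) -> (forall a, 0 <= z a <= 1) -> 0 <= cellval z K b u <= 1.
Proof.
move=> nz z01; rewrite /cellval; case: ifP => _; last by rewrite lexx ler01.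
set c := lab _ _ _; have /andP[h1 h2] := z01 c; have /andP[h3 h4] := z01 c.+1.
have h0 : 0 <= z c - z c.+1 by rewrite subr_ge0.
by rewrite exprn_ge0//= exprn_ile1//; lra.
Qed.

Lemma cellval_Ex d (T : measurableType d) (P : probability T R) (U : T -> R) z K b : is_uniform P U ->
  (forall a, z a.+1 <= z a) -> (forall a, 0 <= z a <= 1) ->
  bm (fun w => cellval z K b (U w)) /\
  Ex P (fun w => cellval z K b (U w)) = \sum_(a < K) (z a - z a.+1) ^+ b.+1.
Proof.
move=> uU nz z01.
have bi (a : nat) : bm (fun w => \1_(`]z a.+1, z a]%classic : set R) (U w) : R).
  by apply: (bm_comp uU.1); exact: bm_indic.
have bt (a : nat) : bm (fun w => \1_(`]z a.+1, z a]%classic : set R) (U w) * (z a - z a.+1) ^+ b).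
  by apply: bmM => //; exact: bm_cst.
have -> : (fun w => cellval z K b (U w)) = fun w => \sum_(a < K) \1_(`]z a.+1, z a]%classic) (U w) * (z a - z a.+1) ^+ b.
  by apply/funext => w; rewrite cellval_sum.
split; first exact: bm_sum.
rewrite Ex_sum//; apply: eq_bigr => a _; rewrite ExZr// is_uniform_itv//.
- by rewrite exprS.
- by case/andP: (z01 a.+1).
- by case/andP: (z01 a).
Qed.

End cells.

(** * Limit laws: moments of gaps and meander, law of the composition *)

Section limit_laws.
Context (R : realType) (alpha theta : R).
Hypotheses (alpha01 : 0 <= alpha < 1) (theta0 : 0 < theta).
Context (d : measure_display) (T : measurableType d) (P : probability T R).
Variables (nu : {measure set R -> \bar R}) (Y : R -> {RV P >-> R}) (X : {RV P >-> R}).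
Hypotheses (hnu : is_levy_measure alpha theta nu) (hY : is_subordinator nu Y)
  (hX : has_stationary_delay_law P nu X).
Hypothesis hXY : indep_systems P (sigma_rv [set: unit] (fun _ => X))
             (sigma_rv [set t : R | 0 <= t] (fun t => Y t)).
Variables (Z : T -> set R) (U : nat -> T -> R).
Hypothesis hZ : forall w, Z w = exp_neg_set (stationary_range (X w) (fun t => Y t w)).
Hypothesis uU : forall i, is_uniform P (U i).
Hypothesis hUind : mutually_independent P U.
Local Notation gl w u := (gap_length (gap_at (Z w) u)).

Lemma closedZ w : closed (Z w).
Proof. by rewrite hZ; exact: closed_exp_neg_set. Qed.

Lemma rcY w t : 0 <= t -> Y s w @[s --> t^'+] --> Y t w.
Proof. by have [_ h _ _ _] := hY; exact: h. Qed.

Lemma hitZ (G : set R) : open G -> measurable [set w | Z w `&` G !=set0].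
Proof.
move=> oG; rewrite (_ : mkset _ =
    [set w | exp_neg_set (stationary_range (X w) (fun t => Y t w)) `&` G !=set0]); last first.
  by apply/seteqP; split => w /=; rewrite hZ.
apply: measurable_hit => //; first exact: rcY.
Qed.

Definition good w := 0 < X w /\ forall e : R, 0 < e -> exists n : nat, expR (- Y n%:R w) < e.

Lemma ae_good : {ae P, forall w, good w}.
Proof.
have h1 : {ae P, forall w, 0 < X w}.
  exists [set w | X w <= 0]; split.
  - rewrite (_ : mkset _ = X @^-1` `]-oo, 0]%classic).
      by rewrite -[X in measurable X]setTI; exact: measurable_funPT.
    by apply/seteqP; split => w /=; rewrite in_itv.
  - exact: (delay_gt0 hnu hX).
  - by move=> w /= /negP; rewrite -leNgt.
have h2 := subordinator_vanish alpha01 theta0 hnu hY hX.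
by apply: filterS2 h1 h2 => w.
Qed.

Lemma zr_noninc N w a : zr (ratio Y X N ^~ w) a.+1 <= zr (ratio Y X N ^~ w) a.
Proof.
rewrite [leLHS]/zr big_ord_recr /= -/(zr (ratio Y X N ^~ w) a).
have h i : 0 <= ratio Y X N i w <= 1 by exact: ratio01.
have /andP[_ h1] := h a; rewrite ler_piMr// /zr prodr_ge0// => i _; by case/andP: (h i).
Qed.

Lemma zr01 N w a : 0 <= zr (ratio Y X N ^~ w) a <= 1.
Proof.
have h i : 0 <= ratio Y X N i w <= 1 by exact: ratio01.
apply/andP; split; first by rewrite /zr prodr_ge0// => i _; case/andP: (h i).
rewrite -(zr0 (ratio Y X N ^~ w)); apply: noninc_le => //; exact: zr_noninc.
Qed.

Lemma zr_zgrid N w : 0 < X w -> zr (ratio Y X N ^~ w) = zgrid (X w) (fun t => Y t w) N.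
Proof.
move=> X0; apply/funext => -[|a]; first by rewrite zr0.
by rewrite (zr_ratio hY)// ltW.
Qed.

(** The second copy w' of the space supplies the uniform point, so this is a mean given [Z]. For b
    >= 1 it is the sum of the (b+1)-st powers of the gap lengths, whence the predecessors
    [(lam i).-1] below. *)
Definition gmom b w : R := Ex P (fun w' => gl w (U 0%N w') ^+ b).

Lemma bm_gap_length i : bm (fun x : T * T => gl x.1 (U i x.2)).
Proof.
apply: bm01; last by move=> x; exact: gap_length01.
apply: (measurable_gap_length closedZ) => //; first exact: hitZ.
exact: (uU i).1.
Qed.

Lemma bm_gap_length_section i w : bm (fun w' => gl w (U i w')).
Proof. exact: (bm_section1 w (bm_gap_length i)). Qed.

Lemma bm_gmom b : bm (gmom b).
Proof.
have h : bm (fun x : T * T => gl x.1 (U 0%N x.2) ^+ b) by apply: bmX; exact: bm_gap_length.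
exact: (bm_fubini P P h).
Qed.

Let Yprops w : good w -> [/\ 0 < X w, Y 0 w = 0, forall s t, 0 <= s -> s <= t -> Y s w <= Y t w &
  (forall t, 0 <= t -> Y s w @[s --> t^'+] --> Y t w) /\
  (forall e : R, 0 < e -> exists n : nat, expR (- Y n%:R w) < e)].
Proof.
move=> [g1 g2]; have [[h1 h2] _ _ _ _] := hY; split => //; first by move=> s t; exact: h2.
by split => //; exact: rcY.
Qed.

Lemma pK_cvg (K : nat -> nat) b w : (forall N, ((N * 2 ^ N).+1 <= K N)%N) -> good w ->
  pK (K N) (ratio Y X N ^~ w) b.+1 @[N --> \oo] --> gmom b w.
Proof.
move=> hK gw; have [x0 y0 yle [yrc yv]] := Yprops gw.
have e N : pK (K N) (ratio Y X N ^~ w) b.+1 =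
    Ex P (fun w' => cellval (zr (ratio Y X N ^~ w)) (K N) b (U 0%N w')).
  by have [_ ->] := cellval_Ex (K N) b (uU 0) (zr_noninc N w) (zr01 N w).
rewrite (_ : (fun N => _) = fun N => Ex P (fun w' => cellval (zr (ratio Y X N ^~ w)) (K N) b (U 0%N w'))); last first.
  by apply/funext => N; exact: e.
apply: (@Ex_lim _ _ _ _ _ _ 1).
- by move=> N; have [] := cellval_Ex (K N) b (uU 0) (zr_noninc N w) (zr01 N w).
- exact: bmX (bm_gap_length_section _ _).
- move=> N w'; have /andP[h1 h2] := cellval01 (K N) b (U 0%N w') (zr_noninc N w) (zr01 N w).
  by rewrite ger0_norm.
- have h1 := one_sided_null (Z w) (uU 0).
  have h2 : {ae P, forall w', 0 < U 0%N w' < 1}.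
    exists [set w | ~ (0 < U 0%N w < 1)]; split => //; last exact: is_uniform_01.
    rewrite (_ : mkset _ = U 0%N @^-1` (~` `]0, 1[%classic)).
      by rewrite -[X in measurable X]setTI; apply: (uU 0).1 => //; exact: measurableC.
    by apply/seteqP; split => w' /=; rewrite in_itv.
  apply: filterS2 h1 h2 => w' k1 k2.
  rewrite hZ in k1 *.
  have [l1 l2] := zgrid_cell_length x0 y0 yle yrc yv hK k2 k1.
  refine (cvg_trans _ (cvg_exprn (b := b) l2)); apply: near_eq_cvg.
  apply: filterS l1 => N uN; rewrite zr_zgrid// /cellval uN /=.
  by case/andP: k2 => _ /ltW ->.
Qed.

Definition meander w : R := 1 - expR (- Num.max (X w) 0).

Lemma bm_meander : bm meander.
Proof. by apply: bmB; [exact: bm_cst|exact: (bm_ratio Y X 0 0)]. Qed.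

Lemma meander01 w : 0 <= meander w <= 1.
Proof. by have /andP[h1 h2] := ratio01 Y X 0 0 w; rewrite /meander -/(ratio Y X 0 0 w); apply/andP; split; lra. Qed.

Section mixed_moments.
Context (I : finType) (lam : I -> nat).
Hypothesis lam_gt0 : forall i, (0 < lam i)%N.

(** In mean, the discretized moments are explicit ([Mk_expect_mark]) and converge first in the
    number of cells, then in the mesh. Pathwise convergence requires the two to grow together. Along
    the diagonal sequence both statements hold, and the limits must agree. *)
Lemma mixed_moment (J : {set I}) m :
  Ex P (fun w => meander w ^+ m * \prod_(i in J) gmom (lam i).-1 w) =
  \sum_(S : {set I} | S \subset J) bmom (1 - alpha) theta (m + wt lam S) (wt lam (J :\: S)) *
     Mh alpha lam theta (J :\: S).
Proof.
have [b00 b1 blim] := incb_rates alpha01 theta0 hnu hY hX.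
pose F K N w := (1 - ratio Y X N 0 w) ^+ m * \prod_(i in J) pK K.+1 (ratio Y X N ^~ w) (lam i).
have EF K N : Ex P (F K N) = \sum_(S : {set I} | S \subset J)
    bmom (1 - alpha) theta (m + wt lam S) (wt lam (J :\: S)) * Mk lam (fun=> incb Y N) K (J :\: S).
  exact: (Mk_expect_mark (bm_ratio Y X N) (fun n => ratio_fact alpha01 theta0 hnu hY hX hXY N n) lam K J m).
pose l N := \sum_(S : {set I} | S \subset J)
    bmom (1 - alpha) theta (m + wt lam S) (wt lam (J :\: S)) * Minf lam (incb Y N) (J :\: S).
have c1 N : Ex P (F K N) @[K --> \oo] --> l N.
  under eq_fun do rewrite EF; apply: cvg_sumr => S _.
  by apply: cvgM; [exact: cvg_cst|exact: (Mk_cvg lam_gt0 (b00 N) (b1 N))].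
set L := (X in _ = X); have c2 : l N @[N --> \oo] --> L.
  apply: cvg_sumr => S _; apply: cvgM; first exact: cvg_cst.
  exact: (Minf_cvg lam_gt0 alpha01 theta0 b00 b1 blim).
(* The lower bound N 2^N makes grid N run at least up to time N, as [pK_cvg] requires. *)
have [K [hK c3]] := diagonal_choice (fun N => (N * 2 ^ N)%N) c1 c2.
have hK1 N : ((N * 2 ^ N).+1 <= (K N).+1)%N by rewrite ltnS.
have c4 : Ex P (F (K N) N) @[N --> \oo] -->
    Ex P (fun w => meander w ^+ m * \prod_(i in J) gmom (lam i).-1 w).
  apply: (@Ex_lim _ _ _ _ _ _ 1).
  - move=> N; apply: bmM.
      by apply: bmX; apply: bmB; [exact: bm_cst|exact: bm_ratio].
    by apply: bm_prod => i _; apply: bm_pK; exact: bm_ratio.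
  - by apply: bmM; [apply: bmX; exact: bm_meander|apply: bm_prod => i _; exact: bm_gmom].
  - move=> N w; rewrite normrM -[leRHS]mulr1; apply: ler_pM; rewrite ?normr_ge0//.
      have /andP[h1 h2] := ratio01 Y X N 0 w.
      by rewrite ger0_norm ?exprn_ge0 ?subr_ge0// exprn_ile1 ?subr_ge0//; lra.
    have h i : 0 <= pK (K N).+1 (ratio Y X N ^~ w) (lam i) <= 1.
      have [bb eb] := cellval_Ex (K N).+1 (lam i).-1 (uU 0) (zr_noninc N w) (zr01 N w).
      rewrite prednK// in eb; rewrite /pK -eb.
      have c01 w' := cellval01 (K N).+1 (lam i).-1 (U 0%N w') (zr_noninc N w) (zr01 N w).
      apply/andP; split; first by apply: Ex_ge0 => w'; case/andP: (c01 w').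
      rewrite -(Ex_cst P 1); apply: Ex_le => //; first exact: bm_cst.
      by move=> w'; case/andP: (c01 w').
    rewrite ger0_norm; last by apply: prodr_ge0 => i _; case/andP: (h i).
    by apply: prodr_ile1 => i _; exact: h.
  - apply: filterS ae_good => w gw.
    suff h : (fun N => meander w ^+ m * \prod_(i in J) pK (K N).+1 (ratio Y X N ^~ w) (lam i)) N
        @[N --> \oo] --> meander w ^+ m * \prod_(i in J) gmom (lam i).-1 w by exact: h.
    apply: cvgM; first exact: cvg_cst.
    have h (i : I) : i \in J -> (fun N => pK (K N).+1 (ratio Y X N ^~ w) (lam i)) N @[N --> \oo] --> gmom (lam i).-1 w.
      by move=> _; have := pK_cvg (b := (lam i).-1) hK1 gw; rewrite prednK.
    exact: (@cvg_prodr R I (index_enum I) (fun i => i \in J)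
      (fun i N => pK (K N).+1 (ratio Y X N ^~ w) (lam i)) (fun i => gmom (lam i).-1 w) h).
by rewrite -(cvg_lim _ c4)// (cvg_lim _ c3).
Qed.

Let wghtE s t : wght alpha (theta - alpha) s t = bmom (1 - alpha) theta s t.
Proof. by rewrite /wght subrK. Qed.

(** The meander plays the part of the first stick. The right side, a moment over J and i0, is [Mh]
    at theta - alpha by [Mh_stick]; re-expanding it in size-biased form at i0 ([Mh_any]) yields the
    left side, with [lam i0] lowered by 1. *)
Lemma meander_exchange (J : {set I}) i0 : i0 \notin J ->
  Ex P (fun w => meander w ^+ (lam i0).-1 * \prod_(i in J) gmom (lam i).-1 w) =
  Ex P (fun w => gmom (lam i0).-1 w * \prod_(i in J) gmom (lam i).-1 w).
Proof.
move=> i0J; rewrite mixed_moment.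
have -> : Ex P (fun w => gmom (lam i0).-1 w * \prod_(i in J) gmom (lam i).-1 w) =
   Ex P (fun w => meander w ^+ 0 * \prod_(i in i0 |: J) gmom (lam i).-1 w).
  by congr Ex; apply/funext => w; rewrite big_setU1//= mul1r.
rewrite mixed_moment; have v0 : 0 < theta - alpha + alpha by rewrite subrK.
have := Mh_stick alpha01 lam_gt0 (v := theta - alpha) (i0 |: J) v0.
rewrite subrK; under eq_bigr do rewrite wghtE -[X in bmom _ _ X _]add0n.
move=> <-; rewrite (Mh_any alpha01 lam_gt0 v0 (setU11 i0 J)) subrK.
have hK (S : {set I}) : (S \subset i0 |: J) && (i0 \in S) -> i0 |: (S :\ i0) = S.
  by move=> /andP[_ h]; rewrite finset.setD1K.
(* Adding i0 matches the subsets of J with the subsets of the larger set that contain i0; the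
   complements are unchanged. *)
rewrite (reindex_onto (fun S : {set I} => i0 |: S) (fun S => S :\ i0) hK).
apply: eq_big => S.
  apply/idP/idP.
    move=> SJ; rewrite finset.setU11 andbT finset.setUS//= setU1K//.
    by apply: contra i0J; exact: (fintype.subsetP SJ).
  move=> /andP[/andP[h1 _] /eqP h2]; have i0S : i0 \notin S by rewrite -h2 !finset.inE eqxx.
  apply/fintype.subsetP => j jS; have := fintype.subsetP h1 j.
  rewrite !finset.inE jS orbT => /(_ isT)/orP[/eqP E|//].
  by move: i0S; rewrite -E jS.
move=> SJ; have i0S : i0 \notin S by apply: contra i0J; exact: (fintype.subsetP SJ).
have w1 : wt lam (i0 |: S) = (lam i0 + wt lam S)%N by rewrite /wt big_setU1.
have d1 : (i0 |: J) :\: (i0 |: S) = J :\: S.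
  apply/setP => j; rewrite !finset.inE; case: eqVneq => [->|]//=.
  by rewrite (negbTE i0J) andbF.
rewrite w1 d1 wghtE; congr (bmom _ _ _ _ * _).
by case: (lam i0) (lam_gt0 i0).
Qed.

End mixed_moments.

Lemma gmom_moment m : Ex P (gmom m) = bmom (1 - alpha) theta m 0.
Proof.
have := @meander_exchange bool (fun=> m.+1) (fun=> ltn0Sn m) finset.set0 true.
rewrite !finset.inE => /(_ isT); under eq_fun do rewrite big_set0 mulr1.
under [in RHS]eq_fun do rewrite big_set0 mulr1.
move=> /= <-; rewrite -(delay_moment alpha01 theta0 hnu (measurable_funPT X) hX m 0).
by congr Ex; apply/funext => w; rewrite expr0 mulr1.
Qed.

Lemma pair_gap_length_law : has_beta_law (P \x P)%E (fun x : T * T => gl x.1 (U 0%N x.2)) (1 - alpha) theta.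
Proof.
have a1 : 0 < 1 - alpha by case/andP: alpha01 => _; rewrite subr_gt0.
apply: has_beta_law_moments => //.
- exact: (bm_gap_length 0).1.
- by move=> x; exact: gap_length01.
- move=> n; have h : bm (fun x : T * T => gl x.1 (U 0%N x.2) ^+ n) by apply: bmX; exact: bm_gap_length.
  by rewrite (Ex_fubini P P h) -gmom_moment.
Qed.

Lemma measurable_gap_length_arg w : measurable_fun setT (fun u : R => gl w u).
Proof.
have h := measurable_gap_length closedZ hitZ (@measurable_id _ R setT).
exact: (measurableT_comp h (@measurable_pair1 _ _ T R w)).
Qed.

(** The beta law of the gap length at a uniform point has no atom at 0. So almost every [Z] is a
    null set, and sample points fall inside gaps. *)
Lemma gap_length_gt0_ae : {ae P, forall w, forall i, {ae P, forall w', 0 < gl w (U i w')}}.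
Proof.
have a1 : 0 < 1 - alpha by case/andP: alpha01 => _; rewrite subr_gt0.
pose g : R -> R := \1_[set 0].
have bg : bm g by apply: bm_indic.
have g0 u : 0 <= g u by rewrite /g indicE ler0n.
have bf : bm (fun x : T * T => g (gl x.1 (U 0%N x.2))).
  exact: (bm_comp (bm_gap_length 0).1 bg).
have E0 : Ex P (fun w => Ex P (fun w' => g (gl w (U 0%N w')))) = 0.
  rewrite -(Ex_fubini P P bf) (has_beta_law_Ex a1 theta0 pair_gap_length_law bg).
  have [_ IZ _ _] := bfunctional_beta a1 theta0.
  transitivity (beta_functional (1 - alpha) theta (fun _ => 0 * 1)); last first.
    by rewrite IZ ?mul0r//; exact: bm_cst.
  apply: eq_Rintegral => x; rewrite inE /= in_itv/= => /andP[x0 _].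
  by rewrite /g indicE memNset ?mul0r//= => e; rewrite e ltxx in x0.
have h := Ex_ge0_eq0 (bm_fubini P P bf) (fun w => Ex_ge0 P (fun w' => g0 _)) E0.
apply: filterS h => w hw i.
have bgw : bm (fun u => g (gl w u)) by exact: (bm_comp (measurable_gap_length_arg w) bg).
have e : Ex P (fun w' => g (gl w (U i w'))) = 0.
  rewrite -hw; apply: (Ex_same_law (g := fun u => g (gl w u))) => //.
  - exact: (uU i).1.
  - exact: (uU 0).1.
  - by move=> A mA; rewrite (uU i).2// (uU 0).2.
have h2 := Ex_ge0_eq0 (bm_comp (uU i).1 bgw) (fun w' => g0 _) e.
apply: filterS h2 => w' /eqP; rewrite /g indicE pnatr_eq0 eqb0 => h3.
have /andP[h4 _] := gap_length01 (Z w) (U i w'); rewrite lt_neqAle h4 andbT eq_sym.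
by apply: contra h3 => /eqP ->; rewrite inE.
Qed.

(* The probability of the composition [rev s]; the two terms correspond to the
   meander containing no sample point, or exactly m of them. *)
Definition comp_weight (s : seq nat) : R :=
  if s is m :: mu then
    bmom (1 - alpha) theta 0 (sumn s) * creg alpha theta s +
    'C(sumn s, m)%:R * bmom (1 - alpha) theta m (sumn mu) * creg alpha theta mu
  else 1.

Let Urect n (B : 'I_n -> set R) : (forall i, measurable (B i)) ->
  Ex P (fun w => \prod_(i < n) \1_(B i) (U i w)) =
  \prod_(i < n) Ex P (fun w => \1_(B i) (U i w)).
Proof.
move=> mB; pose g (i : nat) : R -> R := if insub i is Some k then \1_(B k) else fun=> 1.
have gE (i : 'I_n) : g i = \1_(B i) by rewrite /g valK.
have bg i : bm (g i) by rewrite /g; case: insub => [k|]; [exact: bm_indic|exact: bm_cst].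
have g0 i x : 0 <= g i x by rewrite /g; case: insub => [k|//]; rewrite indicE ler0n.
have := indep_Ex n (fun i => (uU i).1) hUind bg g0.
under eq_fun do under eq_bigr do rewrite gE.
by under [RHS]eq_bigr do rewrite gE.
Qed.

Lemma bm_sample_composition n (u : nat -> T -> R) (s : seq nat) : (forall i, measurable_fun setT (u i)) ->
  bm (fun x : T * T => (sample_composition (Z x.1) n (u ^~ x.2) == s)%:R : R).
Proof.
move=> mu; have mS := measurable_sample_composition closedZ hitZ n s mu.
rewrite (_ : (fun x => _) = \1_[set x : T * T | sample_composition (Z x.1) n (fun i => u i x.2) = s]).
  exact: bm_indic.
apply/funext => x; rewrite indicE; congr ((nat_of_bool _)%:R).
by apply/eqP/idP; rewrite inE.
Qed.

(** The cell counts have mean [kap], with the limit [comp_weight] along a diagonal sequence.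
    Pathwise, they eventually give the composition, because the sample points lie off [Z] and
    [zgrid_labels] applies. *)
Lemma sample_composition_law s : s != [::] -> all (leq 1) s ->
  Ex P (fun w => Ex P (fun w' => (sample_composition (Z w) (sumn s) (U ^~ w') == rev s)%:R)) =
  comp_weight s.
Proof.
case: s => // m mu _ s0; set s := m :: mu in s0 *.
have [b00 b1 blim] := incb_rates alpha01 theta0 hnu hY hX.
have s0' : all (leq 1) mu by case/andP: s0.
have bf := bm_sample_composition (sumn s) (rev s) (fun i => (uU i).1).
have LL N K w : bm (fun w' => (ev K (finset.setTfor 'I_(sumn s)) (zr (ratio Y X N ^~ w)) (U ^~ w') s)%:R : R) /\
    Ex P (fun w' => (ev K (finset.setTfor 'I_(sumn s)) (zr (ratio Y X N ^~ w)) (U ^~ w') s)%:R) =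
    gK K (zr (ratio Y X N ^~ w)) s.
  apply: (label_law (fun i => (uU i).1) (@Urect (sumn s)) _ K (zr_noninc N w) (zr01 N w) s0 erefl).
  by move=> i a b; exact: is_uniform_itv.
pose F K N w := gK K.+1 (zr (ratio Y X N ^~ w)) s.
have EF K N : Ex P (F K N) = bmom (1 - alpha) theta 0 (sumn s) * kap (fun=> incb Y N) K s +
    'C(sumn s, m)%:R * bmom (1 - alpha) theta m (sumn mu) * kap (fun=> incb Y N) K mu.
  exact: (kap_expect (bm_ratio Y X N) (fun n => ratio_fact alpha01 theta0 hnu hY hX hXY N n) K.+1 s).
pose l N := bmom (1 - alpha) theta 0 (sumn s) * kinf (incb Y N) s +
    'C(sumn s, m)%:R * bmom (1 - alpha) theta m (sumn mu) * kinf (incb Y N) mu.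
have c1 N : Ex P (F K N) @[K --> \oo] --> l N.
  under eq_fun do rewrite EF; apply: cvgD.
    by apply: cvgM; [exact: cvg_cst|exact: (kap_cvg (b1 N))].
  by apply: cvgM; [exact: cvg_cst|exact: (kap_cvg (b1 N))].
have c2 : l N @[N --> \oo] --> comp_weight s.
  apply: cvgD.
    by apply: cvgM; [exact: cvg_cst|exact: (kinf_cvg blim)].
  by apply: cvgM; [exact: cvg_cst|exact: (kinf_cvg blim)].
have [K [hK c3]] := diagonal_choice (fun N => (N * 2 ^ N)%N) c1 c2.
have hK1 N : ((N * 2 ^ N).+1 <= (K N).+1)%N by rewrite ltnS.
set L := (X in X = _); have c4 : Ex P (F (K N) N) @[N --> \oo] --> L.
  apply: (@Ex_lim _ _ _ _ _ _ 1).
  - by move=> N; apply: bm_gK => a; apply: bm_zr; exact: bm_ratio.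
  - exact: (bm_fubini P P bf).
  - move=> N w; rewrite /F; have [bb <-] := LL N (K N).+1 w.
    by apply: Ex_norm => // w'; rewrite ger0_norm ?ler0n// lern1 leq_b1.
  - apply: filterS2 ae_good gap_length_gt0_ae => w gw hw.
    have [x0 y0 yle [yrc yv]] := Yprops gw.
    have e N : F (K N) N w = Ex P (fun w' => (ev (K N).+1 (finset.setTfor 'I_(sumn s)) (zr (ratio Y X N ^~ w)) (U ^~ w') s)%:R).
      by have [_ ->] := LL N (K N).+1 w.
    have -> : (fun N => F (K N) N w) = fun N =>
      Ex P (fun w' => (ev (K N).+1 (finset.setTfor 'I_(sumn s)) (zr (ratio Y X N ^~ w)) (U ^~ w') s)%:R).
      by apply/funext.
    apply: (@Ex_lim _ _ _ _ _ _ 1).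
    + by move=> N; have [] := LL N (K N).+1 w.
    + exact: (bm_section1 w bf).
    + by move=> N w'; rewrite ger0_norm ?ler0n// lern1 leq_b1.
    + have h1 : {ae P, forall w', forall i, 0 < gl w (U i w')} by apply: ae_foralln.
      have h2 : {ae P, forall w', forall i, 0 < U i w' < 1}.
        apply: ae_foralln => i.
        exists [set w | ~ (0 < U i w < 1)]; split => //; last exact: is_uniform_01.
        rewrite (_ : mkset _ = U i @^-1` (~` `]0, 1[%classic)).
          by rewrite -[X in measurable X]setTI; apply: (uU i).1 => //; exact: measurableC.
        by apply/seteqP; split => w' /=; rewrite in_itv.
      apply: filterS2 h1 h2 => w' k1 k2.
      have hu i : 0 < U i w' < 1 /\ ~ exp_neg_set (stationary_range (X w) (fun t => Y t w)) (U i w').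
        split; first exact: k2.
        rewrite -hZ => ZU; have := k1 i; rewrite gap_length_notin ?ltxx// => -[_]; exact.
      apply: cvg_near_cst.
      have := zgrid_labels x0 y0 yle yrc yv hK1 (sumn s) hu.
      apply: filterS => N [l1 l2]; congr ((nat_of_bool _)%:R).
      rewrite zr_zgrid// hZ; apply: ev_sample_composition => //.
      by move=> a; exact: zgrid_noninc.
by rewrite -(cvg_lim _ c4)// (cvg_lim _ c3).
Qed.

Hypothesis hUZ : indep_systems P (sigma_random_set Z) (sigma_rv [set: nat] U).

(** [TZ] and [TU] are the original space with only the events of [Z], respectively of [U].
    Independence says that the pair of identity maps into them has a product law, so a mean over w
    becomes an iterated mean over w and w' ([Ex_split]). *)
Definition TZ := g_sigma_algebraType [set [set w | Z w `&` G !=set0] | G in [set G : set R | open G]].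
Definition TU := g_sigma_algebraType (\bigcup_(i in [set: nat]) preimage_set_system setT (U i) measurable).

Lemma measurable_toZ : measurable_fun setT (id : T -> TZ).
Proof.
move=> _ A mA; rewrite setTI preimage_id.
have sub : sigma_random_set Z `<=` @measurable _ T.
  apply: smallest_sub; first exact: sigma_algebra_measurable.
  by move=> _ [G oG <-]; exact: hitZ.
exact: sub.
Qed.

Lemma measurable_toU : measurable_fun setT (id : T -> TU).
Proof.
move=> _ A mA; rewrite setTI preimage_id.
have sub : sigma_rv [set: nat] U `<=` @measurable _ T.
  apply: smallest_sub; first exact: sigma_algebra_measurable.
  move=> _ [i _ [B mB <-]]; exact: (uU i).1.
exact: sub.
Qed.

Lemma Ex_split (f : TZ * TU -> R) : bm f ->
  Ex P (fun w => f (w, w)) = Ex P (fun w => Ex P (fun w' => f (w, w'))).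
Proof.
move=> bf; apply: (Ex_independent_pair measurable_toZ measurable_toU _ bf).
by move=> A B mA mB; apply: hUZ.
Qed.

Lemma hitTZ (G : set R) : open G -> @measurable _ TZ [set w | Z w `&` G !=set0].
Proof. by move=> oG; apply: sub_sigma_algebra; exists G. Qed.

Lemma measurable_UTU i : measurable_fun setT (U i : TU -> R).
Proof. exact: (@measurable_sigma_rv _ _ _ nat [set: nat] U i Logic.I). Qed.

Lemma structural_law : has_beta_law P (fun w => gl w (U 0%N w)) (1 - alpha) theta.
Proof.
have a1 : 0 < 1 - alpha by case/andP: alpha01 => _; rewrite subr_gt0.
have mTZ := @measurable_gap_length R _ _ TZ TU Z closedZ hitTZ (U 0%N) (measurable_UTU 0).
have bTZ : bm (fun x : TZ * TU => gl x.1 (U 0%N x.2)).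
  by apply: bm01 => // x; exact: gap_length01.
apply: has_beta_law_moments => //.
- have h : measurable_fun setT (fun w : T => (w, w)) by exact: measurable_fun_pair.
  exact: (measurableT_comp (bm_gap_length 0).1 h).
- by move=> w; exact: gap_length01.
- by move=> n; rewrite (Ex_split (bmX n bTZ)) -gmom_moment.
Qed.

Lemma measurable_composition n lam : measurable [set w | sample_composition (Z w) n (U ^~ w) = lam].
Proof.
have mS := measurable_sample_composition closedZ hitZ n lam (fun i => (uU i).1).
have h : measurable_fun setT (fun w : T => (w, w)) by exact: measurable_fun_pair.
by have := h measurableT _ mS; rewrite setTI.
Qed.

Lemma composition_law s : s != [::] -> all (leq 1) s ->
  P [set w | sample_composition (Z w) (sumn s) (U ^~ w) = rev s] = (comp_weight s)%:E.
Proof.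
move=> sn s0; have mS := measurable_composition (sumn s) (rev s).
rewrite -fineP// -(Ex_indic P mS); congr EFin.
have mTZ := @measurable_sample_composition R _ _ TZ TU Z closedZ hitTZ (sumn s) U (rev s) measurable_UTU.
have bf : bm (fun x : TZ * TU => (sample_composition (Z x.1) (sumn s) (U ^~ x.2) == rev s)%:R : R).
  rewrite (_ : (fun x => _) = \1_[set x : TZ * TU | sample_composition (Z x.1) (sumn s) (fun i => U i x.2) = rev s]).
    exact: bm_indic.
  apply/funext => x; rewrite indicE; congr ((nat_of_bool _)%:R).
  by apply/eqP/idP; rewrite inE.
rewrite -sample_composition_law// -(Ex_split bf); congr Ex; apply/funext => w.
by rewrite indicE; congr ((nat_of_bool _)%:R); apply/idP/eqP; rewrite inE.
Qed.

End limit_laws.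

(** * The composition structure and the Markov chain *)

Section composition_shape.
Context (R : realType).

Lemma same_class_equiv (Z : set R) n (u : nat -> R) :
  {in [set: 'I_n]%SET & &, equivalence_rel (same_class Z u : rel 'I_n)}.
Proof.
have sym (i j : 'I_n) : same_class Z u i j = same_class Z u j i.
  rewrite /same_class eq_sym; congr (_ || _).
  by apply/asboolP/asboolP; exact: gap_at_sym.
have tr (i j k : 'I_n) : same_class Z u i j -> same_class Z u j k -> same_class Z u i k.
  rewrite /same_class => /orP[/eqP->//|/asboolP h1] /orP[/eqP<-|/asboolP h2].
    by rewrite asboolT ?orbT.
  by rewrite asboolT ?orbT//; exact: gap_at_trans h2.
move=> i j k _ _ _; split; first by rewrite /same_class eqxx.
move=> ij; apply/idP/idP; last exact: tr.
by apply: tr; rewrite sym.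
Qed.

Lemma sample_composition_valid (Z : set R) n (u : nat -> R) :
  is_composition n (sample_composition Z n u).
Proof.
rewrite /is_composition /sample_composition; set s := undup _.
have memT (i : 'I_n) : i \in sort (fun i j : 'I_n => u i <= u j) (enum 'I_n).
  by rewrite mem_sort mem_enum.
apply/andP; split.
  apply/allP => k /mapP[B]; rewrite mem_undup => /mapP[i _ ->] ->.
  by apply/card_gt0P; exists i; rewrite finset.inE /same_class eqxx.
rewrite sumnE big_map.
have cp := card_partition (equivalence_partitionP (@same_class_equiv Z n u)).
have nE : #|[set: 'I_n]%SET| = n by rewrite cardsT card_ord.
apply/eqP; apply: (etrans _ nE); apply: (etrans _ (esym cp)).
rewrite big_uniq ?undup_uniq//=; apply: eq_bigl => B.
rewrite mem_undup; apply/mapP/finset.imsetP => -[i _ ->]; exists i => //.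
  by apply/finset.setP => j; rewrite !finset.inE.
by apply/finset.setP => j; rewrite !finset.inE.
Qed.

End composition_shape.

Lemma measurable_discrete d (T : measurableType d) (A : countType) (C : T -> A) (D : A -> Prop) :
  (forall a, measurable [set w | C w = a]) -> measurable [set w | D (C w)].
Proof.
move=> mC; rewrite (_ : mkset _ = \bigcup_k (if unpickle k is Some a then
    if `[< D a >] then [set w | C w = a] else set0 else set0)).
  by apply: bigcupT_measurable => k; case: unpickle => // a; case: ifP.
apply/seteqP; split => w /=.
  by move=> Dw; exists (pickle (C w)) => //; rewrite pickleK asboolT.
by move=> [k _]; case: unpickle => // a; case: asboolP => // Da /= ->.
Qed.

Lemma mutually_independent_inj d (T : measurableType d) (R : realType) (P : probability T R)
    (U : nat -> T -> R) (u : nat -> nat) : injective u ->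
  mutually_independent P U -> mutually_independent P (fun k => U (u k)).
Proof.
move=> iu iU J B uJ mB.
pose g m := if pselect (exists k, u k = m) is left e then projT1 (cid e) else 0%N.
have gK k : g (u k) = k.
  rewrite /g; case: pselect => [e|[]]; last by exists k.
  by apply: iu; exact: projT2 (cid e).
have := iU (map u J) (fun m => B (g m)); rewrite map_inj_uniq// => /(_ uJ (fun i => mB _)).
rewrite big_map; under eq_bigr do rewrite gK.
move=> <-; congr (P _); apply/seteqP; split => w /=.
  by move=> h _ /mapP[k kJ ->]; rewrite gK; exact: h.
by move=> h k kJ; have := h (u k); rewrite gK; apply; apply: map_f.
Qed.

Section composition_structure.
Context (R : realType) (alpha theta : R).
Hypotheses (alpha01 : 0 <= alpha < 1) (theta0 : 0 < theta).
Context (d : measure_display) (T : measurableType d) (P : probability T R).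
Variables (nu : {measure set R -> \bar R}) (Y : R -> {RV P >-> R}) (X : {RV P >-> R}).
Hypotheses (hnu : is_levy_measure alpha theta nu) (hY : is_subordinator nu Y)
  (hX : has_stationary_delay_law P nu X).
Hypothesis hXY : indep_systems P (sigma_rv [set: unit] (fun _ => X))
             (sigma_rv [set t : R | 0 <= t] (fun t => Y t)).
Variables (Z : T -> set R) (U : nat -> T -> R).
Hypothesis hZ : forall w, Z w = exp_neg_set (stationary_range (X w) (fun t => Y t w)).
Hypothesis uU : forall i, is_uniform P (U i).
Hypothesis hUind : mutually_independent P U.
Hypothesis hUZ : indep_systems P (sigma_random_set Z) (sigma_rv [set: nat] U).
Local Notation gl w u := (gap_length (gap_at (Z w) u)).

Let indep_sub (u : nat -> nat) :
  indep_systems P (sigma_random_set Z) (sigma_rv [set: nat] (fun k => U (u k))).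
Proof.
move=> A B hA hB; apply: hUZ => //; move: B hB; apply: smallest_sub.
  exact: smallest_sigma_algebra.
by move=> t [i _ h]; apply: sub_sigma_algebra; exists (u i).
Qed.

(** Omitting sample point i amounts to sampling with the subsequence given by [bump i]; this states
    that its composition has an unchanged law. *)
Lemma composition_law_sub (u : nat -> nat) s : injective u -> s != [::] -> all (leq 1) s ->
  P [set w | sample_composition (Z w) (sumn s) (fun k => U (u k) w) = rev s] =
  (comp_weight alpha theta s)%:E.
Proof.
move=> iu; exact: (composition_law alpha01 theta0 hnu hY hX hXY hZ (fun i => uU (u i))
  (mutually_independent_inj iu hUind) (@indep_sub u)).
Qed.

Lemma gap_length_gt0_diag i : {ae P, forall w, 0 < gl w (U i w)}.
Proof.
have a1 : 0 < 1 - alpha by case/andP: alpha01 => _; rewrite subr_gt0.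
have [mf hf] := structural_law alpha01 theta0 hnu hY hX hXY hZ (fun j => uU (j + i)%N)
  (@indep_sub (fun j => (j + i)%N)).
exists [set w | gl w (U i w) = 0]; split.
- by have := mf measurableT [set 0] (measurable_set1 0); rewrite setTI.
- have := hf [set 0] (measurable_set1 0); rewrite /preimage /= add0n => ->.
  rewrite (_ : _ `&` _ = set0) ?integral_set0//.
  by apply/seteqP; split => // x [->]; rewrite /= in_itv/= ltxx.
- move=> w /=; have /andP[h _] := gap_length01 (Z w) (U i w).
  by rewrite lt_neqAle h andbT => /negP; rewrite negbK => /eqP.
Qed.

Lemma ae_labelling n : {ae P, forall w, exists K (l : 'I_n -> nat),
  [/\ forall i j : 'I_n, same_class (Z w) (U ^~ w) i j = (l i == l j),
      forall i j : 'I_n, U i w <= U j w -> (l i <= l j)%N & forall i, (l i < K)%N]}.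
Proof.
have h1 : {ae P, forall w, forall i, 0 < gl w (U i w)} by apply: ae_foralln; exact: gap_length_gt0_diag.
have h2 : {ae P, forall w', forall i, 0 < U i w' < 1}.
  apply: ae_foralln => i.
  exists [set w | ~ (0 < U i w < 1)]; split => //; last exact: is_uniform_01.
  rewrite (_ : mkset _ = U i @^-1` (~` `]0, 1[%classic)).
    by rewrite -[X in measurable X]setTI; apply: (uU i).1 => //; exact: measurableC.
  by apply/seteqP; split => w' /=; rewrite in_itv.
have h3 := ae_good alpha01 theta0 hnu hY hX.
apply: filterS3 h1 h2 h3 => w k1 k2 [x0 yv].
have [[hy0 hyle] yrc _ _ _] := hY.
have hu i : 0 < U i w < 1 /\ ~ exp_neg_set (stationary_range (X w) (fun t => Y t w)) (U i w).
  split; first exact: k2.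
  rewrite -hZ => ZU; have := k1 i; rewrite gap_length_notin ?ltxx// => -[_]; exact.
pose K N := (N * 2 ^ N).+1.
have hK N : ((N * 2 ^ N).+1 <= K N)%N by [].
have [N _ /(_ N (leqnn N)) [l1 l2]] := zgrid_labels x0 (hy0 w) (hyle w) (yrc w) yv hK n hu.
pose lb (i : nat) := lab (zgrid (X w) (fun t => Y t w) N) (K N) (U i w).
have hlb (i : 'I_n) : (lb i < K N)%N.
  have nz b : zgrid (X w) (fun t => Y t w) N b.+1 <= zgrid (X w) (fun t => Y t w) N b.
    by apply: zgrid_noninc => // s t; exact: hyle.
  by have [] := labP nz (l1 i).
exists (K N), (fun i => (K N).-1 - lb i)%N; split.
- move=> i j; rewrite hZ l2 -/(lb i) -/(lb j); have := hlb i; have := hlb j.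
  by move=> hj hi; apply/eqP/eqP; lia.
- move=> i j ij; have := lab_le (zgrid (X w) (fun t => Y t w) N) (K N) ij.
  by rewrite -/(lb i) -/(lb j); lia.
- by move=> i; have := hlb i; lia.
Qed.

Let mSC (u : nat -> nat) n lam : measurable [set w | sample_composition (Z w) n (fun k => U (u k) w) = lam].
Proof. exact: (measurable_composition hY hZ (fun i => uU (u i))). Qed.

Let mI (A : T -> bool) : measurable [set w | A w] -> bm (fun w => (A w)%:R : R) /\
  Ex P (fun w => (A w)%:R) = fine (P [set w | A w]).
Proof.
move=> mA; have -> : (fun w => (A w)%:R : R) = \1_[set w | A w].
  by apply/funext => w; rewrite indicE; congr ((nat_of_bool _)%:R); apply/idP/idP; rewrite inE.
by split; [exact: bm_indic|exact: Ex_indic].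
Qed.

(** Summed over the deleted ball, the compositions after deletion are almost surely those of the
    sample with one point omitted ([sum_delete_sample]). Each of the latter has the law of the
    composition one size smaller. *)
Lemma sample_composition_structure (C : nat -> T -> seq nat) :
  (forall n w, C n w = sample_composition (Z w) n (fun i => U i w)) ->
  is_composition_structure P C.
Proof.
move=> hC; split.
- by move=> n w _; rewrite hC; exact: sample_composition_valid.
- move=> n lam _; have := mSC id n lam; congr measurable.
  by apply/seteqP; split => w /=; rewrite hC.
move=> [//|n] mu n2; rewrite ltnS in n2.
have eqS (A : pred (seq nat)) k : [set w | A (C k w)] = [set w | A (sample_composition (Z w) k (fun i => U i w))].
  by apply/seteqP; split => w /=; rewrite hC.
have mA (u : nat -> nat) k (A : pred (seq nat)) : measurable [set w | A (sample_composition (Z w) k (fun i => U (u i) w))].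
  by apply: (measurable_discrete (fun l => A l)) => l; exact: mSC.
pose f (j : nat) w : R := (delete_ball (sample_composition (Z w) n.+1 (fun i => U i w)) j == mu)%:R.
pose g (u : nat -> nat) w : R := (sample_composition (Z w) n (fun i => U (u i) w) == mu)%:R.
have [bf Ef] : (forall j, bm (f j)) /\ forall j, Ex P (f j) = fine (P [set w | delete_ball (C n.+1 w) j = mu]).
  split=> j; have [h1 h2] := mI (mA id n.+1 (fun l => delete_ball l j == mu)) => //.
  rewrite /f h2; congr (fine (P _)); apply/seteqP; split => w /=; rewrite hC; [by move/eqP|by move=> ->].
have [bg Eg] : (forall u, bm (g u)) /\ forall u, injective u -> Ex P (g u) = fine (P [set w | C n w = mu]).
  split=> u; first by have [] := mI (mA u n (fun l => l == mu)).
  move=> iu; have [_ h2] := mI (mA u n (fun l => l == mu)); rewrite /g h2.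
  have e1 (v : nat -> nat) : [set w | sample_composition (Z w) n (fun i => U (v i) w) == mu] =
      [set w | sample_composition (Z w) n (fun i => U (v i) w) = mu].
    by apply/seteqP; split => w /= /eqP.
  rewrite e1; have -> : [set w | C n w = mu] = [set w | sample_composition (Z w) n (fun i => U (id i) w) = mu].
    by apply/seteqP; split => w /=; rewrite hC.
  (* The law is known for genuine compositions only; other values are never taken. *)
  have [/andP[mu0 /eqP mus]|nv] := boolP (is_composition n mu).
    have rs : rev mu != [::].
      by apply/eqP => /(congr1 rev); rewrite revK => E; move: n2; rewrite -mus E.
    have r0 : all (leq 1) (rev mu) by rewrite all_rev.
    have h (v : nat -> nat) : injective v ->
        P [set w | sample_composition (Z w) n (fun i => U (v i) w) = mu] = (comp_weight alpha theta (rev mu))%:E.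
      by move=> iv; rewrite -(composition_law_sub iv rs r0) sumn_rev mus revK.
    by rewrite !h.
  have h (v : nat -> nat) : [set w | sample_composition (Z w) n (fun i => U (v i) w) = mu] = set0.
    apply/seteqP; split => // w /= E; move/negP: nv; apply; rewrite -E.
    exact: sample_composition_valid.
  by rewrite !h.
have main : \sum_(j < n.+1) Ex P (f j) = n.+1%:R * fine (P [set w | C n w = mu]).
  transitivity (\sum_(i < n.+1) Ex P (g (bump i))); last first.
    transitivity (\sum_(i < n.+1) fine (P [set w | C n w = mu])); last first.
      by rewrite sumr_const card_ord mulr_natl.
    by apply: eq_bigr => i _; rewrite Eg//; exact: (can_inj (@bumpK i)).
  rewrite -(Ex_sum P (index_enum 'I_n.+1) (p := xpredT) (F := fun j w => f j w)); last by move=> j _; exact: bf.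
  rewrite -(Ex_sum P (index_enum 'I_n.+1) (p := xpredT) (F := fun i w => g (bump i) w)); last by move=> j _; exact: bg.
  apply: Ex_ae; [by apply: bm_sum => j _; exact: bf|by apply: bm_sum => j _; exact: bg|].
  apply: filterS (ae_labelling n.+1) => w [K [l [h1 h2 h3]]].
  exact: (sum_delete_sample (fun l => (l == mu)%:R : R) h1 h2 h3).
have mD j : measurable [set w | delete_ball (C n.+1 w) j = mu].
  have := mA id n.+1 (fun l => delete_ball l j == mu); congr measurable.
  by apply/seteqP; split => v /=; rewrite hC => /eqP.
rewrite (eq_bigr (fun j : 'I_n.+1 => (Ex P (f j))%:E)); last by move=> j _; rewrite Ef fineP.
rewrite sumEFin main -EFinM mulKf ?pnatr_eq0// fineP//.
have := mSC id n mu; congr measurable.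
by apply/seteqP; split => w /=; rewrite hC.
Qed.

End composition_structure.

(** * Transition probabilities of the chain of left ends *)

Section transition_weights.
Context (R : realType) (alpha theta : R).
Hypotheses (alpha01 : 0 <= alpha < 1) (theta0 : 0 < theta).
Let a := 1 - alpha.
Let c := a + theta.

Let a0 : 0 < a. Proof. by case/andP: alpha01; rewrite /a subr_gt0. Qed.
Let c0 : 0 < c. Proof. exact: addr_gt0. Qed.

(* The probability that the box opened at position x + 1 extends beyond position x + 1 + j. *)
Definition box_tail (x j : nat) : R :=
  'C(x + j, x)%:R * rf (1 - alpha) j * rf (1 - alpha + theta) x / rf (1 - alpha + theta) (x + j).

Lemma box_tail0 x : box_tail x 0 = 1.
Proof. by rewrite /box_tail addn0 binn rf0 !mul1r divff// rf_neq0. Qed.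

Lemma box_tail_gt0 x j : 0 < box_tail x j.
Proof. by rewrite /box_tail divr_gt0 ?mulr_gt0 ?rf_gt0// ltr0n bin_gt0 leq_addr. Qed.

(** The subtracted fraction is the hazard rate: the conditional probability that the box has exactly
    j + 1 balls, given that it has more than j. *)
Lemma box_tailS x j : box_tail x j.+1 =
  box_tail x j * (1 - (j.+1%:R * theta + x%:R * alpha) / (j.+1%:R * (c + (x + j)%:R))).
Proof.
have hb : j.+1%:R * 'C(x + j.+1, x)%:R = (x + j).+1%:R * 'C(x + j, x)%:R :> R.
  rewrite -!natrM -[in LHS](bin_sub (leq_addr _ _)) -[in RHS](bin_sub (leq_addr _ _)) !addKn.
  by rewrite -mul_bin_diag addnS.
have j1 : j.+1%:R != 0 :> R by rewrite pnatr_eq0.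
have hb' : 'C(x + j.+1, x)%:R = (x + j).+1%:R * 'C(x + j, x)%:R / j.+1%:R :> R.
  by rewrite -hb mulrC mulKf.
have h1 := rf_neq0 (x + j) c0.
have h2 : c + (x + j)%:R != 0 by rewrite gt_eqF// ltr_wpDr.
rewrite /box_tail hb' addnS !rfS -/a -/c.
move: h1 h2 j1; rewrite -!natr1 natrD => h1 h2 j1.
have -> : theta = c - a by rewrite /c; ring.
have -> : alpha = 1 - a by rewrite /a; ring.
move: (c) (a) h1 h2 => c' a' h1 h2.
by field; rewrite h1 h2 j1.
Qed.

Let drop x j : 0 <= (j.+1%:R * theta + x%:R * alpha) / (j.+1%:R * (c + (x + j)%:R)).
Proof.
have /andP[al0 _] := alpha01.
have cp : 0 <= c + (x + j)%:R by rewrite addr_ge0 ?ler0n// ltW.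
by rewrite divr_ge0 ?addr_ge0 ?mulr_ge0 ?ler0n ?(ltW theta0).
Qed.

Lemma box_tail_dec x j : box_tail x j.+1 <= box_tail x j.
Proof.
rewrite box_tailS ler_piMr ?(ltW (box_tail_gt0 _ _))//.
by rewrite gerBl drop.
Qed.

Lemma box_tail_noninc x i j : (i <= j)%N -> box_tail x j <= box_tail x i.
Proof. by move=> ij; apply: (noninc_le (box_tail_dec x)). Qed.

(** The hazard rate is at least theta / (c + x + j), whose sum over j diverges. Hence every box is
    finite and the transition probabilities sum to 1. *)
Lemma box_tail_cvg0 x : box_tail x j @[j --> \oo] --> (0 : R).
Proof.
pose y j := theta / (c + (x + j)%:R).
have /andP[al0 al1] := alpha01.
have cp j : 0 < c + (x + j)%:R by rewrite ltr_wpDr.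
have tc : theta <= c by rewrite /c lerDr ltW.
have y01 j : 0 <= y j <= 1.
  rewrite /y; apply/andP; split; first by rewrite divr_ge0 ?ltW.
  by rewrite ler_pdivrMr// mul1r (le_trans tc)// lerDl ler0n.
have hp : \prod_(j < n) (1 - y j) @[n --> \oo] --> (0 : R).
  apply: prod_onem_cvg0 => //.
  have k0 : 0 < theta / (c + x%:R + 1) by rewrite divr_gt0// addr_gt0// ltr_wpDr.
  apply: (dvg_series_harmonic_like k0) => j.
  rewrite /y -mulrA -invfM ler_pM2l// lef_pV2 ?posrE ?cp ?mulr_gt0 ?ltr0n//.
    rewrite natrD -natr1; have := ler0n R j; have := ler0n R x; have := ltW c0; nra.
  by rewrite addr_gt0// ltr_wpDr.
apply: (squeeze_cvgr _ (cvg_cst 0) hp); apply: nearW => n; rewrite ltW ?box_tail_gt0//=.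
elim: n => [|n IH]; first by rewrite box_tail0 big_ord0.
rewrite big_ord_recr /= box_tailS; apply: ler_pM => //.
- exact: ltW (box_tail_gt0 _ _).
- rewrite subr_ge0 ler_pdivrMr ?mulr_gt0 ?ltr0n// mul1r mulrDr lerD//.
    by rewrite ler_wpM2l.
  rewrite -natrM; have x1 : x%:R * alpha <= x%:R by rewrite ler_piMr// ltW.
  apply: (le_trans x1); rewrite ler_nat; lia.
- rewrite lerB// /y ler_pdivlMr ?mulr_gt0 ?ltr0n//.
  have -> : theta / (c + (x + n)%:R) * (n.+1%:R * (c + (x + n)%:R)) = n.+1%:R * theta.
    by rewrite mulrCA divfK ?gt_eqF.
  by rewrite lerDl mulr_ge0.
Qed.

(* The state 0 is never visited; it is sent to 1. *)
Definition trans (i y : nat) : R :=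
  if i is x.+1 then if (i < y)%N then box_tail x (y - i).-1 - box_tail x (y - i) else 0
  else (y == 1)%N%:R.

Arguments trans : simpl never.

Lemma trans_ge0 i y : 0 <= trans i y.
Proof.
case: i => [|x]; rewrite /trans; first exact: ler0n.
case: ifPn => // h; rewrite subr_ge0.
have : (0 < y - x.+1)%N by rewrite subn_gt0.
by case: (y - x.+1)%N => // j _; exact: box_tail_dec.
Qed.

Lemma sum_trans x n : \sum_(0 <= y < x.+2 + n) trans x.+1 y = 1 - box_tail x n.
Proof.
elim: n => [|n IH].
  rewrite addn0 box_tail0 subrr big_nat big1 // => y /andP[_ hy].
  by rewrite /trans ltnNge -ltnS hy.
rewrite addnS big_nat_recr//= IH /trans.
have -> : (x.+1 < x.+2 + n)%N by rewrite addSn ltnS leq_addr.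
have -> : (x.+2 + n - x.+1)%N = n.+1 by lia.
by rewrite /= addrA subrK.
Qed.

Lemma trans_sum1 i : (\sum_(0 <= j <oo) (trans i j)%:E = 1)%E.
Proof.
apply: cvg_lim => //.
have -> : (fun n => \sum_(0 <= j < n) (trans i j)%:E)%E = EFin \o (fun n => \sum_(0 <= j < n) trans i j).
  by apply/funext => n; rewrite /= sumEFin.
apply: cvg_EFin; first exact: nearW.
rewrite /comp /=; case: i => [|x].
  apply: cvg_near_cst; exists 2%N => // n /= n2; rewrite /trans.
  rewrite (bigD1_seq 1%N) ?iota_uniq ?mem_index_iota ?n2//= ?eqxx big1 ?addr0// => j /negbTE j1.
  by rewrite j1.
rewrite -(@cvg_shiftn x.+2) /=.
have -> : (fun n => \sum_(0 <= j < n + x.+2) trans x.+1 j) = fun n => 1 - box_tail x n.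
  by apply/funext => n; rewrite addnC sum_trans.
have h : 1 - box_tail x n @[n --> \oo] --> (1 - 0 : R).
  by apply: cvgB; [exact: cvg_cst|exact: box_tail_cvg0].
by rewrite subr0 in h.
Qed.

(* The renewal decomposition of a composition read from left to right. *)
Definition start (lam : seq nat) (s : nat) : nat := (sumn (take s lam)).+1.
Arguments start : simpl never.

(** This is E e^(-xX), the probability that x sample points all lie to the left of the meander. *)
Let s_ (x : nat) : R := rf theta x / rf (1 - alpha + theta) x.

(** The parenthesis is the probability that the rightmost part of the regenerative composition of x
    + m is m. Weighting by [s_] reverses this right-to-left description into a left-to-right
    transition, and the weights telescope in [creg_trans]. *)
Lemma trans_ratio x m : (0 < m)%N -> trans x.+1 (x.+1 + m) =
  s_ (x + m) * ('C(x + m, m)%:R * levyD alpha theta x m / levyPhi alpha theta (x + m)) / s_ x.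
Proof.
case: m => // j _; rewrite /trans (_ : (x.+1 < x.+1 + j.+1)%N); last by rewrite addnS ltnS leq_addr.
rewrite addKn /= box_tailS mulrBr mulr1 opprB addrC subrK.
have hb : (x + j.+1)%:R * 'C(x + j, x)%:R = j.+1%:R * 'C(x + j.+1, j.+1)%:R :> R.
  rewrite -!natrM -[in LHS](bin_sub (leq_addr _ _)) !addKn.
  by rewrite -mul_bin_diag addnS.
have j1 : j.+1%:R != 0 :> R by rewrite pnatr_eq0.
have hb' : 'C(x + j.+1, j.+1)%:R = (x + j.+1)%:R * 'C(x + j, x)%:R / j.+1%:R :> R.
  by rewrite hb mulrC mulKf.
have h1 := rf_neq0 (x + j) c0.
have h2 : c + (x + j)%:R != 0 by rewrite gt_eqF// ltr_wpDr.
have h3 := rf_neq0 (x + j.+1) theta0; have h4 := rf_neq0 x theta0; have h5 := rf_neq0 x c0.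
have h6 : (x + j.+1)%:R != 0 :> R by rewrite pnatr_eq0 addnS.
rewrite /box_tail /s_ /levyD /levyPhi hb' /= -/a -/c; move: h3 h6.
have -> : rf c (x + j.+1) = rf c (x + j) * (c + (x + j)%:R) by rewrite addnS rfS.
move: (rf theta (x + j.+1)) (rf theta x) h4 (rf c x) h5 (rf c (x + j)) h1 (rf a j) ('C(x + j, x)%:R : R).
move=> p1 p2 h4 p3 h5 p4 h1 p5 p6 h3 h6.
move: j1 h2 h6; rewrite addnS -!natr1 natrD => j1 h2 h6.
by field; rewrite ?h1 ?h2 ?h3 ?h4 ?h5 ?h6 ?j1.
Qed.

Lemma creg_trans lam : all (leq 1) lam ->
  s_ (sumn lam) * creg alpha theta (rev lam) =
  \prod_(s < size lam) trans (start lam s) (start lam s.+1).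
Proof.
elim/last_ind: lam => [_|lam m IH].
  by rewrite big_ord0 /= /s_ !rf0 divr1 mul1r.
rewrite all_rcons => /andP[m0 h]; rewrite size_rcons big_ord_recr/=.
have -> : \prod_(i < size lam) trans (start (rcons lam m) i) (start (rcons lam m) i.+1) =
    \prod_(s < size lam) trans (start lam s) (start lam s.+1).
  by apply: eq_bigr => i _; rewrite /start -!cats1 !takel_cat// ltnW.
rewrite -IH// rev_rcons /= sumn_rcons sumn_rev.
have -> : start (rcons lam m) (size lam) = (sumn lam).+1.
  by rewrite /start -cats1 takel_cat// take_size.
have -> : start (rcons lam m) (size lam).+1 = ((sumn lam).+1 + m)%N.
  by rewrite /start take_oversize ?size_rcons// sumn_rcons addSn.
rewrite trans_ratio// [(m + sumn lam)%N]addnC.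
have hs : s_ (sumn lam) != 0 by rewrite /s_ mulf_neq0 ?invr_neq0 ?rf_neq0.
move: (creg alpha theta (rev lam)) (s_ (sumn lam)) hs => p1 p2 hs.
move: ('C(sumn lam + m, m)%:R * levyD alpha theta (sumn lam) m / levyPhi alpha theta (sumn lam + m)) => q.
by field.
Qed.

(** The last box may continue in a larger sample. Its two cases in [comp_weight], to the left of the
    meander or inside it, merge into the single event that the chain jumps past the last ball. *)
Lemma comp_weight_trans lam m : all (leq 1) lam -> (0 < m)%N ->
  comp_weight alpha theta (rev (rcons lam m)) =
  (\prod_(s < size lam) trans (start lam s) (start lam s.+1)) * box_tail (sumn lam) m.-1.
Proof.
move=> h m0; rewrite -creg_trans// rev_rcons /comp_weight /= sumn_rev.
set x := sumn lam; case: m m0 => // j _.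
have hb : (x + j.+1)%:R * 'C(x + j, x)%:R = j.+1%:R * 'C(j.+1 + x, j.+1)%:R :> R.
  rewrite -!natrM [(j.+1 + x)%N]addnC -[in LHS](bin_sub (leq_addr _ _)) !addKn.
  by rewrite -mul_bin_diag addnS.
have j1 : j.+1%:R != 0 :> R by rewrite pnatr_eq0.
have hb' : 'C(j.+1 + x, j.+1)%:R = (x + j.+1)%:R * 'C(x + j, x)%:R / j.+1%:R :> R.
  by rewrite hb mulrC mulKf.
have h1 := rf_neq0 (x + j) c0.
have h2 : c + (x + j)%:R != 0 by rewrite gt_eqF// ltr_wpDr.
have h3 := rf_neq0 (x + j.+1) theta0; have h4 := rf_neq0 x theta0; have h5 := rf_neq0 x c0.
have h6 : (x + j.+1)%:R != 0 :> R by rewrite pnatr_eq0 addnS.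
rewrite hb' [(j.+1 + x)%N]addnC /box_tail /s_ /bmom /levyD /levyPhi /= !add0n rf0 [(j.+1 + x)%N]addnC -/a -/c; move: h3 h6.
have -> : rf c (x + j.+1) = rf c (x + j) * (c + (x + j)%:R) by rewrite addnS rfS.
have -> : rf a j.+1 = rf a j * (a + j%:R) by rewrite rfS.
move: (rf theta (x + j.+1)) (rf theta x) h4 (rf c x) h5 (rf c (x + j)) h1 (rf a j) ('C(x + j, x)%:R : R)
  (creg alpha theta (rev lam)).
move=> p1 p2 h4 p3 h5 p4 h1 p5 p6 p7 h3 h6.
move: j1 h2 h6; rewrite addnS -!natr1 natrD => j1 h2 h6.
have -> : theta = c - a by rewrite /c; ring.
have -> : alpha = 1 - a by rewrite /a; ring.
move: (c) (a) h2 => c' a' h2.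
by field; rewrite ?h1 ?h2 ?h3 ?h4 ?h5 ?h6 ?j1.
Qed.

End transition_weights.

(** All boxes but the last fix the next visit exactly; the last one only says that the next visit
    lies beyond the string. The start x and the chain are general so that induction can shift
    both. *)
Lemma binary_form_visits (Q' : nat -> nat) x lam : (forall t, Q' t < Q' t.+1)%N -> (x <= Q' 0)%N -> all (leq 1) lam ->
  [seq `[< exists t, Q' t = j >] | j <- iota x (sumn lam)] = binary_form lam <->
  (forall s, (s < size lam)%N -> Q' s = (x + sumn (take s lam))%N) /\ (x + sumn lam <= Q' (size lam))%N.
Proof.
elim: lam x Q' => [|m lam IH] x Q' inc xQ /=.
  by move=> _; split => // _; rewrite addn0.
move=> /andP[m0 h].
have mono s t : (s < t)%N -> (Q' s < Q' t)%N.
  elim: t => // t IHt; rewrite ltnS leq_eqVlt => /orP[/eqP ->//|/IHt h1].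
  exact: ltn_trans h1 (inc t).
have incS t : (Q' t.+1 < Q' t.+2)%N by exact: inc.
have blk : size [seq `[< exists t, Q' t = j >] | j <- iota x m] = size (true :: nseq m.-1 false).
  by rewrite size_map size_iota /= size_nseq prednK.
have vS y : (Q' 0 < y)%N -> `[< exists t, Q' t = y >] = `[< exists t, Q' t.+1 = y >].
  move=> y0; apply/asboolP/asboolP => -[t E]; last by exists t.+1.
  by case: t E => [E|t E]; [move: y0; rewrite E ltnn|exists t].
have tail_eq : (Q' 0 < x + m)%N ->
    [seq `[< exists t, Q' t = j >] | j <- iota (x + m) (sumn lam)] =
    [seq `[< exists t, Q' t.+1 = j >] | j <- iota (x + m) (sumn lam)].
  move=> h1; apply/eq_in_map => y; rewrite mem_iota => /andP[h2 _]; apply: vS.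
  exact: leq_trans h1 h2.
rewrite iotaD map_cat /binary_form /= -/(binary_form lam) -cat_cons; split.
  move=> /eqP; rewrite eqseq_cat// => /andP[/eqP e1 /eqP e2].
  have nthx k : (k < m)%N -> `[< exists t, Q' t = (x + k)%N >] = (k == 0)%N.
    move=> km; have := congr1 (fun s => nth false s k) e1.
    rewrite (nth_map 0%N) ?size_iota// nth_iota// => ->.
    by case: k km => // k km; rewrite /= nth_nseq if_same.
  have [t0 Et] : exists t, Q' t = x.
    by have := nthx 0%N m0; rewrite addn0 => /asboolP.
  have Q0 : Q' 0 = x.
    apply/eqP; rewrite eqn_leq xQ andbT -Et.
    by case: t0 {Et} => // t0; rewrite ltnW// mono.
  have Q1 : (x + m <= Q' 1)%N.
    rewrite leqNgt; apply/negP => h1.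
    have h2 : (x < Q' 1)%N by rewrite -Q0 inc.
    have := nthx (Q' 1 - x)%N; rewrite subnKC ?(ltnW h2)//.
    have -> : (Q' 1 - x < m)%N by rewrite ltn_subLR// ltnW.
    move=> /(_ isT); rewrite asboolT; last by exists 1%N.
    by rewrite subn_eq0 leqNgt h2.
  have xm : (Q' 0 < x + m)%N by rewrite Q0 -[X in (X < _)%N]addn0 ltn_add2l.
  have [h3 h4] := (IH (x + m)%N (fun t => Q' t.+1) incS Q1 h).1 (etrans (esym (tail_eq xm)) e2).
  split; last by rewrite addnA.
  case=> [|s]; first by rewrite take0 addn0.
  by rewrite ltnS => sl; rewrite /= addnA -h3.
move=> [h1 h2].
have Q0 : Q' 0 = x by rewrite h1//= ?take0 addn0.
have xm : (Q' 0 < x + m)%N by rewrite Q0 -[X in (X < _)%N]addn0 ltn_add2l.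
have Q1 : (x + m <= Q' 1)%N.
  case: (lam) h1 h2 => [|k l] h1 h2; first by move: h2; rewrite /= addn0.
  by rewrite (h1 1%N)//= ?take0 addn0.
congr cat.
  case: m m0 {IH h1 h2 blk tail_eq xm} Q1 => // m _ Q1 /=; congr (_ :: _).
    by apply: asboolT; exists 0%N.
  apply: (@eq_from_nth _ false); first by rewrite size_map size_iota size_nseq.
  move=> k; rewrite size_map size_iota => km; rewrite nth_nseq if_same (nth_map 0%N) ?size_iota//.
  rewrite nth_iota//; apply/asboolP => -[t E].
  case: t E => [|t] E; first by move: E; rewrite Q0; lia.
  have : (Q' 1 <= Q' t.+1)%N by case: t {E} => // t; rewrite ltnW// mono.
  by rewrite E; move: Q1; lia.
rewrite tail_eq//; apply/(IH (x + m)%N (fun t => Q' t.+1) incS Q1 h); split.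
  by move=> s sl; rewrite h1//= addnA.
by rewrite -addnA.
Qed.


Section chain.
Context (R : realType) (alpha theta : R).
Hypotheses (alpha01 : 0 <= alpha < 1) (theta0 : 0 < theta).
Context (d : measure_display) (T : measurableType d) (P : probability T R).
Variable U : nat -> T -> R.
Hypothesis uU : forall i, is_uniform P (U i).
Hypothesis hUind : mutually_independent P U.
Local Notation tail := (box_tail alpha theta).
Local Notation tr := (trans alpha theta).

Let tail_ex x (u : R) : 0 < u -> exists j, tail x j.+1 < u.
Proof.
move=> u0; have h := box_tail_cvg0 alpha01 theta0 x.
have [N _ hN] := (cvgr_lt _ h) _ u0.
by exists N; apply: hN => /=.
Qed.

(* Inversion of the distribution function of the transition out of i. *)
Definition step (i : nat) (u : R) : nat :=
  if i is x.+1 then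
    (i + (if pselect (0 < u)%R is left u0 then ex_minn (tail_ex x u0) else 0).+1)%N
  else 1.

Arguments step : simpl never.

Lemma step_inc i u : (i < step i u)%N.
Proof. by case: i => // x; rewrite /step addnS ltnS leq_addr. Qed.

Lemma step_gt x k u : (x.+1 + k < step x.+1 u)%N = (k == 0)%N || (0 < u <= tail x k).
Proof.
rewrite /step ltn_add2l ltnS; case: pselect => u0; last first.
  by rewrite leqn0; move/negP/negbTE : u0 => ->; rewrite orbF.
rewrite u0 /=; case: ex_minnP => j hj jmin.
case: k => // k /=; apply/idP/idP => h.
  rewrite leNgt; apply/negP => /jmin; by rewrite leqNgt h.
rewrite ltnNge; apply/negP => jk.
have := box_tail_noninc alpha01 theta0 x (_ : (j.+1 <= k.+1)%N); rewrite ltnS => /(_ jk).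
by move=> h2; move: (le_lt_trans h2 hj); rewrite ltNge h.
Qed.

Let mgt x k : measurable [set u : R | (x.+1 + k < step x.+1 u)%N].
Proof.
case: k => [|k].
  by rewrite (_ : mkset _ = setT)//; apply/seteqP; split => // u _; rewrite /= step_gt.
rewrite (_ : mkset _ = `]0, tail x k.+1]%classic)//.
by apply/seteqP; split => u /=; rewrite step_gt in_itv.
Qed.

Lemma measurable_step i (A : nat -> Prop) : measurable [set u : R | A (step i u)].
Proof.
apply: (measurable_discrete A) => y; case: i => [|x].
  rewrite /step; case: (eqVneq 1%N y) => [->|h].
    by rewrite (_ : mkset _ = setT)//; apply/seteqP; split.
  rewrite (_ : mkset _ = set0)//; apply/seteqP; split => // u /= e.
  by move: h; rewrite e eqxx.
have [yx|xy] := leqP y x.+1.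
  rewrite (_ : mkset _ = set0)//; apply/seteqP; split => // u /= e.
  by have := step_inc x.+1 u; rewrite e ltnNge yx.
have [k ->] : exists k, y = (x.+1 + k.+1)%N by exists (y - x.+1).-1; lia.
rewrite (_ : mkset _ = [set u : R | (x.+1 + k < step x.+1 u)%N] `\` [set u : R | (x.+1 + k.+1 < step x.+1 u)%N]).
  exact: measurableD.
apply/seteqP; split => u /=; first by move=> ->; rewrite addnS; split; [exact: ltnSn|rewrite ltnn].
by move=> [h /negP]; rewrite -leqNgt => h2; apply/eqP; rewrite eqn_leq h2 addnS.
Qed.

Lemma step_tail t x k : fine (P (U t @^-1` [set u | (x.+1 + k < step x.+1 u)%N])) = tail x k.
Proof.
case: k => [|k].
  rewrite box_tail0//; rewrite (_ : [set u | _] = setT); first exact: (congr1 fine (probability_setT P)).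
  by apply/seteqP; split => // u _; rewrite /= step_gt.
rewrite (_ : [set u | _] = `]0, tail x k.+1]%classic); last first.
  by apply/seteqP; split => u /=; rewrite step_gt in_itv.
have t0 := box_tail_gt0 alpha01 theta0 x k.+1.
have t1 : tail x k.+1 <= 1 by rewrite -(box_tail0 alpha01 theta0 x); apply: box_tail_noninc.
rewrite (is_uniform_sub (uU t))//.
  by rewrite lebesgue_measure_itv/= lte_fin t0 EFinN -EFinB/= subr0.
by move=> u /=; rewrite !in_itv/= => /andP[h1 h2]; rewrite ltW//= (le_trans h2).
Qed.

Lemma step_law t i y : fine (P (U t @^-1` [set u | step i u = y])) = tr i y.
Proof.
case: i => [|x].
  rewrite /trans /step; case: (eqVneq y 1%N) => [->|h].
    rewrite (_ : [set u | _] = setT); first exact: (congr1 fine (probability_setT P)).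
    by apply/seteqP; split.
  rewrite (_ : [set u | _] = set0) ?preimage_set0 ?measure0//; apply/seteqP; split => // u /= e.
  by move: h; rewrite e eqxx.
rewrite /trans; case: ltnP => [xy|yx]; last first.
  rewrite (_ : [set u | _] = set0) ?preimage_set0 ?measure0//; apply/seteqP; split => // u /= e.
  by have := step_inc x.+1 u; rewrite e ltnNge yx.
have [k ->] : exists k, y = (x.+1 + k.+1)%N by exists (y - x.+1).-1; lia.
rewrite addKn /= -!(step_tail t).
have mU (B : set R) : measurable B -> measurable (U t @^-1` B).
  by move=> mB; rewrite -[X in measurable X]setTI; exact: (uU t).1.
rewrite -!Ex_indic; try by apply: mU; first [exact: mgt|exact: measurable_step].
  rewrite -ExB; [|by apply: bm_indic; apply: mU; exact: mgt|by apply: bm_indic; apply: mU; exact: mgt].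
  congr Ex; apply/funext => w; rewrite !indicE.
  have inP (A : set T) (b : bool) : (A w <-> b) -> (w \in A) = b.
    by move=> h; apply/idP/idP; rewrite inE => /h.
  rewrite (inP _ (step x.+1 (U t w) == x.+1 + k.+1)%N); last by split=> /= /eqP.
  rewrite (inP _ (x.+1 + k < step x.+1 (U t w))%N)// (inP _ (x.+1 + k.+1 < step x.+1 (U t w))%N)//.
  move: (step x.+1 (U t w)) => z.
  have e : ((z == x.+1 + k.+1) + (x.+1 + k.+1 < z) = (x.+1 + k < z))%N.
    by case: (ltngtP z (x.+1 + k.+1)) => h /=; case: ltnP => //; lia.
  by apply/eqP; rewrite eq_sym subr_eq -natrD e.
apply: mU; have := measurable_step x.+1 (fun z => z = (x.+1 + k.+1)%N); exact.
Qed.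

Fixpoint chain t w : nat := if t is t'.+1 then step (chain t' w) (U t' w) else 1.

(** The free event [A] on the last state serves for a single value in the Markov property and for a
    tail in the law of the last, truncated box. *)
Lemma chain_law t (x : nat -> nat) (A : nat -> Prop) :
  P [set w | (forall s, (s <= t)%N -> chain s w = x s) /\ A (chain t.+1 w)] =
  ((x 0 == 1)%N%:R * \prod_(s < t) tr (x s) (x s.+1) *
    fine (P (U t @^-1` [set u | A (step (x t) u)])))%:E.
Proof.
have [x0|x0] := eqVneq (x 0) 1%N; last first.
  rewrite !mul0r (_ : mkset _ = set0) ?measure0//; apply/seteqP; split => // w /= [h _].
  by move: x0; rewrite -(h 0%N)//= eqxx.
rewrite mul1r.
pose B i : set R := if (i < t)%N then [set u | step (x i) u = x i.+1] else [set u | A (step (x i) u)].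
have mB i : measurable (B i).
  rewrite /B; case: ifP => _; last exact: measurable_step.
  exact: (measurable_step (x i) (fun y => y = x i.+1)).
have := hUind (iota_uniq 0 t.+1) mB.
rewrite (_ : [set w | forall i, i \in iota 0 t.+1 -> B i (U i w)] =
  [set w | (forall s, (s <= t)%N -> chain s w = x s) /\ A (chain t.+1 w)]); last first.
  apply/seteqP; split => w.
    move=> h; have hB i : (i <= t)%N -> B i (U i w) by move=> it; apply: h; rewrite mem_iota.
    have ch s : (s <= t)%N -> chain s w = x s.
      elim: s => [|s IH] st; first by rewrite x0.
      by rewrite /= IH ?(ltnW st)//; have := hB s (ltnW st); rewrite /B st.
    split => //; rewrite /= ch//; have := hB t (leqnn t); by rewrite /B ltnn.
  move=> [h hA] i; rewrite mem_iota /= add0n ltnS => it; rewrite /B; case: ltnP => ti /=.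
    by have := h i.+1 ti; rewrite /= h.
  have -> : i = t by lia.
  by move: hA; rewrite /= h.
move=> ->; congr EFin; rewrite -[t.+1]addn1 iotaD big_cat /= big_seq1 add0n; congr (_ * _).
  rewrite -[in LHS](subn0 t) -/(index_iota 0 t) big_mkord; apply: eq_bigr => i _.
  by rewrite /B ltn_ord step_law.
by rewrite /B ltnn.
Qed.

Let mchain t y : measurable [set w | chain t w = y].
Proof.
elim: t y => [|t IH] y.
  case: (eqVneq y 1%N) => [->|h]; first by rewrite (_ : mkset _ = setT)//; apply/seteqP; split.
  by rewrite (_ : mkset _ = set0)//; apply/seteqP; split => // w /= e; move: h; rewrite -e eqxx.
rewrite (_ : mkset _ = \bigcup_x ([set w | chain t w = x] `&` U t @^-1` [set u | step x u = y])).
  apply: bigcupT_measurable => x; apply: measurableI => //.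
  rewrite -[X in measurable X]setTI; apply: (uU t).1 => //.
  exact: (measurable_step x (fun z => z = y)).
by apply/seteqP; split => w /= => [<-|[x _ [/= -> ]]//]; exists (chain t w).
Qed.

Lemma measurable_chain t : measurable_fun setT (chain t).
Proof.
move=> _ A _; rewrite setTI; exact: (measurable_discrete A (mchain t)).
Qed.

Lemma markov_representation (C : nat -> T -> seq nat) :
  (forall n s, s != [::] -> all (leq 1) s -> sumn s = n ->
     P (C n @^-1` [set rev s]) = (comp_weight alpha theta s)%:E) ->
  is_self_similar_markov P C.
Proof.
move=> hC; pose Q t : {RV P >-> nat} := mfun_Sub (mem_set (measurable_chain t)).
have QE t w : Q t w = chain t w by [].
exists d, T, P, Q, tr; split.
- split.
  + exact: trans_ge0.
  + exact: trans_sum1.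
  + move=> t x.
    have e0 : P [set w | forall s, (s <= t)%N -> Q s w = x s] =
        ((x 0 == 1)%N%:R * \prod_(s < t) tr (x s) (x s.+1))%:E.
      have := chain_law t x (fun=> True); rewrite (_ : [set u | True] = setT); last by apply/seteqP; split.
      have -> : fine (P (U t @^-1` setT)) = 1 by exact: (congr1 fine (probability_setT P)).
      rewrite mulr1 => <-; congr (P _); apply/seteqP; split => w /=; first by [].
      by case.
    rewrite e0 -EFinM -(step_law t); have := chain_law t x (fun y => y = x t.+1) => <-.
    congr (P _); apply/seteqP; split => w /=.
      by move=> h; split; [move=> s st; apply: h; rewrite leqW|apply: (h t.+1)].
    by move=> [h1 h2] s; rewrite leq_eqVlt => /orP[/eqP ->//|]; rewrite ltnS; exact: h1.
- by [].
- by move=> t w; exact: step_inc.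
move=> n lam n0 /andP[lam0 /eqP lamn].
have ln : rev lam != [::].
  by apply/eqP => /(congr1 rev); rewrite revK => E; move: n0; rewrite -lamn E.
have := hC n (rev lam) ln; rewrite all_rev sumn_rev revK => /(_ lam0 lamn) ->.
case/lastP: lam lam0 lamn ln => [//|lam m]; rewrite all_rcons => /andP[m0 lam0] lamn _.
rewrite comp_weight_trans//.
pose x := start (rcons lam m).
have xs s : (s <= size lam)%N -> x s = start lam s.
  by move=> sl; rewrite /x /start -cats1 takel_cat.
have := chain_law (size lam) x (fun y => (n < y)%N).
have -> : (x 0 == 1)%N = true by rewrite xs// /start take0.
have -> : fine (P (U (size lam) @^-1` [set u | (n < step (x (size lam)) u)%N])) = tail (sumn lam) m.-1.
  rewrite -(step_tail (size lam)) xs// /start take_size -lamn sumn_rcons.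
  by have -> : (sumn lam + m = (sumn lam).+1 + m.-1)%N by lia.
rewrite mul1r (eq_bigr (fun s : 'I_(size lam) => tr (start lam s) (start lam s.+1))); last first.
  by move=> s _; rewrite !xs// ltnW.
move=> <-; congr (P _); apply/seteqP; split => w /=.
  move=> [h1 h2]; rewrite -lamn; apply/(binary_form_visits (Q' := fun t => chain t w)) => //.
  - by move=> t; exact: step_inc.
  - by rewrite all_rcons m0.
  - split; last by rewrite lamn size_rcons.
    by move=> s; rewrite size_rcons ltnS => sl; rewrite h1.
rewrite -lamn => /(binary_form_visits (Q' := fun t => chain t w)) h.
have [||//|h1 h2] := h _ _ _.
- by move=> t; exact: step_inc.
- by [].
- by rewrite all_rcons m0.
- move: h1 h2; rewrite size_rcons => h1 h2.
  by split=> [s sl|]; [rewrite h1|exact: h2].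
Qed.

End chain.

(** * The two-parameter partition structure *)

Section label_counts.

Lemma label_partition_counts n (l : nat -> nat) K : (forall i, (i < n)%N -> (l i < K)%N) ->
  perm_eq [seq count_mem a (mkseq l n) | a <- undup (mkseq l n)]
    [seq c <- fibers K (fun i : 'I_n => l i) | (0 < c)%N].
Proof.
move=> lK; set s := mkseq l n.
have fE a : #|[pred i : 'I_n | l i == a]| = count_mem a s.
  rewrite cardE size_filter /s /mkseq count_map -val_enum_ord count_map enumT.
  by apply: eq_count.
rewrite /fibers (eq_map (g := fun a => count_mem a s)) // filter_map.
apply: perm_map; apply: uniq_perm; rewrite ?undup_uniq ?filter_uniq ?iota_uniq//.
move=> a; rewrite mem_undup mem_filter mem_iota /= add0n -has_count has_pred1.
case as_ : (a \in s) => //=; apply/esym.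
by move: as_ => /mapP[i]; rewrite mem_iota /= add0n => h ->; exact: lK.
Qed.

Lemma label_partition_valid n (l : nat -> nat) :
  is_composition n (label_partition n l) /\ sorted geq (label_partition n l).
Proof.
rewrite /label_partition /ranked; set s := mkseq l n; set c := [seq _ | a <- _].
split; last by apply: sort_sorted => x y; exact: leq_total.
have pc : perm_eq (sort geq c) c by rewrite perm_sort.
rewrite /is_composition (perm_all _ pc) (perm_sumn pc); apply/andP; split.
  by apply/allP => k /mapP[a]; rewrite mem_undup -has_pred1 has_count => h ->.
have := perm_size (perm_count_undup s); rewrite size_flatten /shape -map_comp.
rewrite (eq_map (g := fun a => count_mem a s)); last by move=> a /=; rewrite size_nseq.
by rewrite size_mkseq => ->.
Qed.

Lemma ranked_perm (c lam : seq nat) : sorted geq lam -> (ranked c == lam) = perm_eq c lam.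
Proof.
move=> slam; have tot : total geq by move=> x y; exact: leq_total.
have tr : transitive geq by move=> y x z h1 h2; exact: leq_trans h2 h1.
have asym : antisymmetric geq by move=> x y; rewrite andbC => /anti_leq.
apply/eqP/idP => [<-|h]; first by rewrite perm_sym /ranked perm_sort.
apply: (sorted_eq tr asym) => //; first exact: sort_sorted.
by rewrite perm_sort.
Qed.

End label_counts.

Section total_label.
Context (R : realType).
Implicit Types z : nat -> R.

(** A version of [lab] without truncation. The default 0 concerns points below all the z_j, a null
    event once the sticks fill [0,1]. *)
Definition tlab z (u : R) : nat :=
  if pselect (exists j, z j.+1 < u) is left e then ex_minn e else 0%N.

Lemma tlab_cell z u : (forall a, z a.+1 <= z a) -> u <= z 0%N -> (exists j, z j.+1 < u) ->
  cell z (tlab z u) u.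
Proof.
move=> nz u0 he; rewrite /tlab; case: pselect => // e; case: ex_minnP => j hj jmin.
rewrite /cell hj /=; case: j hj jmin => // j hj jmin.
by rewrite leNgt; apply/negP => /jmin; rewrite ltnn.
Qed.

Lemma tlab_lab z u K : (forall a, z a.+1 <= z a) -> z K < u <= z 0%N -> lab z K u = tlab z u.
Proof.
move=> nz hu; apply/eqP; rewrite -cell_lab//; apply: tlab_cell => //; first by case/andP: hu.
case: K hu => [|K] /andP[h1 h2]; last by exists K.
by move: h1; rewrite ltNge h2.
Qed.

Lemma tlab_uniq z u a : (forall a, z a.+1 <= z a) -> cell z a u -> u <= z 0%N -> tlab z u = a.
Proof.
move=> nz /andP[h1 h2] u0; have he : exists j, z j.+1 < u by exists a.
have /andP[k1 k2] := tlab_cell nz u0 he.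
have [h|h|//] := ltngtP (tlab z u) a.
  by move: k1; rewrite ltNge (le_trans h2 (noninc_le nz h)).
by move: h1; rewrite ltNge (le_trans k2 (noninc_le nz h)).
Qed.

Lemma tlabE z u a : tlab z u = a <->
  (z a.+1 < u /\ (forall j, (j < a)%N -> u <= z j.+1)) \/ (a = 0%N /\ forall j, u <= z j.+1).
Proof.
rewrite /tlab; case: pselect => [e|ne].
  case: ex_minnP => j hj jmin; split.
    by move=> <-; left; split => // k kj; rewrite leNgt; apply/negP => /jmin; rewrite leqNgt kj.
  move=> [[h1 h2]|[_ h]]; last by move: (h j); rewrite leNgt hj.
  apply/eqP; rewrite eqn_leq jmin//= leqNgt; apply/negP => /h2; by rewrite leNgt hj.
split=> [<-|[[h1 _]|[->]]//]; last by case: ne; exists a.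
by right; split => // j; rewrite leNgt; apply/negP => h; apply: ne; exists j.
Qed.

Lemma measurable_tlab z a : measurable [set u | tlab z u = a].
Proof.
rewrite (_ : mkset _ = (`]z a.+1, +oo[%classic `&`
     \bigcap_(j in [set j | (j < a)%N]) `]-oo, z j.+1]%classic) `|`
    (if a == 0%N then \bigcap_j `]-oo, z j.+1]%classic else set0)).
  apply: measurableU.
    by apply: measurableI => //; apply: fin_bigcap_measurable; [exact: finite_II|].
  by case: ifP => // _; apply: bigcapT_measurable => j.
apply/seteqP; split => u.
  move=> /tlabE [[h1 h2]|[-> h]]; [left|right]; rewrite ?eqxx.
    by split; [rewrite /= in_itv/= h1|move=> j /h2 h; rewrite /= in_itv].
  by move=> j _; rewrite /= in_itv/=.
move=> h; apply/tlabE; case: h => [[h1 h2]|].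
  left; split; first by move: h1; rewrite /= in_itv/= andbT.
  by move=> j ja; have := h2 j ja; rewrite /= in_itv.
by case: eqP => // a0 h; right; split => // j; have := h j Logic.I; rewrite /= in_itv.
Qed.

End total_label.

Lemma integral_Ex d (T : measurableType d) (R : realType) (P : probability T R) (B : set T) (g : T -> R) :
  measurable B -> bm g -> (\int[P]_(w in B) (g w)%:E = (Ex P (fun w => g w * \1_B w))%:E)%E.
Proof.
move=> mB bg; rewrite -ExE; last by apply: bmM => //; exact: bm_indic.
rewrite integral_mkcond; apply: eq_integral => w _; rewrite patchE indicE.
by case: ifP => _; rewrite ?mulr1 ?mulr0.
Qed.

(** * A model of the (alpha, theta - alpha) partition structure *)

Section sticks_on_product.
Context (R : realType) (alpha theta : R).
Hypotheses (alpha01 : 0 <= alpha < 1) (theta0 : 0 < theta).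
Context (d : measure_display) (T : measurableType d) (P : probability T R).
Variable U : nat -> T -> R.
Hypothesis uU : forall i, is_uniform P (U i).
Hypothesis hUind : mutually_independent P U.

Let a1 : 0 < 1 - alpha. Proof. by case/andP: alpha01; rewrite subr_gt0. Qed.
Let bi i : 0 < theta + i%:R * alpha.
Proof. by case/andP: alpha01 => a0 _; rewrite ltr_wpDr// mulr_ge0. Qed.

Let quant i : exists q : R -> R, [/\ measurable_fun setT q, forall u, 0 <= q u <= 1 &
  forall (d : measure_display) (T : measurableType d) (P : probability T R) (U : T -> R),
    is_uniform P U -> has_beta_law P (fun w => q (U w)) (1 - alpha) (theta + i%:R * alpha)].
Proof. exact: beta_quantile. Qed.

(* W_i and the labels live on T * T: the sticks are quantiles of the uniform variables
   on the first factor, and those on the second factor are labelled by the sticks. *)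
Definition quantile i : R -> R := projT1 (cid (quant i)).

Let mq i : measurable_fun setT (quantile i). Proof. by have [] := projT2 (cid (quant i)). Qed.
Let q01 i u : 0 <= quantile i u <= 1. Proof. by have [_ h _] := projT2 (cid (quant i)); exact: h. Qed.
Let qlaw i : has_beta_law P (fun w => quantile i (U i w)) (1 - alpha) (theta + i%:R * alpha).
Proof. by have [_ _ h] := projT2 (cid (quant i)); exact: h. Qed.

Definition stick_ratio i w : R := 1 - quantile i (U i w).

Let bq i : bm (quantile i). Proof. exact: bm01. Qed.

Lemma bm_stick_ratio i : bm (stick_ratio i).
Proof. by apply: bmB; [exact: bm_cst|exact: (bm_comp (uU i).1 (bq i))]. Qed.

Lemma stick_ratio01 i w : 0 <= stick_ratio i w <= 1.
Proof. by have /andP[h1 h2] := q01 i (U i w); rewrite /stick_ratio; apply/andP; split; lra. Qed.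

Lemma stick_fact n (mm kk : nat -> nat) :
  Ex P (fun w => \prod_(i < n) ((1 - stick_ratio i w) ^+ mm i * stick_ratio i w ^+ kk i)) =
  \prod_(i < n) stickb alpha (theta - alpha) i (kk i) (mm i).
Proof.
pose g i u := quantile i u ^+ mm i * (1 - quantile i u) ^+ kk i.
have bg i : bm (g i).
  by apply: bmM; apply: bmX => //; apply: bmB => //; exact: bm_cst.
have g0 i u : 0 <= g i u by have /andP[h1 h2] := q01 i u; rewrite mulr_ge0 ?exprn_ge0 ?subr_ge0.
have := indep_Ex n (fun i => (uU i).1) hUind bg g0.
have -> : (fun w => \prod_(i < n) g i (U i w)) =
    (fun w => \prod_(i < n) ((1 - stick_ratio i w) ^+ mm i * stick_ratio i w ^+ kk i)).
  by apply/funext => w; apply: eq_bigr => i _; rewrite /g /stick_ratio subKr.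
move=> ->; apply: eq_bigr => i _.
rewrite /stickb /wght (_ : theta - alpha + i%:R * alpha + alpha = theta + i%:R * alpha); last by ring.
rewrite -(beta_functional_moment a1 (bi i)) -(has_beta_law_Ex a1 (bi i) (qlaw i)).
  by congr Ex; apply/funext => w; rewrite clamp_id.
apply: bmM; apply: bmX; [|apply: bmB; first exact: bm_cst];
  by apply: bm01; [exact: measurable_clamp|exact: clamp01].
Qed.

Definition zst w := zr (stick_ratio ^~ w).

Lemma zst_noninc w a : zst w a.+1 <= zst w a.
Proof.
rewrite /zst [leLHS]/zr big_ord_recr /= -/(zr (stick_ratio ^~ w) a).
have /andP[_ h1] := stick_ratio01 a w; rewrite ler_piMr// /zr prodr_ge0// => i _.
by case/andP: (stick_ratio01 i w).
Qed.

Lemma zst01 w a : 0 <= zst w a <= 1.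
Proof.
apply/andP; split; first by rewrite /zst /zr prodr_ge0// => i _; case/andP: (stick_ratio01 i w).
rewrite -(zr0 (stick_ratio ^~ w)); apply: noninc_le => //; exact: zst_noninc.
Qed.

Lemma bm_zst a : bm (fun w => zst w a).
Proof. by apply: bm_zr; exact: bm_stick_ratio. Qed.

(** The remaining length after j sticks has mean the product of the 1 - E W_i, which tends to 0
    because the means E W_i decay no faster than harmonically; monotonicity in j turns this into an
    almost sure statement. *)
Lemma zst_vanish : {ae P, forall w, forall e : R, 0 < e -> \forall j \near \oo, zst w j < e}.
Proof.
have Ez j : Ex P (fun w => zst w j) = \prod_(i < j) stickb alpha (theta - alpha) i 1 0.
  rewrite -(stick_fact j (fun=> 0%N) (fun=> 1%N)); congr Ex; apply/funext => w.
  by rewrite /zst /zr; apply: eq_bigr => i _; rewrite expr0 mul1r expr1.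
have Elim : \prod_(i < j) stickb alpha (theta - alpha) i 1 0 @[j --> \oo] --> (0 : R).
  have /andP[al0 al1] := alpha01.
  pose y i := (1 - alpha) / (1 - alpha + theta + i%:R * alpha).
  have cp i : 0 < 1 - alpha + theta + i%:R * alpha by rewrite ltr_wpDr ?mulr_ge0// addr_gt0.
  rewrite (_ : (fun j => _) = fun j => \prod_(i < j) (1 - y i)); last first.
    apply/funext => j; apply: eq_bigr => i _; rewrite /stickb /wght /bmom /y /rf !big_ord0 big_ord1 !addr0 mul1r.
    have -> : 1 - alpha + (theta - alpha + i%:R * alpha + alpha) = 1 - alpha + theta + i%:R * alpha by ring.
    have -> : theta - alpha + i%:R * alpha + alpha = theta + i%:R * alpha by ring.
    rewrite add0n big_ord1 addr0.
    apply/eqP; rewrite eq_sym subr_eq -mulrDl.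
    have -> : theta + i%:R * alpha + (1 - alpha) = 1 - alpha + theta + i%:R * alpha by ring.
    by rewrite divff// gt_eqF.
  have y01 i : 0 <= y i <= 1.
    rewrite /y; apply/andP; split; first by rewrite divr_ge0 ?ltW.
    by rewrite ler_pdivrMr// mul1r -addrA lerDl ltW.
  apply: prod_onem_cvg0 => //.
  have d0 : 0 < 1 - alpha + theta + 1 by rewrite addr_gt0// addr_gt0.
  have k0 : 0 < (1 - alpha) / (1 - alpha + theta + 1) by rewrite divr_gt0.
  apply: (dvg_series_harmonic_like k0) => j; rewrite /y -mulrA -invfM ler_pM2l//.
  rewrite lef_pV2 ?posrE ?cp ?mulr_gt0 ?ltr0n//.
  rewrite -natr1; have j0 : 0 <= j%:R :> R by [].
  have h1 : j%:R * alpha <= j%:R by rewrite ler_piMr// ltW.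
  have h2 : 0 <= (1 - alpha + theta) * j%:R by rewrite mulr_ge0// addr_ge0 ?ltW.
  rewrite mulrDr mulr1 mulrDl mul1r; lra.
pose A m := [set w | forall n : nat, m.+1%:R^-1 <= zst w n].
have mA m : measurable (A m).
  have -> : A m = \bigcap_n ((fun w => zst w n) @^-1` `[m.+1%:R^-1, +oo[%classic).
    apply/seteqP; split => w /= h n; first by move=> _; rewrite /= in_itv/= andbT.
    by have := h n Logic.I; rewrite /= in_itv/= andbT.
  apply: bigcapT_measurable => n; rewrite -[X in measurable X]setTI; exact: (bm_zst n).1.
have PA m : P (A m) = 0%E.
  rewrite -fineP// -(Ex_indic P (mA m)); congr EFin.
  apply/eqP; rewrite eq_le Ex_ge0 ?andbT; last by move=> w; rewrite indicE ler0n.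
  have lim : m.+1%:R * \prod_(i < n) stickb alpha (theta - alpha) i 1 0 @[n --> \oo] --> (0 : R).
    rewrite -[X in _ --> X](mulr0 m.+1%:R); apply: cvgM; first exact: cvg_cst.
    exact: Elim.
  rewrite -(cvg_lim _ lim)//; apply: limr_ge; first by apply/cvg_ex; exists 0.
  apply: nearW => n; rewrite -Ez -ExZ; last exact: bm_zst.
  apply: Ex_le; [exact: bm_indic|by apply: bmZ; exact: bm_zst|].
  move=> w; rewrite indicE; case: (boolP (w \in A m)) => [|_].
    by rewrite inE => /(_ n) h; rewrite -ler_pdivrMl// mulr1.
  by rewrite mulr_ge0//; case/andP: (zst01 w n).
have : {ae P, forall w, forall m, ~ A m w}.
  apply: ae_foralln => m; exists (A m); split; [exact: mA|exact: PA|by move=> w /contrapT].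
apply: filterS => w hw e e0.
have /cvgrPdist_lt/(_ _ e0) [m _ /(_ m (leqnn m))] := @cvg_harmonic R.
rewrite /= sub0r normrN ger0_norm// => h.
have [n hn] : exists n, zst w n < m.+1%:R^-1.
  apply: contrapT => hn; apply: (hw m) => n; rewrite leNgt; apply/negP => h2.
  by apply: hn; exists n.
exists n => // j /= nj; apply: le_lt_trans (lt_trans hn h).
by apply: noninc_le => //; exact: zst_noninc.
Qed.

Local Notation PP := (P \x P)%E.

Let W i (x : T * T) : R := quantile i (U i x.1).
Let L k (x : T * T) : nat := tlab (zst x.1) (U k x.2).
Let V i x := stick (fun j => W j x) i.

Let VE i x : V i x = zst x.1 i - zst x.1 i.+1.
Proof.
have e : zst x.1 i = \prod_(j < i) (1 - W j x) by [].
rewrite /V /stick -e /zst [zr _ i.+1]/zr big_ord_recr /= -/(zr (stick_ratio ^~ x.1) i) /stick_ratio.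
by rewrite mulrBr mulr1 opprB addrC subrK.
Qed.

Let bz a : bm (fun x : T * T => zst x.1 a).
Proof. exact: (bm_comp (measurable_fst) (bm_zst a)). Qed.

Let mUs k : measurable_fun setT (fun x : T * T => U k x.2).
Proof. exact: (measurableT_comp (uU k).1 measurable_snd). Qed.

Let bV i : bm (V i).
Proof. by rewrite (funext (VE i)); apply: bmB; exact: bz. Qed.

Let mW i : measurable_fun setT (W i).
Proof. exact: (measurableT_comp (mq i) (measurableT_comp (uU i).1 measurable_fst)). Qed.

Let mLe a k : measurable [set x : T * T | zst x.1 a < U k x.2].
Proof.
have h := measurable_funB (bz a).1 (mUs k).
rewrite (_ : mkset _ = (fun x : T * T => zst x.1 a - U k x.2) @^-1` `]-oo, 0[%classic).
  by rewrite -[X in measurable X]setTI; exact: h.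
by apply/seteqP; split => x /=; rewrite in_itv/= subr_lt0.
Qed.

Let mL1 k a : measurable [set x | L k x = a].
Proof.
rewrite (_ : mkset _ = ([set x : T * T | zst x.1 a.+1 < U k x.2] `&`
   \bigcap_(j in [set j | (j < a)%N]) ~` [set x : T * T | zst x.1 j.+1 < U k x.2]) `|`
  (if a == 0%N then \bigcap_j ~` [set x : T * T | zst x.1 j.+1 < U k x.2] else set0)).
  apply: measurableU.
    apply: measurableI => //; apply: fin_bigcap_measurable; first exact: finite_II.
    by move=> j _; exact: measurableC.
  by case: ifP => // _; apply: bigcapT_measurable => j; exact: measurableC.
apply/seteqP; split => x.
  move=> /tlabE [[h1 h2]|[-> h]]; [left|right]; rewrite ?eqxx.
    by split => // j /h2 h; apply/negP; rewrite -leNgt.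
  by move=> j _; apply/negP; rewrite -leNgt.
move=> h; apply/tlabE; case: h => [[h1 h2]|].
  by left; split => // j ja; rewrite leNgt; apply/negP; exact: (h2 j ja).
case: eqP => // a0 h; right; split => // j; rewrite leNgt; apply/negP; exact: (h j).
Qed.

Let mL k : measurable_fun setT (L k).
Proof. by move=> _ A _; rewrite setTI; exact: (measurable_discrete A (mL1 k)). Qed.

Let mE n (l : nat -> nat) : measurable [set x | forall k, (k < n)%N -> L k x = l k].
Proof.
rewrite (_ : mkset _ = \bigcap_(k in [set k | (k < n)%N]) [set x | L k x = l k]); last by apply/seteqP; split.
apply: fin_bigcap_measurable; first exact: finite_II.
by move=> k _; exact: mL1.
Qed.

Lemma label_prob w k a : (forall e : R, 0 < e -> \forall j \near \oo, zst w j < e) ->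
  Ex P (fun w' => \1_[set u | tlab (zst w) u = a] (U k w')) = zst w a - zst w a.+1.
Proof.
move=> zv; have /andP[z0 _] := zst01 w a.+1; have /andP[_ z1] := zst01 w a.
rewrite -(is_uniform_itv (uU k) z0 (zst_noninc w a) z1); apply: Ex_ae.
- by apply: (bm_comp (uU k).1); apply: bm_indic; exact: measurable_tlab.
- by apply: (bm_comp (uU k).1); exact: bm_indic.
exists [set w | ~ (0 < U k w < 1)]; split; last 1 first.
- move=> w' /= hn h; apply: hn; rewrite !indicE; congr ((nat_of_bool _)%:R).
  have /andP[u0 u1] := h; have u1' : U k w' <= zst w 0 by rewrite /zst zr0 ltW.
  have he : exists j, zst w j.+1 < U k w'.
    by have [N _ hN] := zv _ u0; exists N; apply: hN => /=.
  apply/idP/idP; rewrite !inE /= in_itv/=.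
    by move=> <-; exact: (tlab_cell (@zst_noninc w)).
  by move=> hc; apply: tlab_uniq => //; exact: zst_noninc.
- rewrite (_ : mkset _ = U k @^-1` (~` `]0, 1[%classic)).
    by rewrite -[X in measurable X]setTI; apply: (uU k).1 => //; exact: measurableC.
  by apply/seteqP; split => w' /=; rewrite in_itv.
- exact: is_uniform_01.
Qed.

Let indep_W : mutually_independent PP W.
Proof.
move=> J B uJ mB.
have fstE (A : set T) : measurable A -> PP (A `*` setT) = P A.
  move=> mA; transitivity (P A * P setT)%E; first exact: product_measure1E.
  by rewrite (probability_setT P) mule1.
pose B' i := quantile i @^-1` B i.
have mB' i : measurable (B' i) by rewrite -[X in measurable X]setTI; exact: mq.
have mUB i : measurable (U i @^-1` B' i) by rewrite -[X in measurable X]setTI; exact: (uU i).1.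
have -> : [set w | forall i, i \in J -> B i (W i w)] = [set w | forall i, i \in J -> B' i (U i w)] `*` setT.
  by apply/seteqP; split => x; [move=> h; split|move=> []].
have mS : measurable [set w | forall i, i \in J -> B' i (U i w)].
  rewrite (_ : mkset _ = \bigcap_(i in [set i | i \in J]) (U i @^-1` B' i)); last by apply/seteqP; split.
  by apply: fin_bigcap_measurable; [exact: finite_seq|].
transitivity (P [set w | forall i, i \in J -> B' i (U i w)]); first exact: fstE.
rewrite (hUind uJ mB'); congr EFin; apply: eq_bigr => i _; congr fine.
transitivity (PP ((U i @^-1` B' i) `*` setT)); first by apply: esym; exact: fstE.
by congr (PP _); apply/seteqP; split => x; [move=> []|move=> h; split].
Qed.

Let beta_W i : has_beta_law PP (W i) (1 - alpha) (theta - alpha + i.+1%:R * alpha).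
Proof.
have fstE (A : set T) : measurable A -> PP (A `*` setT) = P A.
  move=> mA; transitivity (P A * P setT)%E; first exact: product_measure1E.
  by rewrite (probability_setT P) mule1.
have [m h] := qlaw i; split; [exact: mW|move=> A mA].
have -> : theta - alpha + i.+1%:R * alpha = theta + i%:R * alpha by rewrite -natr1; ring.
rewrite -h// -fstE.
  by congr (PP _); apply/seteqP; split => x; [move=> hx; split|move=> []].
by rewrite -[X in measurable X]setTI; exact: m.
Qed.

(** Events on the sticks depend on the first coordinate only. With that coordinate fixed the labels
    are independent draws in the second one, so the conditional probability in [cond_L] is Fubini's
    theorem. *)
Let sigmaV_measurable B : sigma_rv setT V B -> measurable B /\ forall w w' w'', B (w, w') -> B (w, w'').
Proof.
pose G := [set B : set (T * T) | measurable B /\ forall w w' w'', B (w, w') -> B (w, w'')].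
suff : sigma_rv setT V `<=` G by apply.
apply: smallest_sub.
  split.
  - by split.
  - move=> A [mA hA]; split; first by apply: measurableD.
    by move=> w w' w'' [_ h]; split => // /(hA _ _ w').
  - move=> F hF; split; first by apply: bigcupT_measurable => k; have [] := hF k.
    by move=> w w' w'' [k _ h]; exists k => //; have [_ h2] := hF k; exact: h2 h.
move=> _ [i _ [A mA <-]]; split; first exact: (bV i).1.
by move=> w w' w'' [_ h]; split => //; move: h; rewrite /preimage /= !VE.
Qed.

Let cond_L n (l : nat -> nat) : is_cond_prob PP (sigma_rv setT V)
  [set x | forall k, (k < n)%N -> L k x = l k] (fun x => \prod_(k < n) V (l k) x).
Proof.
have bp : bm (fun x => \prod_(k < n) V (l k) x) by apply: bm_prod => k _; exact: bV.
split.
- by split; [move=> B /sigmaV_measurable[]|exact: mE].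
- pose TV := g_sigma_algebraType (\bigcup_(i in [set: nat]) preimage_set_system setT (V i) measurable).
  have bVT i : @bm _ TV R (V i).
    split; last by have [_] := bV i.
    exact: (@measurable_sigma_rv _ _ _ nat [set: nat] V i Logic.I).
  have bpT : @bm _ TV R (fun x => \prod_(k < n) V (l k) x) by apply: bm_prod => k _; exact: bVT.
  by move=> A mA; have := bpT.1 measurableT A mA; rewrite setTI.
- exact: (bm_integrable PP bp).
move=> B sB; have [mB hB] := sigmaV_measurable sB.
have mEB := measurableI _ _ (mE n l) mB.
rewrite (integral_Ex PP mB bp) -(fineP PP mEB) -(Ex_indic PP mEB); congr EFin.
have b1 : bm (\1_([set x | forall k, (k < n)%N -> L k x = l k] `&` B) : T * T -> R) by exact: bm_indic.
have b2 : bm (fun x : T * T => (\prod_(k < n) V (l k) x) * \1_B x) by apply: bmM => //; exact: bm_indic.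
rewrite (Ex_fubini P P b1) (Ex_fubini P P b2); apply: Ex_ae; [exact: (bm_fubini P P b1)|exact: (bm_fubini P P b2)|].
apply: filterS zst_vanish => w zv.
have iB w' : \1_B (w, w') = \1_B (w, w) :> R.
  by rewrite !indicE; congr ((nat_of_bool _)%:R); apply/idP/idP; rewrite !inE => h; exact: hB h.
have -> : (fun y => (\prod_(k < n) V (l k) (w, y)) * \1_B (w, y)) =
    fun _ => (\prod_(k < n) (zst w (l k) - zst w (l k).+1)) * \1_B (w, w) :> R.
  by apply/funext => y; rewrite iB; congr (_ * _); apply: eq_bigr => k _; rewrite VE.
rewrite Ex_cst.
pose g k : R -> R := \1_[set u | tlab (zst w) u = l k].
have mg k : measurable [set u | tlab (zst w) u = l k] by exact: measurable_tlab.
have -> : (fun y => \1_([set x | forall k, (k < n)%N -> L k x = l k] `&` B) (w, y)) =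
    fun y => (\prod_(k < n) g k (U k y)) * \1_B (w, w) :> R.
  apply/funext => y; rewrite -(iB y) indicI /=; congr (_ * _); rewrite indicE.
  case: (boolP (_ \in _)) => [|/negP hn].
    rewrite inE => h; rewrite big1// => k _; rewrite /g indicE mem_set//.
    exact: (h k (ltn_ord k)).
  apply/esym/eqP; rewrite prodf_seq_eq0 /=; apply/hasP.
  have [k kn hk] : exists2 k, (k < n)%N & L k (w, y) <> l k.
    apply: contrapT => h; apply: hn; rewrite inE => k kn; apply: contrapT => h2; apply: h; by exists k.
  exists (Ordinal kn); first by rewrite mem_index_enum.
  by rewrite /g indicE memNset.
rewrite ExZr; last by apply: bm_prod => k _; apply: (bm_comp (uU k).1); exact: bm_indic.
have bg k : bm (g k) by exact: bm_indic.
congr (_ * _); rewrite (indep_Ex n (fun i => (uU i).1) hUind bg).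
  by apply: eq_bigr => k _; rewrite label_prob.
by move=> k x; rewrite /g indicE ler0n.
Qed.

Let mC n : forall s : seq nat, measurable [set x | mkseq (L ^~ x) n = s].
Proof.
move=> s; case: (eqVneq (size s) n) => [sn|sn]; last first.
  rewrite (_ : mkset _ = set0)//; apply/seteqP; split => // x /= e.
  by move: sn; rewrite -e size_mkseq eqxx.
have := mE n (nth 0%N s); congr measurable; apply/seteqP; split => x /=.
  move=> h; apply: (@eq_from_nth _ 0%N); first by rewrite size_mkseq.
  by move=> i; rewrite size_mkseq => i_n; rewrite nth_mkseq// h.
by move=> <- k kn; rewrite nth_mkseq.
Qed.

Let mlp n lam : measurable [set x | label_partition n (L ^~ x) = lam].
Proof.
pose F (s : seq nat) := ranked [seq count_mem a s | a <- undup s].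
exact: (measurable_discrete (fun s => F s = lam) (mC n)).
Qed.

Let Urect n (B : 'I_n -> set R) : (forall i, measurable (B i)) ->
  Ex P (fun w => \prod_(i < n) \1_(B i) (U i w)) =
  \prod_(i < n) Ex P (fun w => \1_(B i) (U i w)).
Proof.
move=> mB; pose g (i : nat) : R -> R := if insub i is Some k then \1_(B k) else fun=> 1.
have gE (i : 'I_n) : g i = \1_(B i) by rewrite /g valK.
have bg i : bm (g i) by rewrite /g; case: insub => [k|]; [exact: bm_indic|exact: bm_cst].
have g0 i x : 0 <= g i x by rewrite /g; case: insub => [k|//]; rewrite indicE ler0n.
have := indep_Ex n (fun i => (uU i).1) hUind bg g0.
under eq_fun do under eq_bigr do rewrite gE.
by under [RHS]eq_bigr do rewrite gE.
Qed.

(** Summed over orders, [comp_weight] groups by the part in the meander, if any, and [sum_creg]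
    handles the rest. The result is the decomposition of the label partition by the content of the
    first stick. *)
Lemma label_partition_law lam : lam != [::] -> all (leq 1) lam -> sorted geq lam ->
  PP [set x | label_partition (sumn lam) (L ^~ x) = lam] =
  (\sum_(s <- permutations lam) comp_weight alpha theta s)%:E.
Proof.
move=> l0 lam1 slam; set n := sumn lam.
have mS := mlp n lam.
rewrite -(fineP PP mS) -(Ex_indic PP mS); congr EFin.
have bS : bm (\1_[set x | label_partition n (L ^~ x) = lam] : T * T -> R) by exact: bm_indic.
rewrite (Ex_fubini P P bS).
have sumE : \sum_(s <- permutations lam) comp_weight alpha theta s =
    wght alpha (theta - alpha) 0 n * partw alpha theta lam +
    \sum_(m <- undup lam) 'C(n, m)%:R * wght alpha (theta - alpha) m (n - m) * partw alpha theta (rem m lam).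
  have wE s t : wght alpha (theta - alpha) s t = bmom (1 - alpha) theta s t by rewrite /wght subrK.
  rewrite big_permutations// -(sum_creg alpha01 theta0 lam1) (big_permutations (creg alpha theta) l0) mulr_sumr -big_split /=.
  rewrite big_seq [RHS]big_seq; apply: eq_bigr => m; rewrite mem_undup => ml.
  have r1 : all (leq 1) (rem m lam) by apply/allP => k /mem_rem kl; exact: (allP lam1).
  rewrite -(sum_creg alpha01 theta0 r1) !mulr_sumr -big_split /= big_seq [RHS]big_seq.
  apply: eq_bigr => mu; rewrite mem_permutations => pmu.
  have smu : sumn mu = (n - m)%N by rewrite (perm_sumn pmu) /n (perm_sumn (perm_to_rem ml)) /= addKn.
  have mn : (m <= n)%N by rewrite /n (perm_sumn (perm_to_rem ml)) /= leq_addr.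
  by rewrite !wE /comp_weight /= smu subnKC.
rewrite sumE.
pose a K := \sum_(s <- permutations lam) Ex P (fun w => gK K (zst w) s).
have aE K : a K = ksum alpha K (theta - alpha) lam.
  by rewrite /a /ksum; apply: eq_bigr => s _; rewrite /zst (kap_expect bm_stick_ratio stick_fact).
(* [ksum_cvg] requires a positive parameter, whereas theta - alpha may be zero or negative. One step
   of [ksum_rec] leaves only sums at theta. *)
have c1 : a K.+1 @[K --> \oo] --> wght alpha (theta - alpha) 0 n * partw alpha theta lam +
    \sum_(m <- undup lam) 'C(n, m)%:R * wght alpha (theta - alpha) m (n - m) * partw alpha theta (rem m lam).
  rewrite (_ : (fun K => _) = fun K => wght alpha (theta - alpha) 0 n * ksum alpha K theta lam +
    \sum_(m <- undup lam) 'C(n, m)%:R * wght alpha (theta - alpha) m (n - m) * ksum alpha K theta (rem m lam)); last first.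
    by apply/funext => K; rewrite aE ksum_rec// subrK.
  apply: cvgD; first by apply: cvgM; [exact: cvg_cst|exact: ksum_cvg].
  apply: cvg_sumr => m _; apply: cvgM; first exact: cvg_cst.
  by apply: ksum_cvg => //; apply/allP => k /mem_rem kl; exact: (allP lam1).
have LL K w s : s \in permutations lam ->
    bm (fun w' => (ev K (finset.setTfor 'I_n) (zst w) (U ^~ w') s)%:R : R) /\
    Ex P (fun w' => (ev K (finset.setTfor 'I_n) (zst w) (U ^~ w') s)%:R) = gK K (zst w) s.
  rewrite mem_permutations => ps.
  apply: (label_law (fun i => (uU i).1) (@Urect n) _ K (@zst_noninc w) (zst01 w)).
  - by move=> i x y; exact: is_uniform_itv.
  - by rewrite (perm_all _ ps).
  - by rewrite (perm_sumn ps).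
have bgK K s : bm (fun w => gK K (zst w) s) by apply: bm_gK => b; exact: bm_zst.
have aE2 K : a K = Ex P (fun w => \sum_(s <- permutations lam) gK K (zst w) s).
  by rewrite Ex_sum.
set X := (X in X = _); have c2 : a K.+1 @[K --> \oo] --> X.
  rewrite (_ : (fun K => _) = fun K => Ex P (fun w => \sum_(s <- permutations lam) gK K.+1 (zst w) s)); last first.
    by apply/funext => K; rewrite aE2.
  apply: (@Ex_lim _ _ _ _ _ _ (size (permutations lam))%:R).
  - by move=> K; apply: bm_sum => s _; exact: bgK.
  - exact: (bm_fubini P P bS).
  - move=> K w; rewrite (le_trans (ler_norm_sum _ _ _))//.
    rewrite -sum1_size natr_sum big_seq [leRHS]big_seq; apply: ler_sum => s sl.
    have [b <-] := LL K.+1 w s sl; apply: Ex_norm => // w'.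
    by rewrite ger0_norm ?ler0n// lern1 leq_b1.
  - apply: filterS zst_vanish => w zv.
    pose b K s w' : R := if s \in permutations lam then (ev K.+1 (finset.setTfor 'I_n) (zst w) (U ^~ w') s)%:R else 0.
    have bb K s : bm (b K s).
      by rewrite /b; case: (boolP (s \in permutations lam)) => h; [have [] := LL K.+1 w s h|exact: bm_cst].
    have e K : \sum_(s <- permutations lam) gK K.+1 (zst w) s =
        Ex P (fun w' => \sum_(s <- permutations lam) b K s w').
      rewrite (Ex_sum P (permutations lam) (p := xpredT) (F := b K)); last by move=> s _; exact: bb.
      rewrite big_seq [RHS]big_seq; apply: eq_bigr => s sl; have [_ <-] := LL K.+1 w s sl.
      by congr Ex; apply/funext => w'; rewrite /b sl.
    rewrite (_ : (fun K => _) = fun K => Ex P (fun w' => \sum_(s <- permutations lam) b K s w')); last first.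
      by apply/funext => K; exact: e.
    apply: (@Ex_lim _ _ _ _ _ _ (size (permutations lam))%:R).
    + by move=> K; apply: bm_sum => s _; exact: bb.
    + exact: (bm_section1 w bS).
    + move=> K w'; rewrite (le_trans (ler_norm_sum _ _ _))// -sum1_size natr_sum; apply: ler_sum => s _.
      by rewrite /b; case: ifP => _; rewrite ?normr0// ger0_norm ?ler0n// lern1 leq_b1.
    + have h2 : {ae P, forall w', forall i, 0 < U i w' < 1}.
        apply: ae_foralln => i.
        exists [set w | ~ (0 < U i w < 1)]; split => //; last exact: is_uniform_01.
        rewrite (_ : mkset _ = U i @^-1` (~` `]0, 1[%classic)).
          by rewrite -[X in measurable X]setTI; apply: (uU i).1 => //; exact: measurableC.
        by apply/seteqP; split => w' /=; rewrite in_itv.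
      apply: filterS h2 => w' hu; apply: cvg_near_cst.
      have hK : \forall K \near \oo, forall i : 'I_n, zst w K < U i w'.
        by apply: filter_forall => i; apply: zv; have /andP[] := hu i.
      have [K0 _ hK0] := hK; exists K0 => // K /= KK0.
      have zU (i : 'I_n) : zst w K.+1 < U i w' <= zst w 0.
        rewrite /zst zr0 -/(zst w K.+1); have /andP[_ /ltW ->] := hu i; rewrite andbT.
        by apply: le_lt_trans (hK0 K KK0 i); exact: zst_noninc.
      have labE (i : 'I_n) : lab (zst w) K.+1 (U i w') = L i (w, w').
        by apply: tlab_lab; [exact: zst_noninc|exact: zU].
      have lK i : (i < n)%N -> (L i (w, w') < K.+1)%N.
        move=> i_n; rewrite -(labE (Ordinal i_n)).
        by have [] := labP (@zst_noninc w) (zU (Ordinal i_n)).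
      pose c := [seq c <- cellcount (finset.setTfor 'I_n) (zst w) (U ^~ w') K.+1 | (0 < c)%N].
      have cE : c = [seq c <- fibers K.+1 (fun i : 'I_n => L i (w, w')) | (0 < c)%N].
        rewrite /c /cellcount /fibers; congr seq.filter; apply/eq_in_map => j _.
        by apply: eq_card => i; rewrite !inE /= (cell_lab j (@zst_noninc w) (zU i)) labE.
      have pc := label_partition_counts lK; rewrite -cE in pc.
      have lpE : (label_partition n (fun k => L k (w, w')) == lam) = (c \in permutations lam).
        by rewrite mem_permutations ranked_perm// (permPl pc).
      have evE s : ev K.+1 (finset.setTfor 'I_n) (zst w) (U ^~ w') s = (c == s).
        rewrite /ev -/c; have -> // : [forall i in finset.setTfor 'I_n, zst w K.+1 < U i w' <= zst w 0].
        by apply/fintype.forallP => i; rewrite zU implybT.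
      transitivity ((c \in permutations lam)%:R : R); last first.
        rewrite indicE -lpE; congr ((nat_of_bool _)%:R); apply/eqP/idP; rewrite inE//.
      transitivity (\sum_(s <- permutations lam) (c == s)%:R : R).
        by rewrite big_seq [RHS]big_seq; apply: eq_bigr => s sl; rewrite /b sl evE.
      case: (boolP (c \in permutations lam)) => cl.
        rewrite (bigD1_seq c)//= ?permutations_uniq// eqxx big1 ?addr0// => s sc.
        by rewrite eq_sym (negbTE sc).
      rewrite big_seq big1// => s sl; case: eqP => // E; by move: cl; rewrite E sl.
by rewrite -(cvg_lim _ c2)// (cvg_lim _ c1).
Qed.

Lemma two_parameter_representation (D : nat -> T -> seq nat) :
  (forall n w, is_composition n (D n w)) ->
  (forall n s, measurable [set w | D n w = s]) ->
  (forall s, s != [::] -> all (leq 1) s -> P [set w | D (sumn s) w = rev s] = (comp_weight alpha theta s)%:E) ->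
  is_two_parameter_partition_structure P alpha (theta - alpha) (fun n w => ranked (D n w)).
Proof.
move=> vD mD lD.
pose W' i : {RV PP >-> R} := mfun_Sub (mem_set (mW i)).
pose L' i : {RV PP >-> nat} := mfun_Sub (mem_set (mL i)).
exists _, (T * T)%type, PP, W', L'; split.
- exact: indep_W.
- exact: beta_W.
- exact: cond_L.
move=> n lam n0.
have [/andP[/andP[lam1 /eqP lamn] slam]|nv] := boolP (is_composition n lam && sorted geq lam); last first.
  rewrite (_ : _ @^-1` _ = set0); last first.
    apply/seteqP; split => // w /= e; move/negP: nv; apply; rewrite -e.
    have pr : perm_eq (ranked (D n w)) (D n w) by rewrite /ranked perm_sort.
    rewrite /is_composition (perm_all _ pr) (perm_sumn pr) -/(is_composition n (D n w)) vD /=.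
    by apply: sort_sorted => x y; exact: leq_total.
  rewrite (_ : mkset _ = set0) ?measure0//; apply/seteqP; split => // x /= e; move/negP: nv; apply.
  by rewrite -e; have [-> ->] := label_partition_valid n (fun k => L k x).
have l0 : lam != [::] by apply/eqP => E; move: n0; rewrite -lamn E.
have := label_partition_law l0 lam1 slam; rewrite lamn => lp.
transitivity (\sum_(s <- permutations lam) comp_weight alpha theta s)%:E; last exact/esym/lp.
have mr : measurable [set w | ranked (D n w) = lam].
  exact: (measurable_discrete (fun s => ranked s = lam) (mD n)).
transitivity (P [set w | ranked (D n w) = lam]) => //.
rewrite -(fineP P mr) -(Ex_indic P mr); congr EFin.
have -> : (\1_[set w | ranked (D n w) = lam] : T -> R) =
    fun w => \sum_(s <- permutations lam) \1_[set w | D n w = rev s] w.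
  apply/funext => w; have -> : \1_[set w | ranked (D n w) = lam] w = (rev (D n w) \in permutations lam)%:R :> R.
    rewrite indicE mem_permutations perm_rev -ranked_perm//.
    by congr ((nat_of_bool _)%:R); apply/idP/eqP; rewrite inE.
  have dE s : \1_[set w | D n w = rev s] w = (s == rev (D n w))%:R :> R.
    rewrite indicE; congr ((nat_of_bool _)%:R); apply/idP/eqP; rewrite inE /=.
      by move=> ->; rewrite revK.
    by move=> ->; rewrite revK.
  under eq_bigr do rewrite dE.
  case: (boolP (rev (D n w) \in permutations lam)) => cl.
    rewrite (bigD1_seq (rev (D n w)))//= ?permutations_uniq// eqxx big1 ?addr0// => s sc.
    by rewrite (negbTE sc).
  by rewrite big_seq big1// => s sl; case: eqP => // E; move: cl; rewrite -E sl.
rewrite (Ex_sum P (permutations lam) (p := xpredT) (F := fun s => \1_[set w | D n w = rev s])); last first.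
  by move=> s _; exact: bm_indic.
rewrite big_seq [RHS]big_seq; apply: eq_bigr => s; rewrite mem_permutations => ps.
have s0 : s != [::] by apply/eqP => E; move: l0; rewrite -size_eq0 -(perm_size ps) E.
have sn : sumn s = n by rewrite (perm_sumn ps) lamn.
have := lD s s0; rewrite (perm_all _ ps) => /(_ lam1); rewrite sn => e.
by rewrite (Ex_indic P (mD n _)) e.
Qed.

End sticks_on_product.

Lemma bm_inv_above (R : realType) (x : R) : 0 < x -> bm (fun l : R => if x < l then l^-1 else 0).
Proof.
move=> x0; rewrite (_ : (fun l => _) = fun l => \1_(`]x, +oo[%classic) l * (Num.max l x)^-1); last first.
  apply/funext => l; rewrite indicE; case: ifPn => xl.
    by rewrite mem_set ?mul1r /= ?in_itv/= ?xl// (max_idPl (ltW xl)).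
  by rewrite memNset ?mul0r//= in_itv/= andbT; exact/negP.
apply: bmM; first exact: bm_indic.
split; last first.
  exists x^-1 => l; rewrite ger0_norm ?invr_ge0 ?le_max ?(ltW x0) ?orbT//.
  by rewrite lef_pV2 ?posrE ?lt_max ?x0 ?orbT// le_max lexx orbT.
apply: continuous_measurable_fun => l.
apply: cvgV; first by rewrite gt_eqF// lt_max x0 orbT.
have h : continuous (fun l : R => Num.max l x).
  by move=> z; apply: continuous_max; [exact: cvg_id|exact: cvg_cst].
exact: h.
Qed.

(** * Strong sampling *)

Section moments_to_functions.
Context (R : realType) (d : measure_display) (T : measurableType d) (P : probability T R).

Lemma bfunctional_ext (I J : (R -> R) -> R) : bfunctional I ->
  (forall f, bm f -> I f = J f) -> bfunctional J.
Proof.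
move=> [h1 h2 h3 h4] IJ; split.
- by move=> f g bf bg; rewrite -!IJ ?h1//; exact: bmD.
- by move=> c f bf; rewrite -!IJ ?h2//; exact: bmZ.
- by move=> f bf f0; rewrite -IJ// h3.
- move=> f_ f M bf_ bf hM hl; rewrite -IJ//.
  by rewrite (_ : (fun n => _) = fun n => I (f_ n)); [exact: (h4 _ _ M)|apply/funext => n; rewrite IJ].
Qed.

Definition condE (F : T * T -> R) (f : R -> R) (w : T) : R := Ex P (fun w' => f (F (w, w'))).

Lemma bm_condE F f : measurable_fun setT F -> bm f -> bm (condE F f).
Proof. by move=> mF bf; exact: (bm_fubini P P (bm_comp mF bf)). Qed.

Lemma condE_ge0 F f w : (forall x, 0 <= f x) -> 0 <= condE F f w.
Proof. by move=> f0; apply: Ex_ge0 => w'. Qed.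

Lemma bfunctional_condE (G : T -> R) (F : T * T -> R) : bm G -> (forall w, 0 <= G w) ->
  measurable_fun setT F -> bfunctional (fun f => Ex P (fun w => G w * condE F f w)).
Proof.
move=> bG G0 mF.
have bG1 : bm (fun x : T * T => G x.1) by exact: (bm_comp measurable_fst bG).
apply: (bfunctional_ext (bfunctional_Ex (P \x P)%E bG1 (fun x => G0 x.1) mF)) => f bf.
have bb : bm (fun x : T * T => G x.1 * f (F x)) by apply: bmM => //; exact: bm_comp bf.
rewrite (Ex_fubini P P bb); congr Ex; apply/funext => w /=; rewrite /condE ExZ//.
exact: (bm_section1 w (bm_comp mF bf)).
Qed.

(** Each side is linear in every single function. With the others frozen it is a bounded functional
    of that function, determined by its moments. In [claim], [t] lists the factors already converted
    and [s'] those still powers; it is proved for all [s'], since one more conversion needs all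
    powers of the new factor. The factor with [L1] or [L2] is converted last. *)
Lemma exchange_moments_functions (J : Type) (N : J -> T * T -> R) (f : J -> R -> R) (L1 L2 : T * T -> R) :
  (forall j, measurable_fun setT (N j)) -> (forall j x, 0 <= N j x <= 1) ->
  measurable_fun setT L1 -> (forall x, 0 <= L1 x <= 1) ->
  measurable_fun setT L2 -> (forall x, 0 <= L2 x <= 1) ->
  (forall j, bm (f j)) -> (forall j x, 0 <= f j x) ->
  (forall m (s : seq (J * nat)),
     Ex P (fun w => condE L1 (fun x => clamp x ^+ m) w *
       \prod_(p <- s) condE (N p.1) (fun x => clamp x ^+ p.2) w) =
     Ex P (fun w => condE L2 (fun x => clamp x ^+ m) w *
       \prod_(p <- s) condE (N p.1) (fun x => clamp x ^+ p.2) w)) ->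
  forall f0, bm f0 -> (forall x, 0 <= f0 x) -> forall s : seq J,
  Ex P (fun w => condE L1 f0 w * \prod_(j <- s) condE (N j) (f j) w) =
  Ex P (fun w => condE L2 f0 w * \prod_(j <- s) condE (N j) (f j) w).
Proof.
move=> mN N01 mL1 L101 mL2 L201 bf f0 hyp g bg g0 s.
have X0 m x : 0 <= clamp x ^+ m :> R by rewrite exprn_ge0//; case/andP: (clamp01 x).
have cl (F : T * T -> R) (h : R -> R) : (forall x, 0 <= F x <= 1) -> condE F (h \o clamp (R := R)) = condE F h.
  by move=> F01; apply/funext => w; congr Ex; apply/funext => w' /=; rewrite clamp_id.
have claim t m s' :
  Ex P (fun w => condE L1 (fun x => clamp x ^+ m) w *
    (\prod_(p <- s') condE (N p.1) (fun x => clamp x ^+ p.2) w * \prod_(j <- t) condE (N j) (f j) w)) =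
  Ex P (fun w => condE L2 (fun x => clamp x ^+ m) w *
    (\prod_(p <- s') condE (N p.1) (fun x => clamp x ^+ p.2) w * \prod_(j <- t) condE (N j) (f j) w)).
  elim: t m s' => [|j t IH] m s'.
    under eq_fun do rewrite big_nil mulr1; under [in RHS]eq_fun do rewrite big_nil mulr1; exact: hyp.
  pose G L w := condE L (fun x => clamp x ^+ m) w *
    (\prod_(p <- s') condE (N p.1) (fun x => clamp x ^+ p.2) w * \prod_(j <- t) condE (N j) (f j) w).
  have bG L : measurable_fun setT L -> bm (G L).
    move=> mL; apply: bmM; first exact: (bm_condE mL (bm_clampX _ _)).
    apply: bmM; apply: bm_prod => i _; first exact: (bm_condE (mN _) (bm_clampX _ _)).
    exact: (bm_condE (mN i) (bf i)).
  have G0 L w : 0 <= G L w.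
    apply: mulr_ge0; first by apply: condE_ge0 => x; exact: X0.
    by apply: mulr_ge0; apply: prodr_ge0 => i _; apply: condE_ge0 => x; [exact: X0|exact: f0].
  have IJ n : Ex P (fun w => G L1 w * condE (N j) (fun x => clamp x ^+ n) w) =
      Ex P (fun w => G L2 w * condE (N j) (fun x => clamp x ^+ n) w).
    have e L : (fun w => G L w * condE (N j) (fun x => clamp x ^+ n) w) =
      (fun w => condE L (fun x => clamp x ^+ m) w *
        (\prod_(p <- (j, n) :: s') condE (N p.1) (fun x => clamp x ^+ p.2) w * \prod_(j <- t) condE (N j) (f j) w)).
      by apply/funext => w; rewrite /G big_cons /=; ring.
    by rewrite !e IH.
  have e L : (fun w => condE L (fun x => clamp x ^+ m) w *
    (\prod_(p <- s') condE (N p.1) (fun x => clamp x ^+ p.2) w * \prod_(i <- j :: t) condE (N i) (f i) w)) =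
    fun w => G L w * condE (N j) (f j \o clamp (R := R)) w.
    by apply/funext => w; rewrite cl// big_cons /G; ring.
  rewrite !e.
  exact: (bfunctional_eq_moments (bfunctional_condE (bG _ mL1) (G0 L1) (mN j))
    (bfunctional_condE (bG _ mL2) (G0 L2) (mN j)) IJ (bf j)).
pose G w := \prod_(j <- s) condE (N j) (f j) w.
have bG : bm G by apply: bm_prod => i _; exact: (bm_condE (mN i) (bf i)).
have G0 w : 0 <= G w by apply: prodr_ge0 => i _; apply: condE_ge0 => x; exact: f0.
have e L : (forall x, 0 <= L x <= 1) ->
    (fun w => condE L g w * \prod_(j <- s) condE (N j) (f j) w) = fun w => G w * condE L (g \o clamp (R := R)) w.
  by move=> L01; apply/funext => w; rewrite cl// mulrC.
rewrite (e L1 L101) (e L2 L201).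
have IJ n : Ex P (fun w => G w * condE L1 (fun x => clamp x ^+ n) w) =
    Ex P (fun w => G w * condE L2 (fun x => clamp x ^+ n) w).
  have := claim s n [::]; under eq_fun do rewrite big_nil mul1r mulrC.
  by under [in RHS]eq_fun do rewrite big_nil mul1r mulrC.
exact: (bfunctional_eq_moments (bfunctional_condE bG G0 mL1) (bfunctional_condE bG G0 mL2) IJ bg).
Qed.

End moments_to_functions.

Section measurable_ranked.
Context (R : realType) (d : measure_display) (T : measurableType d).
Context (d' : measure_display) (T' : measurableType d') (P' : probability T' R) (U : T' -> R).
Variable Z : T -> set R.
Hypothesis cZ : forall w, closed (Z w).
Hypothesis hitZ : forall G : set R, open G -> measurable [set w | Z w `&` G !=set0].
Hypothesis uU : is_uniform P' U.

Lemma bm_gap_count (P : probability T R) x : 0 < x ->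
  bm (fun w => gap_count P' U (Z w) (fun l => x < l)).
Proof.
move=> x0; have mg := measurable_gap_length cZ hitZ uU.1.
have bh := bm_inv_above x0.
have bb := bm_comp mg bh.
exact: (bm_fubini P P' bb).
Qed.

Lemma measurable_ranked_gap k : measurable_fun setT (fun w => ranked_gap (Z w) k).
Proof.
(* A point mass at w0 provides a probability on [T], needed to apply Fubini's theorem on the
   product. *)
have [[w0 _]|nw] := pselect (exists w : T, True); last first.
  by move=> _ A _; rewrite (_ : _ `&` _ = set0)//; apply/seteqP; split => // w _; apply: nw; exists w.
have pos x : 0 < x -> measurable [set w | x < ranked_gap (Z w) k].
  move=> x0; rewrite (_ : mkset _ = (fun w => gap_count P' U (Z w) (fun l => x < l)) @^-1` `[k.+1%:R, +oo[%classic).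
    by rewrite -[X in measurable X]setTI; exact: (bm_gap_count (dirac w0) x0).1.
  apply/seteqP; split => w /=; rewrite in_itv/= andbT.
    by move/(ranked_gap_gtP (Z w) uU.1 (is_uniform_sub uU) k x0).
  by move=> h; apply/(ranked_gap_gtP (Z w) uU.1 (is_uniform_sub uU) k x0).
apply: measurable_fun_rays => x.
have -> : (fun w => ranked_gap (Z w) k) @^-1` `]x, +oo[%classic = [set w | x < ranked_gap (Z w) k].
  by apply/seteqP; split => w /=; rewrite in_itv/= andbT.
have [x0|x0|->] := ltgtP x 0; [|exact: pos|].
  rewrite (_ : mkset _ = setT)//; apply/seteqP; split => // w _ /=.
  exact: lt_le_trans x0 (ranked_gap_ge0 _ _).
rewrite (_ : mkset _ = \bigcup_n [set w | n.+1%:R^-1 < ranked_gap (Z w) k]).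
  by apply: bigcupT_measurable => n; apply: pos; rewrite invr_gt0.
apply/seteqP; split => w /=.
  move=> v0; have /cvgrPdist_lt/(_ _ v0) [n _ /(_ n (leqnn n))] := @cvg_harmonic R.
  by rewrite /= sub0r normrN ger0_norm// => h; exists n.
by move=> [n _ /=]; apply: lt_trans; rewrite invr_gt0.
Qed.

Lemma measurable_meander_length : (forall w, Z w 0) ->
  measurable_fun setT (fun w => meander_length (Z w)).
Proof.
move=> Z0; apply: measurable_funB; first exact: measurable_cst.
have sb w : has_sup (Z w `&` `[0, 1]%classic).
  split; first by exists 0; split => //; rewrite /= in_itv/= lexx ler01.
  by exists 1 => z [_]; rewrite /= in_itv/= => /andP[].
apply: measurable_fun_rays => t; set E := _ @^-1` _.
have m1 : measurable [set w | Z w 1].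
  rewrite (_ : mkset _ = \bigcap_n [set w | Z w `&` `]1 - n.+1%:R^-1, 1 + n.+1%:R^-1[%classic !=set0]).
    by apply: bigcapT_measurable => n; apply: hitZ; exact: itv_open.
  apply/seteqP; split => w /=.
    move=> h n _; exists 1; split => //=; rewrite in_itv/= ltrDl invr_gt0 ltr0n andbT.
    by rewrite ltrBlDr ltrDl invr_gt0.
  move=> h; apply: (cZ (w := w)) => V /nbhs_ballP[e /= e0 eV].
  have /cvgrPdist_lt/(_ _ e0) [n _ /(_ n (leqnn n))] := @cvg_harmonic R.
  rewrite /= sub0r normrN ger0_norm// => ne; have {}ne : n.+1%:R^-1 < e by [].
  have [z [Zz]] := h n Logic.I; rewrite /= in_itv/= => /andP[z1 z2].
  exists z; split => //; apply: eV; apply: lt_trans ne.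
  by rewrite -[X in X < _]/(`|1 - z|) ltr_norml; apply/andP; split; [rewrite ltrNl opprB ltrBlDl|rewrite ltrBlDr -ltrBlDl].
have [t0|t0] := ltP t 0.
  rewrite (_ : E = setT)//; apply/seteqP; split => // w _; rewrite /E /= in_itv/= andbT.
  apply: lt_le_trans t0 _; apply: ub_le_sup; first by have [] := sb w.
  by split => //; rewrite /= in_itv/= lexx ler01.
have [t1|t1] := ltP t 1; last first.
  rewrite (_ : E = set0)//; apply/seteqP; split => // w; rewrite /E /= in_itv/= andbT.
  rewrite ltNge (le_trans _ t1)//; apply: ge_sup; first by have [] := sb w.
  by move=> z [_]; rewrite /= in_itv/= => /andP[].
rewrite (_ : E = [set w | Z w `&` `]t, 1[%classic !=set0] `|` [set w | Z w 1]).
  by apply: measurableU => //; apply: hitZ; exact: itv_open.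
apply/seteqP; split => w; rewrite /E /= in_itv/= andbT.
  move=> /(sup_gt (sb w).1)[z [Zz]]; rewrite /= in_itv/= => /andP[z0 z1] tz.
  have [e|e] := eqVneq z 1; [by right; rewrite -e|left].
  by exists z; split => //=; rewrite in_itv/= tz lt_neqAle e.
move=> [[z [Zz]]|Zz].
  rewrite /= in_itv/= => /andP[tz z1]; apply: (lt_le_trans tz); apply: ub_le_sup; first by have [] := sb w.
  by split => //; rewrite /= in_itv/= (ltW z1) (le_trans t0 (ltW tz)).
apply: (lt_le_trans t1); apply: ub_le_sup; first by have [] := sb w.
by split => //; rewrite /= in_itv/= ler01 lexx.
Qed.

End measurable_ranked.

Section strong_sampling.
Context (R : realType) (alpha theta : R).
Hypotheses (alpha01 : 0 <= alpha < 1) (theta0 : 0 < theta).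
Context (d : measure_display) (T : measurableType d) (P : probability T R).
Variables (nu : {measure set R -> \bar R}) (Y : R -> {RV P >-> R}) (X : {RV P >-> R}).
Hypotheses (hnu : is_levy_measure alpha theta nu) (hY : is_subordinator nu Y)
  (hX : has_stationary_delay_law P nu X).
Hypothesis hXY : indep_systems P (sigma_rv [set: unit] (fun _ => X))
             (sigma_rv [set t : R | 0 <= t] (fun t => Y t)).
Variables (Z : T -> set R) (U : nat -> T -> R).
Hypothesis hZ : forall w, Z w = exp_neg_set (stationary_range (X w) (fun t => Y t w)).
Hypothesis uU : forall i, is_uniform P (U i).
Local Notation gl w u := (gap_length (gap_at (Z w) u)).
Local Notation V w := (ranked_gap (Z w)).
Local Notation A := (meander X).
Local Notation PP := (P \x P)%E.

Let cZ w : closed (Z w). Proof. exact: (closedZ hZ). Qed.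
Let hitz := hitZ hY hZ.
Let mU0 := (uU 0).1.
Let subU := is_uniform_sub (uU 0).
Let glx (x : T * T) := gl x.1 (U 0%N x.2).
Let Ax (x : T * T) := A x.1.
Let count (x : R) w := gap_count P (U 0%N) (Z w) (fun l => x < l).
Let fx (j : {posnum R}) (l : R) : R := if j%:num < l then l^-1 else 0.

Let bglx : bm glx. Proof. exact: (bm_gap_length hY hZ uU). Qed.
Let glx01 x : 0 <= glx x <= 1. Proof. exact: gap_length01. Qed.
Let bA : bm A. Proof. exact: (bm_meander Y X). Qed.
Let bAx : bm Ax. Proof. exact: (bm_comp measurable_fst bA). Qed.
Let Ax01 x : 0 <= Ax x <= 1. Proof. exact: meander01. Qed.
Let bfx j : bm (fx j). Proof. exact: bm_inv_above. Qed.
Let fx0 j x : 0 <= fx j x.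
Proof. by rewrite /fx; case: ifP => // h; rewrite invr_ge0 ltW// (lt_trans _ h). Qed.

Let condA f w : condE P Ax f w = f (A w).
Proof. exact: (Ex_cst P (f (A w))). Qed.

(** The mean of [fx x] given [Z] is the number of gaps longer than x. The starting moment identity
    is [meander_exchange], where the index [ord0] carries the power m and the other indices the
    factors of the product. *)
Let exchange_gaps f0 (s : seq {posnum R}) : bm f0 -> (forall x, 0 <= f0 x) ->
  Ex P (fun w => condE P Ax f0 w * \prod_(j <- s) condE P glx (fx j) w) =
  Ex P (fun w => condE P glx f0 w * \prod_(j <- s) condE P glx (fx j) w).
Proof.
move=> bf0 f00.
apply: (exchange_moments_functions (N := fun _ => glx) (fun _ => bglx.1) (fun _ => glx01)
  bAx.1 Ax01 bglx.1 glx01 bfx fx0 _ bf0 f00) => m {}s.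
pose lam (i : 'I_(size s).+1) := (nth 0%N (m :: map snd s) i).+1.
have := @meander_exchange R alpha theta alpha01 theta0 d T P nu Y X hnu hY hX hXY Z U hZ uU
  _ lam (fun i => ltn0Sn _) [set~ ord0]%SET ord0.
rewrite !finset.inE eqxx => /(_ isT).
have gE n w : condE P glx (fun x => clamp x ^+ n) w = gmom P Z U n w.
  by congr Ex; apply/funext => w'; rewrite clamp_id.
have pE w : \prod_(i in [set~ ord0]%SET) gmom P Z U (lam i).-1 w =
    \prod_(p <- s) condE P glx (fun x => clamp x ^+ p.2) w.
  rewrite big_mkcond big_ord_recl /= !finset.inE eqxx mul1r.
  rewrite [RHS](eq_bigr (fun p : {posnum R} * nat => gmom P Z U p.2 w)); last by move=> p _; exact: gE.
  rewrite -(big_map snd xpredT (fun n => gmom P Z U n w)) (big_nth 0%N) big_mkord size_map.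
  by apply: eq_bigr => i _; rewrite !finset.inE.
under eq_fun do rewrite pE; under [in RHS]eq_fun do rewrite pE.
move=> /= e; under eq_fun do rewrite condA clamp_id ?meander01//.
by under [in RHS]eq_fun do rewrite gE.
Qed.

(** At most 1/x gaps are longer than x, so x times the count lies in [0,1], where moments suffice.
    [gfun] then tests whether the count is at least k + 1, that is, whether the ranked length of
    index k exceeds x. *)
Let nfun (p : nat * {posnum R}) (x : T * T) := p.2%:num * count p.2%:num x.1.
Let gfun (p : nat * {posnum R}) : R -> R := \1_(`[p.2%:num * p.1.+1%:R, +oo[%classic).

Let nfun01 p x : 0 <= nfun p x <= 1.
Proof.
have [bd _] : bm (fun w' => fx p.2 (glx (x.1, w'))) /\ True.
  by split => //; exact: (bm_section1 x.1 (bm_comp bglx.1 (bfx p.2))).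
apply/andP; split; first by rewrite /nfun mulr_ge0//; apply: Ex_ge0 => w'; exact: fx0.
rewrite /nfun -ler_pdivlMl// mulr1 -(Ex_cst P p.2%:num^-1); apply: Ex_le => //.
  exact: bm_cst.
move=> w'; case: ifPn => [h|_]; last by rewrite invr_ge0.
by rewrite lef_pV2 ?posrE ?(lt_trans _ h)// ltW.
Qed.

Let mnfun p : measurable_fun setT (nfun p).
Proof.
have p0 : 0 < p.2%:num by [].
pose c := count p.2%:num; have h : bm c := bm_gap_count cZ hitz (uU 0) P p0.
have h2 : bm (fun x : T * T => c x.1) by exact: (@bm_comp _ _ (T * T)%type T R c fst measurable_fst h).
exact: (bmZ _ h2).1.
Qed.

Let bgfun p : bm (gfun p). Proof. exact: bm_indic. Qed.
Let gfun0 p x : 0 <= gfun p x. Proof. by rewrite /gfun indicE ler0n. Qed.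

Let condN p f w : condE P (nfun p) f w = f (nfun p (w, w)).
Proof. exact: (Ex_cst P (f (nfun p (w, w)))). Qed.

(** A second passage from moments to functions. A power of a count is a repeated factor in
    [exchange_gaps], hence the flattened list [r]; the scaling constants are collected in [c]. *)
Let exchange_counts f0 (s : seq (nat * {posnum R})) : bm f0 -> (forall x, 0 <= f0 x) ->
  Ex P (fun w => condE P Ax f0 w * \prod_(p <- s) condE P (nfun p) (gfun p) w) =
  Ex P (fun w => condE P glx f0 w * \prod_(p <- s) condE P (nfun p) (gfun p) w).
Proof.
move=> bf0 f00.
apply: (exchange_moments_functions mnfun nfun01 bAx.1 Ax01 bglx.1 glx01 bgfun gfun0 _ bf0 f00) => m {}s.
pose r := flatten [seq nseq p.2 p.1.2 | p <- s].
pose c : R := \prod_(p <- s) p.1.2%:num ^+ p.2.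
have pE w : \prod_(p <- s) condE P (nfun p.1) (fun x => clamp x ^+ p.2) w =
    c * \prod_(j <- r) condE P glx (fx j) w.
  rewrite /c /r; elim: s {r c} => [|p s IH]; first by rewrite !big_nil mulr1.
  rewrite /= !big_cons big_cat IH condN clamp_id//= big_nseq iter_mulr_1 /nfun exprMn.
  by rewrite -[count _ _]/(condE P glx (fx p.1.2) w); ring.
have bp F : measurable_fun setT F -> bm (fun w => condE P F (fun x => clamp x ^+ m) w *
    \prod_(j <- r) condE P glx (fx j) w).
  move=> mF; apply: bmM; first exact: (bm_condE P mF (bm_clampX _ _)).
  by apply: bm_prod => j _; exact: (bm_condE P bglx.1 (bfx j)).
have e F : (fun w => condE P F (fun x => clamp x ^+ m) w *
     \prod_(p <- s) condE P (nfun p.1) (fun x => clamp x ^+ p.2) w) =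
   fun w => c * (condE P F (fun x => clamp x ^+ m) w * \prod_(j <- r) condE P glx (fx j) w).
  by apply/funext => w; rewrite pE mulrCA.
rewrite (e Ax) (e glx) (ExZ P c (bp _ bAx.1)) (ExZ P c (bp _ bglx.1)).
have cl0 (x : R) : 0 <= clamp x ^+ m by rewrite exprn_ge0//; case/andP: (clamp01 x).
exact: (congr1 ( *%R c) (exchange_gaps r (bm_clampX R m) cl0)).
Qed.

Let above (s : seq (nat * {posnum R})) w := all (fun p => p.2%:num < V w p.1) s.
(** A pi-system for the joint law of one length and all ranked gap lengths: a Borel condition on the
    length and finitely many strict lower bounds on the ranked ones. *)
Let gens : set (set (R * T)) :=
  [set D | exists B s, measurable (B : set R) /\ D = [set y | B y.1 /\ above s y.2]].

Let mV k : measurable_fun setT (fun w => V w k).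
Proof. exact: (measurable_ranked_gap cZ hitz (uU 0) k). Qed.

Let mabove s : measurable [set w | above s w].
Proof.
elim: s => [|p s IH]; first by rewrite (_ : mkset _ = setT)//; apply/seteqP.
rewrite (_ : mkset _ = [set w | above s w] `&` (fun w => V w p.1) @^-1` `]p.2%:num, +oo[%classic).
  by apply: measurableI => //; rewrite -[X in measurable X]setTI; exact: mV.
by apply/seteqP; split => w; rewrite /= in_itv/= andbT; [move=> /andP[]|move=> [-> ->]].
Qed.

Let gens_measurable : gens `<=` measurable.
Proof.
move=> _ [B [s [mB ->]]]; rewrite (_ : mkset _ = B `*` [set w | above s w]).
  exact: measurableX.
by apply/seteqP; split.
Qed.

Let gensI : setI_closed gens.
Proof.
move=> _ _ [B [s [mB ->]]] [B' [s' [mB' ->]]]; exists (B `&` B'), (s ++ s'); split.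
  exact: measurableI.
apply/seteqP; split => y; rewrite /= /above all_cat; first by move=> [[h1 h2] [h3 ->]]; rewrite h2.
by move=> [[h1 h2] /andP[h3 h4]].
Qed.

Let aboveE s w : \prod_(p <- s) condE P (nfun p) (gfun p) w = (above s w)%:R.
Proof.
elim: s => [|p s IH]; first by rewrite big_nil.
rewrite big_cons IH condN /= -/(above s w) /gfun indicE -natrM mulnb; congr ((nat_of_bool (_ && _))%:R).
have h := ranked_gap_gtP (Z w) mU0 subU p.1 (gt0 p.2).
apply/idP/idP; rewrite inE /= in_itv/= andbT ler_pM2l//; first by move/h.
by move=> k; exact/h.
Qed.

Let ma : measurable_fun setT (fun w => (A w, w)).
Proof. by apply: measurable_fun_pair => //; exact: bA.1. Qed.

Let mb : measurable_fun setT (fun x : T * T => (glx x, x.1)).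
Proof. by apply: measurable_fun_pair => //; exact: bglx.1. Qed.

Let pushforward_gens D : gens D ->
  P ((fun w => (A w, w)) @^-1` D) = PP ((fun x : T * T => (glx x, x.1)) @^-1` D).
Proof.
move=> gD; have mD := gens_measurable gD; case: gD => B [s [mB DE]].
have m1 : measurable ((fun w => (A w, w)) @^-1` D) by rewrite -[X in measurable X]setTI; exact: ma.
have m2 : measurable ((fun x : T * T => (glx x, x.1)) @^-1` D) by rewrite -[X in measurable X]setTI; exact: mb.
rewrite -(fineP P m1) -(fineP PP m2) -(Ex_indic P m1) -(Ex_indic PP m2); congr EFin.
have b2 : bm (\1_((fun x : T * T => (glx x, x.1)) @^-1` D) : T * T -> R) by exact: bm_indic.
have iD l w : \1_D (l, w) = \1_B l * (above s w)%:R :> R.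
  rewrite !indicE -natrM mulnb; congr ((nat_of_bool _)%:R).
  by apply/idP/andP; rewrite DE !inE.
rewrite (Ex_fubini P P b2).
have := exchange_counts s (bm_indic R mB) (fun x => ler0n _ _).
under eq_fun do rewrite condA aboveE -iD; under [in RHS]eq_fun do rewrite aboveE.
move=> e; rewrite [LHS]e; congr Ex; apply/funext => w.
rewrite -ExZr; last exact: (bm_section1 w (bm_comp bglx.1 (bm_indic R mB))).
by congr Ex; apply/funext => w'; rewrite -iD.
Qed.

Lemma meander_gap_exchange D : <<s gens >> D ->
  P ((fun w => (A w, w)) @^-1` D) = PP ((fun x : T * T => (glx x, x.1)) @^-1` D).
Proof.
have [P1 P1E] := distribution_exists P ma; have [P2 P2E] := distribution_exists PP mb.
move=> sD; rewrite -P1E -P2E.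
apply: (@g_sigma_algebra_measure_unique _ R _ gens gens_measurable (fun _ => setT) _ _ P1 P2 gensI) => //.
- by move=> _; exists setT, [::]; split => //; apply/seteqP.
- by rewrite bigcup_const.
- by move=> E gE; exact: (etrans (P1E E) (etrans (pushforward_gens gE) (esym (P2E E)))).
- by move=> k; rewrite -ge0_fin_numE//; exact: fin_num_measure.
Qed.

Let SG := g_sigma_algebraType gens.

Let mSG1 : measurable_fun setT (fun y : SG => y.1 : R).
Proof.
move=> _ B mB; rewrite setTI; apply: sub_sigma_algebra; exists B, [::]; split => //.
by apply/seteqP; split => y; [move=> h; split|move=> []].
Qed.

Let mSGV k : measurable_fun setT (fun y : SG => V y.2 k : R).
Proof.
have pos x : 0 < x -> @measurable _ SG [set y | x < V y.2 k].
  move=> x0; apply: sub_sigma_algebra; exists setT, [:: (k, PosNum x0)]; split => //.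
  by apply/seteqP; split => y; rewrite /above /= andbT; [split|move=> []].
apply: measurable_fun_rays => x.
have -> : (fun y : SG => V y.2 k) @^-1` `]x, +oo[%classic = [set y | x < V y.2 k].
  by apply/seteqP; split => w /=; rewrite in_itv/= andbT.
have [x0|x0|->] := ltgtP x 0; [|exact: pos|].
  rewrite (_ : mkset _ = setT)//; apply/seteqP; split => // w _ /=.
  exact: lt_le_trans x0 (ranked_gap_ge0 _ _).
rewrite (_ : mkset _ = \bigcup_n [set y | n.+1%:R^-1 < V y.2 k]).
  by apply: bigcupT_measurable => n; apply: pos; rewrite invr_gt0.
apply/seteqP; split => w /=.
  move=> v0; have /cvgrPdist_lt/(_ _ v0) [n _ /(_ n (leqnn n))] := @cvg_harmonic R.
  by rewrite /= sub0r normrN ger0_norm// => h; exists n.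
by move=> [n _ /=]; apply: lt_trans; rewrite invr_gt0.
Qed.

Let sigmaV := sigma_rv [set: nat] (fun j w => V w j).

Let sigmaV_SG B : sigmaV B -> @measurable _ SG [set y | B y.2].
Proof.
pose G := [set B : set T | @measurable _ SG [set y | B y.2]].
suff : sigmaV `<=` G by apply.
apply: smallest_sub.
  split.
  - by rewrite /G /= (_ : mkset _ = set0)//; apply/seteqP; split.
  - move=> E hE; rewrite /G /= (_ : mkset _ = ~` [set y : SG | E y.2]); first exact: measurableC.
    by apply/seteqP; split => y; [move=> []|].
  - move=> F hF; rewrite /G /= (_ : mkset _ = \bigcup_k [set y : SG | F k y.2]).
      exact: bigcupT_measurable.
    by apply/seteqP; split.
move=> _ [k _ [E mE <-]]; rewrite /G /= (_ : mkset _ = (fun y : SG => V y.2 k) @^-1` E).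
  by rewrite -[X in measurable X]setTI; exact: mSGV.
by apply/seteqP; split => y; [move=> []|].
Qed.

Let sigmaV_measurable B : sigmaV B -> measurable B.
Proof.
suff : sigmaV `<=` measurable by apply.
apply: smallest_sub; first exact: sigma_algebra_measurable.
by move=> _ [k _ [E mE <-]]; exact: mV.
Qed.

Let mSGeq k : @measurable _ SG [set y | y.1 = V y.2 k].
Proof.
rewrite (_ : mkset _ = (fun y : SG => y.1 - V y.2 k : R) @^-1` [set 0]).
  by rewrite -[X in measurable X]setTI; exact: (measurable_funB mSG1 (mSGV k)).
apply/seteqP; split => y /=; first by move=> ->; rewrite subrr.
by move/eqP; rewrite subr_eq0 => /eqP.
Qed.


(** The set without delay: [Z] is e^-X times [ZY], and [ZY] depends on [Y] only, hence is
    independent of [X]. *)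
Let ZY w := exp_neg_set (stationary_range 0 (fun t => Y t w)).
Let TY := g_sigma_algebraType (\bigcup_(t in [set t : R | 0 <= t]) preimage_set_system setT (Y t) measurable).

Let mYTY (t : R) : 0 <= t -> measurable_fun setT (Y t : TY -> R).
Proof. by move=> t0; exact: (@measurable_sigma_rv _ _ _ R [set t : R | 0 <= t] (fun t => Y t) t t0). Qed.

Let toTY : measurable_fun setT (id : T -> TY).
Proof.
move=> _ B mB; rewrite setTI preimage_id.
have sub : sigma_rv [set t : R | 0 <= t] (fun t => Y t) `<=` @measurable _ T.
  apply: smallest_sub; first exact: sigma_algebra_measurable.
  by move=> _ [t _ [E mE <-]]; exact: measurable_funPT.
exact: sub.
Qed.

Let rc w t : 0 <= t -> Y s w @[s --> t^'+] --> Y t w. Proof. exact: (rcY hY). Qed.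
Let cZY w : closed (ZY w). Proof. exact: closed_exp_neg_set. Qed.

Let hitZY (G : set R) : open G -> @measurable _ TY [set w | ZY w `&` G !=set0].
Proof.
move=> oG; apply: (@measurable_hit R _ TY (fun=> 0) (fun t w => Y t w)) => //.
Qed.

Let VY w := ranked_gap (ZY w).

Let mVY j : measurable_fun setT (fun w : TY => VY w j : R).
Proof. exact: (@measurable_ranked_gap R _ TY _ T P (U 0%N) ZY cZY hitZY (uU 0) j). Qed.

Let mglY w : measurable_fun setT (fun w' => gap_length (gap_at (ZY w) (U 0%N w'))).
Proof.
have h := @measurable_gap_length R _ _ TY T ZY cZY hitZY (U 0%N) mU0.
exact: (measurableT_comp h (@measurable_pair1 _ _ TY T w)).
Qed.

(** Given [Y] the right side is a constant, and [X] has a density. *)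
Let diffuse_tie j : {ae P, forall w, X w <> ln (1 + VY w j)}.
Proof.
have mD : measurable [set y : TY * R | y.2 = ln (1 + VY y.1 j)].
  have h1 : measurable_fun setT (fun y : TY * R => 1 + VY y.1 j).
    apply: measurable_funD; first exact: measurable_cst.
    exact: (measurableT_comp (mVY j) measurable_fst).
  have h2 := measurable_funB (measurable_snd (T1 := TY) (T2 := R)) (measurableT_comp (@measurable_ln R) h1).
  rewrite (_ : mkset _ = (fun y : TY * R => y.2 - ln (1 + VY y.1 j)) @^-1` [set 0]).
    by rewrite -[X in measurable X]setTI; exact: h2.
  apply/seteqP; split => y /=; first by move=> ->; rewrite subrr.
  by move/eqP; rewrite subr_eq0 => /eqP.
have bD := bm_indic R mD.
have mX : measurable_fun setT (X : T -> R) by exact: measurable_funPT.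
have ind (B : set TY) (B' : set R) : measurable B -> measurable B' ->
    P (id @^-1` B `&` X @^-1` B') = (P (id @^-1` B) * P (X @^-1` B'))%E.
  move=> mB mB'; rewrite setIC muleC; apply: hXY; last exact: mB.
  by apply: sub_sigma_algebra; exists tt => //; exists B' => //; rewrite setTI.
have e := Ex_independent_pair toTY mX ind bD.
have mW : measurable [set w : T | X w = ln (1 + VY w j)].
  have h : measurable_fun setT (fun w : T => (w : TY, X w)) by exact: measurable_fun_pair.
  by have := h measurableT _ mD; rewrite setTI.
exists [set w | X w = ln (1 + VY w j)]; split => //; last by move=> w /= /contrapT.
rewrite -(fineP P mW) -(Ex_indic P mW); congr EFin.
rewrite [LHS]e -[RHS](Ex_cst P 0); congr Ex; apply/funext => w.
have mc : measurable [set w' | X w' = ln (1 + VY w j)].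
  by have := mX measurableT _ (measurable_set1 (ln (1 + VY w j))); rewrite setTI.
transitivity (fine (P [set w' | X w' = ln (1 + VY w j)])).
  by rewrite -(Ex_indic P mc).
by rewrite (delay_diffuse hnu mX hX).
Qed.

Let stationary_range_shift (x : R) (y : R -> R) v : stationary_range x y (x + v) <-> stationary_range 0 y v.
Proof.
split=> h B /nbhs_ballP[e /= e0 eB].
  have [_ [[t t0 <-] /= h2]] := h _ (nbhsx_ballx (x + v) e e0).
  exists (y t); split; first by exists t => //; rewrite add0r.
  by apply: eB; move: h2; rewrite /ball /= (_ : x + v - (x + y t) = v - y t)//; ring.
have [_ [[t t0 <-] /= h2]] := h _ (nbhsx_ballx v e e0).
exists (x + y t); split; first by exists t.
by apply: eB; move: h2; rewrite /ball /= (_ : x + v - (x + y t) = v - (0 + y t))//; ring.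
Qed.

Let stationary_range_ge (x : R) (y : R -> R) v : (forall t, 0 <= t -> 0 <= y t) -> stationary_range x y v -> x <= v.
Proof.
move=> y0 h; rewrite leNgt; apply/negP => vx.
have [z [[t t0 <-]]] := h [set z | z < x] (open_nbhs_nbhs (conj (@open_lt R x) vx)).
by rewrite /= ltNge lerDl y0.
Qed.

Let Y0 w : Y 0 w = 0. Proof. by have [[h _] _ _ _ _] := hY. Qed.
Let Yge0 w t : 0 <= t -> 0 <= Y t w. Proof. exact: (subordinator_ge0 hY). Qed.

Section positive_delay.
Variable w : T.
Hypothesis X0 : 0 < X w.
Let s := expR (- X w).

Let s01 : 0 < s < 1.
Proof. by rewrite /s expR_gt0 -[ltRHS](@expR0 R) ltr_expR oppr_lt0. Qed.

Let AE : A w = 1 - s. Proof. by rewrite /meander (max_idPl (ltW X0)). Qed.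

Let Zs : Z w s.
Proof.
have := @exp_neg_set_time R (X w) (fun t => Y t w) 0 (lexx 0).
by rewrite Y0 addr0 hZ.
Qed.

Let Zle z : Z w z -> z <= s.
Proof.
rewrite hZ => -[->|[v hv <-]]; first by rewrite expR_ge0.
by rewrite ler_expR lerN2; exact: (stationary_range_ge (Yge0 w) hv).
Qed.

Lemma meander_lengthE : meander_length (Z w) = A w.
Proof. by have [-> _] := meander_top s01 Zs Zle (@cZ w); rewrite AE. Qed.

Let ZscaleE : Z w = [set s * z | z in ZY w].
Proof.
rewrite hZ; apply/seteqP; split => z.
  case=> [->|[v hv <-]]; first by exists 0; [left|rewrite mulr0].
  exists (expR (- (v - X w))); last by rewrite /s -expRD; congr expR; ring.
  by right; exists (v - X w) => //; apply/(stationary_range_shift (X w)); rewrite addrC subrK.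
move=> [y [->|[v hv <-]] <-]; first by left; rewrite mulr0.
right; exists (X w + v); first exact/stationary_range_shift.
by rewrite /s -expRD; congr expR; ring.
Qed.

(** Of two gaps with the tied length, at most one is the meander. The other lies to the left of s =
    e^-X and is s times a gap of [ZY], of length g say. Then 1 - s = s g, that is, X = ln(1 + g). *)
Lemma meander_tie k : 0 < V w k -> V w k = V w k.+1 -> A w = V w k -> exists j, X w = ln (1 + VY w j).
Proof.
move=> v0 tie Av; set v := V w k in v0 tie Av.
have v20 : 0 < v / 2 by rewrite divr_gt0.
have v2v : v / 2 < v by rewrite ltr_pdivrMr// ltr_pMr// ltr1n.
have mg : measurable_fun setT (fun w' => gl w (U 0%N w')).
  exact: (bm_gap_length_section hY hZ uU 0 w).1.
have := ranked_gap_tie mU0 subU mg v0 tie; rewrite -/v.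
have Bv l : l == v -> v / 2 < l by move=> /eqP ->.
have [n [D [iD gD _ ->]]] := gap_countP (Z w) mU0 subU v20 Bv.
rewrite ler_nat => n2.
have [u [u01 nZu] [gu nu1]] : exists2 u, 0 <= u <= 1 /\ ~ Z w u & gl w u = v /\ gap_at (Z w) u <> gap_at (Z w) 1.
  pose i0 := Ordinal (ltnW n2); pose i1 := Ordinal n2.
  have [i hi] : exists i, D i <> gap_at (Z w) 1.
    apply: contrapT => h; have h' i : D i = gap_at (Z w) 1.
      by apply: contrapT => h2; apply: h; exists i.
    by have /iD/(congr1 val) : D i0 = D i1 by rewrite !h'.
  have [[u [hu1 hu2] Du] /eqP gl_v] := gD i; exists u.
    by move: hu1; rewrite /= in_itv.
  by rewrite -Du.
have us : u < s.
  rewrite ltNge; apply/negP => su; apply: nu1; apply: gap_at_eq; apply/gap_atP; split => //.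
    by rewrite ler01 lexx.
  have /andP[_ u1] := u01.
  move=> z; rewrite (min_idPl u1) => /andP[uz _] Zz; apply: nZu.
  by have -> : u = s by apply/eqP; rewrite eq_le su (le_trans uz (Zle Zz)).
have ZY1 : ZY w 1.
  have h := @exp_neg_set_time R 0 (fun t => Y t w) 0 (lexx 0).
  by move: h; rewrite Y0 addr0 oppr0 expR0.
have ZYle z : ZY w z -> z <= 1.
  case=> [->|[x hx <-]]; first exact: ler01.
  by rewrite -[leRHS](@expR0 R) ler_expR oppr_le0; exact: (stationary_range_ge (Yge0 w) hx).
have := gap_length_scale (@cZY w) s01 ZY1 ZYle us; rewrite -ZscaleE gu => e.
have /andP[s0 s1] := s01.
have g0 : 0 < gap_length (gap_at (ZY w) (u / s)).
  by move: v0; rewrite e pmulr_rgt0.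
have [j hj] := gap_length_ranked mU0 subU (mglY w) g0.
exists j; rewrite /VY hj; apply: expR_inj; rewrite lnK ?posrE ?addr_gt0//.
have : s * (1 + gap_length (gap_at (ZY w) (u / s))) = 1 by rewrite mulrDr mulr1 -e -Av AE; ring.
by move/(canRL (mulKf (lt0r_neq0 s0))); rewrite mulr1 => ->; rewrite /s expRN invrK.
Qed.

End positive_delay.

Let ae_pos : {ae P, forall w, 0 < X w}.
Proof. by apply: filterS (ae_good alpha01 theta0 hnu hY hX) => w []. Qed.

Let mglw w : measurable_fun setT (fun w' => gl w (U 0%N w')).
Proof. exact: (bm_gap_length_section hY hZ uU 0 w).1. Qed.

Let blevel w (v : R) : bm (fun w' => (gl w (U 0%N w') == v)%:R : R).
Proof.
have -> : (fun w' => (gl w (U 0%N w') == v)%:R : R) = fun w' => \1_[set v] (gl w (U 0%N w')).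
  by apply/funext => w'; rewrite indicE; congr ((nat_of_bool _)%:R); apply/eqP/idP; rewrite inE.
by apply: (bm_comp (mglw w)); apply: bm_indic.
Qed.

Let gap_count_level w v :
  gap_count P (U 0%N) (Z w) (fun l => l == v) = v^-1 * Ex P (fun w' => (gl w (U 0%N w') == v)%:R).
Proof.
rewrite -(ExZ P v^-1 (blevel w v)); congr Ex; apply/funext => w'.
by case: eqP => [->|_]; rewrite ?mulr1 ?mulr0.
Qed.

Let mSGpos k : @measurable _ SG [set y | 0 < V y.2 k].
Proof.
rewrite (_ : mkset _ = (fun y : SG => V y.2 k) @^-1` `]0, +oo[%classic).
  by rewrite -[X in measurable X]setTI; exact: mSGV.
by apply/seteqP; split => w /=; rewrite in_itv/= andbT.
Qed.

Let mSGtie k : @measurable _ SG [set y | V y.2 k = V y.2 k.+1].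
Proof.
rewrite (_ : mkset _ = (fun y : SG => V y.2 k - V y.2 k.+1 : R) @^-1` [set 0]).
  by rewrite -[X in measurable X]setTI; exact: (measurable_funB (mSGV k) (mSGV k.+1)).
apply/seteqP; split => y /=; first by move=> ->; rewrite subrr.
by move/eqP; rewrite subr_eq0 => /eqP.
Qed.

Let ma' D : @measurable _ SG D -> measurable ((fun w => (A w, w)) @^-1` D).
Proof.
have sub : <<s gens >> `<=` @measurable _ (R * T)%type.
  by apply: smallest_sub; [exact: sigma_algebra_measurable|exact: gens_measurable].
by move=> /sub mD; rewrite -[X in measurable X]setTI; exact: ma.
Qed.

Let mb' D : @measurable _ SG D -> measurable ((fun x : T * T => (glx x, x.1)) @^-1` D).
Proof.
have sub : <<s gens >> `<=` @measurable _ (R * T)%type.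
  by apply: smallest_sub; [exact: sigma_algebra_measurable|exact: gens_measurable].
by move=> /sub mD; rewrite -[X in measurable X]setTI; exact: mb.
Qed.

Let pair_Ex D : @measurable _ SG D ->
  fine (P ((fun w => (A w, w)) @^-1` D)) = Ex P (fun w => Ex P (fun w' => \1_D (glx (w, w'), w))).
Proof.
move=> mD; rewrite (meander_gap_exchange mD) -(Ex_indic PP (mb' mD)).
by rewrite (Ex_fubini P P (bm_indic R (mb' mD))).
Qed.

(** On a positive tie, a uniform point falls into a gap of the tied length with positive conditional
    probability. Exchanging L with A, the event that A equals a positive tied length would have
    positive probability, against [meander_tie] and [diffuse_tie]. *)
Lemma ae_no_tie : {ae P, forall w, forall k, V w k = V w k.+1 -> V w k = 0}.
Proof.
apply: ae_foralln => k.
pose D : set SG := [set y | y.1 = V y.2 k] `&` ([set y | V y.2 k = V y.2 k.+1] `&` [set y | 0 < V y.2 k]).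
have mD : measurable D by apply: measurableI => //; exact: measurableI.
have PD : P ((fun w => (A w, w)) @^-1` D) = 0%E.
  rewrite -(fineP P (ma' mD)) -(Ex_indic P (ma' mD)); congr EFin.
  rewrite -[RHS](Ex_cst P 0); apply: Ex_ae; [exact: (bm_indic R (ma' mD))|exact: bm_cst|].
  apply: filterS2 ae_pos (ae_foralln diffuse_tie) => w X0 nt.
  rewrite indicE memNset// => -[/= Av [tie v0]].
  by have [j] := meander_tie X0 v0 tie Av; exact: nt.
have bD := bm_indic R (mb' mD).
have := pair_Ex mD; rewrite PD => /esym E0.
have := Ex_ge0_eq0 (bm_fubini P P bD) (fun w => Ex_ge0 P (fun w' => ler0n _ _)) E0.
apply: filterS => w hw tie; apply: contrapT => v0.
have {}v0 : 0 < V w k by rewrite lt_neqAle ranked_gap_ge0 eq_sym andbT; exact/eqP.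
have := ranked_gap_tie mU0 subU (mglw w) v0 tie.
have z : Ex P (fun w' => (gl w (U 0%N w') == V w k)%:R) = 0.
  transitivity (Ex P (fun w' => \1_D (glx (w, w'), w) : R)); last exact: hw.
  congr Ex; apply/funext => w'; rewrite indicE; congr ((nat_of_bool _)%:R).
  by apply/eqP/idP; rewrite inE; [move=> h; split|move=> []].
by rewrite gap_count_level z mulr0 leNgt ltr0n.
Qed.

Lemma bm_ranked_gap k : bm (fun w => V w k).
Proof. by apply: bm01 => [|w]; [exact: mV|rewrite ranked_gap_ge0 ranked_gap_le1]. Qed.


(** By exchange, the probability of A = V_k within B is the mean over B of P(L = V_k | Z). Without
    ties the level set is a single gap, which a uniform point hits with probability equal to its
    length. *)
Theorem strong_sampling k : is_cond_prob P sigmaV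
  [set w | meander_length (Z w) = V w k] (fun w => V w k).
Proof.
have Z0 w : Z w 0 by rewrite hZ; left.
have mE : measurable [set w | meander_length (Z w) = V w k].
  have mm := measurable_meander_length cZ hitz Z0.
  rewrite (_ : mkset _ = (fun w => meander_length (Z w) - V w k) @^-1` [set 0]).
    by rewrite -[X in measurable X]setTI; exact: (measurable_funB mm (mV k)).
  apply/seteqP; split => y /=; first by move=> ->; rewrite subrr.
  by move/eqP; rewrite subr_eq0 => /eqP.
split.
- by split => //; exact: sigmaV_measurable.
- move=> B mB; apply: sub_sigma_algebra; exists k => //; exists B => //; by rewrite setTI.
- exact: (bm_integrable P (bm_ranked_gap k)).
move=> B sB; have mB := sigmaV_measurable sB.
rewrite (integral_Ex P mB (bm_ranked_gap k)).
have mEB := measurableI _ _ mE mB.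
pose D : set SG := [set y | y.1 = V y.2 k] `&` [set y | B y.2].
have mD : measurable D by apply: measurableI => //; exact: sigmaV_SG.
rewrite -(fineP P mEB) -(Ex_indic P mEB); congr EFin.
transitivity (fine (P ((fun w => (A w, w)) @^-1` D))).
  rewrite -(Ex_indic P (ma' mD)); apply: Ex_ae; [exact: bm_indic|exact: (bm_indic R (ma' mD))|].
  apply: filterS ae_pos => w X0; rewrite !indicE; congr ((nat_of_bool _)%:R).
  by apply/idP/idP; rewrite !inE /= (meander_lengthE X0).
rewrite (pair_Ex mD); apply: Ex_ae.
- exact: (bm_fubini P P (bm_indic R (mb' mD))).
- by apply: bmM; [exact: bm_ranked_gap|exact: bm_indic].
apply: filterS2 ae_no_tie (gap_length_gt0_ae alpha01 theta0 hnu hY hX hXY hZ uU) => w nt pos.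
have -> : (fun w' => \1_D (glx (w, w'), w)) = fun w' => (gl w (U 0%N w') == V w k)%:R * \1_B w :> R.
  apply/funext => w'; rewrite !indicE -natrM mulnb; congr ((nat_of_bool _)%:R).
  apply/idP/andP => [|[/eqP h1]]; last by rewrite !inE => h2; split.
  by rewrite inE => -[h1 h2]; split; [exact/eqP|rewrite inE].
rewrite (ExZr P _ (blevel w (V w k))); congr (_ * _).
(* When the ranked length is 0 both sides vanish, as L is positive almost surely. *)
have [v0|v0] := eqVneq (V w k) 0.
  rewrite v0 -[RHS](Ex_cst P 0); apply: Ex_ae; [exact: blevel|exact: bm_cst|].
  by apply: filterS (pos 0%N) => w' h; rewrite gt_eqF.
have vp : 0 < V w k by rewrite lt_neqAle ranked_gap_ge0 eq_sym v0.
have := ranked_gap_level mU0 subU (mglw w) nt vp; rewrite gap_count_level.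
by move/(canRL (mulVKf v0)); rewrite mulr1.
Qed.

End strong_sampling.

Theorem theorem14 (R : realType) (alpha theta : R)
    (halpha : 0 <= alpha < 1) (htheta : 0 < theta)
    (d : measure_display) (T : measurableType d) (P : probability T R)
    (nu : {measure set R -> \bar R})
    (Y : R -> {RV P >-> R}) (X : {RV P >-> R}) (U : nat -> {RV P >-> R})
    (Z : T -> set R) (C : nat -> T -> seq nat)
    (hnu : is_levy_measure alpha theta nu)
    (hY : is_subordinator nu Y)
    (hX : has_stationary_delay_law P nu X)
    (hXY : indep_systems P (sigma_rv [set: unit] (fun _ => X))
             (sigma_rv [set t : R | 0 <= t] (fun t => Y t)))
    (hZ : forall w, Z w = exp_neg_set (stationary_range (X w) (fun t => Y t w)))
    (hU : forall i (A : set R), measurable A ->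
            distribution P (U i) A = uniform_prob (@ltr01 R) A)
    (hUind : mutually_independent P (fun i => U i))
    (hUZ : indep_systems P (sigma_random_set Z)
             (sigma_rv [set: nat] (fun i => U i)))
    (hC : forall n w, C n w = sample_composition (Z w) n (fun i => U i w)) :
  [/\ is_composition_structure P C /\ is_self_similar_markov P C,
      is_two_parameter_partition_structure P alpha (theta - alpha)
        (fun n w => ranked (C n w)),
      has_beta_law P (fun w => gap_length (gap_at (Z w) (U 0%N w)))
        (1 - alpha) theta &
      forall k : nat,
        is_cond_prob P (sigma_rv [set: nat] (fun j w => ranked_gap (Z w) j))
          [set w | meander_length (Z w) = ranked_gap (Z w) k]
          (fun w => ranked_gap (Z w) k)].
Proof.
have uU i : is_uniform P (U i) by exact: is_uniform_prob (hU i).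
have composition_of n w : is_composition n (C n w).
  by rewrite hC; exact: sample_composition_valid.
have composition_measurable n s : measurable [set w | C n w = s].
  rewrite (_ : mkset _ = [set w | sample_composition (Z w) n (U ^~ w) = s]); last first.
    by apply/seteqP; split => w /=; rewrite hC.
  exact: (measurable_composition hY hZ uU).
have law s : s != [::] -> all (leq 1) s ->
    P [set w | C (sumn s) w = rev s] = (comp_weight alpha theta s)%:E.
  move=> s0 s1; rewrite -(composition_law halpha htheta hnu hY hX hXY hZ uU hUind hUZ s0 s1).
  by congr (P _); apply/seteqP; split => w /=; rewrite hC.
split.
- split; first exact: (sample_composition_structure halpha htheta hnu hY hX hXY hZ uU hUind hUZ hC).
  by apply: (markov_representation halpha htheta uU hUind) => n s s0 s1 <-; exact: law.
- exact: (two_parameter_representation halpha htheta uU hUind composition_of composition_measurable law).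
- exact: (structural_law halpha htheta hnu hY hX hXY hZ uU hUZ).
- exact: (strong_sampling halpha htheta hnu hY hX hXY hZ uU).
Qed.
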